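(* Let $G$ be one of the rank $2$ complex reflection groups $G_7,G_{11},G_{19}$ (Shephard–Todd numbering). The degrees of $G$ satisfy $d_1=d_2$, so the space $\mathcal{X}_{-d_1}$ of polynomial vector fields on $M_G=\mathrm{Spec}\,\mathbb{C}[V]^G$ of degree $-d_1$ is two-dimensional. There exist exactly three lines $l_1,l_2,l_3\subset\mathcal{X}_{-d_1}$ such that, for nonzero $e\in\mathcal{X}_{-d_1}$, the vector field $e$ and the connection $\boldsymbol{\nabla}^V$ make a natural almost Saito structure for $G$ if and only if $e\in l_1\cup l_2\cup l_3$. These natural almost Saito structures are the ones induced by branched covering maps $\pi:M_K\to M_G$ from the orbit spaces of certain duality groups $K$ which are normal reflection subgroups of $G$: for $G_7$, one subgroup isomorphic to $G_5$ and two subgroups of type $G_6$; for $G_{11}$, subgroups $G_{10}$, $G_9$ and $G_{14}$; for $G_{19}$, subgroups $G_{18}$, $G_{17}$ and $G_{21}$.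
   Context: A duality group is an irreducible finite complex reflection group of rank $n$ generated by $n$ reflections. The degrees are $(12,12)$ for $G_7$, $(24,24)$ for $G_{11}$, $(60,60)$ for $G_{19}$. For a finite complex reflection group $G$ on $V=\mathbb{C}^n$ with degrees $d_1\ge\dots\ge d_n$ and basic invariants $x^1,\dots,x^n$ (homogeneous generators of $\mathbb{C}[V]^G$): $M_G=\mathrm{Spec}\,\mathbb{C}[V]^G$; $M_{G,0}$ is the complement of the image of the union of the reflection hyperplanes of $G$; $E_{\mathrm{deg}}=\sum_\alpha d_\alpha x^\alpha\partial_{x^\alpha}$; $\boldsymbol{\nabla}^V$ is the connection on $TM_{G,0}$ induced from the trivial connection on $TV$ via the orbit map. Almost Saito structure on a complex manifold $N$ with parameter $r\in\mathbb{C}$: a triple $(\boldsymbol{\nabla},\star,e)$ of a torsion-free flat connection on $TN$, an associative commutative $\mathcal{O}_N$-bilinear multiplication $\star$ on $TN$ with unit vector field $E$, and a nonzero vector field $e$, such that for local vector fields $x,y,z$: (ASS1) $\boldsymbol{\nabla}_x(y\star z)-y\star\boldsymbol{\nabla}_xz-\boldsymbol{\nabla}_y(x\star z)+x\star\boldsymbol{\nabla}_yz=[x,y]\star z$; (ASS2) $[e,x\star y]-[e,x]\star y-x\star[e,y]+e\star x\star y=0$; (ASS3) $\boldsymbol{\nabla}_xE=rx$; (ASS4) $\boldsymbol{\nabla}_x\boldsymbol{\nabla}_ye-\boldsymbol{\nabla}_{\boldsymbol{\nabla}_xy}e+\boldsymbol{\nabla}_{x\star y}e=0$. Natural almost Saito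 structure for $G$: an almost Saito structure $(\boldsymbol{\nabla},\star,e)$ on $M_{G,0}$ with $\boldsymbol{\nabla}=\boldsymbol{\nabla}^V$, unit of $\star$ equal to $\frac{1}{d_1}E_{\mathrm{deg}}$ (hence $r=\frac1{d_1}$), and $e$ a nonzero polynomial vector field on $M_G$ of degree $-d_1$ (grading $\deg x^\alpha=d_\alpha$). Induced structures: if $K\subset G$ is a normal reflection subgroup, $\pi:M_K\to M_G$ restricts over $M_{G,0}$ to an unramified Galois covering with group $G/K$; a $G/K$-invariant almost Saito structure on $\pi^{-1}(M_{G,0})$ induces (by pushing forward along local inverses of $\pi$) an almost Saito structure on $M_{G,0}$. A duality group $K$ has a natural almost Saito structure, unique up to scaling of its vector field $e$; ''induced by $\pi$'' means induced from its restriction. *)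

(* Defs.v *)
(* The complex numbers are R[i] for R : realType. Everything but the definition
   of the Shephard-Todd groups is written for a numClosedFieldType C, from which
   the topology and differentiability over C are inferred.                   *)
From HB Require Import structures.
From mathcomp Require Import all_boot all_order all_algebra.
From mathcomp Require Import all_classical all_reals all_analysis.
From mathcomp Require Import complex.
From mathcomp Require mpoly.
(* The notations of mpoly clash with those of the analysis library. *)
Import -(notations) mpoly.
Import Order.TTheory GRing.Theory Num.Theory.
Import numFieldNormedType.Exports.
Set Implicit Arguments.
Unset Strict Implicit.
Unset Printing Implicit Defensive.
Local Open Scope classical_set_scope.
Local Open Scope ring_scope.
Local Open Scope complex_scope.

(* ------------------------------------------------------------------------ *)
(* Linear groups acting on V = C^(n+1) (column vectors) by v |-> g *m v.    *)

Section LinearGroups.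
Context {C : numClosedFieldType} {n : nat}.
Local Notation V := 'cV[C]_n.+1.
Local Notation M := 'M[C]_n.+1.

Definition matrix_group (G : set M) : Prop :=
  [/\ G 1%:M,
      forall g h, G g -> G h -> G (g *m h) &
      forall g, G g -> g \in unitmx /\ G (invmx g)].

Definition generated_group (A : set M) : set M := smallest matrix_group A.

(* The members of a finite group have finite order, so that a reflection in
   such a group is an element whose fixed space is a hyperplane. *)
Definition is_reflection (g : M) : Prop := \rank (g - 1%:M) = 1%N.

Definition irreducible_group (G : set M) : Prop :=
  forall W : {vspace V},
    (forall g v, G g -> v \in W -> g *m v \in W) -> W = 0%VS \/ W = fullv.

Definition finite_reflection_group (G : set M) : Prop :=
  [/\ matrix_group G, finite_set G &
      G = generated_group [set g | G g /\ is_reflection g]].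

Definition duality_group (G : set M) : Prop :=
  [/\ finite_reflection_group G, irreducible_group G &
      exists2 s : 'I_n.+1 -> M,
        (forall i, is_reflection (s i)) & G = generated_group (range s)].

Definition normal_reflection_subgroup (K G : set M) : Prop :=
  [/\ finite_reflection_group K, K `<=` G &
      forall g k, G g -> K k -> K (g *m k *m invmx g)].

Definition conjugate_to (T G : set M) : Prop :=
  exists2 P : M, P \in unitmx & G = [set P *m g *m invmx P | g in T].

Definition reflection_hyperplanes (G : set M) : set V :=
  [set v | exists g, [/\ G g, is_reflection g & g *m v = v]].

End LinearGroups.

(* ------------------------------------------------------------------------ *)
(* The Shephard-Todd groups of rank 2 that are used, by the generators
   lambda S, mu T of Shephard and Todd, where S and T generate the binary
   tetrahedral, octahedral or icosahedral group. A reflection group is of type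
   G_k when it is conjugate to STk in GL_2(C).                              *)

Section ShephardTodd.
Context (R : realType).
Local Notation C := R[i].

Definition zeta (m : nat) : C :=
  cos (2 * pi / m%:R) +i* sin (2 * pi / m%:R).

Definition mx2 (a b c d : C) : 'M[C]_2 :=
  \matrix_(i < 2, j < 2) [:: a; b; c; d]`_(2 * i + j)%N.

Local Notation ii := (zeta 4).
Local Notation omega := (zeta 3).
Local Notation eps := (zeta 8).
Local Notation eta := (zeta 5).

Definition tetS : 'M[C]_2 := mx2 ii 0 0 (- ii).
Definition tetT : 'M[C]_2 :=
  ((Num.sqrt 2)%:C)^-1 *: mx2 eps eps (eps ^+ 3) (eps ^+ 7).

Definition octS : 'M[C]_2 := ((Num.sqrt 2)%:C)^-1 *: mx2 ii 1 (- 1) (- ii).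
Definition octT : 'M[C]_2 := tetT.

Definition icoS : 'M[C]_2 :=
  ((Num.sqrt 5)%:C)^-1 *: mx2 (eta ^+ 4 - eta) (eta ^+ 2 - eta ^+ 3)
                              (eta ^+ 2 - eta ^+ 3) (eta - eta ^+ 4).
Definition icoT : 'M[C]_2 :=
  ((Num.sqrt 5)%:C)^-1 *: mx2 (eta ^+ 2 - eta ^+ 4) (eta ^+ 4 - 1)
                              (1 - eta) (eta ^+ 3 - eta).

Definition gen2 (g h : 'M[C]_2) : set 'M[C]_2 :=
  generated_group [set g; h].

Definition ST5 := gen2 (- omega *: tetS) (- omega *: tetT).
Definition ST6 := gen2 (ii *: tetS) (- omega *: tetT).
Definition ST7 := gen2 ((ii * omega) *: tetS) (- omega *: tetT).

Definition ST9 := gen2 (ii *: octS) (eps *: octT).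
Definition ST10 := gen2 ((eps ^+ 7 * omega ^+ 2) *: octS) (- omega *: octT).
Definition ST11 := gen2 (ii *: octS) ((eps * omega) *: octT).
Definition ST14 := gen2 (ii *: octS) (- omega *: octT).

Definition ST17 := gen2 (ii *: icoS) ((ii * eta ^+ 3) *: icoT).
Definition ST18 := gen2 ((- omega * eta ^+ 3) *: icoS) (omega ^+ 2 *: icoT).
Definition ST19 := gen2 ((ii * omega) *: icoS) ((ii * eta ^+ 3) *: icoT).
Definition ST21 := gen2 (ii *: icoS) (omega ^+ 2 *: icoT).

End ShephardTodd.

Arguments ST5 R : clear implicits.
Arguments ST6 R : clear implicits.
Arguments ST7 R : clear implicits.
Arguments ST9 R : clear implicits.
Arguments ST10 R : clear implicits.
Arguments ST11 R : clear implicits.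
Arguments ST14 R : clear implicits.
Arguments ST17 R : clear implicits.
Arguments ST18 R : clear implicits.
Arguments ST19 R : clear implicits.
Arguments ST21 R : clear implicits.

(* ------------------------------------------------------------------------ *)
(* Orbit spaces. A choice x of basic invariants identifies M_G with C^(n+1),
   and the orbit map V -> M_G with pmap x.                                  *)

Section OrbitSpaces.
Context {C : numClosedFieldType} {n : nat}.
Local Notation V := 'cV[C]_n.+1.
Local Notation M := 'M[C]_n.+1.
Local Notation P := (mpoly n.+1 C).

Definition peval (p : P) (v : V) : C := meval (fun i => v i 0) p.

Definition pmap (x : n.+1.-tuple P) (v : V) : V :=
  \col_i peval (tnth x i) v.

Definition invariant_poly (G : set M) (p : P) : Prop :=
  forall g v, G g -> peval p (g *m v) = peval p v.

(* The degrees are numbered in nonincreasing order. *)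
Definition basic_invariants (G : set M) (x : n.+1.-tuple P)
    (d : 'I_n.+1 -> nat) : Prop :=
  [/\ forall i, tnth x i \is ishomog1 (d i) mdeg,
      forall i j : 'I_n.+1, (i <= j)%N -> (d j <= d i)%N,
      forall i, invariant_poly G (tnth x i) &
      forall f, invariant_poly G f ->
        exists h : P, forall v, peval f v = peval h (pmap x v)].

(* M_{G,0} *)
Definition regular_orbits (G : set M) (x : n.+1.-tuple P) : set V :=
  ~` (pmap x @` reflection_hyperplanes G).

(* A polynomial vector field \sum_i e_i d/dx_i on M_G is given by its
   coefficients, polynomials in the coordinates x_1, ..., x_(n+1) of M_G. *)
Definition poly_field := {ffun 'I_n.+1 -> P}.

Definition field_of (e : poly_field) (y : V) : V := \col_i peval (e i) y.

(* Vector fields of degree k for deg x_i = d_i, deg d/dx_i = - d_i. *)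
Definition poly_fields_of_degree (d : 'I_n.+1 -> nat) (k : int) :
    set poly_field :=
  [set e | forall i m, m \in msupp (e i) ->
     (\sum_j m j * d j)%N%:Z - (d i)%:Z = k].

Definition Edeg (d : 'I_n.+1 -> nat) (y : V) : V :=
  \col_i ((d i)%:R * y i 0).

End OrbitSpaces.

Definition linear_subspace_of_dim (K : fieldType) (E : lmodType K) (m : nat)
    (L : set E) : Prop :=
  exists b : 'I_m -> E,
    (forall c : 'I_m -> K, \sum_i c i *: b i = 0 -> forall i, c i = 0) /\
    L = [set \sum_i c i *: b i | c in [set: 'I_m -> K]].

(* ------------------------------------------------------------------------ *)
(* Almost Saito structures on an open subset N of C^(n+1). Tensors and the
   connection are given by their components in the frame of coordinate vector
   fields, as functions of which only the values on N matter.               *)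

Section AlmostSaito.
Context {C : numClosedFieldType} {n : nat}.
Local Notation V := 'cV[C]_n.+1.

Implicit Types (U N : set V) (X Y Z : V -> V).

(* Frechet differentiability is over the field C. *)
Definition holomorphic U X : Prop := forall p, U p -> differentiable X p.

Definition bracket X Y : V -> V := fun p => 'D_(X p) Y p - 'D_(Y p) X p.

(* gamma p i j = (nabla_{d_i} d_j)(p) *)
Definition christoffel := V -> 'I_n.+1 -> 'I_n.+1 -> V.

Definition cov (gamma : christoffel) X Y : V -> V := fun p =>
  'D_(X p) Y p + \sum_i \sum_j (X p i 0 * Y p j 0) *: gamma p i j.

(* c p i j = (d_i * d_j)(p) *)
Definition structure_constants := V -> 'I_n.+1 -> 'I_n.+1 -> V.

Definition prod_vf (c : structure_constants) X Y : V -> V := fun p =>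
  \sum_i \sum_j (X p i 0 * Y p j 0) *: c p i j.

Definition trivial_conn : christoffel := fun _ _ _ => 0.

Definition curvature (gamma : christoffel) X Y Z : V -> V := fun p =>
  cov gamma X (cov gamma Y Z) p - cov gamma Y (cov gamma X Z) p
  - cov gamma (bracket X Y) Z p.

Record saito_data := SaitoData {
  conn : christoffel;
  mult : structure_constants;
  unit_field : V -> V;
  e_field : V -> V }.

(* x, y, z are vector fields on an arbitrary open subset U of N. The curvature
   R(x, y)z is O_U-linear in z, and is evaluated on the coordinate frame. *)
Record almost_saito N (r : C) (S : saito_data) : Prop := AlmostSaito {
  as_open : open N;
  as_conn_holo : forall i j, holomorphic N (fun p => conn S p i j);
  as_mult_holo : forall i j, holomorphic N (fun p => mult S p i j);
  as_unit_holo : holomorphic N (unit_field S);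
  as_e_holo : holomorphic N (e_field S);
  as_e_neq0 : exists2 p, N p & e_field S p != 0;
  as_torsion_free : forall U X Y, open U -> U `<=` N ->
    holomorphic U X -> holomorphic U Y ->
    forall p, U p -> cov (conn S) X Y p - cov (conn S) Y X p = bracket X Y p;
  as_flat : forall U X Y (w : V), open U -> U `<=` N ->
    holomorphic U X -> holomorphic U Y ->
    forall p, U p -> curvature (conn S) X Y (cst w) p = 0;
  as_multC : forall U X Y, open U -> U `<=` N ->
    holomorphic U X -> holomorphic U Y ->
    forall p, U p -> prod_vf (mult S) X Y p = prod_vf (mult S) Y X p;
  as_multA : forall U X Y Z, open U -> U `<=` N ->
    holomorphic U X -> holomorphic U Y -> holomorphic U Z ->
    forall p, U p -> prod_vf (mult S) (prod_vf (mult S) X Y) Z p =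
                     prod_vf (mult S) X (prod_vf (mult S) Y Z) p;
  as_mult1 : forall U X, open U -> U `<=` N -> holomorphic U X ->
    forall p, U p -> prod_vf (mult S) (unit_field S) X p = X p;
  as_ass1 : forall U X Y Z, open U -> U `<=` N ->
    holomorphic U X -> holomorphic U Y -> holomorphic U Z ->
    let nabla := cov (conn S) in let star := prod_vf (mult S) in
    forall p, U p ->
      nabla X (star Y Z) p - star Y (nabla X Z) p
      - nabla Y (star X Z) p + star X (nabla Y Z) p
      = star (bracket X Y) Z p;
  as_ass2 : forall U X Y, open U -> U `<=` N ->
    holomorphic U X -> holomorphic U Y ->
    let star := prod_vf (mult S) in let e := e_field S in
    forall p, U p ->
      bracket e (star X Y) p - star (bracket e X) Y p
      - star X (bracket e Y) p + star e (star X Y) p = 0;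
  as_ass3 : forall U X, open U -> U `<=` N -> holomorphic U X ->
    forall p, U p -> cov (conn S) X (unit_field S) p = r *: X p;
  as_ass4 : forall U X Y, open U -> U `<=` N ->
    holomorphic U X -> holomorphic U Y ->
    let nabla := cov (conn S) in let star := prod_vf (mult S) in
    let e := e_field S in
    forall p, U p ->
      nabla X (nabla Y e) p - nabla (nabla X Y) e p + nabla (star X Y) e p = 0
}.

(* X' is on phi(U) the image of X under phi. *)
Definition pushes_field (phi : V -> V) U X X' : Prop :=
  forall p, U p -> 'D_(X p) phi p = X' (phi p).

(* Transport along the inverse of phi : U -> phi(U), for all open U in N on
   which phi is injective; phi is meant to be a local isomorphism on N.
   [pushes_op] expresses that an operation op on local vector fields is
   transported to op'. *)
Definition pushes_op (phi : V -> V) N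
    (op op' : (V -> V) -> (V -> V) -> (V -> V)) : Prop :=
  forall U X Y X' Y', open U -> U `<=` N -> set_inj U phi ->
    holomorphic U X -> holomorphic U Y ->
    holomorphic (phi @` U) X' -> holomorphic (phi @` U) Y' ->
    pushes_field phi U X X' -> pushes_field phi U Y Y' ->
    pushes_field phi U (op X Y) (op' X' Y').

Definition pushes_saito (phi : V -> V) N (S S' : saito_data) : Prop :=
  [/\ pushes_op phi N (cov (conn S)) (cov (conn S')),
      pushes_op phi N (prod_vf (mult S)) (prod_vf (mult S')),
      pushes_field phi N (unit_field S) (unit_field S') &
      pushes_field phi N (e_field S) (e_field S')].

End AlmostSaito.

(* ------------------------------------------------------------------------ *)

Section NaturalStructures.
Context {C : numClosedFieldType} {n : nat}.
Local Notation V := 'cV[C]_n.+1.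
Local Notation M := 'M[C]_n.+1.
Local Notation P := (mpoly n.+1 C).

(* gamma is nabla^V, in the coordinates x of M_G. *)
Definition is_nablaV (G : set M) (x : n.+1.-tuple P)
    (gamma : @christoffel C n) : Prop :=
  pushes_op (pmap x) (~` reflection_hyperplanes G)
    (cov trivial_conn) (cov gamma).

(* S is a natural almost Saito structure for G with vector field e. *)
Definition natural_saito (G : set M) (x : n.+1.-tuple P) (d : 'I_n.+1 -> nat)
    (S : saito_data) (e : poly_field) : Prop :=
  [/\ almost_saito (regular_orbits G x) (d ord0)%:R^-1 S,
      is_nablaV G x (conn S),
      forall y, regular_orbits G x y ->
        unit_field S y = (d ord0)%:R^-1 *: Edeg d y,
      e != 0 /\ poly_fields_of_degree d (- (d ord0)%:Z) e &
      forall y, regular_orbits G x y -> e_field S y = field_of e y].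

(* pi is the natural map M_K -> M_G in the coordinates xK and x. *)
Definition orbit_space_map (xK x pi : n.+1.-tuple P) : Prop :=
  forall v, pmap x v = pmap pi (pmap xK v).

(* a is the action of g in G on M_K, for K normal in G. *)
Definition acts_on_orbits (xK : n.+1.-tuple P) (g : M) (a : n.+1.-tuple P) :
    Prop :=
  forall v, pmap xK (g *m v) = pmap a (pmap xK v).

(* The restriction of SK to pi^{-1}(M_{G,0}) is G/K-invariant and induces S on
   M_{G,0}. *)
Definition induced_saito (G : set M) (x xK pi : n.+1.-tuple P)
    (SK S : saito_data) : Prop :=
  let N := pmap pi @^-1` regular_orbits G x in
  (forall g a, G g -> acts_on_orbits xK g a -> pushes_saito (pmap a) N SK SK)
  /\ pushes_saito (pmap pi) N SK S.

End NaturalStructures.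

(* Main.v *)
(* Let a_0, a_1, a_2 be Klein's forms of the tetra-, octa- or icosahedral group, with
   a_0^p_0 + a_1^p_1 + a_2^p_2 = 0, all three terms of degree D.  The powers
   A_i = a_i^p_i are linear forms in the basic invariants of G, so M_(G,0) is the
   complement of three concurrent lines A_i = 0, and a vector field of degree -d_1 is a
   constant vector e.  The Jacobians and the Hessians of the a_i turn the connection
   into explicit Christoffel symbols with simple poles along the lines.

   In a natural structure the matrix L of [y -> nabla_y e] and the matrix M of
   multiplication by e satisfy L' = - L M by (ASS4) and M' = - M^2 by (ASS2), so
   L'' = 2 L M^2.  If e lay on none of the lines, then by Cayley-Hamilton the three
   distinct numbers A_i(e) / A_i would be eigenvalues of the 2 x 2 matrix M.  If
   A_i(e) = 0, then (ASS4) determines the multiplication, and the formula that puts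
   the other two forms A_j, A_k in diagonal shape defines an almost Saito structure.

   The stabilizer K_i of the form a_i in G has basic invariants s = a_i and a linear
   combination t of A_j and A_k, and M_(K_i) -> M_G is the cyclic cover of degree p_i
   branched along A_i = 0.  The structure with e proportional to the field d/dt, tangent
   to that line, lifts to the natural structure of K_i. *)

From HB Require Import structures.
Require Import Defs.
From mathcomp Require Import all_boot all_order all_algebra.
From mathcomp Require Import all_classical all_reals all_analysis.
From mathcomp Require Import complex.
From mathcomp Require mpoly.
From mathcomp Require Import ring lra.
Import -(notations) mpoly.
Import Order.TTheory GRing.Theory Num.Theory.
Import numFieldNormedType.Exports.
Set Implicit Arguments.
Unset Strict Implicit.
Unset Printing Implicit Defensive.
Local Open Scope classical_set_scope.
Local Open Scope ring_scope.

(** The three families are treated at once without any group order or list of invariants. D is the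
    order of the rotation group, 12, 24 or 60, and 1/p_0 + 1/p_1 + 1/p_2 = 1 + 2/D. A concrete group
    enters only through exponents of a primitive D-th root of unity z: containing a scalar, being a
    reflection and fixing a form become congruences modulo D. The scalar z in G then forces the
    degrees of G, and preserving two forms without common zero forces finiteness. The obstacle is
    that nabla^V and induced structures are defined by pushing local vector fields forward on open
    sets where the map is injective. Lifts of constant fields to small open sets turn this into the
    transformation law of Christoffel symbols at each point; the local injectivity comes from
    difference quotients of polynomials. On M_(K_i) the formulas are those of M_G pulled back by the
    cyclic cover. They have to be regular along the ramification locus, so that the cancellation of
    the apparent poles is built into the explicit coefficients. *)

Local Notation pmap := Defs.pmap.

(** * Calculus of polynomial maps *)

Section VectorCalculus.
Context {C : numFieldType} {m n : nat}.
Local Notation V := 'cV[C]_m.+1.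
Local Notation W := 'cV[C]_n.+1.

Lemma is_diff_intro (U Z : normedModType C) (f : U -> Z) p (df : U -> Z) :
  differentiable f p -> (forall h, 'D_h f p = df h) -> is_diff p f df.
Proof.
move=> Df E; split=> //; apply/funext => h.
by rewrite -E deriveE.
Qed.

Lemma is_diffE (U Z : normedModType C) (f : U -> Z) p (df : U -> Z) :
  is_diff p f df -> forall h, 'D_h f p = df h.
Proof. by move=> H h; rewrite deriveE ?diff_val //; apply: ex_diff. Qed.

Lemma is_diff_ext (U Z : normedModType C) (f g : U -> Z) p (df dg : U -> Z) :
  f =1 g -> df =1 dg -> is_diff p f df -> is_diff p g dg.
Proof. by move=> /funext <- /funext <-. Qed.

Lemma is_diff_coord i (p : V) :
  is_diff p (fun v : V => v i 0) (fun h => h i 0).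
Proof.
have @l : {linear V -> C}.
  by exists (fun v : V => v i 0); do 2![eexists]; do ?[constructor];
     rewrite ?mxE // => ? *; rewrite ?mxE//; move=> ?; rewrite !mxE.
have cl : continuous (l : V -> C) := @coord_continuous _ _ _ i 0.
have D : differentiable l p by apply: linear_differentiable.
by split=> //; exact: (diff_lin p cl).
Qed.

Lemma is_diff_col (F : 'I_n.+1 -> V -> C) p (dF : 'I_n.+1 -> V -> C) :
  (forall i, is_diff p (F i) (dF i)) ->
  is_diff p (fun v => \col_i F i v : W) (fun h => \col_i dF i h).
Proof.
move=> HF.
have E (v : V) : (\col_i F i v : W) = \sum_i F i v *: delta_mx i 0.
  apply/colP => k; rewrite mxE summxE (bigD1 k) //= !mxE !eqxx mulr1.
  by rewrite big1 ?addr0 // => j jk; rewrite !mxE eq_sym (negbTE jk) mulr0.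
have Di i : differentiable (fun v : V => F i v *: (delta_mx i 0 : W)) p.
  by apply: differentiableZl; apply: ex_diff.
have -> : (fun v => \col_i F i v : W) =
    \sum_i (fun v : V => F i v *: (delta_mx i 0 : W)).
  by apply/funext => v; rewrite E fct_sumE.
apply: is_diff_intro; first exact: differentiable_sum.
move=> h; rewrite derive_sum; last by move=> i; apply: diff_derivable.
apply/colP => k; rewrite summxE (bigD1 k) //= big1 => [|j jk].
  rewrite addr0 deriveE // diffZl ?diff_val; last exact: ex_diff.
  by rewrite !mxE !eqxx mulr1.
rewrite deriveE // diffZl; last exact: ex_diff.
by rewrite !mxE eq_sym (negbTE jk) mulr0.
Qed.

Lemma is_diff_const (U Z : normedModType C) (c : Z) (p : U) :
  is_diff p (fun=> c) (fun=> 0).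
Proof.
apply: is_diff_intro; first exact: differentiable_cst.
by move=> h; rewrite derive_cst.
Qed.

Lemma is_diff_idfun (U : normedModType C) (p : U) : is_diff p (fun v => v) (fun h => h).
Proof. exact: is_diff_id. Qed.

Lemma is_diff_plus (U Z : normedModType C) (f g : U -> Z) p df dg :
  is_diff p f df -> is_diff p g dg ->
  is_diff p (fun v => f v + g v) (fun h => df h + dg h).
Proof. exact: is_diffD. Qed.

Lemma is_diff_opp (U Z : normedModType C) (f : U -> Z) p df :
  is_diff p f df -> is_diff p (fun v => - f v) (fun h => - df h).
Proof. exact: is_diffN. Qed.

Lemma is_diff_minus (U Z : normedModType C) (f g : U -> Z) p df dg :
  is_diff p f df -> is_diff p g dg ->
  is_diff p (fun v => f v - g v) (fun h => df h - dg h).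
Proof. exact: is_diffB. Qed.

Lemma is_diff_times (U : normedModType C) (f g : U -> C) p df dg :
  is_diff p f df -> is_diff p g dg ->
  is_diff p (fun v => f v * g v) (fun h => df h * g p + f p * dg h).
Proof.
move=> Hf Hg; apply: is_diff_ext (is_diffM Hf Hg) => // h.
by rewrite addrC mulrC.
Qed.

Lemma is_diff_inv (U : normedModType C) (f : U -> C) p df :
  f p != 0 -> is_diff p f df ->
  is_diff p (fun v => (f v)^-1) (fun h => - df h / f p ^+ 2).
Proof.
move=> f0 [Df Ef].
have D : differentiable (fun v => (f v)^-1) p by apply: differentiableV.
apply: is_diff_intro => // h; rewrite deriveE // diffV // Ef.
by rewrite [LHS](_ : _ = - f p ^- 2 * df h) // !mulNr mulrC.
Qed.

Lemma is_diff_div (U : normedModType C) (f g : U -> C) p df dg :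
  g p != 0 -> is_diff p f df -> is_diff p g dg ->
  is_diff p (fun v => f v / g v) (fun h => (df h * g p - f p * dg h) / g p ^+ 2).
Proof.
move=> g0 Hf Hg; apply: is_diff_ext (is_diff_times Hf (is_diff_inv g0 Hg)) => // h.
by field.
Qed.

Lemma is_diff_exp (U : normedModType C) (f : U -> C) p df k :
  is_diff p f df ->
  is_diff p (fun v => f v ^+ k) (fun h => k%:R * f p ^+ k.-1 * df h).
Proof.
move=> Hf; elim: k => [|k IH].
  by apply: is_diff_ext (is_diff_const (1 : C) p) => // h; rewrite /= !mul0r.
apply: is_diff_ext (is_diff_times Hf IH) => h; first by rewrite exprS.
case: k {IH} => [|k] /=; first by rewrite expr0; ring.
by rewrite !exprS -!natr1; ring.
Qed.

Lemma is_diff_mull (U : normedModType C) (k : C) (f : U -> C) p df :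
  is_diff p f df -> is_diff p (fun v => k * f v) (fun h => k * df h).
Proof.
move=> Hf; apply: is_diff_ext (is_diff_times (is_diff_const k p) Hf) => // h.
by rewrite mul0r add0r.
Qed.

Lemma is_diff_comp' (U Y Z : normedModType C) (f : U -> Y) (g : Y -> Z) p df dg :
  is_diff p f df -> is_diff (f p) g dg ->
  is_diff p (fun v => g (f v)) (fun h => dg (df h)).
Proof. by move=> Hf Hg; exact: (@is_diff_comp _ _ _ _ _ _ _ _ _ Hf Hg). Qed.

Lemma is_diff_D (U Z : normedModType C) (f : U -> Z) p :
  differentiable f p -> is_diff p f (fun h => 'D_h f p).
Proof. by move=> D; apply: is_diff_intro. Qed.

Lemma is_diff_sumr (U Z : normedModType C) k (f df : 'I_k -> U -> Z) p :
  (forall i, is_diff p (f i) (df i)) ->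
  is_diff p (fun v => \sum_i f i v) (fun h => \sum_i df i h).
Proof.
elim: k f df => [|k IH] f df H.
  by apply: is_diff_ext (is_diff_const 0 p) => h; rewrite big_ord0.
have := is_diff_plus (IH _ _ (fun i => H (widen_ord (leqnSn k) i))) (H ord_max).
by apply: is_diff_ext => h; rewrite big_ord_recr.
Qed.

Lemma is_diff_row (F : V -> W) p (dF : V -> W) i :
  is_diff p F dF -> is_diff p (fun v => F v i 0) (fun h => dF h i 0).
Proof.
have @l : {linear W -> C}.
  by exists (fun v : W => v i 0); do 2![eexists]; do ?[constructor];
     rewrite ?mxE // => ? *; rewrite ?mxE//; move=> ?; rewrite !mxE.
have cl : continuous (l : W -> C) := @coord_continuous _ _ _ i 0.
move=> H; apply: (is_diff_comp' (g := l) (dg := l)) H _.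
have D : differentiable l (F p) by apply: linear_differentiable.
by split=> //; exact: (diff_lin _ cl).
Qed.

Lemma is_diff_differentiable (U Z : normedModType C) (f : U -> Z) p df :
  is_diff p f df -> differentiable f p.
Proof. by case. Qed.

Lemma differentiable_col (F : 'I_n.+1 -> V -> C) p :
  (forall i, differentiable (F i) p) -> differentiable (fun v => \col_i F i v : W) p.
Proof.
move=> HF; apply: is_diff_differentiable; apply: is_diff_col => i.
exact: is_diff_D.
Qed.

End VectorCalculus.

Ltac diff_rec := do ?[exact: is_diff_const | exact: is_diff_coord |
  apply: is_diff_plus | apply: is_diff_minus | apply: is_diff_opp |
  apply: is_diff_div | apply: is_diff_times | apply: is_diff_exp].
Ltac diff_scalar := apply: is_diff_differentiable; diff_rec.

Section PolynomialMaps.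
Context {C : numClosedFieldType} {n : nat}.
Local Notation V := 'cV[C]_n.+1.
Local Notation P := (mpoly n.+1 C).
Local Notation X_ i := (mpolyX C (mnm1 i)).
Implicit Types (p q : P) (v h k : V).

(** Closure under sums and products from constants and coordinates; evaluation and differentiation
    then need no formula for monomials. *)
Lemma poly_ind (Q : P -> Prop) :
  (forall c, Q (mpolyC n.+1 c)) -> (forall i, Q (X_ i)) ->
  (forall p q, Q p -> Q q -> Q (p + q)) ->
  (forall p q, Q p -> Q q -> Q (p * q)) -> forall p, Q p.
Proof.
move=> QC QX QD QM; elim/mpolyind => [|c m p _ _ Qp]; first exact: (QC 0).
apply: (QD) => //; rewrite -mul_mpolyC; apply: (QM) => //.
rewrite mpolyXE_id; elim/big_ind: _ => [|p' q'|i _]; [exact: (QC 1)|exact: QM|].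
by elim: (m i) => [|e IH]; [exact: (QC 1) | rewrite exprS; apply: (QM)].
Qed.

Lemma mderivXU i j : mderiv i (X_ j) = mpolyC n.+1 (j == i)%:R.
Proof.
rewrite mderivX mnm1E; case: eqP => [->|_]; last by rewrite scale0r mpolyC0.
by rewrite -[X in mnm_sub X]add0m addmK mpolyX0 scale1r mpolyC1.
Qed.

Lemma pevalC c v : peval (mpolyC n.+1 c) v = c.
Proof. exact: mevalC. Qed.
Lemma peval0 v : peval (0 : P) v = 0.
Proof. exact: meval0. Qed.
Lemma pevalX i v : peval (X_ i) v = v i 0.
Proof. exact: mevalXU. Qed.
Lemma pevalD p q v : peval (p + q) v = peval p v + peval q v.
Proof. exact: mevalD. Qed.
Lemma pevalB p q v : peval (p - q) v = peval p v - peval q v.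
Proof. exact: mevalB. Qed.
Lemma pevalM p q v : peval (p * q) v = peval p v * peval q v.
Proof. exact: mevalM. Qed.
Lemma pevalZ c p v : peval (c *: p) v = c * peval p v.
Proof. exact: mevalZ. Qed.
Lemma pevalXn p e v : peval (p ^+ e) v = peval p v ^+ e.
Proof. exact: rmorphXn. Qed.
Lemma peval_sum I (r : seq I) (S : pred I) (F : I -> P) v :
  peval (\sum_(i <- r | S i) F i) v = \sum_(i <- r | S i) peval (F i) v.
Proof. exact: raddf_sum. Qed.
Lemma peval_prod I (r : seq I) (S : pred I) (F : I -> P) v :
  peval (\prod_(i <- r | S i) F i) v = \prod_(i <- r | S i) peval (F i) v.
Proof. exact: rmorph_prod. Qed.

(** The derivative along the constant vector h, kept as a polynomial so that derivatives commute
    formally and identities can be cancelled in the polynomial ring. *)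
Definition pD h p : P := \sum_i h i 0 *: mderiv i p.

Lemma pDC h c : pD h (mpolyC n.+1 c) = 0.
Proof. by rewrite /pD big1 // => i _; rewrite mderivC scaler0. Qed.
Lemma pDX h i : pD h (X_ i) = mpolyC n.+1 (h i 0).
Proof.
rewrite /pD (bigD1 i) //= big1 => [|j ji]; rewrite mderivXU.
  by rewrite eqxx addr0 -mul_mpolyC mpolyC1 mulr1.
by rewrite eq_sym (negbTE ji) mpolyC0 scaler0.
Qed.
Lemma pDD h p q : pD h (p + q) = pD h p + pD h q.
Proof. by rewrite /pD -big_split; apply: eq_bigr => i _; rewrite mderivD scalerDr. Qed.
Lemma pDM h p q : pD h (p * q) = pD h p * q + p * pD h q.
Proof.
rewrite /pD mulr_suml mulr_sumr -big_split; apply: eq_bigr => i _.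
by rewrite mderivM scalerDr scalerAl scalerAr.
Qed.
Lemma pDZ h c p : pD h (c *: p) = c *: pD h p.
Proof.
by rewrite /pD scaler_sumr; apply: eq_bigr => i _; rewrite mderivZ !scalerA mulrC.
Qed.
Lemma pDN h p : pD h (- p) = - pD h p.
Proof. by rewrite -[- p]scaleN1r pDZ scaleN1r. Qed.
Lemma pDB h p q : pD h (p - q) = pD h p - pD h q.
Proof. by rewrite pDD pDN. Qed.
Lemma pDXn h p e : pD h (p ^+ e) = e%:R *: (p ^+ e.-1 * pD h p).
Proof.
elim: e => [|e IH]; first by rewrite expr0 (pDC h 1) scale0r.
rewrite exprS pDM IH; case: e {IH} => [|e] /=.
  by rewrite scale0r mulr0 addr0 !expr0 mulr1 scale1r mul1r.
rewrite -scalerAr mulrA -exprS mulrC -[X in X + _]scale1r -scalerDl.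
by rewrite -[in RHS]natr1 addrC.
Qed.
Lemma pD_add h k p : pD (h + k) p = pD h p + pD k p.
Proof. by rewrite /pD -big_split; apply: eq_bigr => i _; rewrite mxE scalerDl. Qed.
Lemma pD_scale c h p : pD (c *: h) p = c *: pD h p.
Proof.
by rewrite /pD scaler_sumr; apply: eq_bigr => i _; rewrite mxE scalerA.
Qed.
Lemma pD_comm h k p : pD h (pD k p) = pD k (pD h p).
Proof.
have E a b : pD a (pD b p) =
    \sum_i \sum_j (a i 0 * b j 0) *: mderiv i (mderiv j p).
  apply: eq_bigr => i _; rewrite /pD (raddf_sum (mderiv i)) scaler_sumr.
  by apply: eq_bigr => j _; rewrite /= mderivZ scalerA.
rewrite !E exchange_big; apply: eq_bigr => i _; apply: eq_bigr => j _ /=.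
by rewrite mderiv_comm mulrC.
Qed.

Lemma is_diff_peval p v : is_diff v (peval p) (fun h => peval (pD h p) v).
Proof.
elim/poly_ind: p => [c|i|p q Hp Hq|p q Hp Hq].
- apply: is_diff_ext (is_diff_const (c : C) v) => h; first by rewrite pevalC.
  by rewrite pDC peval0.
- apply: is_diff_ext (is_diff_coord i v) => h; first by rewrite pevalX.
  by rewrite pDX pevalC.
- apply: is_diff_ext (is_diff_plus Hp Hq) => h; first by rewrite pevalD.
  by rewrite pDD pevalD.
- apply: is_diff_ext (is_diff_times Hp Hq) => h; first by rewrite pevalM.
  by rewrite pDM pevalD !pevalM.
Qed.

Definition pmapD (x : n.+1.-tuple P) v h : V := \col_i peval (pD h (tnth x i)) v.
Definition pmapD2 (x : n.+1.-tuple P) v h k : V :=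
  \col_i peval (pD h (pD k (tnth x i))) v.

Lemma is_diff_pmap x v : is_diff v (pmap x) (pmapD x v).
Proof. by apply: is_diff_col => i; apply: is_diff_peval. Qed.

Lemma is_diff_pmapD x v h : is_diff v (fun w => pmapD x w h) (fun k => pmapD2 x v k h).
Proof. by apply: is_diff_col => i; apply: is_diff_peval. Qed.

Lemma pmapD_add x v h k : pmapD x v (h + k) = pmapD x v h + pmapD x v k.
Proof. by apply/colP => i; rewrite !mxE pD_add pevalD. Qed.
Lemma pmapD_scale x v c h : pmapD x v (c *: h) = c *: pmapD x v h.
Proof. by apply/colP => i; rewrite !mxE pD_scale pevalZ. Qed.
Lemma pmapD0 x v : pmapD x v 0 = 0.
Proof. by rewrite -[in LHS](scale0r 0) pmapD_scale scale0r. Qed.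
Lemma pmapDN x v h : pmapD x v (- h) = - pmapD x v h.
Proof. by rewrite -[- h]scaleN1r pmapD_scale scaleN1r. Qed.
Lemma pmapDB x v h k : pmapD x v (h - k) = pmapD x v h - pmapD x v k.
Proof. by rewrite pmapD_add pmapDN. Qed.

(** Hadamard's lemma. Continuity of the quotients turns an invertible differential at one point into
    injectivity nearby, in place of an inverse function theorem. *)
Lemma peval_hadamard p : exists M : 'I_n.+1 -> V * V -> C,
  [/\ forall i, continuous (M i),
      forall i v, M i (v, v) = peval (mderiv i p) v &
      forall u v, peval p u - peval p v = \sum_i M i (u, v) * (u i 0 - v i 0)].
Proof.
have cp q : continuous (peval q).
  by move=> v; apply: differentiable_continuous; case: (is_diff_peval q v).
elim/poly_ind: p => [c|i|p q [M [cM dM eM]] [N [cN dN eN]]|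
                     p q [M [cM dM eM]] [N [cN dN eN]]].
- exists (fun _ _ => 0); split=> [i z|i v|u v]; first exact: cst_continuous.
    by rewrite mderivC peval0.
  by rewrite !pevalC subrr big1 // => i _; rewrite mul0r.
- exists (fun j _ => (i == j)%:R); split=> [j z|j v|u v]; first exact: cst_continuous.
    by rewrite mderivXU pevalC.
  rewrite !pevalX (bigD1 i) //= eqxx mul1r big1 ?addr0 // => j ji.
  by rewrite eq_sym (negbTE ji) mul0r.
- exists (fun i z => M i z + N i z); split=> [i z|i v|u v].
  + by apply: cvgD; [exact: cM | exact: cN].
  + by rewrite mderivD pevalD dM dN.
  + rewrite !pevalD opprD addrACA eM eN -big_split /=.
    by apply: eq_bigr => i _; rewrite mulrDl.
- exists (fun i z => M i z * peval q z.1 + peval p z.2 * N i z).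
  split=> [i z|i v|u v].
  + apply: cvgD; apply: cvgM => //; [exact: cM| | |exact: cN].
      by apply: cvg_comp; [exact: cvg_fst | exact: cp].
    by apply: cvg_comp; [exact: cvg_snd | exact: cp].
  + by rewrite mderivM pevalD !pevalM dM dN.
  + have -> : peval (p * q) u - peval (p * q) v =
      (peval p u - peval p v) * peval q u + peval p v * (peval q u - peval q v).
      by rewrite !pevalM; ring.
    rewrite eM eN mulr_suml mulr_sumr -big_split /=.
    by apply: eq_bigr => i _; ring.
Qed.

End PolynomialMaps.

Lemma ord2_sum (Z : nmodType) (F : 'I_2 -> Z) : \sum_i F i = F 0 + F 1.
Proof.
rewrite !big_ord_recl big_ord0 addr0.
by congr (F _ + F _); apply: val_inj.
Qed.

Lemma ord2_prod (Z : pzSemiRingType) (F : 'I_2 -> Z) : \prod_i F i = F 0 * F 1.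
Proof.
rewrite !big_ord_recl big_ord0 mulr1.
by congr (F _ * F _); apply: val_inj.
Qed.

Lemma ord2P (Q : 'I_2 -> Prop) : Q 0 -> Q 1 -> forall i, Q i.
Proof.
move=> Q0 Q1 [[|[|//]] Hi].
  by rewrite (_ : Ordinal Hi = 0) //; apply: val_inj.
by rewrite (_ : Ordinal Hi = 1) //; apply: val_inj.
Qed.

Section UnivariateZeros.
Context {C : numFieldType}.

Lemma poly_zero_fun (q : {poly C}) : (forall t, t != 0 -> q.[t] = 0) -> q = 0.
Proof.
move=> H; apply/eqP/negPn/negP => q0.
(* The roots 1, ..., [size q] are distinct in characteristic 0, and one more than the degree
   allows. *)
have := @max_poly_roots _ q [seq i%:R | i <- iota 1 (size q)] q0.
rewrite size_map size_iota ltnn => Hc; suff: false by [].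
apply: Hc.
  rewrite all_map; apply/allP => i; rewrite mem_iota => /andP[i0 _] /=.
  by apply/rootP/H; rewrite pnatr_eq0 -lt0n.
by rewrite map_inj_uniq ?iota_uniq //; exact: mulrIn (oner_neq0 _).
Qed.

End UnivariateZeros.

(** * Homogeneity, Euler's relation and weights *)

Section HomogeneousPolynomials.
Context {C : numClosedFieldType} {n : nat}.
Local Notation V := 'cV[C]_n.+1.
Local Notation P := (mpoly n.+1 C).

Lemma pevalE (p : P) (v : V) :
  peval p v = \sum_(m <- msupp p) mcoeff m p * \prod_i v i 0 ^+ m i.
Proof. exact: mevalE. Qed.

Lemma peval_homog (p : P) d (t : C) (v : V) :
  p \is ishomog1 d mdeg -> peval p (t *: v) = t ^+ d * peval p v.
Proof.
move=> /dhomogP hp; rewrite !pevalE mulr_sumr !big_seq; apply: eq_bigr => m mp.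
have <- : (\sum_i m i)%N = d by rewrite -mdegE; exact: hp.
rewrite mulrCA -prodrXr -big_split /=.
by congr (_ * _); apply: eq_bigr => i _; rewrite mxE exprMn.
Qed.

Lemma euler_homog (p : P) d (v : V) :
  p \is ishomog1 d mdeg -> peval (pD v p) v = d%:R * peval p v.
Proof.
move=> hp.
have D1 : is_diff (1 : C) (fun t : C => t *: v) (fun t => t *: v).
  exact: is_diff_scalel.
have := is_diff_comp' D1 (is_diff_peval p _).
have D2 : is_diff (1 : C) (fun t : C => t ^+ d * peval p v)
    (fun h => (d%:R * 1 ^+ d.-1 * h) * peval p v + 1 ^+ d * 0).
  by apply: is_diff_times (is_diff_exp d _) (is_diff_const _ _); exact: is_diff_id.
have E : (fun t : C => peval p (t *: v)) = (fun t : C => t ^+ d * peval p v).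
  by apply/funext => t; rewrite (peval_homog _ _ hp).
rewrite E => D3; have := is_diffE D2 1; rewrite (is_diffE D3 1).
by rewrite !scale1r mulr0 addr0 expr1n !mulr1.
Qed.

(** Restricted to the line through v, both sides are polynomials in the scaling parameter t; the
    coefficient of t^D selects the monomials of weight D. *)
Lemma weighted_part (f h : P) (x : n.+1.-tuple P) (d : 'I_n.+1 -> nat) D (v : V) :
  (forall v, peval f v = peval h (pmap x v)) -> f \is ishomog1 D mdeg ->
  (forall i, tnth x i \is ishomog1 (d i) mdeg) ->
  peval f v = \sum_(m <- msupp h | (\sum_j m j * d j)%N == D)
                mcoeff m h * \prod_i peval (tnth x i) v ^+ m i.
Proof.
move=> fh hf hx.
pose c (m : multinom n.+1) := mcoeff m h * \prod_i peval (tnth x i) v ^+ m i.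
pose q : {poly C} := \sum_(m <- msupp h) c m *: 'X^(\sum_j m j * d j)
                     - peval f v *: 'X^D.
have q0 : q = 0.
  apply: poly_zero_fun => t _.
  rewrite hornerD hornerN horner_sum hornerZ hornerXn.
  rewrite mulrC -(peval_homog t v hf) fh pevalE; apply/eqP; rewrite subr_eq0.
  apply/eqP; apply: eq_bigr => m _.
  rewrite hornerZ hornerXn -mulrA; congr (_ * _).
  rewrite -prodrXr -big_split /=; apply: eq_bigr => i _.
  by rewrite mxE (peval_homog _ _ (hx i)) exprMn mulrC mulnC exprM.
have := congr1 (fun q : {poly C} => q`_D) q0.
rewrite coefB coefZ coefXn eqxx mulr1 coef0 coef_sum => /eqP.
rewrite subr_eq0 => /eqP <-; rewrite [RHS]big_mkcond /=; apply: eq_bigr => m _.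
by rewrite coefZ coefXn [D == _]eq_sym; case: eqP; rewrite ?mulr1 ?mulr0.
Qed.

End HomogeneousPolynomials.

Section BinaryPolynomials.
Context {C : numClosedFieldType}.
Local Notation V := 'cV[C]_2.
Local Notation P := (mpoly 2 C).

Definition vec2 (a b : C) : V := \col_i (if i == 0 then a else b).

Lemma vec2_0 a b : vec2 a b 0 0 = a. Proof. by rewrite mxE. Qed.
Lemma vec2_1 a b : vec2 a b 1 0 = b. Proof. by rewrite mxE. Qed.

Lemma vec2P (u v : V) : u 0 0 = v 0 0 -> u 1 0 = v 1 0 -> u = v.
Proof. by move=> e0 e1; apply/colP; apply: ord2P. Qed.

Lemma vec2_neq0 (v : V) : v != 0 -> v 0 0 != 0 \/ v 1 0 != 0.
Proof.
move=> v0; case: (eqVneq (v 0 0) 0) => [e0|]; last by left.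
by right; apply: contra v0 => /eqP e1; apply/eqP/vec2P; rewrite mxE.
Qed.

Definition det2 (u v : V) : C := u 0 0 * v 1 0 - u 1 0 * v 0 0.

(* Kronecker substitution (x, y) = (t, t ^ N) *)
Lemma mpoly2_zero_fun (p : P) : (forall v, peval p v = 0) -> p = 0.
Proof.
move=> H; apply/eqP/negPn/negP => p0.
pose N := (msize p).+1; pose k (m : multinom 2) := (m 0%R + N * m 1%R)%N.
have lN (m : multinom 2) i : m \in msupp p -> (m i < N)%N.
  move=> mp; rewrite ltnS; apply: leq_trans (ltnW (msize_mdeg_lt mp)).
  by rewrite mdegE (bigD1 i) //= leq_addr.
pose q : {poly C} := \sum_(m <- msupp p) mcoeff m p *: 'X^(k m).
have q0 : q = 0.
  apply: poly_zero_fun => t _; rewrite -(H (vec2 t (t ^+ N))) pevalE horner_sum.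
  apply: eq_bigr => m _; rewrite hornerZ hornerXn ord2_prod vec2_0 vec2_1.
  by rewrite -exprM -exprD.
have [m0 m0p] : exists m0, m0 \in msupp p.
  case E : (msupp p) => [|m0 s]; last by exists m0; rewrite mem_head.
  by move: p0; rewrite -msupp_eq0 E.
have := congr1 (fun q : {poly C} => q`_(k m0)) q0.
rewrite coef0 coef_sum (bigD1_seq m0) ?msupp_uniq //= coefZ coefXn eqxx mulr1.
rewrite big_seq_cond big1 ?addr0 => [/eqP|m /andP[mp m0m]].
  by rewrite mcoeff_eq0 m0p.
rewrite coefZ coefXn; case: eqP; rewrite ?mulr0 // => E; case/eqP: m0m.
have E0 : m 0 = m0 0.
  by have := congr1 (modn^~ N) E; rewrite /k /= ![(_ + N * _)%N]addnC !(mulnC N) !modnMDl !modn_small ?lN.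
have E1 : m 1 = m0 1 by move: E; rewrite /k E0 => /addnI /eqP; rewrite eqn_mul2l /= => /eqP.
by apply/mnmP; apply: ord2P.
Qed.

Lemma peval_inj (p q : P) : peval p =1 peval q -> p = q.
Proof.
move=> E; apply/eqP; rewrite -subr_eq0; apply/eqP/mpoly2_zero_fun => v.
by rewrite pevalB E subrr.
Qed.

(** Polynomials form a domain: an identity may be proved after multiplication by a form that is not
    identically zero. *)
Lemma peval_cancel (p q : P) v0 : peval p v0 != 0 ->
  (forall v, peval p v * peval q v = 0) -> forall v, peval q v = 0.
Proof.
move=> p0 H; have : p * q = 0 by apply: mpoly2_zero_fun => v; rewrite pevalM.
move/eqP; rewrite mulf_eq0 => /orP[/eqP pE|/eqP -> v]; last by rewrite peval0.
by rewrite pE peval0 eqxx in p0.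
Qed.

End BinaryPolynomials.

(** * Zeros and fibres of binary forms, local injectivity *)

Section BinaryForms.
Context {C : numClosedFieldType}.
Local Notation V := 'cV[C]_2.
Local Notation P := (mpoly 2 C).
Implicit Types f : P.

Lemma peval_curve f (a b : {poly C}) :
  exists q : {poly C}, forall t, q.[t] = peval f (vec2 a.[t] b.[t]).
Proof.
elim/(@poly_ind C 1): f => [c|i|f g [q hq] [q' hq']|f g [q hq] [q' hq']].
- by exists c%:P => t; rewrite hornerC pevalC.
- by move: i; apply: ord2P; [exists a | exists b] => t;
     rewrite pevalX ?vec2_0 ?vec2_1.
- by exists (q + q') => t; rewrite hornerD hq hq' pevalD.
- by exists (q * q') => t; rewrite hornerM hq hq' pevalM.
Qed.

(** The polynomial f(t, 1) has a root unless it is a nonzero constant; in that case f is a multiple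
    of y^k and vanishes at (1, 0). *)
Lemma form_zero f k : f \is ishomog1 k mdeg -> (0 < k)%N ->
  exists2 v : V, v != 0 & peval f v = 0.
Proof.
move=> hf k0.
have [q1 hq1] := peval_curve f 'X 1.
have [q2 hq2] := peval_curve f 1 'X.
have [s1|/closed_rootP[t /rootP qt]] := eqVneq (size q1) 1%N; last first.
  exists (vec2 t 1); last by rewrite -qt hq1 hornerX hornerC.
  apply/negP => /eqP/(congr1 (fun v : V => v 1 0)); rewrite vec2_1 mxE.
  exact/eqP/oner_neq0.
exists (vec2 1 0).
  apply/negP => /eqP/(congr1 (fun v : V => v 0 0)); rewrite vec2_0 mxE.
  exact/eqP/oner_neq0.
have [c _ q1c] := size_poly1P _ (introT eqP s1).
have q20 : q2 - c *: 'X^k = 0.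
  apply: poly_zero_fun => t t0; rewrite hornerD hornerN hornerZ hornerXn hq2.
  rewrite hornerX hornerC (_ : vec2 1 t = t *: vec2 t^-1 1); last first.
    by apply: vec2P; rewrite !mxE /= ?mulfV ?mulr1.
  rewrite (peval_homog _ _ hf) -[X in vec2 X _]hornerX -[X in vec2 _ X](hornerC 1 t^-1).
  by rewrite -hq1 q1c hornerC mulrC subrr.
move/eqP: q20; rewrite subr_eq0 => /eqP /(congr1 (horner^~ 0)).
by rewrite hq2 hornerX hornerC hornerZ hornerXn expr0n gtn_eqF // mulr0.
Qed.

Lemma form_at0 f k : f \is ishomog1 k mdeg -> (0 < k)%N -> peval f 0 = 0.
Proof.
by move=> hf k0; rewrite -(scale0r 0) (peval_homog _ _ hf) expr0n gtn_eqF ?mul0r.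
Qed.

(** A nontrivial zero of the form t f^r - s^r g has its values on the weighted ray of (s, t), and a
    root of a scalar moves it to (s, t). This makes orbit maps surjective. *)
Lemma forms_surjective (f g : P) l r (s t : C) :
  f \is ishomog1 l mdeg -> g \is ishomog1 (r * l)%N mdeg -> (0 < l)%N -> (0 < r)%N ->
  (forall v, peval f v = 0 -> peval g v = 0 -> v = 0) ->
  exists2 v : V, peval f v = s & peval g v = t.
Proof.
move=> hf hg l0 r0 nz.
have rl0 : (0 < r * l)%N by rewrite muln_gt0 r0.
have hF : t *: f ^+ r - s ^+ r *: g \is ishomog1 (r * l)%N mdeg.
  apply: rpredB; apply: rpredZ => //.
  by rewrite mulnC; exact: dhomogMn.
have [v v0] := form_zero hF rl0.
rewrite pevalB !pevalZ pevalXn => /eqP; rewrite subr_eq0 => /eqP E.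
have [s0|s0] := eqVneq s 0; last first.
  have fv : peval f v != 0.
    apply: contra v0 => /eqP fv; apply/eqP/nz => //.
    move: E; rewrite fv expr0n gtn_eqF // mulr0 => /esym/eqP.
    by rewrite mulf_eq0 expf_eq0 (negbTE s0) andbF /= => /eqP.
  pose c := l.-root (s / peval f v).
  have cl : c ^+ l = s / peval f v by rewrite rootCK.
  exists (c *: v); rewrite (peval_homog _ _ hf, peval_homog _ _ hg).
    by rewrite cl divfK.
  rewrite mulnC exprM cl expr_div_n mulrAC -E mulfK //.
  by rewrite expf_eq0 (negbTE fv) andbF.
have [t0|t0] := eqVneq t 0.
  by exists 0; rewrite ?s0 ?t0 (form_at0 hf, form_at0 hg).
have fv : peval f v = 0.
  move: E; rewrite s0 expr0n gtn_eqF // mul0r => /eqP.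
  by rewrite mulf_eq0 (negbTE t0) expf_eq0 r0 /= => /eqP.
have gv : peval g v != 0 by apply: contra v0 => /eqP gv; apply/eqP/nz.
pose c := (r * l).-root (t / peval g v).
have cl : c ^+ (r * l) = t / peval g v by rewrite rootCK.
exists (c *: v); rewrite (peval_homog _ _ hf, peval_homog _ _ hg).
  by rewrite fv mulr0 s0.
by rewrite cl divfK.
Qed.

Lemma finite_roots (q : {poly C}) : q != 0 -> finite_set [set t | root q t].
Proof.
move=> q0; have [rs qE] := closed_field_poly_normal q.
apply: (@sub_finite_set _ _ [set` rs]); last exact: finite_seq.
move=> t /=; rewrite qE rootZ ?lead_coef_eq0 //.
by rewrite root_prod_XsubC.
Qed.

Lemma finite_power_roots (D : nat) (c d : C) : (0 < D)%N -> d != 0 ->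
  finite_set [set y | y ^+ D * c = d].
Proof.
move=> D0 d0; apply: (@sub_finite_set _ _ [set y | root (c *: 'X^D - d%:P) y]).
  move=> y /= E; apply/rootP.
  by rewrite hornerD hornerN hornerZ hornerXn hornerC mulrC E subrr.
apply: finite_roots; apply/negP => /eqP /(congr1 (horner^~ 0)) /eqP.
rewrite hornerD hornerN hornerZ hornerXn !hornerC expr0n gtn_eqF //.
by rewrite mulr0 sub0r oppr_eq0 (negbTE d0).
Qed.

(** The fibre lies in the zero set of t f - s g, which is finitely many lines, and each line meets
    it in the solutions of a power equation. *)
Lemma forms_finite_fiber (f g : P) D (s t : C) :
  f \is ishomog1 D mdeg -> g \is ishomog1 D mdeg -> (0 < D)%N ->
  (forall v, peval f v = 0 -> peval g v = 0 -> v = 0) -> s != 0 \/ t != 0 ->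
  finite_set [set v : V | peval f v = s /\ peval g v = t].
Proof.
move=> hf hg D0 nz st0.
pose F : P := t *: f - s *: g.
have hF : F \is ishomog1 D mdeg by apply: rpredB; apply: rpredZ.
have F0 : exists v, peval F v != 0.
  apply: contrapT => /forallNP F0.
  have {}F0 v : t * peval f v = s * peval g v.
    have /negP/negPn/eqP := F0 v.
    by rewrite pevalB !pevalZ => /eqP; rewrite subr_eq0 => /eqP.
  have [v v0 fv] := form_zero hf D0; have [w w0 gw] := form_zero hg D0.
  case: st0 => e0; [move: v0 (F0 v) | move: w0 (F0 w)].
    rewrite fv mulr0 => v0 /esym/eqP; rewrite mulf_eq0 (negbTE e0) => /eqP gv.
    by rewrite (nz v) ?eqxx in v0.
  rewrite gw mulr0 => w0 /eqP; rewrite mulf_eq0 (negbTE e0) => /eqP fw.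
  by rewrite (nz w) ?eqxx in w0.
have [q hq] := peval_curve F 'X 1.
have qE u : q.[u] = peval F (vec2 u 1) by rewrite hq hornerX hornerC.
have q0 : q != 0.
  apply/negP => /eqP q0; have [v /negP[]] := F0; apply/eqP.
  apply: (@peval_cancel _ (mpolyX C (mnm1 1)) F (vec2 0 1)).
    by rewrite pevalX vec2_1 oner_neq0.
  move=> w; rewrite pevalX; have [->|w1] := eqVneq (w 1 0) 0; first by rewrite mul0r.
  rewrite (_ : w = w 1 0 *: vec2 (w 0 0 / w 1 0) 1); last first.
    by apply: vec2P; rewrite !mxE /= ?mulr1 // mulrC divfK.
  by rewrite (peval_homog _ _ hF) -qE q0 horner0 !mulr0.
pose fib (u : V) := [set c *: u | c in
  (if s != 0 then [set y | y ^+ D * peval f u = s]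
   else [set y | y ^+ D * peval g u = t])].
have finfib u : finite_set (fib u).
  apply: finite_image; case: ifPn => [s0|/negPn/eqP s0].
    exact: finite_power_roots.
  by apply: finite_power_roots => //; case: st0 => //; rewrite s0 eqxx.
apply: (@sub_finite_set _ _
  (fib (vec2 1 0) `|` \bigcup_(u in [set u | root q u]) fib (vec2 u 1))); last first.
  rewrite finite_setU; split=> //.
  by apply: bigcup_finite => [|u _]; [exact: finite_roots|].
have infib c u : peval f (c *: u) = s -> peval g (c *: u) = t -> fib u (c *: u).
  move=> fs gt; exists c => //; rewrite /fib.
  by case: ifP => _ /=; rewrite -(peval_homog _ _ hf, peval_homog _ _ hg).
move=> v /= [fv gv]; have [v1|v1] := eqVneq (v 1 0) 0.
  left; have vE : v = v 0 0 *: vec2 1 0.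
    by apply: vec2P; rewrite !mxE /= ?mulr1 ?mulr0.
  by rewrite vE; apply: infib; rewrite -vE.
have vE : v = v 1 0 *: vec2 (v 0 0 / v 1 0) 1.
  by apply: vec2P; rewrite !mxE /= ?mulr1 // mulrC divfK.
right; exists (v 0 0 / v 1 0); last first.
  by have := infib (v 1 0) (vec2 (v 0 0 / v 1 0) 1); rewrite -vE; apply.
apply/rootP/(mulfI (expf_neq0 D v1)).
by rewrite qE -(peval_homog _ _ hF) -vE pevalB !pevalZ fv gv mulrC subrr mulr0.
Qed.

Lemma mx2P (g h : 'M[C]_2) : (forall v : V, g *m v = h *m v) -> g = h.
Proof.
move=> H; apply/matrixP => i j; have := congr1 (fun v : V => v i 0) (H (delta_mx j 0)).
have E (A : 'M[C]_2) : (A *m (delta_mx j 0 : V)) i 0 = A i j.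
  rewrite mxE (bigD1 j) //= big1 => [|k kj]; rewrite mxE.
    by rewrite !eqxx mulr1 addr0.
  by rewrite (negbTE kj) mulr0.
by rewrite !E.
Qed.

(** A linear map preserving f and g is determined by the images of the two basis vectors, and these
    lie in finite fibres of (f, g). *)
Lemma finite_form_stabilizer (f g : P) D :
  f \is ishomog1 D mdeg -> g \is ishomog1 D mdeg -> (0 < D)%N ->
  (forall v, peval f v = 0 -> peval g v = 0 -> v = 0) ->
  finite_set [set A : 'M[C]_2 |
    forall v, peval f (A *m v) = peval f v /\ peval g (A *m v) = peval g v].
Proof.
move=> hf hg D0 nz.
pose fib (v : V) := [set u : V | peval f u = peval f v /\ peval g u = peval g v].
have finfib v : v != 0 -> finite_set (fib v).
  move=> v0; apply: (forms_finite_fiber hf hg) => //.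
  have [fv|fv] := eqVneq (peval f v) 0; last by left.
  by right; apply: contra v0 => /eqP gv; apply/eqP/nz.
have n0 (j : 'I_2) : (delta_mx j 0 : V) != 0.
  apply/negP => /eqP/(congr1 (fun v : V => v j 0))/eqP.
  by rewrite !mxE !eqxx oner_eq0.
pose cols (uw : V * V) : 'M[C]_2 := \matrix_(i, j) (if j == 0 then uw.1 i 0 else uw.2 i 0).
apply: (@sub_finite_set _ _
  [set cols uw | uw in fib (delta_mx 0 0) `*` fib (delta_mx 1 0)]).
  move=> A /= HA; exists (A *m delta_mx 0 0, A *m delta_mx 1 0) => /=.
    by split; apply: HA.
  have E (j i : 'I_2) : (A *m (delta_mx j 0 : V)) i 0 = A i j.
    rewrite mxE (bigD1 j) //= big1 => [|k kj]; rewrite mxE.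
      by rewrite !eqxx mulr1 addr0.
    by rewrite (negbTE kj) mulr0.
  by apply/matrixP => i; apply: ord2P; rewrite mxE /= E.
by apply: finite_image; apply: finite_setX; apply: finfib.
Qed.

Lemma open_neq0 (f : V -> C) : continuous f -> open [set v | f v != 0].
Proof.
by move=> cf; rewrite openE => v fv; exact: cvgr_neq0 (f v) (cf v) fv.
Qed.

(** The determinant of the Hadamard quotients is nonzero at (p, p), hence nearby; there x(u) = x(v)
    is a linear system in u - v with only the zero solution. *)
Lemma pmap_locally_injective (x : 2.-tuple P) (p : V) (N : set V) :
  open N -> N p -> (forall h, pmapD x p h = 0 -> h = 0) ->
  exists U, [/\ open U, U `<=` N, U p & set_inj U (pmap x)].
Proof.
move=> oN Np inj.
have [M0 [c0 d0 e0]] := peval_hadamard (tnth x 0).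
have [M1 [c1 d1 e1]] := peval_hadamard (tnth x 1).
pose d z := M0 0 z * M1 1 z - M0 1 z * M1 0 z.
have cd : continuous d.
  by move=> z; apply: cvgB; apply: cvgM; [exact: c0|exact: c1|exact: c0|exact: c1].
have dp : d (p, p) != 0.
  apply/negP => /eqP d00; rewrite /d !(d0, d1) in d00.
  pose a i j := peval (mderiv j (tnth x i)) p.
  have DE h i : pmapD x p h i 0 = h 0 0 * a i 0 + h 1 0 * a i 1.
    by rewrite mxE /pD ord2_sum pevalD !pevalZ.
  have k1 : vec2 (a 0 1) (- a 0 0) = 0.
    apply: inj; apply: vec2P; rewrite DE vec2_0 vec2_1 mxE; first by ring.
    by apply: etrans (_ : - (a 0 0 * a 1 1 - a 0 1 * a 1 0) = _);
       [ring|rewrite d00 oppr0].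
  have k2 : vec2 (a 1 1) (- a 1 0) = 0.
    apply: inj; apply: vec2P; rewrite DE vec2_0 vec2_1 mxE; last by ring.
    by rewrite -d00 /a; ring.
  have z i : a i 0 = 0 /\ a i 1 = 0.
    move: i; apply: ord2P; [move: k1 | move: k2] => k;
    have := congr1 (fun v : V => v 0 0) k; have := congr1 (fun v : V => v 1 0) k;
    by rewrite vec2_0 vec2_1 !mxE => /eqP; rewrite oppr_eq0 => /eqP.
  have := inj (vec2 1 0) _; have -> : pmapD x p (vec2 1 0) = 0.
    by apply/colP => i; rewrite DE (proj1 (z i)) (proj2 (z i)) !mulr0 addr0 mxE.
  move=> /(_ erefl) /(congr1 (fun v : V => v 0 0)) /eqP.
  by rewrite vec2_0 mxE oner_eq0.
have nd : \forall z \near (p, p), d z != 0 := cvgr_neq0 (d (p, p)) (cd (p, p)) dp.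
case: nd => [[A B] /= [nA nB] AB].
exists (A^° `&` B^° `&` N); split.
- by do 2!apply: openI => //; exact: open_interior.
- by move=> z [].
- by split=> //; split.
move=> u v /set_mem[[Au Bu] Nu] /set_mem[[Av Bv] Nv] E.
have duv : d (u, v) != 0.
  by apply: (AB (u, v)); split; [exact: interior_subset Au|exact: interior_subset Bv].
have E0 : M0 0 (u, v) * (u 0 0 - v 0 0) + M0 1 (u, v) * (u 1 0 - v 1 0) = 0.
  rewrite -(ord2_sum (fun i => M0 i (u, v) * (u i 0 - v i 0))) -e0.
  by have := congr1 (fun v : V => v 0 0) E; rewrite !mxE => ->; rewrite subrr.
have E1 : M1 0 (u, v) * (u 0 0 - v 0 0) + M1 1 (u, v) * (u 1 0 - v 1 0) = 0.
  rewrite -(ord2_sum (fun i => M1 i (u, v) * (u i 0 - v i 0))) -e1.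
  by have := congr1 (fun v : V => v 1 0) E; rewrite !mxE => ->; rewrite subrr.
apply: vec2P; apply/eqP; rewrite -subr_eq0; apply/eqP/(mulfI duv); rewrite mulr0.
  transitivity (M1 1 (u, v) * (M0 0 (u, v) * (u 0 0 - v 0 0) + M0 1 (u, v) * (u 1 0 - v 1 0))
    - M0 1 (u, v) * (M1 0 (u, v) * (u 0 0 - v 0 0) + M1 1 (u, v) * (u 1 0 - v 1 0))).
    by rewrite /d; ring.
  by rewrite E0 E1 !mulr0 subrr.
transitivity (M0 0 (u, v) * (M1 0 (u, v) * (u 0 0 - v 0 0) + M1 1 (u, v) * (u 1 0 - v 1 0))
    - M1 0 (u, v) * (M0 0 (u, v) * (u 0 0 - v 0 0) + M0 1 (u, v) * (u 1 0 - v 1 0))).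
  by rewrite /d; ring.
by rewrite E0 E1 !mulr0 subrr.
Qed.

End BinaryForms.

Section LinearSubstitution.
Context {C : numClosedFieldType}.
Local Notation V := 'cV[C]_2.
Local Notation P := (mpoly 2 C).
Local Notation M := 'M[C]_2.

Definition plin (g : M) (p : P) : P :=
  comp_mpoly [tuple \sum_j g i j *: mpolyX C (mnm1 j) | i < 2] p.

Lemma peval_plin g p v : peval (plin g p) v = peval p (g *m v).
Proof.
rewrite /peval comp_mpoly_meval; apply: meval_eq => i.
rewrite tnth_mktuple -/(peval _ v) peval_sum mxE; apply: eq_bigr => j _.
by rewrite pevalZ pevalX.
Qed.

Lemma is_diff_mulmx (g : M) (v : V) : is_diff v (fun w => g *m w) (fun h => g *m h).
Proof.
apply: is_diff_ext (is_diff_col (F := fun i w => \sum_j g i j * w j 0)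
   (dF := fun i h => \sum_j g i j * h j 0) _) => [w|w|i].
- by apply/colP => i; rewrite !mxE.
- by apply/colP => i; rewrite !mxE.
- by apply: is_diff_sumr => j; apply/is_diff_mull/is_diff_coord.
Qed.

Lemma peval_pD_plin g p v h :
  peval (pD h (plin g p)) v = peval (pD (g *m h) p) (g *m v).
Proof.
have H := is_diff_comp' (is_diff_mulmx g v) (is_diff_peval p _).
rewrite -(is_diffE H) -(is_diffE (is_diff_peval (plin g p) v)).
by congr ('D_h _ v); apply/funext => w; rewrite peval_plin.
Qed.

Lemma pD_plin g p h : pD h (plin g p) = plin g (pD (g *m h) p).
Proof. by apply: peval_inj => v; rewrite peval_pD_plin peval_plin. Qed.

Lemma homogP (p : P) d :
  (forall t v, peval p (t *: v) = t ^+ d * peval p v) -> p \is ishomog1 d mdeg.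
Proof.
move=> H; apply/dhomogP => m mp.
(* Scaling by t = 2 already tells the degrees of the monomials apart. *)
pose q : P := \sum_(m <- msupp p) (mcoeff m p * 2 ^+ mdeg m) *: mpolyX C m.
have qE : q = 2 ^+ d *: p.
  apply: peval_inj => v; rewrite peval_sum pevalZ -H pevalE; apply: eq_bigr => k _.
  rewrite pevalZ -mulrA; congr (_ * _); rewrite mdegE -prodrXr.
  rewrite /peval mevalX -big_split /=; apply: eq_bigr => i _.
  by rewrite mxE exprMn.
have /eqP := congr1 (mcoeff m) qE.
rewrite mcoeffZ raddf_sum /= (bigD1_seq m) ?msupp_uniq //= big1 => [|k km].
  rewrite mcoeffZ mcoeffX eqxx mulr1 addr0 mulrC -subr_eq0 -mulrBl mulf_eq0.
  rewrite mcoeff_eq0 mp orbF subr_eq0 -!natrX eqr_nat.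
  by rewrite eqn_exp2l // => /eqP.
by rewrite mcoeffZ mcoeffX (negbTE km) mulr0.
Qed.

Lemma plin_homog g p d : p \is ishomog1 d mdeg -> plin g p \is ishomog1 d mdeg.
Proof.
move=> hp; apply: homogP => t v.
by rewrite !peval_plin -scalemxAr (peval_homog _ _ hp).
Qed.

End LinearSubstitution.

(** * Reflection hyperplanes as the critical locus of the orbit map *)

Section Hyperplanes.
Context {C : numClosedFieldType}.
Local Notation V := 'cV[C]_2.
Local Notation P := (mpoly 2 C).
Local Notation M := 'M[C]_2.
Variables (H : set M) (y : 2.-tuple P) (d : 'I_2 -> nat).
Hypotheses (gH : matrix_group H) (finH : finite_set H) (hy : basic_invariants H y d).

(* A polynomial that is flat at all translates g v, g <> 1, keeps its
   differential at v when it is averaged over the group. *)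
Lemma free_pmapD_inj (v : V) : (forall g, H g -> g *m v = v -> g = 1%:M) ->
  forall h, pmapD y v h = 0 -> h = 0.
Proof.
move=> free h yh; case: gH => H1 HM HV.
have [s0 sE0] := proj1 (finite_seqP H) finH.
pose s := undup s0.
have sE g : (g \in s) <-> H g by rewrite mem_undup sE0.
have us : uniq s := undup_uniq _.
(* An affine form that vanishes at g v, in a coordinate where g v and v differ, so that it does not
   vanish at v. *)
pose lam (g : M) : P :=
  let i := if (g *m v) 0 0 == v 0 0 then 1 else 0 in
  mpolyX C (mnm1 i) - mpolyC 2 ((g *m v) i 0).
have lam_g g : peval (lam g) (g *m v) = 0.
  by rewrite pevalB pevalX pevalC subrr.
have lam_v g : H g -> g != 1%:M -> peval (lam g) v != 0.
  move=> Hg g1; rewrite pevalB pevalX pevalC subr_eq0 eq_sym.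
  case: ifPn => // /eqP E; apply: contra g1 => /eqP E'.
  by apply/eqP/free => //; apply: vec2P.
pose L : P := \prod_(g <- s | g != 1%:M) lam g.
have Lv : peval L v != 0.
  rewrite peval_prod prodf_seq_neq0; apply/allP => g /sE Hg.
  by apply/implyP; exact: lam_v.
have Lg g : H g -> g != 1%:M -> peval L (g *m v) = 0.
  move=> /sE gs g1; apply/eqP; rewrite peval_prod prodf_seq_eq0.
  by apply/hasP; exists g; rewrite ?g1 ?lam_g /=.
(* The square kills value and differential at every g v with g <> 1, while the differential at v is
   L(v)^2 times the k-th coordinate. *)
pose p k : P := (mpolyX C (mnm1 k) - mpolyC 2 (v k 0)) * L ^+ 2.
pose f k : P := \sum_(g <- s) plin g (p k).
have inv_f k : invariant_poly H (f k).
  move=> g w Hg; rewrite !peval_sum.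
  rewrite [RHS](perm_big [seq a *m g | a <- s]) /=; last first.
    apply: uniq_perm => //.
      rewrite map_inj_uniq // => a b /(congr1 (mulmx^~ (invmx g))).
      by rewrite !mulmxK //; case: (HV g Hg).
    move=> a; apply/idP/idP => [/sE Ha|].
      case: (HV g Hg) => ug Hi.
      rewrite -[a](mulmxKV ug); apply: map_f; apply/sE; exact: HM.
    by case/mapP => b /sE Hb ->; apply/sE/HM.
  by rewrite big_map; apply: eq_bigr => a _; rewrite !peval_plin mulmxA.
have Df k : peval (pD h (f k)) v = h k 0 * peval L v ^+ 2.
  have -> : pD h (f k) = \sum_(g <- s) plin g (pD (g *m h) (p k)).
    rewrite /f; elim: (s) => [|g r IH]; rewrite ?big_nil ?big_cons.
      by rewrite (pDC h 0).
    by rewrite pDD IH pD_plin.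
  rewrite peval_sum (bigD1_seq _ (proj2 (sE _) H1) us) /=.
  rewrite big_seq_cond big1 ?addr0 => [|g /andP[/sE Hg g1]]; rewrite peval_plin.
    rewrite !mul1mx pDM pevalD pevalM pevalXn [X in _ + X]pevalM.
    rewrite pevalB pevalX pevalC subrr mul0r addr0.
    by rewrite pDB pDX pDC subr0 pevalC.
  rewrite pDM pDXn pevalD pevalM pevalXn Lg // expr0n mulr0 add0r.
  by rewrite pevalM pevalZ pevalM pevalXn Lg // expr1 mul0r !mulr0.
apply/colP => k; rewrite mxE.
apply: (mulIf (expf_neq0 2 Lv)); rewrite mul0r -Df.
case: hy => _ _ _ /(_ _ (inv_f k)) [q qE].
have D1 := is_diff_comp' (is_diff_pmap y v) (is_diff_peval q _).
have E : peval (f k) = (fun w => peval q (pmap y w)) by apply/funext.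
rewrite -(is_diffE (is_diff_peval (f k) v)) E (is_diffE D1) yh.
by rewrite /pD big1 ?peval0 // => i _; rewrite mxE scale0r.
Qed.

Lemma fixer_is_reflection (g : M) (v : V) :
  v != 0 -> g != 1%:M -> g *m v = v -> is_reflection g.
Proof.
move=> v0 g1 gv; rewrite /is_reflection; apply/eqP; rewrite eqn_leq; apply/andP; split.
  rewrite -ltnS ltn_neqAle rank_leq_row andbT; apply/negP => /eqP rk.
  have ug : g - 1%:M \in unitmx by rewrite -row_free_unit -row_leq_rank rk.
  move/eqP: v0; apply; rewrite -[v](mulKmx ug) mulmxBl gv mul1mx subrr.
  by rewrite mulmx0.
by rewrite lt0n mxrank_eq0 subr_eq0.
Qed.

(** At a fixed point of g, invariance of y kills the range of g - 1. Conversely a trivial stabilizer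
    makes the differential injective, and in dimension 2 a nontrivial element fixing v <> 0 is a
    reflection. The existence of some reflection settles v = 0. *)
Lemma reflection_hyperplanesP (v : V) : (exists2 g, H g & is_reflection g) ->
  reflection_hyperplanes H v <-> exists2 h, h != 0 & pmapD y v h = 0.
Proof.
move=> [g0 Hg0 refl0]; case: gH => H1 HM HV; split.
  case=> g [Hg rg gv].
  have [k gk] : exists k : V, (g - 1%:M) *m k != 0.
    apply: contrapT => /forallNP E.
    have : g - 1%:M = 0.
      by apply: mx2P => k; have /negP/negPn/eqP -> := E k; rewrite mul0mx.
    by move=> E0; move: rg; rewrite /is_reflection E0 mxrank0.
  exists ((g - 1%:M) *m k) => //; apply/colP => i.
  rewrite mulmxBl mul1mx !mxE pD_add pevalD -scaleN1r pD_scale pevalZ mulN1r.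
  case: hy => _ _ /(_ i) yi _.
  have E : plin g (tnth y i) = tnth y i.
    by apply: peval_inj => w; rewrite peval_plin yi.
  by rewrite -[in X in _ - X]E peval_pD_plin gv subrr.
case=> h h0 yh; have [->|v0] := eqVneq v 0.
  by exists g0; split; rewrite ?mulmx0.
apply: contrapT => nv; move/eqP: h0; apply.
apply: (free_pmapD_inj _ yh) => g Hg gv; apply/eqP/negPn/negP => g1.
by apply: nv; exists g; split=> //; apply: fixer_is_reflection gv.
Qed.

End Hyperplanes.

(** * Almost Saito structures in coordinates *)

Section TensorCriterion.
Context {C : numClosedFieldType} {n : nat}.
Local Notation V := 'cV[C]_n.+1.
Implicit Types (T : 'I_n.+1 -> 'I_n.+1 -> V) (x y z : V).

Definition bil T x y : V := \sum_i \sum_j (x i 0 * y j 0) *: T i j.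

Lemma bilDl T x x' y : bil T (x + x') y = bil T x y + bil T x' y.
Proof.
rewrite /bil -big_split; apply: eq_bigr => i _; rewrite -big_split.
by apply: eq_bigr => j _; rewrite mxE mulrDl scalerDl.
Qed.
Lemma bilDr T x y y' : bil T x (y + y') = bil T x y + bil T x y'.
Proof.
rewrite /bil -big_split; apply: eq_bigr => i _; rewrite -big_split.
by apply: eq_bigr => j _; rewrite mxE mulrDr scalerDl.
Qed.
Lemma bilZl T k x y : bil T (k *: x) y = k *: bil T x y.
Proof.
rewrite /bil scaler_sumr; apply: eq_bigr => i _; rewrite scaler_sumr.
by apply: eq_bigr => j _; rewrite mxE scalerA mulrA.
Qed.
Lemma bilZr T k x y : bil T x (k *: y) = k *: bil T x y.
Proof.
rewrite /bil scaler_sumr; apply: eq_bigr => i _; rewrite scaler_sumr.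
by apply: eq_bigr => j _; rewrite mxE scalerA mulrCA.
Qed.
Lemma bilNl T x y : bil T (- x) y = - bil T x y.
Proof. by rewrite -[- x]scaleN1r bilZl scaleN1r. Qed.
Lemma bil0l T y : bil T 0 y = 0.
Proof. by rewrite -[X in bil T X y](scale0r 0) bilZl scale0r. Qed.
Lemma bil0r T x : bil T x 0 = 0.
Proof. by rewrite -[X in bil T x X](scale0r 0) bilZr scale0r. Qed.

Lemma bil_delta T i j : bil T (delta_mx i 0) (delta_mx j 0) = T i j.
Proof.
rewrite /bil (bigD1 i) //= (bigD1 j) //= !mxE !eqxx mulr1 scale1r.
rewrite big1 => [|k kj]; last by rewrite !mxE (negbTE kj) mulr0 scale0r.
rewrite addr0 big1 ?addr0 // => k ki.
by rewrite big1 // => l _; rewrite !mxE (negbTE ki) mul0r scale0r.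
Qed.

Lemma is_diff_scale (k : V -> C) (f : V -> V) p dk df :
  is_diff p k dk -> is_diff p f df ->
  is_diff p (fun q => k q *: f q) (fun h => dk h *: f p + k p *: df h).
Proof.
move=> Hk Hf; apply: is_diff_ext (is_diff_col (fun i => is_diff_times Hk (is_diff_row i Hf))).
  by move=> q; apply/colP => i; rewrite !mxE.
by move=> q; apply/colP => i; rewrite !mxE.
Qed.

Lemma is_diff_bil (T : V -> 'I_n.+1 -> 'I_n.+1 -> V) (X Y : V -> V) p dT dX dY :
  (forall i j, is_diff p (fun q => T q i j) (dT i j)) ->
  is_diff p X dX -> is_diff p Y dY ->
  is_diff p (fun q => bil (T q) (X q) (Y q))
    (fun h => bil (fun i j => dT i j h) (X p) (Y p) +
              (bil (T p) (dX h) (Y p) + bil (T p) (X p) (dY h))).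
Proof.
move=> HT HX HY; apply: is_diff_ext (is_diff_sumr (fun i => is_diff_sumr (fun j =>
  is_diff_scale (is_diff_times (is_diff_row i HX) (is_diff_row j HY)) (HT i j)))) => // h.
rewrite /bil -!big_split; apply: eq_bigr => i _; rewrite -!big_split.
by apply: eq_bigr => j _ /=; rewrite [RHS]addrC scalerDl.
Qed.

Lemma is_diff_bil_const (T : V -> 'I_n.+1 -> 'I_n.+1 -> V) x y p dT :
  (forall i j, is_diff p (fun q => T q i j) (dT i j)) ->
  is_diff p (fun q => bil (T q) x y) (fun h => bil (fun i j => dT i j h) x y).
Proof.
move=> HT; apply: is_diff_ext (is_diff_bil HT (is_diff_const x p) (is_diff_const y p)) => // h.
by rewrite bil0l bil0r !addr0.
Qed.

Lemma covE (g : @christoffel C n) X Y p :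
  cov g X Y p = 'D_(X p) Y p + bil (g p) (X p) (Y p).
Proof. by []. Qed.

Lemma prod_vfE (c : @structure_constants C n) X Y p :
  prod_vf c X Y p = bil (c p) (X p) (Y p).
Proof. by []. Qed.

Ltac vector_ring :=
  repeat match goal with |- context [bil ?T ?x ?y] =>
    let u := fresh "u" in set u := bil T x y; clearbody u end;
  apply/colP => ?; rewrite !mxE; ring.

(* Tensoriality: the axioms hold as soon as they hold for constant vector fields. *)
Lemma almost_saito_intro (N : set V) (r : C) (S : saito_data) (e : V) (dE : V -> V) :
  open N -> (exists p, N p) ->
  (forall i j, holomorphic N (fun p => conn S p i j)) ->
  (forall i j, holomorphic N (fun p => mult S p i j)) ->
  e_field S = (fun=> e) -> e != 0 ->
  (forall p, N p -> is_diff p (unit_field S) dE) ->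
  (forall p x, N p -> dE x + bil (conn S p) x (unit_field S p) = r *: x) ->
  (forall p x y, N p -> bil (conn S p) x y = bil (conn S p) y x) ->
  (forall p x y, N p -> bil (mult S p) x y = bil (mult S p) y x) ->
  (forall p x y z, N p -> bil (mult S p) (bil (mult S p) x y) z =
                          bil (mult S p) x (bil (mult S p) y z)) ->
  (forall p x, N p -> bil (mult S p) (unit_field S p) x = x) ->
  (forall p x y z, N p ->
     'D_x (fun q => bil (conn S q) y z) p + bil (conn S p) x (bil (conn S p) y z) =
     'D_y (fun q => bil (conn S q) x z) p + bil (conn S p) y (bil (conn S p) x z)) ->
  (forall p x y z, N p ->
     'D_x (fun q => bil (mult S q) y z) p + bil (conn S p) x (bil (mult S p) y z)
       - bil (mult S p) y (bil (conn S p) x z) =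
     'D_y (fun q => bil (mult S q) x z) p + bil (conn S p) y (bil (mult S p) x z)
       - bil (mult S p) x (bil (conn S p) y z)) ->
  (forall p x y, N p ->
     'D_e (fun q => bil (mult S q) x y) p + bil (mult S p) e (bil (mult S p) x y) = 0) ->
  (forall p x y, N p ->
     'D_x (fun q => bil (conn S q) y e) p + bil (conn S p) x (bil (conn S p) y e)
     - bil (conn S p) (bil (conn S p) x y) e + bil (conn S p) (bil (mult S p) x y) e = 0) ->
  almost_saito N r S.
Proof.
case: S => g c E eS /= oN [p0 Np0] hg hc eE e0 hE a3 gC cC cA c1 flat T1 T2 T4.
have Dg p : N p -> forall i j,
    is_diff p (fun q => g q i j) (fun h => 'D_h (fun q => g q i j) p).
  by move=> Np i j; apply: is_diff_D; apply: hg.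
have Dc p : N p -> forall i j,
    is_diff p (fun q => c q i j) (fun h => 'D_h (fun q => c q i j) p).
  by move=> Np i j; apply: is_diff_D; apply: hc.
pose dg p h i j := 'D_h (fun q => g q i j) p.
pose dc p h i j := 'D_h (fun q => c q i j) p.
have DgE p h x y : N p -> 'D_h (fun q => bil (g q) x y) p = bil (dg p h) x y.
  by move=> Np; rewrite (is_diffE (is_diff_bil_const x y (Dg p Np))).
have DcE p h x y : N p -> 'D_h (fun q => bil (c q) x y) p = bil (dc p h) x y.
  by move=> Np; rewrite (is_diffE (is_diff_bil_const x y (Dc p Np))).
have DX U X p : U `<=` N -> holomorphic U X -> U p -> is_diff p X (fun h => 'D_h X p).
  by move=> UN hX Up; apply: is_diff_D; apply: hX.
have DgX U X Y p h : U `<=` N -> holomorphic U X -> holomorphic U Y -> U p ->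
    'D_h (fun q => bil (g q) (X q) (Y q)) p = bil (dg p h) (X p) (Y p) +
      (bil (g p) ('D_h X p) (Y p) + bil (g p) (X p) ('D_h Y p)).
  move=> UN hX hY Up; have Np := UN _ Up.
  by rewrite (is_diffE (is_diff_bil (Dg p Np) (DX _ _ _ UN hX Up) (DX _ _ _ UN hY Up))).
have DcX U X Y p h : U `<=` N -> holomorphic U X -> holomorphic U Y -> U p ->
    'D_h (fun q => bil (c q) (X q) (Y q)) p = bil (dc p h) (X p) (Y p) +
      (bil (c p) ('D_h X p) (Y p) + bil (c p) (X p) ('D_h Y p)).
  move=> UN hX hY Up; have Np := UN _ Up.
  by rewrite (is_diffE (is_diff_bil (Dc p Np) (DX _ _ _ UN hX Up) (DX _ _ _ UN hY Up))).
have hcst U w : holomorphic U (fun=> w : V) by move=> q _; exact: differentiable_cst.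
have e_const : forall w p : V, 'D_w (fun=> e) p = 0 by move=> w p; exact: derive_cst.
split=> //=.
- by move=> p Np; case: (hE p Np).
- by rewrite eE => p _; exact: differentiable_cst.
- by exists p0; rewrite // eE.
- move=> U X Y oU UN hX hY p Up; rewrite !covE /bracket.
  by rewrite (gC p (X p)); [rewrite opprD addrACA subrr addr0 | exact: UN].
- move=> U X Y w oU UN hX hY p Up; have Np := UN _ Up.
  rewrite /curvature !covE /bracket.
  have F Z : cov g Z (cst w) = (fun q => bil (g q) (Z q) w).
    by apply/funext => q; rewrite covE derive_cst add0r.
  rewrite !F (DgX U _ (fun=> w)) // (DgX U _ (fun=> w)) // !derive_cst !add0r.
  rewrite !bil0r !addr0 bilDl bilNl.
  have := flat p (X p) (Y p) w Np; rewrite !DgE // => /eqP; rewrite -subr_eq0 => /eqP <-.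
  by vector_ring.
- by move=> U X Y oU UN hX hY p Up; rewrite !prod_vfE; apply: cC; exact: UN.
- by move=> U X Y Z oU UN hX hY hZ p Up; rewrite !prod_vfE; apply: cA; exact: UN.
- by move=> U X oU UN hX p Up; rewrite prod_vfE; apply: c1; exact: UN.
- move=> U X Y Z oU UN hX hY hZ p Up; have Np := UN _ Up.
  rewrite !covE !prod_vfE /bracket /=.
  rewrite (DcX U) // (DcX U) // !covE !bilDr bilDl bilNl.
  have := T1 p (X p) (Y p) (Z p) Np; rewrite !DcE // => /eqP; rewrite -subr_eq0 => /eqP t1.
  apply/eqP; rewrite -subr_eq0 -t1; apply/eqP.
  by vector_ring.
- move=> U X Y oU UN hX hY p Up; have Np := UN _ Up.
  rewrite eE /bracket /= !prod_vfE (DcX U) // !e_const !subr0.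
  rewrite -(T2 p (X p) (Y p) Np) DcE //.
  by vector_ring.
- move=> U X oU UN hX p Up; have Np := UN _ Up.
  by rewrite covE (is_diffE (hE p Np)); apply: a3.
- move=> U X Y oU UN hX hY p Up; have Np := UN _ Up.
  have F Z : cov g Z (fun=> e) = (fun q => bil (g q) (Z q) e).
    by apply/funext => q; rewrite covE e_const add0r.
  rewrite eE !F covE (DgX U _ (fun=> e)) // e_const prod_vfE !covE.
  rewrite bil0r addr0 bilDl.
  rewrite -(T4 p (X p) (Y p) Np) DgE //.
  by vector_ring.
Qed.

End TensorCriterion.

(** * Pushing connections and products forward along polynomial maps *)

Section Pushforward.
Context {C : numClosedFieldType}.
Local Notation V := 'cV[C]_2.
Local Notation P := (mpoly 2 C).
Implicit Types (x : 2.-tuple P) (p q h k : V).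

Lemma eq_on_open_derive (f g : V -> V) (U : set V) p h :
  open U -> U p -> (forall q, U q -> f q = g q) ->
  'D_h f p = 'D_h g p.
Proof.
move=> oU Up E; apply: near_eq_derive.
by near=> q; apply: E; near: q; exact: open_nbhs_nbhs.
Unshelve. all: by end_near. Qed.

Lemma is_diff_pmapD_comp x (F Y : V -> V) p dF dY : is_diff p F dF -> is_diff p Y dY ->
  is_diff p (fun q => pmapD x (F q) (Y q))
    (fun h => pmapD2 x (F p) (dF h) (Y p) + pmapD x (F p) (dY h)).
Proof.
move=> HF HY; apply: is_diff_ext (is_diff_col (fun i => is_diff_sumr (fun j =>
  is_diff_times (is_diff_row j HY)
    (is_diff_comp' HF (is_diff_peval (mderiv j (tnth x i)) (F p)))))).
  move=> q; apply/colP => i; rewrite !mxE /pD peval_sum.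
  by apply: eq_bigr => j _; rewrite pevalZ.
move=> h /=; apply/colP => i; rewrite !mxE pD_comm /pD !peval_sum -big_split.
apply: eq_bigr => j _ /=; rewrite !pevalZ addrC; congr (_ + _).
by rewrite -/(pD (dF h) (tnth x i)) (_ : mderiv j (pD (dF h) (tnth x i)) = pD (dF h) (mderiv j (tnth x i))) //
  /pD raddf_sum; apply: eq_bigr => l _; rewrite /= mderivZ mderiv_comm.
Qed.

Lemma is_diff_pmapD_field x (Y : V -> V) p dY : is_diff p Y dY ->
  is_diff p (fun q => pmapD x q (Y q)) (fun h => pmapD2 x p h (Y p) + pmapD x p (dY h)).
Proof. by move=> HY; apply: is_diff_pmapD_comp => //; exact: is_diff_id. Qed.

Lemma pmapD_comp (x y f : 2.-tuple P) v h :
  (forall w, pmap x w = pmap f (pmap y w)) ->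
  pmapD x v h = pmapD f (pmap y v) (pmapD y v h).
Proof.
move=> E; rewrite -(is_diffE (is_diff_pmap x v)) (_ : pmap x = (fun w => pmap f (pmap y w))).
  by rewrite (is_diffE (is_diff_comp' (is_diff_pmap y v) (is_diff_pmap f _))).
exact/funext.
Qed.

Lemma pmapD2_comp (x y f : 2.-tuple P) v h k :
  (forall w, pmap x w = pmap f (pmap y w)) ->
  pmapD2 x v h k = pmapD2 f (pmap y v) (pmapD y v h) (pmapD y v k)
                   + pmapD f (pmap y v) (pmapD2 y v h k).
Proof.
move=> E; rewrite -(is_diffE (is_diff_pmapD x v k)).
rewrite (_ : (fun w => _) = (fun w => pmapD f (pmap y w) (pmapD y w k))).
  by rewrite (is_diffE (is_diff_pmapD_comp f (is_diff_pmap y v) (is_diff_pmapD y v k))).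
by apply/funext => w; exact: pmapD_comp.
Qed.

Lemma pushes_fieldP x (U : set V) X X' :
  pushes_field (pmap x) U X X' <-> forall p, U p -> pmapD x p (X p) = X' (pmap x p).
Proof.
by split=> H p Up; have := H p Up; rewrite (is_diffE (is_diff_pmap x p)).
Qed.

(** The hypothesis is the transformation law of Christoffel symbols; the derivative of the relation
    between Y and Y' supplies the remaining terms. *)
Lemma pushes_cov_intro x N (g g' : @christoffel C 1) :
  (forall p h k, N p -> pmapD x p (bil (g p) h k) =
     pmapD2 x p h k + bil (g' (pmap x p)) (pmapD x p h) (pmapD x p k)) ->
  pushes_op (pmap x) N (cov g) (cov g').
Proof.
move=> H U X Y X' Y' oU UN _ hX hY hX' hY' /pushes_fieldP pX pY.
apply/pushes_fieldP => p Up; move/pushes_fieldP in pY.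
have DY := is_diff_D (hY p Up).
have DY' : is_diff (pmap x p) Y' (fun h => 'D_h Y' (pmap x p)).
  by apply: is_diff_D; apply: hY'; exists p.
have := eq_on_open_derive (X p) oU Up pY.
rewrite (is_diffE (is_diff_pmapD_field x DY)).
rewrite (is_diffE (is_diff_comp' (is_diff_pmap x p) DY')) => E.
rewrite !covE pmapD_add H ?UN; last exact: UN.
by rewrite addrCA addrA E pX // pY.
Qed.

Lemma pushes_prod_intro x N (c c' : @structure_constants C 1) :
  (forall p h k, N p -> pmapD x p (bil (c p) h k) =
     bil (c' (pmap x p)) (pmapD x p h) (pmapD x p k)) ->
  pushes_op (pmap x) N (prod_vf c) (prod_vf c').
Proof.
move=> H U X Y X' Y' oU UN _ hX hY hX' hY' /pushes_fieldP pX pY.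
apply/pushes_fieldP => p Up; move/pushes_fieldP in pY.
by rewrite !prod_vfE H ?pX ?pY //; exact: UN.
Qed.

(** Local lifts of constant fields of the target, by Cramer's rule. As test fields they make the
    pushforward condition pointwise without differentiating a local inverse of x. *)
Lemma pmapD_frame x N p : open N -> N p -> (forall h, pmapD x p h = 0 -> h = 0) ->
  exists U, [/\ open U, U `<=` N, U p, set_inj U (pmap x) &
    forall h, exists X, [/\ holomorphic U X, X p = h &
      forall q, U q -> pmapD x q (X q) = pmapD x p h]].
Proof.
move=> oN Np inj.
pose a i j : P := mderiv j (tnth x i).
have DE q h i : pmapD x q h i 0 = h 0 0 * peval (a i 0) q + h 1 0 * peval (a i 1) q.
  by rewrite mxE /pD ord2_sum pevalD !pevalZ.
pose d : P := a 0 0 * a 1 1 - a 0 1 * a 1 0.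
have dE q : peval d q = peval (a 0 0) q * peval (a 1 1) q - peval (a 0 1) q * peval (a 1 0) q.
  by rewrite pevalB !pevalM.
have dp : peval d p != 0.
  apply/negP => /eqP d0; rewrite dE in d0.
  have k1 : vec2 (peval (a 0 1) p) (- peval (a 0 0) p) = 0.
    apply: inj; apply: vec2P; rewrite DE vec2_0 vec2_1 mxE; first by ring.
    by rewrite -[RHS]oppr0 -d0; ring.
  have k2 : vec2 (peval (a 1 1) p) (- peval (a 1 0) p) = 0.
    apply: inj; apply: vec2P; rewrite DE vec2_0 vec2_1 mxE; last by ring.
    by rewrite -d0; ring.
  have z i : peval (a i 0) p = 0 /\ peval (a i 1) p = 0.
    move: i; apply: ord2P; [move: k1 | move: k2] => k;
    have := congr1 (fun v : V => v 0 0) k; have := congr1 (fun v : V => v 1 0) k;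
    by rewrite vec2_0 vec2_1 !mxE => /eqP; rewrite oppr_eq0 => /eqP.
  have := inj (vec2 1 0) _; have -> : pmapD x p (vec2 1 0) = 0.
    by apply/colP => i; rewrite DE (proj1 (z i)) (proj2 (z i)) !mulr0 addr0 mxE.
  move=> /(_ erefl) /(congr1 (fun v : V => v 0 0)) /eqP.
  by rewrite vec2_0 mxE oner_eq0.
have cd : continuous (peval d).
  by move=> v; apply: differentiable_continuous; case: (is_diff_peval d v).
have [U [oU UN Up iU]] := pmap_locally_injective
  (openI oN (open_neq0 cd)) (conj Np dp : (N `&` [set v | peval d v != 0]) p) inj.
exists U; split=> // [z /UN[]//|h].
pose b := pmapD x p h.
pose X q : V := \col_i (if i == 0 then
   (peval (a 1 1) q * b 0 0 - peval (a 0 1) q * b 1 0) / peval d q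
   else (peval (a 0 0) q * b 1 0 - peval (a 1 0) q * b 0 0) / peval d q).
have XE q : peval d q != 0 -> pmapD x q (X q) = b.
  by rewrite dE => dq; apply: vec2P; rewrite DE !mxE /= dE; field.
exists X; split.
- move=> q /UN[_ dq]; apply: differentiable_col; apply: ord2P => /=;
  by diff_scalar => //; exact: is_diff_peval.
- apply/eqP; rewrite -subr_eq0; apply/eqP/inj.
  by rewrite pmapDB XE ?subrr.
- by move=> q /UN[_ dq]; exact: XE.
Qed.

(** The condition is applied to lifts of constant fields: the target derivative is zero, and
    differentiating the lift produces [pmapD2]. *)
Lemma pushes_cov_elim x N (g g' : @christoffel C 1) p h k : open N -> N p ->
  (forall h, pmapD x p h = 0 -> h = 0) ->
  pushes_op (pmap x) N (cov g) (cov g') ->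
  pmapD x p (bil (g p) h k) =
    pmapD2 x p h k + bil (g' (pmap x p)) (pmapD x p h) (pmapD x p k).
Proof.
move=> oN Np inj push; have [U [oU UN Up iU F]] := pmapD_frame oN Np inj.
have [X [hX Xp pX]] := F h; have [Y [hY Yp pY]] := F k.
have hc (w : V) A : holomorphic A (fun=> w) by move=> q _; exact: differentiable_cst.
have fX : pushes_field (pmap x) U X (fun=> pmapD x p h) by apply/pushes_fieldP.
have fY : pushes_field (pmap x) U Y (fun=> pmapD x p k) by apply/pushes_fieldP.
have := push U X Y _ _ oU UN iU hX hY (hc _ _) (hc _ _) fX fY.
move/pushes_fieldP => /(_ p Up); rewrite !covE Xp Yp derive_cst add0r => <-.
have DY := is_diff_D (hY p Up).
have := eq_on_open_derive h oU Up pY.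
rewrite (is_diffE (is_diff_pmapD_field x DY)) derive_cst Yp => E.
by rewrite pmapD_add addrA E add0r.
Qed.

End Pushforward.

(** * Structures on the complement of three lines *)

Section LinearForms.
Context {C : numClosedFieldType}.
Local Notation V := 'cV[C]_2.
Implicit Types a b c x y z p q : V.

Definition lf a x : C := a 0 0 * x 0 0 + a 1 0 * x 1 0.

Lemma lfD a x y : lf a (x + y) = lf a x + lf a y.
Proof. by rewrite /lf !mxE; ring. Qed.
Lemma lfB a x y : lf a (x - y) = lf a x - lf a y.
Proof. by rewrite /lf !mxE; ring. Qed.
Lemma lfZ a k x : lf a (k *: x) = k * lf a x.
Proof. by rewrite /lf !mxE; ring. Qed.
Lemma lf0 a : lf a 0 = 0.
Proof. by rewrite /lf !mxE; ring. Qed.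

Lemma is_diff_lf a p : is_diff p (lf a) (lf a).
Proof.
by apply: is_diff_ext (is_diff_plus (is_diff_mull (a 0 0) (is_diff_coord 0 p))
  (is_diff_mull (a 1 0) (is_diff_coord 1 p))).
Qed.

Lemma is_diff_lf_comp a (F : V -> V) p dF : is_diff p F dF ->
  is_diff p (fun q => lf a (F q)) (fun h => lf a (dF h)).
Proof. by move=> HF; apply: (is_diff_comp' HF (is_diff_lf a _)). Qed.

Lemma lf_derive a (F : V -> V) p h : differentiable F p ->
  lf a ('D_h F p) = 'D_h (fun q => lf a (F q)) p.
Proof. by move=> DF; rewrite (is_diffE (is_diff_lf_comp a (is_diff_D DF))). Qed.

Lemma lf_inj a b x y : det2 a b != 0 -> lf a x = lf a y -> lf b x = lf b y -> x = y.
Proof.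
move=> ab; rewrite /lf => ea eb; apply: vec2P; apply: (mulfI ab); rewrite /det2.
  transitivity (b 1 0 * (a 0 0 * x 0 0 + a 1 0 * x 1 0) -
                a 1 0 * (b 0 0 * x 0 0 + b 1 0 * x 1 0)); first by ring.
  by rewrite ea eb; ring.
transitivity (a 0 0 * (b 0 0 * x 0 0 + b 1 0 * x 1 0) -
              b 0 0 * (a 0 0 * x 0 0 + a 1 0 * x 1 0)); first by ring.
by rewrite ea eb; ring.
Qed.

Lemma lf_neq0 a b x : det2 a b != 0 -> x != 0 -> lf a x != 0 \/ lf b x != 0.
Proof.
move=> ab x0; have [ea|] := eqVneq (lf a x) 0; last by left.
right; apply: contra x0 => /eqP eb; apply/eqP; apply: (lf_inj ab); by rewrite lf0.
Qed.

(* The vector on which the linear forms a and b take the values s and t. *)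
Definition mkv a b (s t : C) : V :=
  vec2 ((s * b 1 0 - t * a 1 0) / det2 a b) ((a 0 0 * t - b 0 0 * s) / det2 a b).

Lemma lf_mkv_l a b s t : det2 a b != 0 -> lf a (mkv a b s t) = s.
Proof.
by move=> ab; rewrite /lf vec2_0 vec2_1; rewrite /det2 in ab *; field.
Qed.
Lemma lf_mkv_r a b s t : det2 a b != 0 -> lf b (mkv a b s t) = t.
Proof.
by move=> ab; rewrite /lf vec2_0 vec2_1; rewrite /det2 in ab *; field.
Qed.

Lemma differentiable_mkv a b (s t : V -> C) p : det2 a b != 0 ->
  differentiable s p -> differentiable t p -> differentiable (fun q => mkv a b (s q) (t q)) p.
Proof.
move=> ab ds dt; apply: differentiable_col; apply: ord2P => /=;
by diff_scalar => //; exact: is_diff_D.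
Qed.

Definition bilmk a b (s t : V -> V -> C) (i j : 'I_2) : V :=
  mkv a b (s (delta_mx i 0) (delta_mx j 0)) (t (delta_mx i 0) (delta_mx j 0)).

Definition bilinear_form (s : V -> V -> C) : Prop :=
  (forall x x' y k, s (k *: x + x') y = k * s x y + s x' y) /\
  (forall x y y' k, s x (k *: y + y') = k * s x y + s x y').

Lemma vec2_delta x : x = x 0 0 *: delta_mx 0 0 + (x 1 0 *: delta_mx 1 0 + 0).
Proof. by apply: vec2P; rewrite !mxE /= ?mulr1n ?mulr0n; ring. Qed.

Lemma bilinear_form0 s x : bilinear_form s -> s 0 x = 0 /\ s x 0 = 0.
Proof.
case=> l r; split.
  have := l 0 0 x 1; rewrite scaler0 addr0 mul1r => /eqP.
  by rewrite -subr_eq0 opprD addrA subrr sub0r oppr_eq0 => /eqP.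
have := r x 0 0 1; rewrite scaler0 addr0 mul1r => /eqP.
by rewrite -subr_eq0 opprD addrA subrr sub0r oppr_eq0 => /eqP.
Qed.

Lemma bil_bilmk a b s t x y : bilinear_form s -> bilinear_form t ->
  bil (bilmk a b s t) x y = mkv a b (s x y) (t x y).
Proof.
move=> bs bt.
have E u : bilinear_form u -> u x y =
    \sum_i \sum_j (x i 0 * y j 0) * u (delta_mx i 0) (delta_mx j 0).
  move=> bu; have [l r] := bu; have z v := bilinear_form0 v bu.
  rewrite !ord2_sum {1}(vec2_delta x) {1}(vec2_delta y) !l !r.
  by rewrite !(proj1 (z _)) !(proj2 (z _)); ring.
rewrite /bil /bilmk !ord2_sum (E s bs) (E t bt) !ord2_sum.
by rewrite /mkv; apply: vec2P; rewrite !mxE /=; ring.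
Qed.

End LinearForms.

(* Ring and field compare atoms up to conversion, which is slow on linear forms. *)
Ltac lf_atoms := repeat match goal with |- context [lf ?v ?x] =>
  let u := fresh "u" in set u := lf v x in *; clearbody u end.

Section OrbitSpaceStructure.
Context {C : numClosedFieldType}.
Local Notation V := 'cV[C]_2.
Variables (a b c e : V) (ka kb kc del : C).
Hypotheses (abc : a + b + c = 0) (ab : det2 a b != 0) (kabc : ka + kb + kc = 2 * del).
Hypotheses (e0 : e != 0) (ce : lf c e = 0).
Implicit Types x y z p q : V.

Local Notation A := (lf a).
Local Notation B := (lf b).
Local Notation D := (lf c).

Definition arr_compl : set V := [set p | [&& A p != 0, B p != 0 & D p != 0]].

Lemma lfc x : D x = - (A x + B x).
Proof.
apply/eqP; rewrite eq_sym -subr_eq0 -opprD oppr_eq0; apply/eqP.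
have := congr1 (fun v => lf v x) abc.
by rewrite /lf !mxE !mul0r addr0 => <-; ring.
Qed.

Definition arr_form p x y : C := A x * A y / A p + B x * B y / B p + D x * D y / D p.
(** The value of the form L on the Christoffel symbol. The relation ka + kb + kc = 2 del makes the
    formula for D, with kc, a consequence of those for A and B, so that the three lines play the
    same role. *)
Definition arr_gam p (k : C) (L : V -> C) x y : C :=
  - (del * (L x * L y / L p) + (k - del) * arr_form p x y).

Definition arr_conn : @christoffel C 1 :=
  fun p => bilmk a b (arr_gam p ka A) (arr_gam p kb B).
(** The componentwise product in the values of A and B, rescaled so that its unit at p is the vector
    p itself. *)
Definition arr_mult : @structure_constants C 1 :=
  fun p => bilmk a b (fun x y => A x * A y / A p) (fun x y => B x * B y / B p).

Lemma arr_gam_bilinear p k L : (forall x y s, L (s *: x + y) = s * L x + L y) ->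
  bilinear_form (arr_gam p k L).
Proof.
by move=> hL; split=> *; rewrite /arr_gam /arr_form hL !lfD !lfZ; ring.
Qed.

Lemma lf_lin v x y s : lf v (s *: x + y) = s * lf v x + lf v y.
Proof. by rewrite lfD lfZ. Qed.

Lemma bil_arr_conn p x y :
  bil (arr_conn p) x y = mkv a b (arr_gam p ka A x y) (arr_gam p kb B x y).
Proof. by apply: bil_bilmk; apply: arr_gam_bilinear; exact: lf_lin. Qed.

Lemma bil_arr_mult p x y :
  bil (arr_mult p) x y = mkv a b (A x * A y / A p) (B x * B y / B p).
Proof. by apply: bil_bilmk; split=> *; rewrite lf_lin; ring. Qed.

Lemma A_conn p x y : A (bil (arr_conn p) x y) = arr_gam p ka A x y.
Proof. by rewrite bil_arr_conn lf_mkv_l. Qed.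
Lemma B_conn p x y : B (bil (arr_conn p) x y) = arr_gam p kb B x y.
Proof. by rewrite bil_arr_conn lf_mkv_r. Qed.
Lemma A_mult p x y : A (bil (arr_mult p) x y) = A x * A y / A p.
Proof. by rewrite bil_arr_mult lf_mkv_l. Qed.
Lemma B_mult p x y : B (bil (arr_mult p) x y) = B x * B y / B p.
Proof. by rewrite bil_arr_mult lf_mkv_r. Qed.

Lemma is_diff_arr_gam p k v y z : arr_compl p ->
  lf v p != 0 ->
  is_diff p (fun q => arr_gam q k (lf v) y z) (fun h =>
    del * (lf v y * lf v z * lf v h / lf v p ^+ 2) + (k - del) *
    (A y * A z * A h / A p ^+ 2 + B y * B z * B h / B p ^+ 2 + D y * D z * D h / D p ^+ 2)).
Proof.
move=> /and3P[pa pb pc] pv.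
have F u s : lf u p != 0 -> is_diff p (fun q => s / lf u q) (fun h => - s * lf u h / lf u p ^+ 2).
  move=> up; apply: is_diff_ext (is_diff_div up (is_diff_const s p) (is_diff_lf u p)) => // h.
  by rewrite mul0r sub0r -mulNr.
apply: is_diff_ext (is_diff_opp (is_diff_plus (is_diff_mull del (F v (lf v y * lf v z) pv))
  (is_diff_mull (k - del) (is_diff_plus (is_diff_plus (F a (A y * A z) pa)
   (F b (B y * B z) pb)) (F c (D y * D z) pc))))) => // h.
by lf_atoms; field; rewrite pa pb pc pv.
Qed.

Lemma is_diff_arr_mult p v y z : lf v p != 0 ->
  is_diff p (fun q => lf v y * lf v z / lf v q) (fun h => - (lf v y * lf v z * lf v h / lf v p ^+ 2)).
Proof.
move=> pv.
apply: is_diff_ext (is_diff_div pv (is_diff_const (lf v y * lf v z) p) (is_diff_lf v p)) => // h.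
by rewrite mul0r sub0r mulNr.
Qed.

Definition arr_saito : saito_data := SaitoData arr_conn arr_mult (fun p => p) (fun=> e).

Lemma differentiable_arr_conn p : arr_compl p -> forall x y,
  differentiable (fun q => bil (arr_conn q) x y) p.
Proof.
move=> Np x y; have /and3P[pa pb pc] := Np.
have -> : (fun q => bil (arr_conn q) x y) =
    (fun q => mkv a b (arr_gam q ka A x y) (arr_gam q kb B x y)).
  by apply/funext => q; exact: bil_arr_conn.
apply: (differentiable_mkv (s := fun q => arr_gam q ka A x y)
  (t := fun q => arr_gam q kb B x y) ab).
  exact: is_diff_differentiable (is_diff_arr_gam ka x y Np pa).
exact: is_diff_differentiable (is_diff_arr_gam kb x y Np pb).
Qed.

Lemma differentiable_arr_mult p : arr_compl p -> forall x y,
  differentiable (fun q => bil (arr_mult q) x y) p.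
Proof.
move=> Np x y; have /and3P[pa pb pc] := Np.
have -> : (fun q => bil (arr_mult q) x y) =
    (fun q => mkv a b (A x * A y / A q) (B x * B y / B q)).
  by apply/funext => q; exact: bil_arr_mult.
apply: (differentiable_mkv (s := fun q => A x * A y / A q)
  (t := fun q => B x * B y / B q) ab).
  exact: is_diff_differentiable (is_diff_arr_mult x y pa).
exact: is_diff_differentiable (is_diff_arr_mult x y pb).
Qed.

Lemma A_dconn p h x y : arr_compl p -> A ('D_h (fun q => bil (arr_conn q) x y) p) =
    del * (A x * A y * A h / A p ^+ 2) + (ka - del) *
    (A x * A y * A h / A p ^+ 2 + B x * B y * B h / B p ^+ 2 + D x * D y * D h / D p ^+ 2).
Proof.
move=> Np; have /and3P[pa pb pc] := Np.
rewrite lf_derive; last exact: differentiable_arr_conn.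
rewrite -(is_diffE (is_diff_arr_gam ka x y Np pa)).
by congr ('D_h _ p); apply/funext => q; rewrite A_conn.
Qed.
Lemma B_dconn p h x y : arr_compl p -> B ('D_h (fun q => bil (arr_conn q) x y) p) =
    del * (B x * B y * B h / B p ^+ 2) + (kb - del) *
    (A x * A y * A h / A p ^+ 2 + B x * B y * B h / B p ^+ 2 + D x * D y * D h / D p ^+ 2).
Proof.
move=> Np; have /and3P[pa pb pc] := Np.
rewrite lf_derive; last exact: differentiable_arr_conn.
rewrite -(is_diffE (is_diff_arr_gam kb x y Np pb)).
by congr ('D_h _ p); apply/funext => q; rewrite B_conn.
Qed.
Lemma A_dmult p h x y : arr_compl p -> A ('D_h (fun q => bil (arr_mult q) x y) p) =
   - (A x * A y * A h / A p ^+ 2).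
Proof.
move=> Np; have /and3P[pa pb pc] := Np.
rewrite lf_derive; last exact: differentiable_arr_mult.
rewrite -(is_diffE (is_diff_arr_mult x y pa)).
by congr ('D_h _ p); apply/funext => q; rewrite A_mult.
Qed.
Lemma B_dmult p h x y : arr_compl p -> B ('D_h (fun q => bil (arr_mult q) x y) p) =
   - (B x * B y * B h / B p ^+ 2).
Proof.
move=> Np; have /and3P[pa pb pc] := Np.
rewrite lf_derive; last exact: differentiable_arr_mult.
rewrite -(is_diffE (is_diff_arr_mult x y pb)).
by congr ('D_h _ p); apply/funext => q; rewrite B_mult.
Qed.

Lemma arr_compl_open : open arr_compl.
Proof.
have cont v : continuous (lf v).
  by move=> p; apply: differentiable_continuous; case: (is_diff_lf v p).
have -> : arr_compl = [set p | A p != 0] `&` ([set p | B p != 0] `&` [set p | D p != 0]).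
  by apply/seteqP; split=> p /=; [case/and3P | case=> ? [? ?]; apply/and3P].
by do 2!(apply: openI; first exact: open_neq0); exact: open_neq0.
Qed.

Lemma arr_compl_neq0 : exists p, arr_compl p.
Proof.
exists (mkv a b 1 1); rewrite /arr_compl /= lfc lf_mkv_l // lf_mkv_r //.
by rewrite oppr_eq0 oner_eq0 -[1 + 1]/(2%:R) pnatr_eq0.
Qed.

(** All axioms reduce to rational identities in the values of A and B. The condition [D e = 0]
    enters only (ASS4), as B e = - A e; (ASS2) holds for every constant e. *)
Lemma arr_almost_saito : almost_saito arr_compl (1 - del) arr_saito.
Proof.
have kcE : kc = 2 * del - ka - kb by rewrite -kabc; ring.
have eB : B e = - A e.
  by have := ce; rewrite lfc => /eqP; rewrite oppr_eq0 addr_eq0 => /eqP ->; rewrite opprK.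
apply: (almost_saito_intro (S := arr_saito) (e := e) (dE := fun h => h)).
- exact: arr_compl_open.
- exact: arr_compl_neq0.
- move=> i j p Np /=; rewrite (_ : (fun q => _) =
    (fun q => bil (arr_conn q) (delta_mx i 0) (delta_mx j 0))).
    exact: differentiable_arr_conn.
  by apply/funext => q; rewrite bil_delta.
- move=> i j p Np /=; rewrite (_ : (fun q => _) =
    (fun q => bil (arr_mult q) (delta_mx i 0) (delta_mx j 0))).
    exact: differentiable_arr_mult.
  by apply/funext => q; rewrite bil_delta.
- by [].
- exact: e0.
- move=> p x Np; have /and3P[pa pb] := Np; rewrite lfc oppr_eq0 => pc /=; apply: (lf_inj ab);
  rewrite lfD lfZ ?A_conn ?B_conn /arr_gam /arr_form !lfc;
  by lf_atoms; field; rewrite ?pa ?pb ?pc.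
- by move=> p x y _ /=; apply: (lf_inj ab); rewrite ?A_conn ?B_conn /arr_gam /arr_form; ring.
- by move=> p x y _ /=; apply: (lf_inj ab); rewrite ?A_mult ?B_mult; ring.
- by move=> p x y z _ /=; apply: (lf_inj ab); rewrite ?A_mult ?B_mult ?A_mult ?B_mult; ring.
- move=> p x Np; have /and3P[pa pb _] := Np => /=.
  by apply: (lf_inj ab); rewrite ?A_mult ?B_mult; field.
- move=> p x y z Np; have /and3P[pa pb] := Np; rewrite lfc oppr_eq0 => pc /=.
  apply: (lf_inj ab); rewrite !lfD ?A_dconn ?B_dconn // ?A_conn ?B_conn /arr_gam /arr_form;
  rewrite !lfc !A_conn !B_conn /arr_gam /arr_form !lfc;
  by lf_atoms; field; rewrite ?pa ?pb ?pc.
- move=> p x y z Np; have /and3P[pa pb] := Np; rewrite lfc oppr_eq0 => pc /=.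
  apply: (lf_inj ab); rewrite !lfB !lfD ?A_dmult ?B_dmult // ?A_conn ?B_conn /arr_gam /arr_form;
  rewrite !lfc !(A_mult, B_mult) !(A_conn, B_conn) /arr_gam /arr_form !lfc;
  by lf_atoms; field; rewrite ?pa ?pb ?pc.
- move=> p x y Np; have /and3P[pa pb _] := Np => /=.
  by apply: (lf_inj ab); rewrite lf0 lfD ?A_dmult ?B_dmult // !(A_mult, B_mult); field.
- move=> p x y Np; have /and3P[pa pb] := Np; rewrite lfc oppr_eq0 => pc /=.
  apply: (lf_inj ab); rewrite lf0 !(lfB, lfD) ?A_dconn ?B_dconn // ?A_conn ?B_conn /arr_gam /arr_form;
  rewrite !lfc !(A_mult, B_mult, A_conn, B_conn) /arr_gam /arr_form !lfc eB;
  by lf_atoms; field; rewrite ?pa ?pb ?pc.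
Qed.

End OrbitSpaceStructure.

(** * Which constant fields e can occur, and uniqueness of the product *)

Section ConstantFields.
Context {C : numClosedFieldType}.
Local Notation V := 'cV[C]_2.
Variables (N : set V) (r : C) (S : @saito_data C 1) (e : V).
Hypotheses (HS : almost_saito N r S) (eE : forall p, N p -> e_field S p = e).
Implicit Types x y p q : V.

Local Lemma e_const p h : N p -> 'D_h (e_field S) p = 0.
Proof.
move=> Np; rewrite (eq_on_open_derive (g := fun=> e) h (as_open HS) Np eE).
exact: derive_cst.
Qed.

Local Lemma hcst x : holomorphic N (fun=> x : V).
Proof. by move=> q _; exact: differentiable_cst. Qed.

Lemma saito_e_hessian p x y : N p ->
  'D_x (fun q => bil (conn S q) y e) p + bil (conn S p) x (bil (conn S p) y e)
   - bil (conn S p) (bil (conn S p) x y) e + bil (conn S p) (bil (mult S p) x y) e = 0.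
Proof.
move=> Np.
have := as_ass4 HS (as_open HS) (@subset_refl _ N) (hcst x) (hcst y) Np.
have E q Z : N q -> cov (conn S) Z (e_field S) q = bil (conn S q) (Z q) e.
  by move=> Nq; rewrite covE e_const // add0r eE.
rewrite /= !E // {1}covE (E p) //.
rewrite (eq_on_open_derive (g := fun q => bil (conn S q) y e) x (as_open HS) Np); last first.
  by move=> q Nq; rewrite E.
by rewrite covE derive_cst add0r prod_vfE.
Qed.

Lemma saito_e_lie p x y : N p ->
  'D_e (fun q => bil (mult S q) x y) p + bil (mult S p) e (bil (mult S p) x y) = 0.
Proof.
move=> Np.
have := as_ass2 HS (as_open HS) (@subset_refl _ N) (hcst x) (hcst y) Np.
have B0 z q : N q -> bracket (e_field S) (fun=> z) q = 0.
  by move=> Nq; rewrite /bracket derive_cst e_const // subr0.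
by rewrite /= !prod_vfE !B0 // bil0l bil0r !subr0 /bracket e_const // subr0 eE.
Qed.

Lemma saito_mult_diff p : N p -> forall i j,
  is_diff p (fun q => mult S q i j) (fun h => 'D_h (fun q => mult S q i j) p).
Proof. by move=> Np i j; apply: is_diff_D; apply: (as_mult_holo HS). Qed.

End ConstantFields.

Section Necessity.
Context {C : numClosedFieldType}.
Local Notation V := 'cV[C]_2.
Variables (a b c : V) (ka kb kc del : C).
Hypotheses (abc : a + b + c = 0) (ab : det2 a b != 0) (kabc : ka + kb + kc = 2 * del).
Hypotheses (del0 : del != 0) (kaD : ka != del) (kbD : kb != del) (kcD : kc != del).
Implicit Types x y z p q : V.
Local Notation A := (lf a).
Local Notation B := (lf b).
Local Notation D := (lf c).
Local Notation N := (arr_compl a b c).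
Variables (S : @saito_data C 1) (r : C) (e : V).
Hypotheses (HS : almost_saito N r S) (eE : forall p, N p -> e_field S p = e).
Hypothesis gE : forall p x y, N p -> bil (conn S p) x y = bil (arr_conn a b c ka kb del p) x y.

Local Notation G := (arr_conn a b c ka kb del).

Lemma arr_e_hessian p x y : N p ->
  'D_x (fun q => bil (G q) y e) p + bil (G p) x (bil (G p) y e)
   - bil (G p) (bil (G p) x y) e + bil (G p) (bil (mult S p) x y) e = 0.
Proof.
move=> Np; have := saito_e_hessian HS eE x y Np.
rewrite (eq_on_open_derive (g := fun q => bil (G q) y e) x (as_open HS) Np); last first.
  by move=> q Nq; exact: gE.
by rewrite (gE x y Np) (gE y e Np) (gE x _ Np) (gE _ e Np) (gE _ e Np).
Qed.

Lemma arr_conn_symm p x y : bil (G p) x y = bil (G p) y x.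
Proof.
by apply: (lf_inj ab); rewrite ?A_conn ?B_conn // /arr_gam /arr_form; lf_atoms; ring.
Qed.

Local Notation L q y := (bil (G q) y e).
Local Notation M q y := (bil (mult S q) e y).

(** This is (ASS4) with x = e: the two terms quadratic in the connection cancel because the
    connection is symmetric. *)
Lemma dL_eq p y : N p -> 'D_e (fun q => L q y) p = - L p (M p y).
Proof.
move=> Np; have := arr_e_hessian e y Np.
rewrite (arr_conn_symm p e y) (arr_conn_symm p e) addrK => /eqP.
by rewrite addr_eq0 => /eqP.
Qed.

Lemma is_diff_G_comp p (F : V -> V) dF : N p -> is_diff p F dF ->
  is_diff p (fun q => L q (F q)) (fun h => 'D_h (fun q => L q (F p)) p + L p (dF h)).
Proof.
move=> Np HF.
have HG i j : is_diff p (fun q => G q i j) (fun h => 'D_h (fun q => G q i j) p).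
  apply: is_diff_D; rewrite (_ : (fun q => _) = (fun q => bil (G q) (delta_mx i 0) (delta_mx j 0))).
    exact: differentiable_arr_conn.
  by apply/funext => q; rewrite bil_delta.
apply: is_diff_ext (is_diff_bil HG HF (is_diff_const e p)) => // h.
by rewrite bil0r addr0 (is_diffE (is_diff_bil_const _ _ HG)).
Qed.

Lemma d2L_eq p y : N p ->
  'D_e (fun q => 'D_e (fun q' => L q' y) q) p = L p (M p (M p y)) + L p (M p (M p y)).
Proof.
move=> Np.
rewrite (eq_on_open_derive (g := fun q => - L q (M q y)) e (as_open HS) Np); last first.
  by move=> q; exact: dL_eq.
have HM := is_diff_bil_const e y (saito_mult_diff HS Np).
rewrite (is_diffE (is_diff_opp (is_diff_G_comp Np HM))).
have := saito_e_lie HS eE e y Np => /eqP; rewrite (is_diffE HM) addr_eq0 => /eqP ->.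
by rewrite dL_eq // bilNl opprD !opprK.
Qed.

Lemma is_diff_cube (v p : V) (s : C) : lf v p != 0 ->
  is_diff p (fun q => s / lf v q ^+ 2) (fun h => - (2 * s * lf v h / lf v p ^+ 3)).
Proof.
move=> vp; apply: is_diff_ext (is_diff_div (g := fun q => lf v q ^+ 2) (expf_neq0 2 vp) (is_diff_const s p)
  (is_diff_exp 2 (is_diff_lf v p))) => // h.
by rewrite /= expr1; move: vp; lf_atoms => vp; field.
Qed.

Lemma A_d2L p y : N p ->
  A ('D_e (fun q => 'D_e (fun q' => L q' y) q) p) =
  - (2 * (del * (A y * (A e / A p) ^+ 3) + (ka - del) *
    (A y * (A e / A p) ^+ 3 + B y * (B e / B p) ^+ 3 + D y * (D e / D p) ^+ 3))) /\
  B ('D_e (fun q => 'D_e (fun q' => L q' y) q) p) =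
  - (2 * (del * (B y * (B e / B p) ^+ 3) + (kb - del) *
    (A y * (A e / A p) ^+ 3 + B y * (B e / B p) ^+ 3 + D y * (D e / D p) ^+ 3))).
Proof.
move=> Np; have /and3P[pa pb pc] := Np; have oN := as_open HS.
pose t k v q := del * (lf v y * lf v e * lf v e / lf v q ^+ 2) + (k - del) *
  (A y * A e * A e / A q ^+ 2 + B y * B e * B e / B q ^+ 2 + D y * D e * D e / D q ^+ 2).
have Dt k v : lf v p != 0 -> is_diff p (t k v) (fun h =>
    - (2 * (del * (lf v y * lf v e * lf v e * lf v h / lf v p ^+ 3) + (k - del) *
     (A y * A e * A e * A h / A p ^+ 3 + B y * B e * B e * B h / B p ^+ 3 +
      D y * D e * D e * D h / D p ^+ 3)))).
  move=> pv; apply: is_diff_ext (is_diff_plus (is_diff_mull del (is_diff_cube _ pv))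
    (is_diff_mull (k - del) (is_diff_plus (is_diff_plus (is_diff_cube _ pa)
      (is_diff_cube _ pb)) (is_diff_cube _ pc)))) => // h.
  by lf_atoms; field; rewrite pa pb pc pv.
rewrite (eq_on_open_derive (g := fun q => mkv a b (t ka a q) (t kb b q)) e oN Np); last first.
  move=> q Nq; apply: (lf_inj ab); rewrite ?lf_mkv_l ?lf_mkv_r //.
    by rewrite A_dconn.
  by rewrite B_dconn.
have dmk : differentiable (fun q => mkv a b (t ka a q) (t kb b q)) p.
  apply: (differentiable_mkv ab); first exact: is_diff_differentiable (Dt ka a pa).
  exact: is_diff_differentiable (Dt kb b pb).
split; rewrite lf_derive //.
  rewrite (_ : (fun q => _) = t ka a); last by apply/funext => q; rewrite lf_mkv_l.
  by rewrite (is_diffE (Dt ka a pa)); lf_atoms; field; rewrite pa pb pc.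
rewrite (_ : (fun q => _) = t kb b); last by apply/funext => q; rewrite lf_mkv_r.
by rewrite (is_diffE (Dt kb b pb)); lf_atoms; field; rewrite pa pb pc.
Qed.

(* By Cayley-Hamilton, [L'' = 2 L M^2] and [L' = - L M] make each e_i / p_i a root of
   the characteristic polynomial of M; three distinct values are too many. *)
Lemma e_on_arrangement : [\/ A e = 0, B e = 0 | D e = 0].
Proof.
have [|Ae] := eqVneq (A e) 0; first by constructor 1.
have [|Be] := eqVneq (B e) 0; first by constructor 2.
have [|De] := eqVneq (D e) 0; first by constructor 3.
exfalso.
(* The point p with A p = 1 and B p = s must not be proportional to e, so that the three ratios
   differ; s = 1 works unless A e = B e, and then s = 2 does. *)
have [s [s0 s1 sE]] : exists s : C, [/\ s != 0, 1 + s != 0 & B e != s * A e].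
  have n2 : (2%:R : C) != 0 by rewrite pnatr_eq0.
  have n3 : (3%:R : C) != 0 by rewrite pnatr_eq0.
  have [E|E] := eqVneq (B e) (A e); last first.
    by exists 1; split; [exact: oner_neq0 | exact: n2 | rewrite mul1r].
  exists 2%:R; split; [exact: n2 | exact: n3 |].
  rewrite E -subr_eq0 (_ : A e - 2 * A e = - A e); last by ring.
  by rewrite oppr_eq0.
pose p := mkv a b 1 s.
have Ap : A p = 1 by rewrite lf_mkv_l.
have Bp : B p = s by rewrite lf_mkv_r.
have Dp : D p = - (1 + s) by rewrite (lfc abc) Ap Bp.
have Np : N p by rewrite /arr_compl /= Ap Bp Dp oppr_eq0 oner_eq0 s0 s1.
pose f0 := mkv a b 1 0; pose f1 := mkv a b 0 1.
pose m00 := A (M p f0); pose m01 := A (M p f1).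
pose m10 := B (M p f0); pose m11 := B (M p f1).
have yE y : y = A y *: f0 + B y *: f1.
  by apply: (lf_inj ab); rewrite lfD !lfZ /f0 /f1 ?lf_mkv_l ?lf_mkv_r //; ring.
have AM y : A (M p y) = A y * m00 + B y * m01.
  by rewrite {1}(yE y) bilDr !bilZr lfD !lfZ.
have BM y : B (M p y) = A y * m10 + B y * m11.
  by rewrite {1}(yE y) bilDr !bilZr lfD !lfZ.
pose t := m00 + m11; pose d := m00 * m11 - m01 * m10.
have CH y : M p (M p y) = t *: M p y - d *: y.
  by apply: (lf_inj ab); rewrite lfB !lfZ !(AM, BM) /t /d; lf_atoms; ring.
pose xa := A e / A p; pose xb := B e / B p; pose xc := D e / D p.
pose f (x : C) := x ^+ 3 - t * x ^+ 2 + d * x.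
have key y :
    del * (A y * f xa) + (ka - del) * (A y * f xa + B y * f xb + D y * f xc) = 0 /\
    del * (B y * f xb) + (kb - del) * (A y * f xa + B y * f xb + D y * f xc) = 0.
  (* The left side is 2 L (M^2 - t M + d) applied to y, which is zero by Cayley-Hamilton. *)
  have E : 'D_e (fun q => 'D_e (fun q' => L q' y) q) p
         + (2 * t) *: 'D_e (fun q => L q y) p + (2 * d) *: L p y = 0.
    rewrite d2L_eq // dL_eq // CH bilDl bilNl !bilZl.
    by apply/colP => i; rewrite !mxE; ring.
  have [EA EB] := A_d2L y Np.
  split; apply: (mulfI (_ : (- 2 : C) != 0)); rewrite ?oppr_eq0 ?pnatr_eq0 // mulr0.
    rewrite -[RHS](lf0 a) -E !lfD !lfZ EA A_dconn // A_conn // /arr_gam /arr_form.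
    by rewrite /f /xa /xb /xc !expr_div_n; lf_atoms; ring.
  rewrite -[RHS](lf0 b) -E !lfD !lfZ EB B_dconn // B_conn // /arr_gam /arr_form.
  by rewrite /f /xa /xb /xc !expr_div_n; lf_atoms; ring.
(* Taking y = f0 and y = f1 gives (kb - del) (f xa - f xc) = 0 and (ka - del) (f xb - f xc) = 0, and
   then del f xc = 0. *)
have {}key : [/\ f xa = 0, f xb = 0 & f xc = 0].
  have [k1 k2] := key f0; have [k3 k4] := key f1.
  rewrite !(lfc abc) /f0 /f1 !lf_mkv_l // !lf_mkv_r // in k1 k2 k3 k4.
  have e1 : f xa = f xc.
    apply/eqP; rewrite -subr_eq0; apply/eqP; apply: (mulfI (_ : kb - del != 0)).
      by rewrite subr_eq0.
    by rewrite mulr0 -k2; ring.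
  have e2 : f xb = f xc.
    apply/eqP; rewrite -subr_eq0; apply/eqP; apply: (mulfI (_ : ka - del != 0)).
      by rewrite subr_eq0.
    by rewrite mulr0 -k3; ring.
  have e3 : f xc = 0.
    by apply: (mulfI del0); rewrite mulr0 -k1 e1 e2; ring.
  by split; rewrite ?e1 ?e2 e3.
have chi (u : C) : u != 0 -> f u = 0 -> u ^+ 2 - t * u + d = 0.
  by move=> u0 fu; apply: (mulfI u0); rewrite mulr0 -fu /f; ring.
have [fa fb fc] := key.
have xa0 : xa != 0 by rewrite mulf_neq0 // invr_eq0 Ap oner_neq0.
have xb0 : xb != 0 by rewrite mulf_neq0 // invr_eq0 Bp.
have xc0 : xc != 0 by rewrite mulf_neq0 // invr_eq0 Dp oppr_eq0.
have xab : xa != xb.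
  rewrite /xa /xb Ap Bp divr1; apply: contra sE => /eqP E; apply/eqP.
  by rewrite E mulrC divfK.
have xac : xa != xc.
  rewrite /xa /xc Ap Dp (lfc abc) divr1; apply: contra sE => /eqP E; apply/eqP.
  have : A e * (1 + s) = A e + B e by rewrite {1}E; move: s1; lf_atoms => s1; field.
  by rewrite mulrDr mulr1 => /addrI <-; rewrite mulrC.
have xbc : xb != xc.
  rewrite /xb /xc Bp Dp (lfc abc); apply: contra sE => /eqP E.
  have : B e * (1 + s) = s * (A e + B e).
    by rewrite -[B e in LHS](divfK s0) E; move: s0 s1; lf_atoms => s0 s1; field.
  by rewrite mulrDr mulr1 mulrDr [s * B e]mulrC => /addIr ->.
(* Two distinct roots add up to t, so that xb and xc would both be t - xa. *)
have sum (u v : C) : u != v -> u ^+ 2 - t * u + d = 0 -> v ^+ 2 - t * v + d = 0 -> u + v = t.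
  move=> uv eu ev; apply: (mulfI (_ : u - v != 0)); first by rewrite subr_eq0.
  apply/eqP; rewrite -subr_eq0; apply/eqP.
  by rewrite -[RHS](subrr 0) -{1}eu -ev; ring.
move/eqP: xbc; apply; apply: (addrI xa).
by rewrite (sum _ _ xab) ?(sum _ _ xac) //; apply: chi.
Qed.

(** In u = A y A e / A p and v = B y B e / B p, the equation L y = 0 is a linear system of
    determinant del (del - kc). *)
Lemma arr_L_inj p y : N p -> e != 0 -> D e = 0 -> L p y = 0 -> y = 0.
Proof.
move=> Np e0 De Ly; have /and3P[pa pb pc] := Np.
have kcE : kc = 2 * del - ka - kb by rewrite -kabc; ring.
have BeE : B e = - A e.
  by have := De; rewrite (lfc abc) => /eqP; rewrite oppr_eq0 addr_eq0 => /eqP ->; rewrite opprK.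
have Ae : A e != 0.
  by case: (lf_neq0 ab e0) => //; rewrite BeE oppr_eq0.
have EA := congr1 (lf a) Ly; have EB := congr1 (lf b) Ly.
rewrite A_conn // lf0 /arr_gam /arr_form De mulr0 mul0r addr0 in EA.
rewrite B_conn // lf0 /arr_gam /arr_form De mulr0 mul0r addr0 in EB.
pose u := A y * A e / A p; pose v := B y * B e / B p.
have dt : del * (del - kc) != 0 by rewrite mulf_neq0 // subr_eq0 eq_sym.
have u0 : u = 0.
  apply: (mulfI dt); rewrite mulr0.
  transitivity (- (kb * - (del * u + (ka - del) * (u + v))) +
    (ka - del) * - (del * v + (kb - del) * (u + v))); first by rewrite kcE; ring.
  by rewrite EA EB; ring.
have v0 : v = 0.
  apply: (mulfI dt); rewrite mulr0.
  transitivity (- (ka * - (del * v + (kb - del) * (u + v))) +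
    (kb - del) * - (del * u + (ka - del) * (u + v))); first by rewrite kcE; ring.
  by rewrite EA EB; ring.
apply: (lf_inj ab); rewrite lf0.
  by apply: (mulIf (mulf_neq0 Ae (invr_neq0 pa))); rewrite mul0r mulrA.
have Be : B e != 0 by rewrite BeE oppr_eq0.
by apply: (mulIf (mulf_neq0 Be (invr_neq0 pb))); rewrite mul0r mulrA.
Qed.

(** By (ASS4), L applied to the product of x and y depends only on the connection and e. The model
    [arr_saito] with the same e satisfies the same equation, and L is injective. *)
Lemma mult_unique p x y : N p -> e != 0 -> D e = 0 ->
  bil (mult S p) x y = bil (arr_mult a b p) x y.
Proof.
move=> Np e0 De; apply/eqP; rewrite -subr_eq0; apply/eqP.
apply: (arr_L_inj Np e0 De); rewrite bilDl bilNl.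
have S0 := arr_almost_saito abc ab kabc e0 De.
have := saito_e_hessian S0 (fun q _ => erefl) x y Np; have := arr_e_hessian x y Np.
move=> /eqP; rewrite addrC addr_eq0 => /eqP -> /eqP.
by rewrite addrC addr_eq0 => /eqP ->; rewrite subrr.
Qed.

End Necessity.

(** * The structure on the orbit space of a duality group *)

Section DualityStructure.
Context {C : numClosedFieldType}.
Local Notation V := 'cV[C]_2.
Implicit Types x y z p q h : V.

Definition bilv (s t : V -> V -> C) (i j : 'I_2) : V :=
  vec2 (s (delta_mx i 0) (delta_mx j 0)) (t (delta_mx i 0) (delta_mx j 0)).

Lemma bil_bilv s t x y : bilinear_form s -> bilinear_form t ->
  bil (bilv s t) x y = vec2 (s x y) (t x y).
Proof.
move=> bs bt.
have E u : bilinear_form u -> u x y =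
    \sum_i \sum_j (x i 0 * y j 0) * u (delta_mx i 0) (delta_mx j 0).
  move=> bu; have [l r] := bu; have z v := bilinear_form0 v bu.
  rewrite !ord2_sum {1}(vec2_delta x) {1}(vec2_delta y) !l !r.
  by rewrite !(proj1 (z _)) !(proj2 (z _)); ring.
rewrite /bil /bilv !ord2_sum (E s bs) (E t bt) !ord2_sum.
by apply: vec2P; rewrite !mxE /=; ring.
Qed.

Variables (nu1 nu2 del k1 k2 tau : C) (r' : nat).
Local Notation r := (r'.+2%:R : C).
Hypothesis k12 : k1 + k2 + (1 - r^-1) = 2 * del.
Hypotheses (nu12 : nu1 != nu2) (tau0 : tau != 0).

Local Notation T q := (q (0 : 'I_2) (0 : 'I_1)).
Local Notation S q := (q (1 : 'I_2) (0 : 'I_1)).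
Local Notation U q := (S q ^+ r'.+1).
Local Notation W q := (S q ^+ r').

(** In coordinates (t, s) on M_K with s of weight D / r, the discriminant of K is (t + nu1 s^r) (t +
    nu2 s^r). The factors are, up to scalars, the pullbacks of the two lines over which M_K -> M_G
    does not ramify. *)
Definition disc1 q : C := T q + nu1 * (S q * U q).
Definition disc2 q : C := T q + nu2 * (S q * U q).
Definition disc q : C := disc1 q * disc2 q.
Definition disc_compl : set V := [set q | (disc1 q != 0) && (disc2 q != 0)].

(** The t-component, and below the s-component, of the componentwise product in the values of
    [disc1] and [disc2]. Pulled back to (t, s) it seems to have poles along s = 0, but these cancel
    and only [disc] remains in the denominator. *)
Definition dmult0 q x y : C :=
  ((T q + (nu1 + nu2) * (S q * U q)) * (T x * T y)
   + r * U q * (nu1 * nu2) * (S q * U q) * (T x * S y + S x * T y)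
   - r ^+ 2 * U q ^+ 2 * (nu1 * nu2) * T q * (S x * S y)) / disc q.
Definition dmult1 q x y : C :=
  (- (S q / r) * (T x * T y) + T q * (T x * S y + S x * T y)
   + r * U q * ((nu1 + nu2) * T q + nu1 * nu2 * (S q * U q)) * (S x * S y)) / disc q.
(** A one-form that annihilates the unit field (t, s / r), proportional to the differential of t /
    s^r. *)
Definition dpsi q x : C := S q * T x - r * T q * S x.
Definition dmu : C := nu2 * (k1 - del) + nu1 * (k2 - del).
Definition dtheta : C := del * r - r + 1.

Definition dual_mult : @structure_constants C 1 := fun q => bilv (dmult0 q) (dmult1 q).
(** The two components are minus the Hessians of the basic invariants t and s of K, expressed
    through their differentials; [hess_power] and [hess_form] are the source of the two shapes. *)
Definition dual_conn : @christoffel C 1 := fun q =>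
  bilv (fun x y => - (del * dmult0 q x y + dmu * W q * (dpsi q x * dpsi q y) / disc q))
       (fun x y => - (dtheta / r * dmult1 q x y)).
Definition dual_unit q : V := vec2 (T q) (S q / r).
Definition dual_e : V := vec2 tau 0.

Lemma bil_dual_mult q x y : bil (dual_mult q) x y = vec2 (dmult0 q x y) (dmult1 q x y).
Proof. by apply: bil_bilv; split=> *; rewrite /dmult0 /dmult1 !mxE; ring. Qed.

Lemma bil_dual_conn q x y : bil (dual_conn q) x y =
  vec2 (- (del * dmult0 q x y + dmu * W q * (dpsi q x * dpsi q y) / disc q))
       (- (dtheta / r * dmult1 q x y)).
Proof. by apply: bil_bilv; split=> *; rewrite /dmult0 /dmult1 /dpsi !mxE; ring. Qed.

Lemma r_neq0 : r != 0. Proof. by rewrite pnatr_eq0. Qed.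

Lemma disc_neq0 q : disc_compl q -> disc q != 0.
Proof. by case/andP=> d1 d2; rewrite mulf_neq0. Qed.

Lemma is_diff_U p : is_diff p (fun q : V => U q) (fun h => (r - 1) * W p * S h).
Proof.
apply: is_diff_ext (is_diff_exp r'.+1 (is_diff_coord 1 p)) => // h /=.
by congr (_ * _ * _); rewrite -[r'.+2%:R]natr1; ring.
Qed.

Definition ddisc p h : C :=
  (T h + nu1 * (r * U p * S h)) * disc2 p + disc1 p * (T h + nu2 * (r * U p * S h)).

Lemma SU_W p : U p = S p * W p. Proof. by rewrite exprS. Qed.

Ltac diff_leaf p := do ?[exact: is_diff_const | exact: (is_diff_U p) | exact: is_diff_coord |
  apply: is_diff_plus | apply: is_diff_minus | apply: is_diff_opp |
  apply: is_diff_times | apply: is_diff_exp].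

(* Class resolution may leave the zero function of the ring of functions. *)
Ltac eval_zero := cbv beta; repeat match goal with |- context [@Algebra.zero ?A ?h] =>
  change (@Algebra.zero A h) with (0 : C) end.

Lemma is_diff_disc p : is_diff p disc (ddisc p).
Proof.
apply: (is_diff_ext (f := fun q => (T q + nu1 * (S q * U q)) * (T q + nu2 * (S q * U q))) (fun q => erefl)); last by diff_leaf p.
by move=> h; eval_zero; rewrite /ddisc /disc1 /disc2 !SU_W; ring.
Qed.

Definition dnum0 p x y h : C :=
  (T h + (nu1 + nu2) * (r * U p * S h)) * (T x * T y)
  + r * (nu1 * nu2) * ((2 * r - 1) * U p ^+ 2 * S h) * (T x * S y + S x * T y)
  - r ^+ 2 * (nu1 * nu2) * (2 * (r - 1) * W p * S h * U p * T p + U p ^+ 2 * T h) * (S x * S y).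
Definition dnum1 p x y h : C :=
  - (S h / r) * (T x * T y) + T h * (T x * S y + S x * T y)
  + r * ((r - 1) * W p * S h * ((nu1 + nu2) * T p + nu1 * nu2 * (S p * U p))
    + U p * ((nu1 + nu2) * T h + nu1 * nu2 * (r * U p * S h))) * (S x * S y).

Lemma is_diff_dmult0 p x y : disc_compl p ->
  is_diff p (fun q => dmult0 q x y)
    (fun h => (dnum0 p x y h - dmult0 p x y * ddisc p h) / disc p).
Proof.
move=> /disc_neq0 d0.
apply: (is_diff_ext (f := fun q => dmult0 q x y) (fun q => erefl)); last first.
  by apply: (is_diff_div d0); [diff_leaf p | exact: is_diff_disc].
move=> h; eval_zero; rewrite /dmult0 /dnum0; move: (ddisc p h) (disc p) d0 => dd d d0.
by rewrite !SU_W /=; field; rewrite d0.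
Qed.

Lemma is_diff_dmult1 p x y : disc_compl p ->
  is_diff p (fun q => dmult1 q x y)
    (fun h => (dnum1 p x y h - dmult1 p x y * ddisc p h) / disc p).
Proof.
move=> /disc_neq0 d0.
apply: (is_diff_ext (f := fun q => dmult1 q x y) (fun q => erefl)); last first.
  by apply: (is_diff_div d0); [diff_leaf p | exact: is_diff_disc].
move=> h; eval_zero; rewrite /dmult1 /dnum1; move: (ddisc p h) (disc p) d0 => dd d d0.
have := r_neq0; move: (r'.+2%:R : C) => rr r0.
by rewrite !SU_W /=; field; rewrite d0 r0.
Qed.

Definition dual_saito : saito_data := SaitoData dual_conn dual_mult dual_unit (fun=> dual_e).

Lemma is_diff_vec2 (f g : V -> C) p df dg : is_diff p f df -> is_diff p g dg ->
  is_diff p (fun q => vec2 (f q) (g q)) (fun h => vec2 (df h) (dg h)).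
Proof.
move=> Df Dg; pose F (i : 'I_2) q := if i == 0 then f q else g q.
pose dF (i : 'I_2) q := if i == 0 then df q else dg q.
have H i : is_diff p (F i) (dF i) by move: i; apply: ord2P.
by apply: is_diff_ext (is_diff_col H).
Qed.

Lemma D_dual_mult p x y h : disc_compl p ->
  'D_h (fun q => bil (dual_mult q) x y) p =
  vec2 ((dnum0 p x y h - dmult0 p x y * ddisc p h) / disc p)
       ((dnum1 p x y h - dmult1 p x y * ddisc p h) / disc p).
Proof.
move=> Np; rewrite -(is_diffE (is_diff_vec2 (is_diff_dmult0 x y Np) (is_diff_dmult1 x y Np))).
by congr ('D_h _ p); apply/funext => q; rewrite bil_dual_mult.
Qed.

Definition dWt p : C := r'%:R * S p ^+ r'.-1.

Lemma is_diff_hess_term p x y : disc_compl p ->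
  is_diff p (fun q => dmu * W q * (dpsi q x * dpsi q y) / disc q) (fun h =>
    (dmu * (dWt p * S h * (dpsi p x * dpsi p y)
      + W p * ((S h * T x - r * T h * S x) * dpsi p y + dpsi p x * (S h * T y - r * T h * S y)))
     - dmu * W p * (dpsi p x * dpsi p y) / disc p * ddisc p h) / disc p).
Proof.
move=> /disc_neq0 d0.
apply: (is_diff_ext (f := fun q => dmu * W q * (dpsi q x * dpsi q y) / disc q) (fun q => erefl)); last first.
  by apply: (is_diff_div d0); [diff_leaf p | exact: is_diff_disc].
move=> h; eval_zero; rewrite /dWt /dpsi; move: (ddisc p h) (disc p) d0 => dd d d0.
move: (S p ^+ r'.-1) (S p ^+ r') => w' w.
by field; rewrite d0.
Qed.

Lemma D_dual_conn p x y h : disc_compl p ->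
  'D_h (fun q => bil (dual_conn q) x y) p =
  vec2 (- (del * ((dnum0 p x y h - dmult0 p x y * ddisc p h) / disc p) +
    (dmu * (dWt p * S h * (dpsi p x * dpsi p y)
      + W p * ((S h * T x - r * T h * S x) * dpsi p y + dpsi p x * (S h * T y - r * T h * S y)))
     - dmu * W p * (dpsi p x * dpsi p y) / disc p * ddisc p h) / disc p))
       (- (dtheta / r * ((dnum1 p x y h - dmult1 p x y * ddisc p h) / disc p))).
Proof.
move=> Np; rewrite -(is_diffE (is_diff_vec2
  (is_diff_opp (is_diff_plus (is_diff_mull del (is_diff_dmult0 x y Np)) (is_diff_hess_term x y Np)))
  (is_diff_opp (is_diff_mull (dtheta / r) (is_diff_dmult1 x y Np))))).
by congr ('D_h _ p); apply/funext => q; rewrite bil_dual_conn.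
Qed.

Lemma differentiable_dual_mult p x y : disc_compl p ->
  differentiable (fun q => bil (dual_mult q) x y) p.
Proof.
move=> Np; rewrite (_ : (fun q => _) = (fun q => vec2 (dmult0 q x y) (dmult1 q x y))).
  exact: is_diff_differentiable (is_diff_vec2 (is_diff_dmult0 x y Np) (is_diff_dmult1 x y Np)).
by apply/funext => q; rewrite bil_dual_mult.
Qed.

Lemma differentiable_dual_conn p x y : disc_compl p ->
  differentiable (fun q => bil (dual_conn q) x y) p.
Proof.
move=> Np; rewrite (_ : (fun q => _) = (fun q => vec2
  (- (del * dmult0 q x y + dmu * W q * (dpsi q x * dpsi q y) / disc q))
  (- (dtheta / r * dmult1 q x y)))).
  exact: is_diff_differentiable (is_diff_vec2
    (is_diff_opp (is_diff_plus (is_diff_mull del (is_diff_dmult0 x y Np)) (is_diff_hess_term x y Np)))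
    (is_diff_opp (is_diff_mull (dtheta / r) (is_diff_dmult1 x y Np)))).
by apply/funext => q; rewrite bil_dual_conn.
Qed.

Lemma disc_compl_open : open disc_compl.
Proof.
have cT : continuous (fun q : V => T q) by move=> q; exact: (@coord_continuous _ _ _ 0 0).
have cd k : continuous (fun q : V => T q + k * (S q * U q)).
  move=> q; apply: differentiable_continuous; apply: is_diff_differentiable.
  by diff_leaf q.
have -> : disc_compl = [set q | disc1 q != 0] `&` [set q | disc2 q != 0].
  by apply/seteqP; split=> q /=; [case/andP | case=> ? ?; apply/andP].
by apply: openI; apply: open_neq0; exact: cd.
Qed.

Lemma disc_compl_neq0 : exists p, disc_compl p.
Proof.
exists (vec2 1 0); rewrite /disc_compl /= /disc1 /disc2 vec2_0 vec2_1 mul0r !mulr0 addr0.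
by rewrite oner_neq0.
Qed.

Lemma k2E : k2 = 2 * del - (1 - r^-1) - k1.
Proof. by rewrite -k12; ring. Qed.

Ltac dual_unfold := rewrite /dmult0 /dmult1 /dnum0 /dnum1 /disc /dpsi /ddisc /disc1 /disc2 !SU_W.
Ltac dual_atoms p := move: (S p) (T p) (S p ^+ r') => s t w.

Lemma dual_mult_unit p x : disc_compl p -> bil (dual_mult p) (dual_unit p) x = x.
Proof.
case/andP; rewrite bil_dual_mult => d1 d2; have := r_neq0; move: d1 d2; dual_unfold.
rewrite vec2_0 vec2_1.
move: (r'.+2%:R : C) => rr d1 d2 r0.
apply: vec2P; rewrite ?vec2_0 ?vec2_1; move: (x 0 0) (x 1 0) => x0 x1; move: d1 d2; dual_atoms p => d1 d2;
by field; rewrite ?d1 ?d2 ?r0.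
Qed.

Lemma dual_mult_assoc p x y z : disc_compl p ->
  bil (dual_mult p) (bil (dual_mult p) x y) z = bil (dual_mult p) x (bil (dual_mult p) y z).
Proof.
case/andP; rewrite !bil_dual_mult => d1 d2; have := r_neq0; move: d1 d2; dual_unfold.
rewrite !vec2_0 !vec2_1.
move: (r'.+2%:R : C) => rr d1 d2 r0.
apply: vec2P; rewrite ?vec2_0 ?vec2_1; 
move: (x 0 0) (x 1 0) (y 0 0) (y 1 0) (z 0 0) (z 1 0) => x0 x1 y0 y1 z0 z1; move: d1 d2; dual_atoms p => d1 d2;
by field; rewrite ?d1 ?d2 ?r0.
Qed.
(** The derivative of W = s^(r-2) involves s^(r-3), which is not a power of s when r = 2. Naming v =
    s^(r-3), or setting W = 1, leaves rational identities in both cases. *)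
Lemma dWt_cases p : (exists v, W p = S p * v /\ dWt p = (r - 2) * v) \/
  [/\ W p = 1, r = 2 & dWt p = 0].
Proof.
rewrite /dWt; case: (r') => [|k]; first by right; rewrite mul0r.
by left; exists (S p ^+ k); rewrite exprS -!natr1 /=; split=> //; ring.
Qed.

Lemma dual_conn_unit p x : disc_compl p ->
  vec2 (T x) (S x / r) + bil (dual_conn p) x (dual_unit p) = (1 - del) *: x.
Proof.
case/andP; rewrite !bil_dual_conn => d1 d2; have := r_neq0; move: d1 d2; dual_unfold.
rewrite /dtheta !vec2_0 !vec2_1 => d1 d2.
move: (r'.+2%:R : C) => rr r0.
apply: vec2P; rewrite !mxE /=; move: d1 d2; move: (x 0 0) (x 1 0) => x0 x1; dual_atoms p => d1 d2;
by field; rewrite ?d1 ?d2 ?r0.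
Qed.

Lemma dual_conn_symm p x y : bil (dual_conn p) x y = bil (dual_conn p) y x.
Proof.
rewrite !bil_dual_conn /dmult0 /dmult1; congr (vec2 (- (_ * (_ / _) + _ * _ / _)) (- (_ * (_ / _))));
by ring.
Qed.

Lemma dual_mult_symm p x y : bil (dual_mult p) x y = bil (dual_mult p) y x.
Proof.
by rewrite !bil_dual_mult /dmult0 /dmult1; congr (vec2 (_ / _) (_ / _)); ring.
Qed.

(** No derivative of the connection occurs, so that s, t and w = s^(r-2) can be treated as
    independent variables; the relation between k1, k2 and del is used through [k2E]. *)
Lemma dual_potential p x y z : disc_compl p ->
  'D_x (fun q => bil (dual_mult q) y z) p + bil (dual_conn p) x (bil (dual_mult p) y z)
    - bil (dual_mult p) y (bil (dual_conn p) x z) =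
  'D_y (fun q => bil (dual_mult q) x z) p + bil (dual_conn p) y (bil (dual_mult p) x z)
    - bil (dual_mult p) x (bil (dual_conn p) y z).
Proof.
move=> Np; rewrite !D_dual_mult // !(bil_dual_mult, bil_dual_conn).
have := r_neq0; case/andP: Np; dual_unfold; rewrite /dtheta /dmu k2E !vec2_0 !vec2_1.
move: (r'.+2%:R : C) => rr d1 d2 r0.
apply: vec2P; rewrite !mxE /=; move: d1 d2;
move: (x 0 0) (x 1 0) (y 0 0) (y 1 0) (z 0 0) (z 1 0) => x0 x1 y0 y1 z0 z1; dual_atoms p => d1 d2;
by field; rewrite ?d1 ?d2 ?r0.
Qed.

Lemma dual_e_lie p x y : disc_compl p ->
  'D_dual_e (fun q => bil (dual_mult q) x y) p
    + bil (dual_mult p) dual_e (bil (dual_mult p) x y) = 0.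
Proof.
move=> Np; rewrite !D_dual_mult // !bil_dual_mult.
have := r_neq0; case/andP: Np; dual_unfold; rewrite /dual_e !vec2_0 !vec2_1.
move: (r'.+2%:R : C) => rr d1 d2 r0.
apply: vec2P; rewrite !mxE /=; move: d1 d2;
move: (x 0 0) (x 1 0) (y 0 0) (y 1 0) => x0 x1 y0 y1; dual_atoms p => d1 d2;
by field; rewrite ?d1 ?d2 ?r0.
Qed.

Lemma dual_e_hessian p x y : disc_compl p ->
  'D_x (fun q => bil (dual_conn q) y dual_e) p
    + bil (dual_conn p) x (bil (dual_conn p) y dual_e)
    - bil (dual_conn p) (bil (dual_conn p) x y) dual_e
    + bil (dual_conn p) (bil (dual_mult p) x y) dual_e = 0.
Proof.
move=> Np; rewrite !D_dual_conn // !(bil_dual_mult, bil_dual_conn).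
have cW := dWt_cases p.
have := r_neq0; case/andP: Np; dual_unfold; rewrite /dtheta /dmu k2E /dual_e !vec2_0 !vec2_1.
move: cW; move: (dWt p) (r'.+2%:R : C) => dW rr cW d1 d2 r0.
apply: vec2P; rewrite !mxE /=; move: cW d1 d2;
move: (x 0 0) (x 1 0) (y 0 0) (y 1 0) => x0 x1 y0 y1; dual_atoms p;
move=> [[v [wE dE]]|[wE rrE dE]] d1 d2; subst w dW; try subst rr;
rewrite ?mulr1 in d1 d2 *;
by field; rewrite ?d1 ?d2 ?r0.
Qed.

Lemma dual_flat p x y z : disc_compl p ->
  'D_x (fun q => bil (dual_conn q) y z) p + bil (dual_conn p) x (bil (dual_conn p) y z) =
  'D_y (fun q => bil (dual_conn q) x z) p + bil (dual_conn p) y (bil (dual_conn p) x z).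
Proof.
move=> Np; rewrite !D_dual_conn // !bil_dual_conn.
have cW := dWt_cases p.
have := r_neq0; case/andP: Np; dual_unfold; rewrite /dtheta /dmu k2E !vec2_0 !vec2_1.
move: cW; move: (dWt p) (r'.+2%:R : C) => dW rr cW d1 d2 r0.
apply: vec2P; rewrite !mxE /=; move: cW d1 d2;
move: (x 0 0) (x 1 0) (y 0 0) (y 1 0) (z 0 0) (z 1 0) => x0 x1 y0 y1 z0 z1; dual_atoms p;
move=> [[v [wE dE]]|[wE rrE dE]] d1 d2; subst w dW; try subst rr;
rewrite ?mulr1 in d1 d2 *;
by field; rewrite ?d1 ?d2 ?r0.
Qed.

Lemma is_diff_dual_unit p : is_diff p dual_unit (fun h => vec2 (T h) (S h / r)).
Proof.
apply: is_diff_vec2; first exact: is_diff_coord.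
apply: is_diff_ext (is_diff_mull r^-1 (is_diff_coord 1 p)) => h; exact: mulrC.
Qed.

Lemma dual_e_neq0 : dual_e != 0.
Proof.
apply/negP => /eqP/(congr1 (fun v : V => T v)); rewrite vec2_0 mxE.
exact/eqP.
Qed.

Lemma dual_almost_saito : almost_saito disc_compl (1 - del) dual_saito.
Proof.
apply: (almost_saito_intro (S := dual_saito) (e := dual_e)
  (dE := fun h => vec2 (T h) (S h / r))).
- exact: disc_compl_open.
- exact: disc_compl_neq0.
- move=> i j p Np /=; rewrite (_ : (fun q => _) =
    (fun q => bil (dual_conn q) (delta_mx i 0) (delta_mx j 0))).
    exact: differentiable_dual_conn.
  by apply/funext => q; rewrite bil_delta.
- move=> i j p Np /=; rewrite (_ : (fun q => _) =
    (fun q => bil (dual_mult q) (delta_mx i 0) (delta_mx j 0))).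
    exact: differentiable_dual_mult.
  by apply/funext => q; rewrite bil_delta.
- by [].
- exact: dual_e_neq0.
- by move=> p _; exact: is_diff_dual_unit.
- by move=> p x Np; exact: dual_conn_unit.
- by move=> p x y _; exact: dual_conn_symm.
- by move=> p x y _; exact: dual_mult_symm.
- by move=> p x y z Np; exact: dual_mult_assoc.
- by move=> p x Np; exact: dual_mult_unit.
- by move=> p x y z Np; exact: dual_flat.
- by move=> p x y z Np; exact: dual_potential.
- by move=> p x y Np; exact: dual_e_lie.
- by move=> p x y Np; exact: dual_e_hessian.
Qed.

End DualityStructure.

(** Indices of forms live in Z/3: statements for i, i + 1 and i + 1 + 1 are cyclic, and this
    equation closes the cycle. *)
Lemma ord3_cycle (i : 'I_3) : i + 1 + 1 + 1 = i.
Proof. by case: i => [[|[|[|//]]] Hi]; apply: val_inj. Qed.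

Lemma ord3P (i : 'I_3) (Q : 'I_3 -> Prop) : Q i -> Q (i + 1) -> Q (i + 1 + 1) -> forall j, Q j.
Proof.
have E (j k : 'I_3) : (j : nat) = k -> j = k by exact: val_inj.
case: i => [[|[|[|//]]] Hi] Q0 Q1 Q2 [[|[|[|//]]] Hj];
by [rewrite (E (Ordinal Hj) (Ordinal Hi)) | rewrite (E (Ordinal Hj) (Ordinal Hi + 1)) |
    rewrite (E (Ordinal Hj) (Ordinal Hi + 1 + 1))].
Qed.

Lemma ord3_sum (Z : nmodType) (F : 'I_3 -> Z) (i : 'I_3) :
  \sum_j F j = F i + F (i + 1) + F (i + 1 + 1).
Proof.
rewrite (reindex_inj (addrI i)) !big_ord_recl big_ord0 /= addrA [X in _ + X]addr0.
by congr (F _ + F _ + F _); apply: val_inj; case: i => [[|[|[|//]]] Hi].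
Qed.

(** * Klein forms and their orbit spaces *)

Section KleinForms.
Context {C : numClosedFieldType}.
Local Notation V := 'cV[C]_2.
Local Notation P := (mpoly 2 C).
Implicit Types v x y : V.

Definition hess (f : P) v x y : C := peval (pD x (pD y f)) v.
Definition grad (f : P) v x : C := peval (pD x f) v.

(* Binary forms a_i of degree m_i with a_0^p_0 + a_1^p_1 + a_2^p_2 = 0, whose Jacobian
   and Hessian determinants are monomials in the a_i; on T v, iota is the ratio of [a_i, a_j]
   to p_k a_k^(p_k - 1). *)
Record klein_forms (a : 'I_3 -> P) (p m : 'I_3 -> nat) (D : nat) (iota : C) : Prop := {
  kf_homog : forall i, a i \is ishomog1 (m i) mdeg;
  kf_m : forall i, (1 < m i)%N;
  kf_p : forall i, (1 < p i)%N;
  kf_pm : forall i, (p i * m i)%N = D;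
  kf_iota : iota != 0;
  kf_kappa : \sum_i (1 - (p i)%:R^-1) = 2 * (1 - D%:R^-1) :> C;
  kf_rel : forall v, \sum_i peval (a i) v ^+ p i = 0;
  kf_nz : forall v, peval (a 0) v = 0 -> peval (a 1) v = 0 -> v = 0;
  kf_jac : forall i v x y,
    grad (a i) v x * grad (a (i + 1)) v y - grad (a i) v y * grad (a (i + 1)) v x =
    iota * (p (i + 1 + 1))%:R * peval (a (i + 1 + 1)) v ^+ (p (i + 1 + 1)).-1 * det2 x y;
  kf_hess : forall i v u x y,
    hess (a i) v u u * hess (a i) v x y - hess (a i) v u x * hess (a i) v u y =
    ((m i).-1%:R * D%:R * iota / ((m (i + 1))%:R * (m (i + 1 + 1))%:R)) ^+ 2 *
    peval (a (i + 1)) v ^+ (p (i + 1)).-2 * peval (a (i + 1 + 1)) v ^+ (p (i + 1 + 1)).-2 *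
    (det2 u x * det2 u y) }.

Lemma grad_plin g f v x : grad (plin g f) v x = grad f (g *m v) (g *m x).
Proof. exact: peval_pD_plin. Qed.

Lemma hess_plin g f v x y : hess (plin g f) v x y = hess f (g *m v) (g *m x) (g *m y).
Proof. by rewrite /hess !pD_plin peval_plin. Qed.

Lemma det2_mulmx (g : 'M[C]_2) x y :
  det2 (g *m x) (g *m y) = (g 0 0 * g 1 1 - g 0 1 * g 1 0) * det2 x y.
Proof. by rewrite /det2 !mxE !ord2_sum; ring. Qed.

(** Needed because G is only conjugate to the model group; the Jacobian identities see the change of
    coordinates through its determinant, which goes into iota. *)
Lemma klein_forms_plin a p m D iota (g : 'M[C]_2) : g \in unitmx ->
  klein_forms a p m D iota ->
  klein_forms (fun i => plin g (a i)) p m D (iota * (g 0 0 * g 1 1 - g 0 1 * g 1 0)).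
Proof.
move=> ug [h1 h2 h3 h4 h5 hk h6 h7 h8 h9].
have dg : g 0 0 * g 1 1 - g 0 1 * g 1 0 != 0.
  apply/negP => /eqP dg0.
  have := det2_mulmx g (invmx g *m vec2 1 0) (invmx g *m vec2 0 1).
  rewrite !mulKVmx // dg0 mul0r /det2 !vec2_0 !vec2_1 mul0r subr0 mulr1 => /eqP.
  by rewrite oner_eq0.
split=> //.
- by move=> i; apply: plin_homog.
- by rewrite mulf_neq0.
- by move=> v; rewrite -[RHS](h6 (g *m v)); apply: eq_bigr => i _; rewrite peval_plin.
- move=> v; rewrite !peval_plin => e0 e1.
  by rewrite -[v](mulKmx ug) (h7 _ e0 e1) mulmx0.
- by move=> i v x y; rewrite !grad_plin h8 peval_plin det2_mulmx; ring.
- by move=> i v u x y; rewrite !hess_plin h9 !peval_plin !det2_mulmx; ring.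
Qed.

Section Consequences.
Variables (a : 'I_3 -> P) (p m : 'I_3 -> nat) (D : nat) (iota : C).
Hypothesis K : klein_forms a p m D iota.

Local Notation pw i := (a i ^+ p i).

Lemma grad_exp f k v x : grad (f ^+ k) v x = k%:R * peval f v ^+ k.-1 * grad f v x.
Proof. by rewrite /grad pDXn pevalZ pevalM pevalXn mulrA. Qed.

Lemma hess_exp f k v x y : hess (f ^+ k) v x y =
  k%:R * (k.-1%:R * peval f v ^+ k.-2 * grad f v x * grad f v y + peval f v ^+ k.-1 * hess f v x y).
Proof.
rewrite /hess pDXn pDZ pevalZ pDM pDXn pevalD !pevalM pevalZ pevalM !pevalXn /grad.
by ring.
Qed.

Lemma euler_grad i v : grad (a i) v v = (m i)%:R * peval (a i) v.
Proof. exact: euler_homog (kf_homog K i). Qed.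

Lemma pD_homog (f : P) d x : f \is ishomog1 d mdeg -> pD x f \is ishomog1 d.-1 mdeg.
Proof.
move=> hf; apply/dhomogP => k; rewrite mcoeff_msupp /pD raddf_sum /=.
case: d hf => [|d] hf.
  have -> : f = mpolyC 2 (mcoeff mnm0 f).
    apply/mpolyP => u; rewrite mcoeffC; case: eqP => [->|/eqP u0]; first by rewrite mulr1.
    rewrite mulr0; apply: (dhomog_nemf_coeff hf).
    by rewrite mdeg_eq0.
  by rewrite big1 ?eqxx // => j _; rewrite mderivC scaler0 mcoeff0.
apply: contra_neqP => /eqP kd; apply: big1 => j _.
rewrite mcoeffZ mcoeff_mderiv (dhomog_nemf_coeff hf) ?mul0rn ?mulr0 //.
have E : mdeg (mnm_add k (mnm1 j)) = (mdeg k).+1 by rewrite mdegD mdeg1 addn1.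
by apply: contra kd => /eqP E'; rewrite -eqSS -E E'.
Qed.

Lemma euler_hess i v x : hess (a i) v v x = (m i).-1%:R * grad (a i) v x.
Proof. by apply: euler_homog; apply: pD_homog; exact: (kf_homog K). Qed.

Lemma natp_neq0 i : (p i)%:R != 0 :> C.
Proof. by rewrite pnatr_eq0 -lt0n ltnW // (kf_p K). Qed.
Lemma natm_neq0 i : (m i)%:R != 0 :> C.
Proof. by rewrite pnatr_eq0 -lt0n ltnW // (kf_m K). Qed.
Lemma natm1_neq0 i : (m i).-1%:R != 0 :> C.
Proof. by rewrite pnatr_eq0; case: (m i) (kf_m K i) => [|[]]. Qed.
Lemma natD_eq i : D%:R = (p i)%:R * (m i)%:R :> C.
Proof. by rewrite -(kf_pm K i) natrM. Qed.
Lemma natD_neq0 : D%:R != 0 :> C.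
Proof. by rewrite (natD_eq 0) mulf_neq0 ?natp_neq0 ?natm_neq0. Qed.
Lemma natm1E i : (m i).-1%:R = (m i)%:R - 1 :> C.
Proof. by case: (m i) (kf_m K i) => // k _; rewrite -natr1 addrK. Qed.
Lemma natp1E i : (p i).-1%:R = (p i)%:R - 1 :> C.
Proof. by case: (p i) (kf_p K i) => // k _; rewrite -natr1 addrK. Qed.

Lemma kf_nz2 i v : peval (a i) v = 0 -> peval (a (i + 1)) v = 0 -> v = 0.
Proof.
move=> ei e1.
have e2 : peval (a (i + 1 + 1)) v = 0.
  have := kf_rel K v; rewrite (ord3_sum _ i) ei e1 !expr0n !gtn_eqF ?add0r;
    do ?[exact: ltnW (kf_p K _)].
  by move/eqP; rewrite expf_eq0 => /andP[_ /eqP].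
have az := @ord3P i (fun j => peval (a j) v = 0) ei e1 e2.
exact: (kf_nz K).
Qed.

(** The Jacobian identity with the position vector as one argument, where Euler's relation replaces
    a derivative by a value; [kf_hess_euler] treats the Hessian in the same way. *)
Lemma kf_omega i v x :
  (m i)%:R * peval (a i) v * grad (a (i + 1)) v x
  - (m (i + 1))%:R * peval (a (i + 1)) v * grad (a i) v x =
  iota * (p (i + 1 + 1))%:R * peval (a (i + 1 + 1)) v ^+ (p (i + 1 + 1)).-1 * det2 v x.
Proof. by rewrite -(kf_jac K) !euler_grad; ring. Qed.

Lemma kf_hess_euler i v x y :
  (m i)%:R * (m i).-1%:R * peval (a i) v * hess (a i) v x y =
  (m i).-1%:R ^+ 2 * (grad (a i) v x * grad (a i) v y) +
  ((m i).-1%:R * D%:R * iota / ((m (i + 1))%:R * (m (i + 1 + 1))%:R)) ^+ 2 *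
    peval (a (i + 1)) v ^+ (p (i + 1)).-2 * peval (a (i + 1 + 1)) v ^+ (p (i + 1 + 1)).-2 *
    (det2 v x * det2 v y).
Proof. by rewrite -(kf_hess K) !euler_hess euler_grad; ring. Qed.

(** With A = a_i^p_i and c = a_(i+2), this is c dA - p A dc, a multiple of the differential of A /
    c^p; it annihilates the Euler vector v. *)
Definition kpsi i v x : C :=
  peval (a (i + 1 + 1)) v * grad (pw i) v x - (p (i + 1 + 1))%:R * peval (pw i) v * grad (a (i + 1 + 1)) v x.

(* Obtained by eliminating [det2 v x] between [kf_omega] and [kf_hess_euler]. *)
Lemma hess_power i v x y : peval (a i) v != 0 -> peval (a (i + 1)) v != 0 ->
  hess (pw i) v x y = (1 - D%:R^-1) * (grad (pw i) v x * grad (pw i) v y / peval (pw i) v) +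
   (m i).-1%:R / D%:R * peval (a (i + 1 + 1)) v ^+ (p (i + 1 + 1)).-2 *
   (kpsi i v x * kpsi i v y) / (peval (pw i) v * peval (pw (i + 1)) v).
Proof.
move=> a0 b0.
have om u := kf_omega (i + 1 + 1) v u; rewrite ord3_cycle in om.
have hh := kf_hess_euler i v x y.
have Ep j : peval (a j) v != 0 -> peval (pw j) v = peval (a j) v ^+ 2 * peval (a j) v ^+ (p j).-2.
  by move=> _; rewrite pevalXn -exprD; case: (p j) (kf_p K j) => [|[]].
have Ep1 j : peval (a j) v ^+ (p j).-1 = peval (a j) v * peval (a j) v ^+ (p j).-2.
  by rewrite -exprS; case: (p j) (kf_p K j) => [|[]].
rewrite /kpsi hess_exp !grad_exp (Ep i) // (Ep (i + 1)) // !Ep1 natp1E.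
rewrite !Ep1 in om.
have pa0 := natp_neq0 i; have pb0 := natp_neq0 (i + 1); have pc0 := natp_neq0 (i + 1 + 1).
have ma0 := natm_neq0 i; have mb0 := natm_neq0 (i + 1); have mc0 := natm_neq0 (i + 1 + 1).
have m10 := natm1_neq0 i; have i0 := kf_iota K.
have wa0 : peval (a i) v ^+ (p i).-2 != 0 by rewrite expf_neq0.
have wb0 : peval (a (i + 1)) v ^+ (p (i + 1)).-2 != 0 by rewrite expf_neq0.
have ox := om x; have oy := om y; clear om.
have Dp := natD_eq i; have Dq := natD_eq (i + 1); have Dr := natD_eq (i + 1 + 1).
have m1E := natm1E i.
move: wa0 wb0 hh ox oy; clear Ep Ep1.
move: (peval (a (i + 1 + 1)) v ^+ _) (peval (a (i + 1)) v ^+ _) (peval (a i) v ^+ _) => wc wb wa.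
move: a0 b0 m1E m10; move: (peval (a i) v) (peval (a (i + 1)) v) (peval (a (i + 1 + 1)) v) => av bv cv.
move: (grad (a i) v x) (grad (a i) v y) (grad (a (i + 1 + 1)) v x) (grad (a (i + 1 + 1)) v y) => ax ay cx cy.
move: (hess (a i) v x y) (det2 v x) (det2 v y) => hxy dx dy.
move: pa0 pb0 pc0 ma0 mb0 mc0 Dp Dq Dr.
move: ((p i)%:R : C) ((p (i + 1))%:R : C) ((p (i + 1 + 1))%:R : C) ((m i)%:R : C) ((m (i + 1))%:R : C) ((m (i + 1 + 1))%:R : C) ((m i).-1%:R : C) (D%:R : C).
move=> pa pb pc ma mb mc m1 DD pa0 pb0 pc0 ma0 mb0 mc0 Dp Dq Dr a0 b0 m1E m10 wa0 wb0 hh ox oy.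
have DD0 : DD != 0 by rewrite Dp mulf_neq0.
(* What remains is rational: the p_j are D / m_j, and the Hessian and both values of [det2 v] are
   solved for, leaving the gradients free. *)
have paE : pa = DD / ma by rewrite Dp; field.
have pbE : pb = DD / mb by rewrite Dq; field.
have pcE : pc = DD / mc by rewrite Dr; field.
have hE : hxy = (m1 ^+ 2 * (ax * ay) + (m1 * DD * iota / (mb * mc)) ^+ 2 * wb * wc * (dx * dy)) / (ma * m1 * av).
  by rewrite -hh; field; rewrite ma0 m10 a0.
have dxE : dx = (mc * cv * ax - ma * av * cx) / (iota * pb * (bv * wb)).
  by rewrite ox; field; rewrite i0 pb0 b0 wb0.
have dyE : dy = (mc * cv * ay - ma * av * cy) / (iota * pb * (bv * wb)).
  by rewrite oy; field; rewrite i0 pb0 b0 wb0.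
clear ox oy hh Dp Dq Dr pa0 pb0 pc0.
rewrite hE dxE dyE paE pbE pcE m1E {hE dxE dyE paE pbE pcE}.
rewrite m1E in m10.
field.
by rewrite wb0 b0 wa0 a0 mc0 ma0 DD0 m10 mb0 i0.
Qed.

Lemma kf_rel3 i v : peval (pw i) v + peval (pw (i + 1)) v + peval (pw (i + 1 + 1)) v = 0.
Proof. by have := kf_rel K v; rewrite (ord3_sum _ i) !pevalXn. Qed.

(** If a_i were zero, the Jacobian identity would make a_(i+2) zero as well, and the two would have
    common zeros other than the origin. *)
Lemma kf_form_neq0 i : a i != 0.
Proof.
apply/negP => /eqP ai0.
have a2 v : peval (a (i + 1 + 1)) v = 0.
  have := kf_jac K i v (vec2 1 0) (vec2 0 1).
  have g0 x : grad (a i) v x = 0 by rewrite /grad ai0 (pDC x 0) peval0.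
  rewrite !g0 !mul0r subrr /det2 !vec2_0 !vec2_1 mul0r subr0 mulr1 mulr1 => /esym/eqP.
  rewrite !mulf_eq0 (negbTE (kf_iota K)) (negbTE (natp_neq0 _)) /= expf_eq0.
  by move=> /andP[_ /eqP].
have := @kf_nz2 (i + 1 + 1) (vec2 1 0) (a2 _).
rewrite ord3_cycle ai0 peval0 => /(_ erefl) /(congr1 (fun v : V => v 0 0)) /eqP.
by rewrite vec2_0 mxE oner_eq0.
Qed.

Lemma kf_generic : exists v, forall i, peval (a i) v != 0.
Proof.
have n0 : a 0 * a 1 * a (1 + 1) != 0 by rewrite !mulf_neq0 // kf_form_neq0.
apply: contrapT => /forallNP H; move/eqP: n0; apply; apply: mpoly2_zero_fun => v.
have [k] := proj2 (existsNP _) (H v); move=> /negP/negPn/eqP; rewrite !pevalM.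
move: k; apply: (@ord3P 0); rewrite ?add0r => ->; by rewrite ?mul0r ?mulr0 ?mul0r.
Qed.

(* The apparent pole along a_i = 0 of the Hessian of a_i cancels. *)
Lemma hess_form i v x y :
  (p i)%:R ^+ 2 * (peval (pw (i + 1)) v * peval (pw (i + 1 + 1)) v) * hess (a i) v x y =
  (m i).-1%:R / (m i)%:R * (peval (a i) v * (grad (pw (i + 1)) v x * grad (pw (i + 1)) v y)
    - (p i)%:R * peval (pw (i + 1)) v *
      (grad (pw (i + 1)) v x * grad (a i) v y + grad (a i) v x * grad (pw (i + 1)) v y)
    - (p i)%:R ^+ 2 * peval (pw (i + 1)) v * peval (a i) v ^+ (p i).-1 *
      (grad (a i) v x * grad (a i) v y)).
Proof.
pose A := pw (i + 1); pose B := pw (i + 1 + 1).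
pose Q : P := (p i)%:R ^+ 2 *: (A * B * pD x (pD y (a i))) -
  ((m i).-1%:R / (m i)%:R) *: (a i * (pD x A * pD y A) - (p i)%:R *: (A * (pD x A * pD y (a i) + pD x (a i) * pD y A))
  - (p i)%:R ^+ 2 *: (A * a i ^+ (p i).-1 * (pD x (a i) * pD y (a i)))).
suff QE : peval Q v = 0.
  apply/eqP; rewrite -subr_eq0; apply/eqP; apply: etrans QE.
  rewrite /Q !(pevalB, pevalZ, pevalM, pevalD, pevalXn) -/(hess _ _ _ _) -!/(grad _ _ _).
  rewrite -!pevalXn -/A -/B; ring.
have [v0 hv0] := kf_generic.
(* After multiplication by the three forms only points with a_(i+1) and a_(i+2) nonzero matter.
   There a_i Q = 0 follows by elimination, with no division by a_i. *)
apply: (@peval_cancel _ (a i * a (i + 1) * a (i + 1 + 1)) Q v0).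
  by rewrite !pevalM !mulf_neq0.
move=> {}v; rewrite !pevalM.
have [->|a0] := eqVneq (peval (a (i + 1)) v) 0; first by rewrite mulr0 !mul0r.
have [->|b0] := eqVneq (peval (a (i + 1 + 1)) v) 0; first by rewrite mulr0 !mul0r.
apply: etrans (_ : peval (a (i + 1)) v * peval (a (i + 1 + 1)) v * (peval (a i) v * peval Q v) = 0).
  by ring.
suff -> : peval (a i) v * peval Q v = 0 by rewrite mulr0.
have hx := kf_omega i v x; have hy := kf_omega i v y.
have hh := kf_hess_euler i v x y; have rel := kf_rel3 i v.
rewrite /Q !(pevalB, pevalZ, pevalM, pevalD, pevalXn) -/(hess _ _ _ _) -!/(grad _ _ _).
rewrite -/(grad (a i) v x) -/(grad (a i) v y) /A /B !grad_exp.
have Ep j : peval (pw j) v = peval (a j) v ^+ 2 * peval (a j) v ^+ (p j).-2.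
  by rewrite pevalXn -exprD; case: (p j) (kf_p K j) => [|[]].
have Ep' j : peval (a j) v ^+ p j = peval (a j) v ^+ 2 * peval (a j) v ^+ (p j).-2.
  by rewrite -Ep pevalXn.
have Ep1 j : peval (a j) v ^+ (p j).-1 = peval (a j) v * peval (a j) v ^+ (p j).-2.
  by rewrite -exprS; case: (p j) (kf_p K j) => [|[]].
rewrite ?Ep ?Ep' ?Ep1 in rel hx hy *.
have pa0 := natp_neq0 (i + 1); have pb0 := natp_neq0 (i + 1 + 1); have pc0 := natp_neq0 i.
have ma0 := natm_neq0 (i + 1); have mb0 := natm_neq0 (i + 1 + 1); have mc0 := natm_neq0 i.
have m10 := natm1_neq0 i; have i0 := kf_iota K.
have wa0 : peval (a (i + 1)) v ^+ (p (i + 1)).-2 != 0 by rewrite expf_neq0.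
have wb0 : peval (a (i + 1 + 1)) v ^+ (p (i + 1 + 1)).-2 != 0 by rewrite expf_neq0.
have Dp := natD_eq (i + 1); have Dq := natD_eq (i + 1 + 1); have Dr := natD_eq i.
move: wa0 wb0 hh hx hy rel; clear Ep Ep1 Ep' Q A B.
move: (peval (a i) v ^+ (p i).-2) (peval (a (i + 1 + 1)) v ^+ (p (i + 1 + 1)).-2)
  (peval (a (i + 1)) v ^+ (p (i + 1)).-2) => wc wb wa.
move: a0 b0; move: (peval (a (i + 1)) v) (peval (a (i + 1 + 1)) v) (peval (a i) v) => av bv cv.
move: (grad (a (i + 1)) v x) (grad (a (i + 1)) v y) (grad (a i) v x) (grad (a i) v y) => ax ay cx cy.
move: (hess (a i) v x y) (det2 v x) (det2 v y) => hxy dx dy.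
move: m10 pa0 pb0 pc0 ma0 mb0 mc0 Dp Dq Dr.
move: ((p (i + 1))%:R : C) ((p (i + 1 + 1))%:R : C) ((p i)%:R : C) ((m (i + 1))%:R : C) ((m (i + 1 + 1))%:R : C) ((m i)%:R : C) ((m i).-1%:R : C) (D%:R : C).
move=> pa pb pc ma mb mc m1 DD m10 pa0 pb0 pc0 ma0 mb0 mc0 Dp Dq Dr a0 b0 wa0 wb0 hh hx hy rel.
have DD0 : DD != 0 by rewrite Dp mulf_neq0.
have paE : pa = DD / ma by rewrite Dp; field.
have pbE : pb = DD / mb by rewrite Dq; field.
have pcE : pc = DD / mc by rewrite Dr; field.
have hE : cv * hxy = (m1 ^+ 2 * (cx * cy) + (m1 * DD * iota / (ma * mb)) ^+ 2 * wa * wb * (dx * dy)) / (mc * m1).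
  by rewrite -hh; field; rewrite mc0 m10.
have dxE : dx = (mc * cv * ax - ma * av * cx) / (iota * pb * (bv * wb)).
  by rewrite hx; field; rewrite i0 pb0 b0 wb0.
have dyE : dy = (mc * cv * ay - ma * av * cy) / (iota * pb * (bv * wb)).
  by rewrite hy; field; rewrite i0 pb0 b0 wb0.
have cE : cv ^+ 2 * wc = - (av ^+ 2 * wa + bv ^+ 2 * wb).
  by apply/eqP; rewrite -addr_eq0; apply/eqP; apply: etrans rel; ring.
clear hx hy hh Dp Dq Dr rel pa0 pb0 pc0.
pose lhs := pc ^+ 2 * (av ^+ 2 * wa * (bv ^+ 2 * wb) * (cv * hxy)) -
  m1 / mc * (cv ^+ 2 * (pa * (av * wa) * ax * (pa * (av * wa) * ay)) -
    pc * cv * (av ^+ 2 * wa * (pa * (av * wa) * ax * cy + cx * (pa * (av * wa) * ay))) -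
    pc ^+ 2 * (av ^+ 2 * wa * (cv ^+ 2 * wc) * (cx * cy))).
apply: etrans (_ : lhs = 0); first by rewrite /lhs; ring.
rewrite /lhs hE cE dxE dyE paE pbE pcE.
field.
by rewrite ?wb0 ?b0 ?wa0 ?a0 ?mc0 ?ma0 ?DD0 ?m10 ?mb0 ?i0.
Qed.

End Consequences.
End KleinForms.

(** * Jacobians and degrees of basic invariants *)

Section JacobianCriterion.
Context {C : numClosedFieldType}.
Local Notation V := 'cV[C]_2.
Local Notation P := (mpoly 2 C).
Implicit Types (v h : V) (x : 2.-tuple P).

Definition grad_row (f : P) v : V := vec2 (grad f v (vec2 1 0)) (grad f v (vec2 0 1)).

Lemma grad_lf f v h : grad f v h = lf (grad_row f v) h.
Proof.
rewrite /lf vec2_0 vec2_1 {1}(_ : h = h 0 0 *: vec2 1 0 + h 1 0 *: vec2 0 1); last first.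
  by apply: vec2P; rewrite !mxE /=; ring.
by rewrite /grad pD_add !pD_scale pevalD !pevalZ; ring.
Qed.

Definition jac x v : C := det2 (grad_row (tnth x 0) v) (grad_row (tnth x 1) v).

Lemma pmapD_injP x v : (forall h, pmapD x v h = 0 -> h = 0) <-> jac x v != 0.
Proof.
have E h i : pmapD x v h i 0 = lf (grad_row (tnth x i) v) h by rewrite mxE -grad_lf.
split=> [inj|j0 h h0]; last first.
  by apply: (lf_inj j0); rewrite lf0 -E h0 mxE.
apply/negP => /eqP j0; rewrite /jac in j0.
have Ea h : pmapD x v h 0 0 = lf (grad_row (tnth x 0) v) h by exact: E.
have Eb h : pmapD x v h 1 0 = lf (grad_row (tnth x 1) v) h by exact: E.
move: (grad_row (tnth x 0) v) (grad_row (tnth x 1) v) Ea Eb j0 => a b Ea Eb j0.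
have ka : vec2 (a 1 0) (- a 0 0) = 0.
  apply: inj; apply: vec2P; rewrite ?Ea ?Eb mxE /lf vec2_0 vec2_1; first by ring.
  by rewrite -[RHS]oppr0 -j0 /det2; ring.
have kb : vec2 (b 1 0) (- b 0 0) = 0.
  apply: inj; apply: vec2P; rewrite ?Ea ?Eb mxE /lf vec2_0 vec2_1; last by ring.
  by rewrite -j0 /det2; ring.
have z (w : V) : vec2 (w 1 0) (- w 0 0) = 0 -> w = 0.
  move=> w0; apply: vec2P; rewrite mxE; last first.
    by have := congr1 (fun u : V => u 0 0) w0; rewrite vec2_0 mxE.
  have := congr1 (fun u : V => u 1 0) w0; rewrite vec2_1 mxE => /eqP.
  by rewrite oppr_eq0 => /eqP.
have /(congr1 (fun u : V => u 0 0))/eqP : vec2 1 0 = 0 :> V.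
  apply: inj; apply: vec2P; rewrite ?Ea ?Eb [RHS]mxE.
    by rewrite (z a ka) /lf !mxE !mul0r addr0.
  by rewrite (z b kb) /lf !mxE !mul0r addr0.
by rewrite vec2_0 mxE oner_eq0.
Qed.

Lemma grad_comp (f h : P) x v k : (forall v, peval f v = peval h (pmap x v)) ->
  grad f v k = grad h (pmap x v) (pmapD x v k).
Proof.
move=> fE; rewrite /grad -(is_diffE (is_diff_peval f v)).
rewrite (_ : peval f = (fun w => peval h (pmap x w))); last by apply/funext.
by rewrite (is_diffE (is_diff_comp' (is_diff_pmap x v) (is_diff_peval h _))).
Qed.

(** By the chain rule, a kernel vector of dx would kill the differentials of f and g. *)
Lemma jac_neq0_of_generated x (f g hf hg : P) v :
  (forall v, peval f v = peval hf (pmap x v)) ->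
  (forall v, peval g v = peval hg (pmap x v)) ->
  (forall k, grad f v k = 0 -> grad g v k = 0 -> k = 0) -> jac x v != 0.
Proof.
move=> fE gE inj; apply/pmapD_injP => h h0; apply: inj.
  by rewrite (grad_comp _ _ fE) h0 /grad /pD big1 ?peval0 // => i _; rewrite mxE scale0r.
by rewrite (grad_comp _ _ gE) h0 /grad /pD big1 ?peval0 // => i _; rewrite mxE scale0r.
Qed.

Lemma homog0_const (f : P) v : f \is ishomog1 0 mdeg -> peval f v = peval f 0.
Proof. by move=> hf; rewrite -(scale0r v) (peval_homog _ _ hf) expr0 mul1r. Qed.

Lemma grad_const (f : P) c v h : (forall w, peval f w = c) -> grad f v h = 0.
Proof.
move=> fE; have -> : f = mpolyC 2 c by apply: peval_inj => w; rewrite fE pevalC.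
by rewrite /grad pDC peval0.
Qed.

Lemma jac_neq0_homog x d v i : jac x v != 0 -> tnth x i \is ishomog1 (d i) mdeg ->
  (0 < d i)%N /\ exists w, peval (tnth x i) w != 0.
Proof.
move=> j0 hi.
have nc c : ~ (forall w, peval (tnth x i) w = c).
  move=> xc; move/eqP: j0; apply.
  have r0 : grad_row (tnth x i) v = 0.
    by apply: vec2P; rewrite !mxE /= (grad_const _ _ xc).
  by move: i r0 {hi xc}; apply: ord2P => r0; rewrite /jac r0 /det2 !mxE; ring.
split.
  rewrite lt0n; apply/negP => /eqP d0; rewrite d0 in hi.
  by apply: (nc (peval (tnth x i) 0)) => w; exact: homog0_const.
apply: contrapT => /forallNP H; apply: (nc 0) => w.
by have /negP/negPn/eqP := H w.
Qed.

(** A monomial of degree n in the x_i has weight at least n k, so that weight k > 0 leaves only the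
    x_i of degree exactly k. *)
Lemma lin_part (f h : P) x (d : 'I_2 -> nat) k v :
  (forall v, peval f v = peval h (pmap x v)) -> f \is ishomog1 k mdeg ->
  (forall i, tnth x i \is ishomog1 (d i) mdeg) -> (0 < k)%N -> (forall i, (k <= d i)%N) ->
  peval f v = \sum_i (if d i == k then mcoeff (mnm1 i) h else 0) * peval (tnth x i) v.
Proof.
move=> fE hf hx k0 kd; rewrite (weighted_part v fE hf hx).
pose F (u : multinom 2) := mcoeff u h * \prod_i peval (tnth x i) v ^+ u i.
have FU i : F (mnm1 i) = mcoeff (mnm1 i) h * peval (tnth x i) v.
  rewrite /F (bigD1 i) //= big1 => [|j ji]; rewrite mnm1E.
    by rewrite eqxx expr1 mulr1.
  by rewrite eq_sym (negbTE ji) expr0.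
have wU i : (\sum_j (mnm1 i : multinom 2) j * d j)%N = d i.
  rewrite (bigD1 i) //= big1 => [|j ji]; rewrite mnm1E ?eqxx ?mul1n ?addn0 //.
  by rewrite eq_sym (negbTE ji).
have E (u : multinom 2) : (if (\sum_j u j * d j)%N == k then F u else 0) =
    \sum_i (if (u == mnm1 i) && (d i == k) then F (mnm1 i) else 0).
  case: ifPn => [/eqP wu|wu]; last first.
    rewrite big1 // => i _; case: ifPn => // /andP[/eqP uE /eqP dk].
    by rewrite uE wU dk eqxx in wu.
  have : mdeg u = 1%N.
    have : (mdeg u * k <= k)%N.
      rewrite -[leqRHS]wu mdegE big_distrl /=; apply: leq_sum => j _.
      by rewrite leq_mul.
    rewrite -[leqRHS]mul1n leq_pmul2r // leq_eqVlt => /orP[/eqP //|].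
    rewrite ltnS leqn0 mdeg_eq0 => /eqP u0; rewrite u0 big1 in wu.
      by rewrite -wu in k0.
    by move=> j _; rewrite mnm0E.
  move=> /eqP; case/mdeg1P => i /eqP uE; rewrite uE wU in wu.
  rewrite (bigD1 i) //= uE eqxx wu eqxx big1 ?addr0 // => j ji.
  by case: ifPn => // /andP[/eqP/(congr1 (fun u : multinom 2 => u j))];
     rewrite !mnm1E eqxx eq_sym (negbTE ji).
rewrite big_mkcond /= (eq_bigr _ (fun u _ => E u)) exchange_big /=.
apply: eq_bigr => i _; rewrite -big_mkcond /=; case: ifPn => dk; last first.
  by rewrite mul0r big1 // => u; rewrite andbF.
rewrite -FU; have [ih|ih] := boolP (mnm1 i \in msupp h).
  rewrite (eq_bigl (fun u => u == mnm1 i)); last by move=> u; rewrite andbT.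
  rewrite big_mkcond (bigD1_seq (mnm1 i)) ?msupp_uniq //= eqxx big1 ?addr0 //.
  by move=> u /negbTE ->.
rewrite FU (memN_msupp_eq0 ih) mul0r big1_seq // => u /andP[/andP[/eqP -> _]].
Qed.

End JacobianCriterion.

Section Degrees.
Context {C : numClosedFieldType}.
Local Notation V := 'cV[C]_2.
Local Notation P := (mpoly 2 C).
Local Notation M := 'M[C]_2.
Variables (a : 'I_3 -> P) (p m : 'I_3 -> nat) (D : nat) (iota : C).
Variables (G : set M) (Kg : 'I_3 -> set M) (z : C).

(** The interface between the concrete groups and the geometry. The scalars z and z^p_i determine
    the degrees of G and K_i, and the factorization of G by powers of z relates the invariants of
    the two groups. *)
Record klein_groups : Prop := {
  kg_forms : klein_forms a p m D iota;
  kg_G : matrix_group G;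
  kg_K : forall i, matrix_group (Kg i);
  kg_sub : forall i, Kg i `<=` G;
  kg_prim : D.-primitive_root z;
  kg_zG : G z%:M;
  kg_zK : forall i, Kg i (z ^+ p i)%:M;
  kg_factor : forall i g, G g -> exists2 k, Kg i k & exists e, g = z ^+ e *: k;
  kg_inv : forall i g v, Kg i g -> peval (a i) (g *m v) = peval (a i) v;
  kg_invG : forall i g v, G g -> peval (a i ^+ p i) (g *m v) = peval (a i ^+ p i) v;
  kg_refl : forall i, exists2 g, Kg i g & is_reflection g }.

Hypothesis H : klein_groups.
Let K := kg_forms H.
Local Notation pw i := (a i ^+ p i).

Lemma pw_homog i : pw i \is ishomog1 D mdeg.
Proof. by rewrite -(kf_pm K i) mulnC; apply: dhomogMn; exact: (kf_homog K). Qed.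

Lemma D_gt0 : (0 < D)%N. Proof. exact: prim_order_gt0 (kg_prim H). Qed.
Lemma m_gt0 i : (0 < m i)%N. Proof. exact: ltnW (kf_m K i). Qed.
Lemma p_gt0 i : (0 < p i)%N. Proof. exact: ltnW (kf_p K i). Qed.

Lemma pw_nz i v : peval (pw i) v = 0 -> peval (pw (i + 1)) v = 0 -> v = 0.
Proof.
rewrite !pevalXn => /eqP; rewrite expf_eq0 => /andP[_ /eqP e0] /eqP.
by rewrite expf_eq0 => /andP[_ /eqP e1]; exact: (kf_nz2 K) e0 e1.
Qed.

Lemma form_pw_nz i v : peval (a i) v = 0 -> peval (pw (i + 1)) v = 0 -> v = 0.
Proof.
move=> e0; rewrite pevalXn => /eqP; rewrite expf_eq0 => /andP[_ /eqP e1].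
exact: (kf_nz2 K) e0 e1.
Qed.

Lemma kf_grad_inj i v k : peval (a (i + 1 + 1)) v != 0 ->
  grad (a i) v k = 0 -> grad (a (i + 1)) v k = 0 -> k = 0.
Proof.
move=> av g0 g1.
have E y : det2 k y = 0.
  have := kf_jac K i v k y; rewrite g0 g1 mul0r mulr0 subrr => /esym/eqP.
  rewrite !mulf_eq0 (negbTE (kf_iota K)) (negbTE (natp_neq0 K _)) /=.
  by rewrite expf_eq0 (negbTE av) andbF /= => /eqP.
apply: vec2P; rewrite mxE.
  by have := E (vec2 0 1); rewrite /det2 vec2_0 vec2_1 mulr1 mulr0 subr0.
by have /eqP := E (vec2 1 0); rewrite /det2 vec2_0 vec2_1 mulr1 mulr0 sub0r oppr_eq0 => /eqP.
Qed.

Lemma grad_pw_eq0 i v k : peval (a i) v != 0 -> grad (pw i) v k = 0 -> grad (a i) v k = 0.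
Proof.
move=> av /eqP; rewrite grad_exp !mulf_eq0 (negbTE (natp_neq0 K _)) /=.
by rewrite expf_eq0 (negbTE av) andbF /= => /eqP.
Qed.

Lemma pw_jac i v x y : grad (pw i) v x * grad (pw (i + 1)) v y -
    grad (pw i) v y * grad (pw (i + 1)) v x =
  (p i)%:R * (p (i + 1))%:R * (p (i + 1 + 1))%:R * iota *
  (peval (a i) v ^+ (p i).-1 * peval (a (i + 1)) v ^+ (p (i + 1)).-1 *
   peval (a (i + 1 + 1)) v ^+ (p (i + 1 + 1)).-1) * det2 x y.
Proof.
rewrite !grad_exp; have := kf_jac K i v x y.
move: (grad (a i) v x) (grad (a i) v y) (grad (a (i + 1)) v x) (grad (a (i + 1)) v y) => ax ay bx b_y E.
transitivity ((p i)%:R * peval (a i) v ^+ (p i).-1 * ((p (i + 1))%:R *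
  peval (a (i + 1)) v ^+ (p (i + 1)).-1) * (ax * b_y - ay * bx)); first by ring.
by rewrite E; ring.
Qed.

Lemma pw_grad_inj i v : (forall j, peval (a j) v != 0) ->
  forall k, grad (pw i) v k = 0 -> grad (pw (i + 1)) v k = 0 -> k = 0.
Proof.
move=> av k g0 g1.
exact: kf_grad_inj (av _) (grad_pw_eq0 (av _) g0) (grad_pw_eq0 (av _) g1).
Qed.

Section OrbitSpace.
Variables (x : 2.-tuple P) (d : 'I_2 -> nat).
Hypothesis hx : basic_invariants G x d.

Lemma pw_generated i : exists h : P, forall v, peval (pw i) v = peval h (pmap x v).
Proof. by case: hx => _ _ _; apply => g v Gg; exact: kg_invG. Qed.

Lemma hx_homog j : tnth x j \is ishomog1 (d j) mdeg. Proof. by case: hx. Qed.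

(** The Jacobian of x is not identically zero, so no x_j is constant, and invariance under z makes D
    divide every d_j. The A_i have degree D, hence are linear in x. A coordinate with d_j > D would
    be absent from all of them, against their independence. *)
Lemma orbit_degrees : (forall j, d j = D) /\
  exists al : 'I_3 -> V,
    [/\ forall i v, peval (pw i) v = lf (al i) (pmap x v),
        forall i, al i + al (i + 1) + al (i + 1 + 1) = 0 &
        forall i, det2 (al i) (al (i + 1)) != 0].
Proof.
have [v0 hv0] := kf_generic K.
have jx : jac x v0 != 0.
  have [h0 e0] := pw_generated 0; have [h1 e1] := pw_generated (0 + 1).
  exact: jac_neq0_of_generated e0 e1 (pw_grad_inj hv0).
have dvd j : (D %| d j)%N.
  have [_ [w xw]] := jac_neq0_homog jx (hx_homog j).
  rewrite (prim_order_dvd (kg_prim H)).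
  case: hx => hom _ inv _; have := inv j _ w (kg_zG H).
  rewrite mul_scalar_mx (peval_homog _ _ (hom j)) -[X in _ = X]mul1r.
  by move/(mulIf xw) => ->.
have dD j : (D <= d j)%N.
  by apply: dvdn_leq => //; have [] := jac_neq0_homog jx (hx_homog j).
have /choice[h hE] := pw_generated.
pose al i : V := \col_j (if d j == D then mcoeff (mnm1 j) (h i) else 0).
have alE i v : peval (pw i) v = lf (al i) (pmap x v).
  rewrite (lin_part v (hE i) (pw_homog i) hx_homog D_gt0 dD) ord2_sum /lf.
  by rewrite !mxE.
have gE k u : grad (pw k) v0 u = lf (al k) (pmapD x v0 u).
  rewrite /grad -(is_diffE (is_diff_peval (pw k) v0)).
  rewrite (_ : peval _ = (fun w => lf (al k) (pmap x w))); last exact/funext.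
  by rewrite (is_diffE (is_diff_lf_comp (al k) (is_diff_pmap x v0))).
have det i : det2 (al i) (al (i + 1)) != 0.
  apply/negP => /eqP d0; have /eqP := pw_jac i v0 (vec2 1 0) (vec2 0 1).
  rewrite !gE /lf; move: (pmapD x v0 (vec2 1 0)) (pmapD x v0 (vec2 0 1)) => u w.
  rewrite (_ : _ - _ = det2 (al i) (al (i + 1)) * det2 u w); last by rewrite /det2; ring.
  rewrite d0 mul0r eq_sym !mulf_eq0 !expf_eq0 !(negbTE (natp_neq0 K _)) (negbTE (kf_iota K)).
  rewrite !(negbTE (hv0 _)) !andbF /det2 !vec2_0 !vec2_1 mul0r subr0 mulr1 oner_eq0.
  by [].
split.
  move=> j; apply/eqP/negPn/negP => dj.
  have al0 i : al i j 0 = 0 by rewrite mxE (negbTE dj).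
  move/eqP: (det 0); apply; rewrite /det2.
  by move: j al0 {dj}; apply: ord2P => al0; rewrite !al0; ring.
exists al; split=> // i; set s := al i + _ + _.
have lfC u w : lf u w = lf w u :> C by rewrite /lf; ring.
(* The differential of the relation between the A_i; the vectors [pmapD x v0 u] span the plane, so s
   = 0. *)
have s0 u : lf (pmapD x v0 u) s = 0.
  rewrite lfC /s /lf !mxE.
  apply: etrans (_ : grad (pw i) v0 u + grad (pw (i + 1)) v0 u + grad (pw (i + 1 + 1)) v0 u = 0).
    rewrite !gE /lf !mxE; ring.
  rewrite /grad -!pevalD -!pDD -/(grad _ _ _); apply: (grad_const (c := 0)) => w.
  by rewrite !pevalD (kf_rel3 K).
apply: (lf_inj (a := pmapD x v0 (vec2 1 0)) (b := pmapD x v0 (vec2 0 1))); rewrite ?s0 ?lf0 //.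
by apply: contra jx => /eqP <-; apply/eqP; rewrite /jac /det2 !mxE /=; ring.
Qed.

Lemma invariant_degree_D (f : P) i : f \is ishomog1 D mdeg -> invariant_poly G f ->
  exists s t, forall v, peval f v = s * peval (pw (i + 1)) v + t * peval (pw i) v.
Proof.
move=> hf finv; have [dD [al [alE _ det]]] := orbit_degrees.
have [h hE] : exists h : P, forall v, peval f v = peval h (pmap x v) by case: hx => _ _ _; apply.
have dD' j : (D <= d j)%N by rewrite dD.
have fE v : peval f v = lf (\col_j mcoeff (mnm1 j) h) (pmap x v).
  rewrite (lin_part v hE hf hx_homog D_gt0 dD') ord2_sum /lf !dD eqxx.
  by rewrite !mxE.
set b := \col_j _ in fE.
pose w1 := mkv (al (i + 1)) (al i).
have dt : det2 (al (i + 1)) (al i) != 0.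
  by rewrite (_ : det2 _ _ = - det2 (al i) (al (i + 1))) ?oppr_eq0 // /det2; ring.
exists (det2 b (al i) / det2 (al (i + 1)) (al i)), (det2 (al (i + 1)) b / det2 (al (i + 1)) (al i)).
move=> v; rewrite fE !alE; move: dt; rewrite /lf /det2 => dt.
by field.
Qed.

End OrbitSpace.

Section SubgroupOrbitSpace.
Variables (x : 2.-tuple P) (d : 'I_2 -> nat) (i : 'I_3).
Variables (y : 2.-tuple P) (e : 'I_2 -> nat).
Hypotheses (hx : basic_invariants G x d) (hy : basic_invariants (Kg i) y e).

(* Multiplied by a power of the form a_i, a K_i-invariant becomes G-invariant of degree D. *)
Lemma K_invariant_power (f : P) j : f \is ishomog1 (m i * j)%N mdeg ->
  invariant_poly (Kg i) f -> (j < p i)%N ->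
  exists t, forall v, peval f v = t * peval (a i) v ^+ j.
Proof.
move=> hf finv jp.
pose g := a i ^+ (p i - j) * f.
have hg : g \is ishomog1 D mdeg.
  have -> : D = (m i * (p i - j) + m i * j)%N.
    by rewrite -mulnDr subnK ?(ltnW jp) // mulnC (kf_pm K).
  by apply: dhomogM => //; apply: dhomogMn; exact: (kf_homog K).
have ginv : invariant_poly G g.
  move=> u v Gu; have [k Kk [n uE]] := kg_factor H i Gu.
  rewrite !pevalM !pevalXn uE -scalemxAl (peval_homog _ _ (kf_homog K i)).
  rewrite (peval_homog _ _ hf) (finv _ _ Kk) (kg_inv H _ Kk) exprMn mulrACA -[RHS]mul1r.
  congr (_ * _); rewrite -!exprM -exprD.
  rewrite (_ : (_ + _)%N = (D * n)%N); last first.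
    by rewrite -mulnA -mulnDr -mulnDr subnK ?(ltnW jp) // [(m i * _)%N]mulnC (kf_pm K) mulnC.
  by rewrite exprM (prim_expr_order (kg_prim H)) expr1n.
have [s [t gE]] := invariant_degree_D hx i hg ginv.
(* At a zero of a_i the product g and the A_i-term vanish while A_(i+1) does not, so the coefficient
   s is 0; then the power of a_i can be cancelled. *)
have [v1 v10 av1] := form_zero (kf_homog K i) (m_gt0 i).
have s0 : s = 0.
  have := gE v1; rewrite pevalM !pevalXn av1 !expr0n !gtn_eqF ?subn_gt0 ?p_gt0 //.
  rewrite mul0r mulr0 addr0 => /esym/eqP; rewrite mulf_eq0 => /orP[/eqP //|].
  move=> /eqP Av; case/eqP: v10; apply: (form_pw_nz av1).
  by rewrite pevalXn.
exists t => v.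
have [w aw] : exists w, peval (a i ^+ (p i - j)) w != 0.
  by have [w hw] := kf_generic K; exists w; rewrite pevalXn expf_neq0.
have := @peval_cancel _ (a i ^+ (p i - j)) (f - t *: a i ^+ j) w aw.
move=> /(_ _ v); rewrite pevalB pevalZ pevalXn => E; apply/eqP; rewrite -subr_eq0; apply/eqP.
apply: E => u; rewrite -pevalM mulrBr pevalB -/g gE s0 mul0r add0r.
rewrite pevalM pevalZ mulrCA -pevalM -exprD subnK ?subrr //.
exact: ltnW.
Qed.

(** The scalar z^p_i makes m_i divide both degrees, and a_i shows that m_i is the smaller one. The
    larger is m_i j. For j < p_i both invariants would be multiples of powers of a_i; for j > p_i
    the form A_(i+1) would be a multiple of a_i^p_i. Independent differentials exclude both. An
    invariant of degree D is then fixed by z too, hence by G. *)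
Lemma K_degrees : [/\ e 0 = D, e 1 = m i &
  exists lam mu nu, [/\ lam != 0, mu != 0,
    forall v, peval (tnth y 1) v = lam * peval (a i) v &
    forall v, peval (tnth y 0) v = mu * peval (pw (i + 1)) v + nu * peval (pw i) v]].
Proof.
have hom j : tnth y j \is ishomog1 (e j) mdeg by case: hy.
have inv j : invariant_poly (Kg i) (tnth y j) by case: hy.
have e10 : (e 1%R <= e 0%R)%N by case: hy => _ /(_ 0 1 isT).
have [v0 hv0] := kf_generic K.
have [hc cE] : exists h : P, forall v, peval (a i) v = peval h (pmap y v).
  by case: hy => _ _ _; apply => g v Kg'; exact: (kg_inv H).
have [hA AE] : exists h : P, forall v, peval (pw (i + 1)) v = peval h (pmap y v).
  by case: hy => _ _ _; apply => g v Kg'; apply: (kg_invG H); exact: (kg_sub H) Kg'.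
have inj k : grad (a i) v0 k = 0 -> grad (pw (i + 1)) v0 k = 0 -> k = 0.
  by move=> g0 g1; exact: (kf_grad_inj (hv0 _) g0 (grad_pw_eq0 (hv0 _) g1)).
have jy : jac y v0 != 0 := jac_neq0_of_generated cE AE inj.
have egt j : (0 < e j)%N by have [] := jac_neq0_homog jy (hom j).
have dvd j : (m i %| e j)%N.
  have [_ [w yw]] := jac_neq0_homog jy (hom j).
  have := inv j _ w (kg_zK H i); rewrite mul_scalar_mx (peval_homog _ _ (hom j)).
  rewrite -[X in _ = X]mul1r => /(mulIf yw) /eqP; rewrite -exprM.
  rewrite -(prim_order_dvd (kg_prim H)) -(kf_pm K i) dvdn_pmul2l //.
  exact: p_gt0.
have ge j : (m i <= e j)%N by apply: dvdn_leq.
have e1 : e 1 = m i.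
  have [v av] : exists v, peval (a i) v != 0 by exists v0.
  move/eqP: av; rewrite (lin_part v cE (kf_homog K i) hom (m_gt0 i) ge) ord2_sum.
  case: eqP => [e0|_]; last case: eqP => // _.
    by move=> _; apply/eqP; rewrite eqn_leq ge andbT -e0.
  by rewrite !mul0r addr0.
have y1 : exists2 lam, lam != 0 & forall v, peval (tnth y 1) v = lam * peval (a i) v.
  have [|t tE] := @K_invariant_power (tnth y 1) 1 _ (inv 1) (kf_p K i).
    by rewrite muln1 -e1.
  exists t; last by move=> v; rewrite tE expr1.
  have [_ [w yw]] := jac_neq0_homog jy (hom 1).
  by apply: contra yw => /eqP t0; rewrite tE t0 mul0r.
have [lam lam0 y1E] := y1.
have g1E u : grad (tnth y 1) v0 u = lam * grad (a i) v0 u.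
  rewrite (_ : tnth y 1 = lam *: a i); last by apply: peval_inj => v; rewrite pevalZ.
  by rewrite /grad pDZ pevalZ.
have [j e0E] : exists j, e 0 = (m i * j)%N by have /dvdnP[j ->] := dvd 0; exists j; rewrite mulnC.
have jp : j = p i.
  case: (ltngtP j (p i)) => // jp.
    have hom0 : tnth y 0 \is ishomog1 (m i * j)%N mdeg by rewrite -e0E.
    have [t tE] := K_invariant_power hom0 (inv 0) jp.
    have g0E u : grad (tnth y 0) v0 u = t * (j%:R * peval (a i) v0 ^+ j.-1 * grad (a i) v0 u).
      rewrite (_ : tnth y 0 = t *: a i ^+ j); last by apply: peval_inj => v; rewrite pevalZ pevalXn.
      by rewrite -grad_exp /grad pDZ pevalZ.
    by exfalso; move/eqP: jy; apply; rewrite /jac /det2 !mxE /= !g0E !g1E; ring.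
  exfalso.
  (* If e 0 exceeds D, the only monomial of weight D is the p_i-th power of the second invariant,
     which is proportional to a_i. *)
  pose kap : C := \sum_(u <- msupp hA | (\sum_j u j * e j)%N == D) mcoeff u hA.
  have AE' v : peval (pw (i + 1)) v = kap * peval (tnth y 1) v ^+ p i.
    rewrite (weighted_part v AE (pw_homog _) hom) /kap mulr_suml; apply: eq_bigr => u.
    have -> : (\sum_j u j * e j)%N = (u 0%R * e 0%R + u 1%R * e 1%R)%N by exact: ord2_sum.
    rewrite e1 e0E => /eqP wu; rewrite ord2_prod.
    have u0 : u 0 = 0%N.
      case E : (u 0) wu => [|q] // wu; have : (m i * p i < m i * j)%N by rewrite ltn_pmul2l ?m_gt0.
      rewrite mulnC (kf_pm K) -wu ltnNge => /negP[].
      by rewrite mulSn -addnA leq_addr.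
    have u1 : u 1 = p i.
      apply/eqP; rewrite -(eqn_pmul2r (m_gt0 i)) (kf_pm K) -[X in _ == X]wu u0.
      by rewrite mul0n add0n.
    by rewrite u0 u1 expr0 mul1r.
  have gAE u : grad (pw (i + 1)) v0 u =
      kap * ((p i)%:R * peval (tnth y 1) v0 ^+ (p i).-1 * (lam * grad (a i) v0 u)).
    rewrite (_ : pw (i + 1) = kap *: tnth y 1 ^+ p i); last first.
      by apply: peval_inj => v; rewrite pevalZ [in RHS]pevalXn.
    by rewrite -g1E -grad_exp /grad pDZ pevalZ.
  have {}inj k : grad (a i) v0 k = 0 -> k = 0.
    by move=> g0; apply: inj => //; rewrite gAE g0 !mulr0.
  set r0 := grad_row (a i) v0.
  have kz : vec2 (r0 1 0) (- r0 0 0) = 0.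
    by apply: inj; rewrite grad_lf -/r0 /lf vec2_0 vec2_1; ring.
  have z1 : r0 1 0 = 0 by have := congr1 (fun u : V => u 0 0) kz; rewrite vec2_0 => ->; rewrite mxE.
  have z0 : r0 0 0 = 0.
    apply/eqP; rewrite -oppr_eq0; apply/eqP.
    by have := congr1 (fun u : V => u 1 0) kz; rewrite vec2_1 => ->; rewrite mxE.
  have /(congr1 (fun u : V => u 0 0))/eqP : vec2 1 0 = 0 :> V.
    by apply: inj; rewrite grad_lf -/r0 /lf z0 z1 !mul0r addr0.
  by rewrite vec2_0 mxE oner_eq0.
rewrite jp in e0E; have e0D : e 0 = D by rewrite e0E mulnC (kf_pm K).
split=> //; have inv0 : invariant_poly G (tnth y 0).
  move=> u v Gu; have [k Kk [n uE]] := kg_factor H i Gu.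
  rewrite uE -scalemxAl (peval_homog _ _ (hom 0)) (inv 0 _ _ Kk) e0D -exprM mulnC exprM.
  by rewrite (prim_expr_order (kg_prim H)) expr1n mul1r.
have hom0 : tnth y 0 \is ishomog1 D mdeg by rewrite -e0D.
have [mu [nu y0E]] := invariant_degree_D hx i hom0 inv0.
exists lam, mu, nu; split=> //.
apply/negP => /eqP mu0; move/eqP: jy; apply.
have g0E u : grad (tnth y 0) v0 u = nu * ((p i)%:R * peval (a i) v0 ^+ (p i).-1 * grad (a i) v0 u).
  rewrite (_ : tnth y 0 = nu *: pw i); last first.
    by apply: peval_inj => v; rewrite pevalZ y0E mu0 mul0r add0r.
  by rewrite -grad_exp /grad pDZ pevalZ.
by rewrite /jac /det2 !mxE /= !g0E !g1E; ring.
Qed.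

End SubgroupOrbitSpace.
End Degrees.

(** * The connection nabla^V in the coordinates of M_G *)

Section FlatConnection.
Context {C : numClosedFieldType}.
Local Notation V := 'cV[C]_2.

Lemma pmapD_surj (x : 2.-tuple (mpoly 2 C)) (v w : V) : jac x v != 0 ->
  exists h, pmapD x v h = w.
Proof.
move=> jv; exists (mkv (grad_row (tnth x 0) v) (grad_row (tnth x 1) v) (w 0 0) (w 1 0)).
apply: vec2P; rewrite mxE -/(grad _ _ _) grad_lf.
  by rewrite lf_mkv_l.
by rewrite lf_mkv_r.
Qed.

Lemma bil_trivial p (h k : V) : bil (@trivial_conn C 1 p) h k = 0.
Proof. by rewrite /bil big1 // => j _; rewrite big1 // => l _; rewrite scaler0. Qed.

Lemma continuous_peval (f : mpoly 2 C) : continuous (peval f).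
Proof. by move=> v; apply: differentiable_continuous; case: (is_diff_peval f v). Qed.

Lemma jac_open (y : 2.-tuple (mpoly 2 C)) : open [set v | jac y v != 0].
Proof.
apply: open_neq0; rewrite (_ : jac y = peval
  (pD (vec2 1 0) (tnth y 0) * pD (vec2 0 1) (tnth y 1) -
   pD (vec2 0 1) (tnth y 0) * pD (vec2 1 0) (tnth y 1))); first exact: continuous_peval.
by apply/funext => v; rewrite pevalB !pevalM /jac /det2 !mxE.
Qed.

(** The trivial connection pushes forward to Gamma exactly when Gamma applied to dx(h) and dx(k) is
    minus the second differential of x. Every tangent vector over N is of the form dx(h), so this
    determines Gamma. *)
Lemma is_nablaV_iff (H : set 'M[C]_2) (x : 2.-tuple (mpoly 2 C)) (N : set V)
    (Gam g : @christoffel C 1) :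
  ~` reflection_hyperplanes H = [set v | jac x v != 0] ->
  (forall q, N q -> exists2 v, pmap x v = q & jac x v != 0) ->
  (forall v, jac x v != 0 -> N (pmap x v)) ->
  (forall v h k, jac x v != 0 ->
     pmapD2 x v h k + bil (Gam (pmap x v)) (pmapD x v h) (pmapD x v k) = 0) ->
  is_nablaV H x g <-> forall q h k, N q -> bil (g q) h k = bil (Gam q) h k.
Proof.
rewrite /is_nablaV => -> lift NP rel; split=> [P q h k /lift[v <- jv]|E].
  have [h' <-] := pmapD_surj h jv; have [k' <-] := pmapD_surj k jv.
  have inj := proj2 (pmapD_injP x v) jv.
  have := pushes_cov_elim h' k' (jac_open (y := x)) jv inj P.
  rewrite bil_trivial pmapD0 => /esym/eqP; rewrite addrC addr_eq0 => /eqP->.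
  by have := rel v h' k' jv; move/eqP; rewrite addrC addr_eq0 => /eqP->.
apply: pushes_cov_intro => v h k jv; rewrite bil_trivial pmapD0 E.
  by rewrite rel.
exact: NP.
Qed.

End FlatConnection.

Section OrbitSpaceGeometry.
Context {C : numClosedFieldType}.
Local Notation V := 'cV[C]_2.
Local Notation P := (mpoly 2 C).
Local Notation M := 'M[C]_2.
Variables (a : 'I_3 -> P) (p m : 'I_3 -> nat) (D : nat) (iota : C).
Variables (G : set M) (Kg : 'I_3 -> set M) (z : C).
Hypothesis H : klein_groups a p m D iota G Kg z.
Let K := kg_forms H.
Local Notation pw i := (a i ^+ p i).

(** The pole coefficient along A = 0: for A = a^p the second derivative is (1 - 1/p) dA dA / A plus
    a term in the Hessian of a. *)
Definition kappa i : C := 1 - (p i)%:R^-1.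
Definition delta : C := 1 - D%:R^-1.

Lemma kappa_sum i : kappa (i + 1) + kappa (i + 1 + 1) + kappa i = 2 * delta.
Proof. by have := kf_kappa K; rewrite (ord3_sum _ (i + 1)) ord3_cycle. Qed.

Lemma delta_neq0 : delta != 0.
Proof.
rewrite subr_eq0 eq_sym invr_eq1 -[1]/(1%:R) eqr_nat -(kf_pm K 0).
by rewrite muln_eq1 negb_and !gtn_eqF ?(kf_p K) ?(kf_m K).
Qed.

Lemma kappa_deltaE i : kappa i - delta = - ((m i).-1%:R / D%:R).
Proof.
rewrite /kappa /delta (natm1E K) (natD_eq K i).
by field; rewrite (natm_neq0 K) (natp_neq0 K).
Qed.

Lemma kappa_neq_delta i : kappa i != delta.
Proof.
rewrite -subr_eq0 kappa_deltaE oppr_eq0 mulf_neq0 ?invr_eq0 ?(natD_neq0 K) //.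
exact: natm1_neq0 K i.
Qed.

Lemma finite_G : finite_set G.
Proof.
apply: sub_finite_set (finite_form_stabilizer (pw_homog H 0) (pw_homog H 1) (D_gt0 H) _).
  by move=> g Gg v /=; split; apply: (kg_invG H).
by move=> v; have := @pw_nz _ _ _ _ _ _ _ _ _ H 0 v; rewrite add0r.
Qed.

Lemma finite_K i : finite_set (Kg i).
Proof. exact: sub_finite_set (kg_sub H (i := i)) finite_G. Qed.

Variables (x : 2.-tuple P) (d : 'I_2 -> nat) (al : 'I_3 -> V).
Hypotheses (hx : basic_invariants G x d)
  (alE : forall i v, peval (pw i) v = lf (al i) (pmap x v))
  (al_sum : forall i, al i + al (i + 1) + al (i + 1 + 1) = 0)
  (al_det : forall i, det2 (al i) (al (i + 1)) != 0).

Lemma grad_al i v h : grad (pw i) v h = lf (al i) (pmapD x v h).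
Proof.
rewrite /grad -(is_diffE (is_diff_peval (pw i) v)).
rewrite (_ : peval _ = (fun w => lf (al i) (pmap x w))); last exact/funext.
by rewrite (is_diffE (is_diff_lf_comp (al i) (is_diff_pmap x v))).
Qed.

Lemma hess_al i v h k : hess (pw i) v h k = lf (al i) (pmapD2 x v h k).
Proof.
rewrite /hess -(is_diffE (is_diff_peval (pD k (pw i)) v)).
rewrite (_ : peval _ = (fun w => lf (al i) (pmapD x w k))); last first.
  by apply/funext => w; rewrite -grad_al.
by rewrite (is_diffE (is_diff_lf_comp (al i) (is_diff_pmapD x v k))).
Qed.

Lemma pmap_x_surj y : exists v, pmap x v = y.
Proof.
have hg : pw (0 + 1) \is ishomog1 (1 * D)%N mdeg by rewrite mul1n; exact: pw_homog H _.
have [v e0 e1] := forms_surjective (lf (al 0) y) (lf (al (0 + 1)) y) (pw_homog H 0) hg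
  (D_gt0 H) (ltn0Sn 0) (@pw_nz _ _ _ _ _ _ _ _ _ H 0).
by exists v; apply: (lf_inj (al_det 0)); rewrite -alE.
Qed.

Lemma jac_x_neq0 v : jac x v != 0 <-> forall j, peval (a j) v != 0.
Proof.
split=> [jx j|av]; last first.
  apply/pmapD_injP => h h0; apply: (pw_grad_inj H av (i := 0)); by rewrite grad_al h0 lf0.
apply: contra jx => /eqP aj; apply/eqP.
have := pw_jac H j v (vec2 1 0) (vec2 0 1).
rewrite aj expr0n (gtn_eqF (_ : 0 < (p j).-1)%N); last by rewrite -ltnS prednK ?(p_gt0 H) // (kf_p K).
rewrite !mul0r !mulr0 mul0r !grad_al => E.
apply: (mulfI (al_det j)); rewrite mulr0 -[RHS]E.
by rewrite /lf /jac /det2 !mxE /=; ring.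
Qed.

Lemma hyperplanes_G v : reflection_hyperplanes G v <-> ~ (forall j, peval (a j) v != 0).
Proof.
have [g Kg' rg] := kg_refl H 0.
rewrite (reflection_hyperplanesP (kg_G H) finite_G hx v); last by exists g => //; exact: (kg_sub H) Kg'.
rewrite -jac_x_neq0 -pmapD_injP; split.
  by case=> h h0 xh inj; move/eqP: h0; apply; exact: inj.
move=> ninj; apply: contrapT => nh; apply: ninj => h xh; apply: contrapT => /eqP h0.
by apply: nh; exists h.
Qed.

Lemma hyperplanes_G_compl : ~` reflection_hyperplanes G = [set v | jac x v != 0].
Proof.
apply/seteqP; split=> v /=; rewrite hyperplanes_G => h.
  by apply/jac_x_neq0; apply: contrapT.
by apply; apply/jac_x_neq0.
Qed.

Lemma regular_orbits_G i :
  regular_orbits G x = arr_compl (al (i + 1)) (al (i + 1 + 1)) (al i).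
Proof.
apply/seteqP; split=> y.
  move=> ny; have [v vy] := pmap_x_surj y.
  have av : forall j, peval (a j) v != 0.
    by apply: contrapT => /hyperplanes_G hv; apply: ny; exists v.
  by rewrite /arr_compl /= -vy -!alE !pevalXn !expf_neq0.
move=> /and3P[y1 y2 y0] [v /hyperplanes_G nv vy]; apply: nv.
rewrite -vy -!alE !pevalXn !expf_eq0 !(p_gt0 H) /= in y0 y1 y2.
exact: (ord3P (i := i)).
Qed.

(** Write A, B, C for A_(i+1), A_(i+2), A_i. Then C dA - A dC is a_i^(p_i-1) times [kpsi], and A + B
    + C = 0 makes - (C dA - A dC)^2 / (A B C) equal to the symmetric sum [arr_form]; this
    symmetrizes the last term of [hess_power]. *)
Lemma hess_arr i v h k : (forall j, peval (a j) v != 0) ->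
  lf (al (i + 1)) (pmapD2 x v h k) =
  - arr_gam (al (i + 1)) (al (i + 1 + 1)) (al i) delta (pmap x v) (kappa (i + 1)) (lf (al (i + 1)))
     (pmapD x v h) (pmapD x v k).
Proof.
move=> av; rewrite /arr_gam /arr_form -hess_al -!grad_al -!alE opprK kappa_deltaE.
rewrite (hess_power K) // /kpsi ord3_cycle.
have C0 := av i; have A0 : peval (pw (i + 1)) v != 0 by rewrite pevalXn expf_neq0.
have B0 : peval (pw (i + 1 + 1)) v != 0 by rewrite pevalXn expf_neq0.
have rel := kf_rel3 K i v.
have relh u : grad (pw i) v u + grad (pw (i + 1)) v u + grad (pw (i + 1 + 1)) v u = 0.
  rewrite /grad -!pevalD -!pDD -/(grad _ _ _); apply: (grad_const (c := 0)) => w.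
  by rewrite !pevalD (kf_rel3 K).
have CE : peval (pw i) v = peval (a i) v ^+ 2 * peval (a i) v ^+ (p i).-2.
  by rewrite pevalXn -exprD; case: (p i) (kf_p K i) => [|[]].
have CgE u : grad (pw i) v u = (p i)%:R * (peval (a i) v * peval (a i) v ^+ (p i).-2) * grad (a i) v u.
  by rewrite grad_exp -exprS; case: (p i) (kf_p K i) => [|[]].
have BE : peval (pw (i + 1 + 1)) v = - (peval (pw i) v + peval (pw (i + 1)) v).
  by apply/eqP; rewrite -addr_eq0 addrC; apply/eqP.
have BgE u : grad (pw (i + 1 + 1)) v u = - (grad (pw i) v u + grad (pw (i + 1)) v u).
  by apply/eqP; rewrite -addr_eq0 addrC; apply/eqP; exact: relh.
rewrite !BgE BE !CgE CE in B0 *.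
have w0 : peval (a i) v ^+ (p i).-2 != 0 by rewrite expf_neq0.
have D0 := natD_neq0 K.
move: w0 A0 B0 C0; clear rel relh CE CgE BE BgE.
move: (peval (a i) v ^+ (p i).-2) => w; move: (peval (a i) v) (peval (pw (i + 1)) v) => c A.
move: (grad (a i) v h) (grad (a i) v k) (grad (pw (i + 1)) v h) (grad (pw (i + 1)) v k) => ch ck Ah Ak.
rewrite /delta; move: D0; move: (D%:R : C) ((p i)%:R : C) ((m (i + 1)).-1%:R : C) => DD r m1 D0 w0 A0 B0 c0.
rewrite oppr_eq0 in B0.
by field; rewrite ?w0 ?A0 ?B0 ?c0 ?D0.
Qed.

Lemma conn_relation i v h k : (forall j, peval (a j) v != 0) ->
  pmapD2 x v h k +
  bil (arr_conn (al (i + 1)) (al (i + 1 + 1)) (al i) (kappa (i + 1)) (kappa (i + 1 + 1)) delta (pmap x v))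
    (pmapD x v h) (pmapD x v k) = 0.
Proof.
move=> av; apply: (lf_inj (al_det (i + 1))); rewrite lfD lf0 ?A_conn ?B_conn ?al_det //.
  by rewrite hess_arr // addNr.
rewrite hess_arr // ord3_cycle; apply/eqP; rewrite addrC subr_eq0; apply/eqP.
by rewrite /arr_gam /arr_form; congr (- (_ + _ * _)); ring.
Qed.

Lemma regular_lift i y : arr_compl (al (i + 1)) (al (i + 1 + 1)) (al i) y ->
  exists2 v, pmap x v = y & jac x v != 0.
Proof.
rewrite -regular_orbits_G => ny; have [v vy] := pmap_x_surj y; exists v => //.
apply/jac_x_neq0; apply: contrapT => /hyperplanes_G hv; apply: ny; by exists v.
Qed.

Lemma jac_x_regular i v : jac x v != 0 ->
  arr_compl (al (i + 1)) (al (i + 1 + 1)) (al i) (pmap x v).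
Proof. by move/jac_x_neq0 => av; rewrite /arr_compl /= -!alE !pevalXn !expf_neq0. Qed.

Lemma is_nablaV_G i g : is_nablaV G x g <->
  forall q h k, arr_compl (al (i + 1)) (al (i + 1 + 1)) (al i) q -> bil (g q) h k =
    bil (arr_conn (al (i + 1)) (al (i + 1 + 1)) (al i) (kappa (i + 1)) (kappa (i + 1 + 1)) delta q) h k.
Proof.
apply: is_nablaV_iff => [|q|v|v h k /jac_x_neq0 av].
- exact: hyperplanes_G_compl.
- exact: regular_lift.
- exact: jac_x_regular.
- exact: conn_relation.
Qed.

End OrbitSpaceGeometry.

Section GradientLinearity.
Context {C : numClosedFieldType}.
Local Notation P := (mpoly 2 C).
Implicit Types (f g : P) (v x y : 'cV[C]_2).

Lemma gradD f g v x : grad (f + g) v x = grad f v x + grad g v x.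
Proof. by rewrite /grad pDD pevalD. Qed.

Lemma gradZ c f v x : grad (c *: f) v x = c * grad f v x.
Proof. by rewrite /grad pDZ pevalZ. Qed.

Lemma hessD f g v x y : hess (f + g) v x y = hess f v x y + hess g v x y.
Proof. by rewrite /hess !pDD pevalD. Qed.

Lemma hessZ c f v x y : hess (c *: f) v x y = c * hess f v x y.
Proof. by rewrite /hess !pDZ pevalZ. Qed.

End GradientLinearity.

(** * The orbit space of K_i *)

Section DualityOrbitSpace.
Context {C : numClosedFieldType}.
Local Notation V := 'cV[C]_2.
Local Notation P := (mpoly 2 C).
Local Notation M := 'M[C]_2.
Variables (a : 'I_3 -> P) (p m : 'I_3 -> nat) (D : nat) (iota : C).
Variables (G : set M) (Kg : 'I_3 -> set M) (z : C).
Hypothesis H : klein_groups a p m D iota G Kg z.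
Let K := kg_forms H.
Local Notation pw i := (a i ^+ p i).
Local Notation kap := (kappa (C := C) p).
Local Notation del := (delta (C := C) D).

Variables (i : 'I_3) (y : 2.-tuple P) (e : 'I_2 -> nat) (lam mu nu : C) (r' : nat).
Hypotheses (hy : basic_invariants (Kg i) y e) (pE : p i = r'.+2).
Hypotheses (lam0 : lam != 0) (mu0 : mu != 0)
  (y1E : forall v, peval (tnth y 1) v = lam * peval (a i) v)
  (y0E : forall v, peval (tnth y 0) v = mu * peval (pw (i + 1)) v + nu * peval (pw i) v).

(** With second invariant lam a_i and first invariant mu A_(i+1) + nu A_i, the constants nu1 and nu2
    turn [disc1] into mu A_(i+1) and [disc2] into - mu A_(i+2). *)
Definition nu1 : C := - nu / lam ^+ r'.+2.
Definition nu2 : C := (mu - nu) / lam ^+ r'.+2.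
Local Notation r := (r'.+2%:R : C).
Local Notation T q := (q (0 : 'I_2) (0 : 'I_1)).
Local Notation S q := (q (1 : 'I_2) (0 : 'I_1)).

Lemma lam_exp k : lam ^+ k != 0. Proof. by rewrite expf_neq0. Qed.

Lemma nu12 : nu1 != nu2.
Proof.
rewrite -subr_eq0 /nu1 /nu2 (_ : _ - _ = - (mu / lam ^+ r'.+2)); last by ring.
by rewrite oppr_eq0 mulf_neq0 ?invr_eq0 ?lam_exp.
Qed.

Lemma kappa12 : kap (i + 1) + kap (i + 1 + 1) + (1 - r^-1) = 2 * del.
Proof. by rewrite -(kappa_sum H i) /kappa pE. Qed.

Lemma y_poly1 : tnth y 1 = lam *: a i.
Proof. by apply: peval_inj => v; rewrite pevalZ y1E. Qed.

Lemma y_poly0 : tnth y 0 = mu *: pw (i + 1) + nu *: pw i.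
Proof. by apply: peval_inj => v; rewrite pevalD !pevalZ y0E. Qed.

Lemma pmap_yE v : pmap y v = vec2 (mu * peval (pw (i + 1)) v + nu * peval (pw i) v) (lam * peval (a i) v).
Proof. by apply: vec2P; rewrite mxE ?vec2_0 ?vec2_1. Qed.

Lemma pmapD_yE v h : pmapD y v h =
  vec2 (mu * grad (pw (i + 1)) v h + nu * grad (pw i) v h) (lam * grad (a i) v h).
Proof.
apply: vec2P; rewrite mxE ?vec2_0 ?vec2_1 -/(grad _ _ _) ?y_poly0 ?y_poly1.
  by rewrite gradD !gradZ.
by rewrite gradZ.
Qed.

Lemma pmapD2_yE v h k : pmapD2 y v h k =
  vec2 (mu * hess (pw (i + 1)) v h k + nu * hess (pw i) v h k) (lam * hess (a i) v h k).
Proof.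
apply: vec2P; rewrite mxE ?vec2_0 ?vec2_1 -/(hess _ _ _ _) ?y_poly0 ?y_poly1.
  by rewrite hessD !hessZ.
by rewrite hessZ.
Qed.

Lemma disc1_y v : disc1 nu1 r' (pmap y v) = mu * peval (pw (i + 1)) v.
Proof.
rewrite /disc1 -exprS pmap_yE vec2_0 vec2_1 exprMn /nu1 [peval (a i ^+ _) v]pevalXn pE.
by field; exact: lam_exp.
Qed.

Lemma disc2_y v : disc2 nu2 r' (pmap y v) = - (mu * peval (pw (i + 1 + 1)) v).
Proof.
have := kf_rel3 K i v => /eqP; rewrite addr_eq0 => /eqP E.
rewrite -mulrN -E /disc2 -exprS pmap_yE vec2_0 vec2_1 exprMn /nu2 [peval (a i ^+ _) v]pevalXn pE.
by field; exact: lam_exp.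
Qed.

Lemma pmap_y_surj q : exists v, pmap y v = q.
Proof.
have hg : pw (i + 1) \is ishomog1 (p i * m i)%N mdeg by rewrite (kf_pm K); exact: pw_homog H _.
have [v e0 e1] := forms_surjective (S q / lam) (disc1 nu1 r' q / mu) (kf_homog K i) hg
  (m_gt0 H i) (p_gt0 H i) (@form_pw_nz _ _ _ _ _ _ _ _ _ H i).
exists v; have S1 : S (pmap y v) = S q by rewrite pmap_yE vec2_1 e0 mulrC divfK.
apply: vec2P => //.
have := disc1_y v; rewrite e1 mulrC divfK // /disc1 S1.
by move/addIr.
Qed.

Lemma jac_y_neq0 v : jac y v != 0 <-> peval (a (i + 1)) v != 0 /\ peval (a (i + 1 + 1)) v != 0.
Proof.
split=> [jy|[a1 a2]]; last first.
  apply/pmapD_injP => h; rewrite pmapD_yE => E.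
  have /eqP : S (vec2 (mu * grad (pw (i + 1)) v h + nu * grad (pw i) v h) (lam * grad (a i) v h)) = 0.
    by rewrite E mxE.
  rewrite vec2_1 mulf_eq0 (negbTE lam0) /= => /eqP c0.
  have /eqP : T (vec2 (mu * grad (pw (i + 1)) v h + nu * grad (pw i) v h) (lam * grad (a i) v h)) = 0.
    by rewrite E mxE.
  rewrite vec2_0 [grad (pw i) v h]grad_exp c0 mulr0 mulr0 addr0 mulf_eq0 (negbTE mu0) /= => /eqP A0.
  refine (kf_grad_inj H a2 c0 (grad_pw_eq0 H a1 A0)).
have E : jac y v = - (lam * mu * ((p (i + 1))%:R * iota * (p (i + 1 + 1))%:R) *
   (peval (a (i + 1)) v ^+ (p (i + 1)).-1 * peval (a (i + 1 + 1)) v ^+ (p (i + 1 + 1)).-1)).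
  have := kf_jac K i v (vec2 1 0) (vec2 0 1).
  rewrite /jac /grad_row /det2 !vec2_0 !vec2_1 y_poly0 y_poly1.
  rewrite !gradD !gradZ !grad_exp.
  set c0 := grad (a i) v _; set c1 := grad (a i) v _.
  set A0 := grad (a (i + 1)) v _; set A1 := grad (a (i + 1)) v _.
  set w := _ ^+ (p (i + 1 + 1)).-1; set w1 := _ ^+ (p (i + 1)).-1; set w2 := _ ^+ (p i).-1.
  move=> J; transitivity (- (lam * mu * (p (i + 1))%:R * w1 * (c0 * A0 - c1 * A1))).
    by ring.
  by rewrite J; ring.
have p1 j : (0 < (p j).-1)%N by case: (p j) (kf_p K j) => [|[]].
move: jy; rewrite E oppr_eq0 !mulf_eq0 !expf_eq0 !p1 !negb_or.
by case/andP => _ /andP[].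
Qed.

Lemma hyperplanes_K_compl : ~` reflection_hyperplanes (Kg i) = [set v | jac y v != 0].
Proof.
have P' v := reflection_hyperplanesP (kg_K H i) (@finite_K _ _ _ _ _ _ _ _ _ H i) hy v (kg_refl H i).
apply/seteqP; split=> v /=; rewrite P'.
  by move=> nh; apply/pmapD_injP => h h0; apply: contrapT => /eqP hn; apply: nh; exists h.
by move=> /pmapD_injP inj [h h0 /inj]; exact/eqP.
Qed.

Lemma disc_compl_y v : disc_compl nu1 nu2 r' (pmap y v) <-> jac y v != 0.
Proof.
rewrite jac_y_neq0 /disc_compl /= disc1_y disc2_y oppr_eq0 !mulf_eq0 (negbTE mu0) /=.
rewrite !pevalXn !expf_eq0 !(p_gt0 H) /=.
by split=> [/andP[]|[-> ->]].
Qed.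

Lemma regular_orbits_K : regular_orbits (Kg i) y = disc_compl nu1 nu2 r'.
Proof.
apply/seteqP; split=> q.
  move=> nq; have [v vq] := pmap_y_surj q; rewrite -vq; apply/disc_compl_y.
  have : (~` reflection_hyperplanes (Kg i)) v by move=> hv; apply: nq; exists v.
  by rewrite hyperplanes_K_compl.
move=> dq [v hv vq]; move: dq; rewrite -vq => /disc_compl_y.
by have := hyperplanes_K_compl => /(congr1 (fun A => A v)) /= <-; apply.
Qed.

Lemma kappa_delta2 : kap (i + 1 + 1) - del = - (1 - r^-1) - (kap (i + 1) - del).
Proof.
have E : kap (i + 1 + 1) =
  kap (i + 1) + kap (i + 1 + 1) + (1 - r^-1) - (1 - r^-1) - kap (i + 1) by ring.
by rewrite E kappa12; ring.
Qed.

Lemma dtheta_K : dtheta del r' = (m i).-1%:R / (m i)%:R.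
Proof.
have r0 := natp_neq0 K i; have m0 := natm_neq0 K i.
rewrite /dtheta /delta (natm1E K) (natD_eq K i) -pE.
by field; rewrite r0 m0.
Qed.

Lemma dpsi_y v h : dpsi r' (pmap y v) (pmapD y v h) = lam * mu * kpsi a p (i + 1) v h.
Proof.
rewrite /dpsi /kpsi ord3_cycle pmapD_yE pmap_yE !vec2_0 !vec2_1 -pE.
rewrite [grad (pw i) v h]grad_exp [peval (pw i) v]pevalXn pE /= !exprS.
by ring.
Qed.

(** The Hessian of a_i from [hess_form] gives the s-component; those of A_(i+1) and A_i combine to
    the t-component. After the powers of a_i and lam are named, the identity is rational. *)
Lemma conn_relation_K v h k : jac y v != 0 ->
  pmapD2 y v h k + bil (dual_conn nu1 nu2 del (kap (i + 1)) (kap (i + 1 + 1)) r' (pmap y v))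
     (pmapD y v h) (pmapD y v k) = 0.
Proof.
move=> /jac_y_neq0[a1 a2].
have r0 := natp_neq0 K i; rewrite pE in r0.
have A0 : peval (pw (i + 1)) v != 0 by rewrite pevalXn expf_neq0.
have B0 : peval (pw (i + 1 + 1)) v != 0 by rewrite pevalXn expf_neq0.
have hA := hess_power K h k a1 a2; rewrite ord3_cycle in hA.
have hc := hess_form K i v h k.
have hC := hess_exp (a i) (p i) v h k.
have d1 := disc1_y v; have d2 := disc2_y v.
have BE : peval (pw (i + 1 + 1)) v = - (peval (pw i) v + peval (pw (i + 1)) v).
  by have /eqP := kf_rel3 K i v; rewrite addrC addr_eq0 => /eqP.
have CE : peval (pw i) v = peval (a i) v ^+ 2 * peval (a i) v ^+ r'.
  by rewrite pevalXn -exprD pE.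
have r1 : r - 1 = r'.+1%:R :> C by rewrite -natr1 addrK.
have CgE u : grad (pw i) v u = r * (peval (a i) v * peval (a i) v ^+ r') * grad (a i) v u.
  by rewrite grad_exp pE -exprS.
have hcE : hess (a i) v h k = dtheta del r' / (r ^+ 2 * (peval (pw (i + 1)) v * peval (pw (i + 1 + 1)) v)) *
   (peval (a i) v * (grad (pw (i + 1)) v h * grad (pw (i + 1)) v k)
    - r * peval (pw (i + 1)) v *
      (grad (pw (i + 1)) v h * grad (a i) v k + grad (a i) v h * grad (pw (i + 1)) v k)
    - r ^+ 2 * peval (pw (i + 1)) v * (peval (a i) v * peval (a i) v ^+ r') *
      (grad (a i) v h * grad (a i) v k)).
  have n0 : r ^+ 2 * (peval (pw (i + 1)) v * peval (pw (i + 1 + 1)) v) != 0.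
    by rewrite !mulf_neq0 // expf_neq0.
  by apply: (mulfI n0); rewrite dtheta_K -!pE hc pE -exprS [RHS]mulrA [_ * (_ / _)]mulrC divfK // -pE.
have hAE : hess (pw (i + 1)) v h k = del * (grad (pw (i + 1)) v h * grad (pw (i + 1)) v k / peval (pw (i + 1)) v)
   - (kap (i + 1) - del) * peval (a i) v ^+ r' * (kpsi a p (i + 1) v h * kpsi a p (i + 1) v k) /
    (peval (pw (i + 1)) v * peval (pw (i + 1 + 1)) v).
  by rewrite hA (kappa_deltaE H) pE !mulNr opprK.
rewrite pmapD2_yE bil_dual_conn !dpsi_y.
rewrite hC hcE hAE /dmult0 /dmult1 /disc d1 d2 pmapD_yE [pmapD y v k]pmapD_yE pmap_yE !vec2_0 !vec2_1.
rewrite /dmu kappa_delta2 /nu1 /nu2 !CgE /kpsi ord3_cycle CE pE /= -r1.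
rewrite !exprMn !exprS BE CE /dtheta in B0 *.
move: (lam_exp r') A0 B0 r0; clear - lam0 mu0.
move: (grad (pw (i + 1)) v h) (grad (pw (i + 1)) v k) (grad (a i) v h) (grad (a i) v k) => Ah Ak ch ck.
move: (peval (pw (i + 1)) v) => A; move: (lam ^+ r') (peval (a i) v ^+ r') => lw w.
move: (peval (a i) v) (kap (i + 1)) del r => c k1 dl rr lw0 A0 B0 r0.
rewrite ?expr0 ?expr1 oppr_eq0 in B0.
by apply: vec2P; rewrite !mxE /=; field; rewrite ?mu0 ?lam0 ?lw0 ?A0 ?r0 ?B0.
Qed.

Lemma is_nablaV_K g : is_nablaV (Kg i) y g <->
  forall q h k, disc_compl nu1 nu2 r' q ->
    bil (g q) h k = bil (dual_conn nu1 nu2 del (kap (i + 1)) (kap (i + 1 + 1)) r' q) h k.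
Proof.
apply: is_nablaV_iff => [|q dq|v jv|v h k].
- exact: hyperplanes_K_compl.
- have [v vq] := pmap_y_surj q; exists v => //.
  by apply/disc_compl_y; rewrite vq.
- exact/disc_compl_y.
- exact: conn_relation_K.
Qed.

End DualityOrbitSpace.

(** * Induced structures *)

Section ConstantPolynomialFields.
Context {C : numClosedFieldType}.
Local Notation V := 'cV[C]_2.

Definition const_field (v : V) : @poly_field C 1 := [ffun j => mpolyC 2 (v j 0)].

Lemma field_of_const v q : field_of (const_field v) q = v.
Proof. by apply/colP => j; rewrite mxE ffunE pevalC. Qed.

Lemma const_field_inj : injective const_field.
Proof. by move=> u v E; rewrite -(field_of_const u 0) E field_of_const. Qed.

Lemma const_field_lin c u v : const_field (c *: u + v) = c *: const_field u + const_field v.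
Proof. by apply/ffunP => j; rewrite !ffunE !mxE mpolyCD mpolyCM mul_mpolyC. Qed.

Lemma const_field_eq0 v : (const_field v == 0) = (v == 0).
Proof.
rewrite -(inj_eq const_field_inj); congr (_ == _).
by apply/ffunP => j; rewrite !ffunE mxE.
Qed.

Lemma constant_mpoly (f : mpoly 2 C) : (forall k, k \in msupp f -> k = mnm0) ->
  f = mpolyC 2 (mcoeff mnm0 f).
Proof.
move=> h; apply/mpolyP => k; rewrite mcoeffC; case: eqP => [<-|/eqP k0]; first by rewrite mulr1.
by rewrite mulr0; apply/eqP; rewrite -[_ == 0]negbK -mcoeff_msupp; apply: contra k0 => /h ->.
Qed.

Lemma field_degreeE (s t u : nat) : s%:Z - t%:Z = - u%:Z -> (s + u = t)%N.
Proof. by move/eqP; rewrite subr_eq addrC -subr_eq opprK => /eqP E; apply/eqP; rewrite -eqz_nat PoszD E. Qed.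

Lemma const_field_degree (d : 'I_2 -> nat) (v : V) :
  (forall j, v j 0 != 0 -> d j = d ord0) -> poly_fields_of_degree d (- (d ord0)%:Z) (const_field v).
Proof.
move=> h j k; rewrite ffunE msuppC; case: eqP => // /eqP vj.
rewrite inE => /eqP ->; rewrite big1 ?sub0r ?(h j) // => l _.
by rewrite mnm0E.
Qed.

(** A monomial of weight w in the j-th coefficient satisfies w + d_1 = d_j, and d_j is at most d_1:
    so w = 0, and a coefficient with d_j < d_1 vanishes. *)
Lemma lowest_degree_fields (d : 'I_2 -> nat) (f : @poly_field C 1) :
  (0 < d 1%R)%N -> (d 1%R <= d 0%R)%N -> poly_fields_of_degree d (- (d ord0)%:Z) f ->
  exists2 v, f = const_field v & d 1%R != d 0%R -> v 1 0 = 0.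
Proof.
move=> d1 d01 hf.
have hk j k : k \in msupp (f j) -> (k 0%R * d 0%R + k 1%R * d 1%R + d 0%R = d j)%N.
  by move/(hf j)/field_degreeE; rewrite ord2_sum.
have k0 j k : k \in msupp (f j) -> k = mnm0.
  move/hk => E; have dj : (d j <= d 0%R)%N by move: j {E}; apply: ord2P.
  have : (k 0%R * d 0%R + k 1%R * d 1%R == 0)%N.
    by rewrite -leqn0 -(leq_add2r (d 0%R)) E add0n.
  rewrite addn_eq0 !muln_eq0 !(gtn_eqF d1) (gtn_eqF (leq_trans d1 d01)) !orbF => /andP[/eqP e0 /eqP e1].
  by apply/mnmP; apply: ord2P; rewrite mnm0E.
exists (\col_j mcoeff mnm0 (f j)).
  by apply/ffunP => j; rewrite ffunE mxE; apply: constant_mpoly; exact: k0.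
move=> ne; rewrite mxE; apply/eqP; rewrite -[_ == 0]negbK -mcoeff_msupp.
apply/negP => /hk; rewrite !mnm0E /= => /eqP; rewrite eq_sym; exact/negP.
Qed.

End ConstantPolynomialFields.

Section DeckTransformations.
Context {C : numClosedFieldType}.
Local Notation V := 'cV[C]_2.
Variables (f a : 2.-tuple (mpoly 2 C)) (N : set V) (S S' : @saito_data C 1).
Hypotheses (fa : forall q, pmap f (pmap a q) = pmap f q) (Na : forall q, N q -> N (pmap a q))
  (inj : forall q h, N q -> pmapD f q h = 0 -> h = 0)
  (fconn : forall q h k, N q -> pmapD f q (bil (conn S q) h k) =
     pmapD2 f q h k + bil (conn S' (pmap f q)) (pmapD f q h) (pmapD f q k))
  (fmult : forall q h k, N q -> pmapD f q (bil (mult S q) h k) =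
     bil (mult S' (pmap f q)) (pmapD f q h) (pmapD f q k))
  (funit : forall q, N q -> pmapD f q (unit_field S q) = unit_field S' (pmap f q))
  (fe : forall q, N q -> pmapD f q (e_field S q) = e_field S' (pmap f q)).

Lemma pushes_saito_intro : pushes_saito (pmap f) N S S'.
Proof.
split; first exact: pushes_cov_intro.
- exact: pushes_prod_intro.
- exact/pushes_fieldP.
- exact/pushes_fieldP.
Qed.

(** Both sides are compared after applying f, which is immersive on N and satisfies f o a = f; a
    structure that f pushes to M_G is thus invariant. *)
Lemma deck_transformation_saito : pushes_saito (pmap a) N S S.
Proof.
have fa' q : pmap f q = pmap f (pmap a q) by [].
have D q h : pmapD f (pmap a q) (pmapD a q h) = pmapD f q h by rewrite -(pmapD_comp _ _ fa').
have inj2 q u v : N q -> pmapD f (pmap a q) u = pmapD f (pmap a q) v -> u = v.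
  move=> Nq E; apply/eqP; rewrite -subr_eq0; apply/eqP; apply: (inj (Na Nq)).
  by rewrite pmapDB E subrr.
split.
- apply: pushes_cov_intro => q h k Nq; apply: (inj2 q) => //.
  rewrite D fconn // pmapD_add fconn ?fa ?D; last exact: Na.
  by rewrite (pmapD2_comp _ _ _ fa') addrAC addrC addrA.
- apply: pushes_prod_intro => q h k Nq; apply: (inj2 q) => //.
  by rewrite D fmult // fmult ?fa ?D //; exact: Na.
- apply/pushes_fieldP => q Nq; apply: (inj2 q) => //.
  by rewrite D funit // funit ?fa //; exact: Na.
- apply/pushes_fieldP => q Nq; apply: (inj2 q) => //.
  by rewrite D fe // fe ?fa //; exact: Na.
Qed.

End DeckTransformations.

Section InducedStructures.
Context {C : numClosedFieldType}.
Local Notation V := 'cV[C]_2.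
Local Notation P := (mpoly 2 C).
Local Notation M := 'M[C]_2.
Variables (a : 'I_3 -> P) (p m : 'I_3 -> nat) (D : nat) (iota : C).
Variables (G : set M) (Kg : 'I_3 -> set M) (z : C).
Hypothesis H : klein_groups a p m D iota G Kg z.
Let K := kg_forms H.
Local Notation pw i := (a i ^+ p i).
Local Notation kap := (kappa (C := C) p).
Local Notation del := (delta (C := C) D).
Variables (x : 2.-tuple P) (d : 'I_2 -> nat) (al : 'I_3 -> V).
Hypotheses (hx : basic_invariants G x d) (dE : forall j, d j = D)
  (alE : forall i v, peval (pw i) v = lf (al i) (pmap x v))
  (al_sum : forall i, al i + al (i + 1) + al (i + 1 + 1) = 0)
  (al_det : forall i, det2 (al i) (al (i + 1)) != 0).
Variables (i : 'I_3).
Local Notation al1 := (al (i + 1)).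
Local Notation al2 := (al (i + 1 + 1)).
Local Notation al0 := (al i).
Local Notation NG := (arr_compl al1 al2 al0).
Local Notation GamG := (arr_conn al1 al2 al0 (kap (i + 1)) (kap (i + 1 + 1)) del).

Lemma al_sum_cycle : al1 + al2 + al0 = 0.
Proof. by rewrite -[X in _ + al X](ord3_cycle i). Qed.

Lemma natural_degree : (d ord0)%:R^-1 = 1 - del :> C.
Proof. by rewrite dE /delta subKr. Qed.

Lemma Edeg_G (q : V) : (d ord0)%:R^-1 *: Edeg d q = q.
Proof.
apply/colP => j; rewrite !mxE !dE mulrA mulVf ?mul1r //.
exact: natD_neq0 K.
Qed.

Definition special_line : set (@poly_field C 1) := [set const_field v | v in [set v | lf al0 v = 0]].

Lemma const_field_degree_G (v : V) : poly_fields_of_degree d (- (d ord0)%:Z) (const_field v).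
Proof. by apply: const_field_degree => j _; rewrite !dE. Qed.

Lemma degree_fields_G (f : @poly_field C 1) : poly_fields_of_degree d (- (d ord0)%:Z) f -> exists v, f = const_field v.
Proof.
by move=> hf; have [||v -> _] := lowest_degree_fields _ _ hf; rewrite ?dE ?(D_gt0 H) //; exists v.
Qed.

Lemma natural_saito_special v : v != 0 -> lf al0 v = 0 ->
  natural_saito G x d (arr_saito al1 al2 al0 v (kap (i + 1)) (kap (i + 1 + 1)) del) (const_field v).
Proof.
move=> v0 lv; have RE := regular_orbits_G H hx alE al_det i.
split.
- rewrite RE natural_degree.
  exact: arr_almost_saito al_sum_cycle (al_det (i + 1)) (kappa_sum H i) v0 lv.
- exact/(is_nablaV_G H hx alE al_det i _).
- by move=> q _; rewrite Edeg_G.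
- by rewrite const_field_eq0; split=> //; exact: const_field_degree_G.
- by move=> q _; rewrite field_of_const.
Qed.

Variables (y : 2.-tuple P) (e : 'I_2 -> nat) (lam mu nu : C) (r' : nat).
Hypotheses (hy : basic_invariants (Kg i) y e) (pE : p i = r'.+2)
  (e0E : e 0 = D) (e1E : e 1 = m i).
Hypotheses (lam0 : lam != 0) (mu0 : mu != 0)
  (y1E : forall v, peval (tnth y 1) v = lam * peval (a i) v)
  (y0E : forall v, peval (tnth y 0) v = mu * peval (pw (i + 1)) v + nu * peval (pw i) v).
Variable f : 2.-tuple P.
Hypothesis fE : orbit_space_map y x f.
Local Notation r := (r'.+2%:R : C).
Local Notation T q := (q (0 : 'I_2) (0 : 'I_1)).
Local Notation S q := (q (1 : 'I_2) (0 : 'I_1)).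
Local Notation n1 := (nu1 lam nu r').
Local Notation n2 := (nu2 lam mu nu r').
Local Notation NK := (disc_compl n1 n2 r').
Local Notation GamK := (dual_conn n1 n2 del (kap (i + 1)) (kap (i + 1 + 1)) r').
Local Notation N := (pmap f @^-1` NG).
Let surj := pmap_y_surj H pE lam0 mu0 y1E y0E.

Lemma f1 q : lf al1 (pmap f q) = disc1 n1 r' q / mu.
Proof.
by have [v <-] := surj q; rewrite -fE -alE (disc1_y pE lam0 y1E y0E) mulrAC divff // mul1r.
Qed.

Lemma f2 q : lf al2 (pmap f q) = - (disc2 n2 r' q / mu).
Proof.
have [v <-] := surj q; rewrite -fE -alE (disc2_y H pE lam0 y1E y0E).
by rewrite mulNr opprK mulrAC divff // mul1r.
Qed.

Lemma lf_al0 w : lf al0 w = - (lf al1 w + lf al2 w).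
Proof. exact: lfc al_sum_cycle w. Qed.

Lemma Df1 q h : lf al1 (pmapD f q h) = (T h + n1 * (r * S q ^+ r'.+1 * S h)) / mu.
Proof.
rewrite -(is_diffE (is_diff_lf_comp al1 (is_diff_pmap f q))).
rewrite (_ : (fun q => lf al1 (pmap f q)) = (fun q : V => mu^-1 * (q 0 0 + n1 * q 1 0 ^+ r'.+2))).
  rewrite (is_diffE (is_diff_mull _ (is_diff_plus (is_diff_coord 0 q)
    (is_diff_mull n1 (is_diff_exp r'.+2 (is_diff_coord 1 q)))))) /=.
  by rewrite mulrC.
by apply/funext => u; rewrite f1 mulrC /disc1 -exprS.
Qed.

Lemma Df2 q h : lf al2 (pmapD f q h) = - ((T h + n2 * (r * S q ^+ r'.+1 * S h)) / mu).
Proof.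
rewrite -(is_diffE (is_diff_lf_comp al2 (is_diff_pmap f q))).
rewrite (_ : (fun q => lf al2 (pmap f q)) = (fun q : V => - mu^-1 * (q 0 0 + n2 * q 1 0 ^+ r'.+2))).
  rewrite (is_diffE (is_diff_mull _ (is_diff_plus (is_diff_coord 0 q)
    (is_diff_mull n2 (is_diff_exp r'.+2 (is_diff_coord 1 q)))))) /=.
  by rewrite mulNr mulrC.
by apply/funext => u; rewrite f2 mulNr mulrC /disc2 -exprS.
Qed.

(** The value of A_i is proportional to [disc1] - [disc2], a multiple of s^r, so the ramification
    locus s = 0 is removed. *)
Lemma cover_domainE q : N q -> [/\ disc1 n1 r' q != 0, disc2 n2 r' q != 0 & S q != 0].
Proof.
rewrite /preimage /= /arr_compl /= lf_al0 f1 f2 oppr_eq0 !mulf_eq0 invr_eq0 (negbTE mu0) !orbF.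
case/and3P => d1 d2 d3; split=> //; apply: contra d3 => /eqP s0.
by rewrite /disc1 /disc2 s0 !mul0r !mulr0 addrN oppr0.
Qed.

Lemma cover_domain_disc q : N q -> NK q.
Proof. by case/cover_domainE => d1 d2 _; apply/andP. Qed.

Lemma cover_immersion q h : N q -> pmapD f q h = 0 -> h = 0.
Proof.
case/cover_domainE => d1 d2 s0 E.
have := Df1 q h; have := Df2 q h; rewrite E !lf0 => /esym/eqP; rewrite oppr_eq0 => /eqP E2 /esym/eqP E1.
move: E1 E2; rewrite mulf_eq0 invr_eq0 (negbTE mu0) orbF => /eqP E1 /eqP.
rewrite mulf_eq0 invr_eq0 (negbTE mu0) orbF => /eqP E2.
have Sh : S h = 0.
  have /eqP : (n1 - n2) * (r * S q ^+ r'.+1) * S h = 0 by rewrite -[RHS](subrr 0) -{1}E1 -E2; ring.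
  rewrite !mulf_eq0 subr_eq0 (negbTE (nu12 nu r' lam0 mu0)) (negbTE (r_neq0 r')) expf_eq0 (negbTE s0) /=.
  by move/eqP.
apply: vec2P; rewrite mxE //.
by move: E1; rewrite Sh !mulr0 addr0.
Qed.

Lemma cover_mult q h k : N q -> pmapD f q (bil (dual_mult n1 n2 r' q) h k) =
  bil (arr_mult al1 al2 (pmap f q)) (pmapD f q h) (pmapD f q k).
Proof.
move=> Nq; have [d1 d2 s0] := cover_domainE Nq.
have r0 := r_neq0 (C := C) r'.
apply: (lf_inj (al_det (i + 1))); move: d1 d2 r0; rewrite ?(A_mult (al_det _)) ?(B_mult (al_det _)) ?f1 ?f2 !(Df1, Df2);
  rewrite bil_dual_mult !vec2_0 !vec2_1 /dmult0 /dmult1 /disc /disc1 /disc2 -![_ * (_ ^+ _ * _)]mulrA !exprS;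
  move: n1 n2 r (S q) (T q) (T h) (S h) (T k) (S k) (S q ^+ r') => c1 c2 rr s t h0 h1 k0 k1 w d1 d2 r0;
  by field; rewrite ?mu0 ?r0 ?d1 ?d2.
Qed.

(** Both connections pull back to the trivial one on V. Lifting q to V, the second-order chain rule
    for x = f o y relates them. *)
Lemma cover_conn q h k : N q -> pmapD f q (bil (GamK q) h k) =
  pmapD2 f q h k + bil (GamG (pmap f q)) (pmapD f q h) (pmapD f q k).
Proof.
move=> Nq; have [v vq] := surj q; rewrite -vq in Nq *.
have jv : jac y v != 0.
  exact/(disc_compl_y H pE lam0 mu0 y1E y0E)/cover_domain_disc.
have [h' <-] := pmapD_surj h jv; have [k' <-] := pmapD_surj k jv.
have jx : jac x v != 0.
  apply/pmapD_injP => u; rewrite (pmapD_comp _ _ fE) => /(cover_immersion Nq).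
  exact: (proj2 (pmapD_injP y v) jv).
have := conn_relation_K H pE lam0 mu0 y1E y0E h' k' jv; move/eqP; rewrite addrC addr_eq0 => /eqP->.
have := conn_relation H alE al_det i h' k' (proj1 (jac_x_neq0 H alE al_det v) jx).
rewrite (pmapD2_comp _ _ _ fE) !(pmapD_comp _ _ fE) fE -addrA addrCA => /eqP.
by rewrite addr_eq0 => /eqP E; rewrite pmapDN E opprK.
Qed.

Lemma cover_unit (q : V) : pmapD f q (dual_unit r' q) = pmap f q.
Proof.
have E : r * S q ^+ r'.+1 * (S q / r) = S q * S q ^+ r'.+1.
  by rewrite mulrAC mulrCA divff ?r_neq0 // mulr1.
by apply: (lf_inj (al_det (i + 1))); rewrite ?f1 ?f2 ?Df1 ?Df2 /dual_unit vec2_0 vec2_1 E.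
Qed.

Lemma cover_e q tau : pmapD f q (dual_e tau) = mkv al1 al2 (tau / mu) (- (tau / mu)).
Proof.
by apply: (lf_inj (al_det (i + 1))); rewrite ?lf_mkv_l ?lf_mkv_r ?al_det ?Df1 ?Df2 // vec2_0 vec2_1 !mulr0 addr0.
Qed.

Lemma deck_map g (b : 2.-tuple P) : G g -> acts_on_orbits y g b ->
  forall q, pmap f (pmap b q) = pmap f q.
Proof.
move=> Gg ab q; have [v <-] := surj q; rewrite -ab -!fE.
by apply/colP => j; rewrite !mxE; case: hx => _ _ inv _; exact: inv.
Qed.

Lemma Edeg_K (q : V) : (e ord0)%:R^-1 *: Edeg e q = dual_unit r' q.
Proof.
have D0 := natD_neq0 K; have m0 := natm_neq0 K i; have p0 := natp_neq0 K i.
apply: vec2P; rewrite !mxE ?vec2_0 ?vec2_1 -[e ord0]/(e 0) e0E ?e1E mulrA.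
  by rewrite mulVf ?mul1r.
by rewrite /= (natD_eq K i) -pE; field; rewrite m0 p0.
Qed.

Lemma natural_degree_K : (e ord0)%:R^-1 = 1 - del :> C.
Proof. by rewrite -[e ord0]/(e 0) e0E /delta subKr. Qed.

Lemma dual_saito_natural tau : tau != 0 -> natural_saito (Kg i) y e
  (dual_saito n1 n2 del (kap (i + 1)) (kap (i + 1 + 1)) tau r') (const_field (dual_e tau)).
Proof.
move=> t0; split.
- rewrite (regular_orbits_K H hy pE lam0 mu0 y1E y0E) natural_degree_K.
  exact: (dual_almost_saito n1 n2 (kappa12 H pE) t0).
- exact/(is_nablaV_K H hy pE lam0 mu0 y1E y0E).
- by move=> q _; rewrite Edeg_K.
- rewrite const_field_eq0 dual_e_neq0 //; split=> //.
  apply: const_field_degree; apply: ord2P => //.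
  by rewrite vec2_1 eqxx.
- by move=> q _; rewrite field_of_const.
Qed.

(** Since m_i < D, a field of degree - D has no component along the second coordinate: the field e
    of K is unique up to scaling. *)
Lemma natural_field_K (eK : @poly_field C 1) : eK != 0 -> poly_fields_of_degree e (- (e ord0)%:Z) eK ->
  exists2 tau, tau != 0 & eK = const_field (dual_e tau).
Proof.
move=> eK0 /lowest_degree_fields; rewrite e0E e1E.
have mD : (m i < D)%N by rewrite -(kf_pm K i) ltn_Pmull ?(kf_p K) ?(m_gt0 H).
case=> [||w eE w1]; rewrite ?(m_gt0 H) ?(ltnW mD) //.
have wE : w = dual_e (w 0 0) by apply: vec2P; rewrite ?vec2_0 ?vec2_1 ?w1 ?(ltn_eqF mD).
exists (w 0 0); last by rewrite -wE.
move: eK0; rewrite eE const_field_eq0; apply: contra => /eqP w0.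
by rewrite wE w0; apply/eqP/vec2P; rewrite ?vec2_0 ?vec2_1 mxE.
Qed.

Lemma cover_lift q' : NG q' -> exists2 q, pmap f q = q' & N q.
Proof.
move=> Nq; have [v vq] := pmap_x_surj H alE al_det q'.
by exists (pmap y v); rewrite /preimage /= -fE vq.
Qed.

Lemma lf_opp v : lf al0 v = 0 -> lf al2 v = - lf al1 v.
Proof. by rewrite lf_al0 => /eqP; rewrite oppr_eq0 addrC addr_eq0 => /eqP. Qed.

(** By [mult_unique] the product of SG is [arr_mult], so all tensors of SG are explicit and the
    explicit structure of K_i maps to them; invariance under G is then that of deck
    transformations. *)
Lemma special_induced rr SG : almost_saito (regular_orbits G x) rr SG ->
  (exists2 e', natural_saito G x d SG e' & special_line e') ->
  exists SK eK, natural_saito (Kg i) y e SK eK /\ induced_saito G x y f SK SG.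
Proof.
have RE := regular_orbits_G H hx alE al_det i.
rewrite RE => asG [e' nat_e [v lv ve]]; move: nat_e; rewrite -ve => -[_ nab unitE [e0 _] eE].
rewrite const_field_eq0 in e0; rewrite RE in unitE eE.
have gE := proj1 (is_nablaV_G H hx alE al_det i _) nab.
have e_E q : NG q -> e_field SG q = v by move=> Nq; rewrite eE // field_of_const.
have mE q h k : NG q -> bil (mult SG q) h k = bil (arr_mult al1 al2 q) h k.
  move=> Nq; exact: (mult_unique al_sum_cycle (al_det _) (kappa_sum H i) (delta_neq0 H)
    (kappa_neq_delta H i) asG e_E gE).
(* By [cover_e] the field tau d/dt maps to the vector on which A_(i+1) takes the value tau / mu, so
   tau = mu A_(i+1)(v) yields v. *)
have t0 : mu * lf al1 v != 0.
  rewrite mulf_neq0 //; apply: contra e0 => /eqP l1; apply/eqP.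
  by apply: (lf_inj (al_det i)); rewrite ?lf0.
exists (dual_saito n1 n2 del (kap (i + 1)) (kap (i + 1 + 1)) (mu * lf al1 v) r').
exists (const_field (dual_e (mu * lf al1 v))); split; first exact: dual_saito_natural.
rewrite /induced_saito RE.
have C1 q h k : N q -> pmapD f q (bil (GamK q) h k) =
    pmapD2 f q h k + bil (conn SG (pmap f q)) (pmapD f q h) (pmapD f q k).
  by move=> Nq; rewrite cover_conn // gE.
have C2 q h k : N q -> pmapD f q (bil (dual_mult n1 n2 r' q) h k) =
    bil (mult SG (pmap f q)) (pmapD f q h) (pmapD f q k).
  by move=> Nq; rewrite cover_mult // mE.
have C3 q : N q -> pmapD f q (dual_unit r' q) = unit_field SG (pmap f q).
  by move=> Nq; rewrite cover_unit unitE // Edeg_G.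
have C4 q : N q -> pmapD f q (dual_e (mu * lf al1 v)) = e_field SG (pmap f q).
  move=> Nq; rewrite cover_e e_E // mulrAC divff // mul1r.
  by apply: (lf_inj (al_det (i + 1))); rewrite ?lf_mkv_l ?lf_mkv_r ?al_det // lf_opp.
split; last exact: pushes_saito_intro.
move=> g b Gg ab; have fb := deck_map Gg ab.
apply: (deck_transformation_saito (f := f) (S' := SG)) => //.
- by move=> q; rewrite /preimage /= fb.
- exact: cover_immersion.
Qed.

Lemma cover_domain_open : open N.
Proof.
apply: open_comp; last exact: arr_compl_open.
by move=> q _; apply: differentiable_continuous; case: (is_diff_pmap f q).
Qed.

Lemma arr_conn_unit (q w : V) : NG q -> w + bil (GamG q) w q = (1 - del) *: w.
Proof.
case/and3P => A0 B0 C0.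
have F : arr_form al1 al2 al0 q w q = 0.
  by rewrite /arr_form !mulfK // (lf_al0 w) addrN.
apply: (lf_inj (al_det (i + 1))); rewrite lfD lfZ ?A_conn ?B_conn ?al_det // /arr_gam F mulr0 addr0.
  by rewrite mulfK //; ring.
by rewrite mulfK //; ring.
Qed.

(** Every regular point lifts to the cover, where connection, unit field and e of the natural
    structure of K_i are known; pushing forward fixes those of SG. *)
Lemma induced_special rr SG : almost_saito (regular_orbits G x) rr SG ->
  (exists SK eK, natural_saito (Kg i) y e SK eK /\ induced_saito G x y f SK SG) ->
  exists2 e', natural_saito G x d SG e' & special_line e'.
Proof.
have RE := regular_orbits_G H hx alE al_det i.
move=> asG [SK [eK [[_ nabK unitK [eK0 degK] eKE] [_]]]]; rewrite RE => -[pc _ pu pe].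
have [tau t0 eKc] := natural_field_K eK0 degK.
rewrite (regular_orbits_K H hy pE lam0 mu0 y1E y0E) in unitK eKE.
have gK := proj1 (is_nablaV_K H hy pE lam0 mu0 y1E y0E _) nabK.
pose v := mkv al1 al2 (tau / mu) (- (tau / mu)).
have lv : lf al0 v = 0 by rewrite lf_al0 lf_mkv_l ?lf_mkv_r ?al_det // addrN oppr0.
have v0 : v != 0.
  have : tau / mu != 0 by rewrite mulf_neq0 ?invr_eq0.
  by apply: contra => /eqP v0; rewrite -(lf_mkv_l (tau / mu) (- (tau / mu)) (al_det (i + 1))) -/v v0 lf0.
have gE q' h k : NG q' -> bil (conn SG q') h k = bil (GamG q') h k.
  case/cover_lift => q <- Nq; have inj h' := cover_immersion (h := h') Nq.
  have jf := proj1 (pmapD_injP f q) inj.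
  have [h' <-] := pmapD_surj h jf; have [k' <-] := pmapD_surj k jf.
  have := pushes_cov_elim h' k' cover_domain_open Nq inj pc.
  rewrite gK; last exact: cover_domain_disc.
  by rewrite cover_conn // => /addrI.
have uE q' : NG q' -> unit_field SG q' = q'.
  case/cover_lift => q <- Nq; have := proj1 (pushes_fieldP _ _ _ _) pu q Nq.
  by rewrite unitK ?Edeg_K ?cover_unit //; exact: cover_domain_disc.
have eE q' : NG q' -> e_field SG q' = v.
  case/cover_lift => q <- Nq; have := proj1 (pushes_fieldP _ _ _ _) pe q Nq.
  rewrite eKE; last exact: cover_domain_disc.
  by rewrite eKc field_of_const cover_e.
(* The parameter of SG is recovered from (ASS3) for the constant field q, evaluated at the point
   q. *)
have rE : rr = 1 - del.
  rewrite RE in asG; have [q Nq] := arr_compl_neq0 al_sum_cycle (al_det (i + 1)).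
  have hc : holomorphic NG (cst q) by move=> u _; exact: differentiable_cst.
  have := as_ass3 asG (@arr_compl_open _ al1 al2 al0) (fun _ h => h) hc Nq.
  rewrite covE (eq_on_open_derive q (@arr_compl_open _ al1 al2 al0) Nq uE) uE // gE //.
  rewrite (is_diffE (is_diff_idfun q)) arr_conn_unit //.
  move=> /(congr1 (lf al1)); rewrite !lfZ; case/and3P: Nq => A0 _ _.
  by move/(mulIf A0).
exists (const_field v); last by exists v.
split.
- by rewrite natural_degree -rE.
- exact/(is_nablaV_G H hx alE al_det i).
- by rewrite RE => q Nq; rewrite Edeg_G uE.
- by rewrite const_field_eq0; split=> //; exact: const_field_degree_G.
- by rewrite RE => q Nq; rewrite field_of_const eE.
Qed.

End InducedStructures.

(** * The statement for arbitrary Klein forms and groups *)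

Section KleinGroupsTheorem.
Context {C : numClosedFieldType}.
Local Notation V := 'cV[C]_2.
Local Notation P := (mpoly 2 C).
Local Notation M := 'M[C]_2.

Definition perp (a : V) : V := vec2 (a 1 0) (- a 0 0).

Lemma perpP (a v : V) : a != 0 -> lf a v = 0 -> exists t, v = t *: perp a.
Proof.
move=> /vec2_neq0 ne; rewrite /lf => E; case: ne => a0.
  exists (- v 1 0 / a 0 0); apply: vec2P; rewrite !mxE /=; last by field.
  apply: (mulfI a0); rewrite -[LHS](addrK (a 1 0 * v 1 0)) E; by field.
exists (v 0 0 / a 1 0); apply: vec2P; rewrite !mxE /=; first by field.
by apply: (mulfI a0); rewrite -[LHS](addKr (a 0 0 * v 0 0)) E; field.
Qed.

Lemma lf_perp (a b : V) : lf a (perp b) = det2 a b.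
Proof. by rewrite /lf /det2 vec2_0 vec2_1 mulrN. Qed.

Lemma det2_self (a : V) : det2 a a = 0.
Proof. by rewrite /det2; ring. Qed.

Lemma const_fieldZ c (v : V) : const_field (c *: v) = c *: const_field v.
Proof.
rewrite -[c *: v]addr0 const_field_lin (_ : const_field 0 = 0) ?addr0 //.
by apply/eqP; rewrite const_field_eq0.
Qed.

Lemma lf_line_dim1 (a : V) : a != 0 ->
  linear_subspace_of_dim 1 [set const_field v | v in [set v : V | lf a v = 0]].
Proof.
move=> a0; exists (fun _ => const_field (perp a)); split=> [c|].
  rewrite big_ord1 => /eqP; rewrite scaler_eq0 const_field_eq0 => /orP[/eqP c0 j|/eqP p0].
    by rewrite (ord1 j).
  by case/eqP: a0; apply: vec2P; rewrite mxE;
    [have /eqP := congr1 (fun v : V => v 1 0) p0; rewrite vec2_1 mxE oppr_eq0 => /eqP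
    |have := congr1 (fun v : V => v 0 0) p0; rewrite vec2_0 mxE].
apply/seteqP; split=> u /=.
  by case=> v /(perpP a0)[t ->] <-; exists (fun=> t) => //; rewrite big_ord1 const_fieldZ.
case=> c _ <-; rewrite big_ord1; exists (c ord0 *: perp a); last exact: const_fieldZ.
by rewrite /= lfZ lf_perp det2_self mulr0.
Qed.

Variables (a : 'I_3 -> P) (p m : 'I_3 -> nat) (D : nat) (iota : C).
Variables (G : set M) (Kg : 'I_3 -> set M) (z : C).
Hypothesis H : klein_groups a p m D iota G Kg z.
Let K := kg_forms H.
Variables (x : 2.-tuple P) (d : 'I_2 -> nat).
Hypothesis hx : basic_invariants G x d.

(** Comparing scalars, equal groups would have m_i = m_(i+1). Then a_(i+1) is an invariant of K_i of
    degree m_i, hence a multiple of a_i, and both would share a zero. This separates the two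
    subgroups of type G_6, whose forms have equal degree. *)
Lemma klein_subgroup_neq i : Kg i <> Kg (i + 1).
Proof.
have dvd j k : Kg j = Kg k -> (m j %| m k)%N.
  move=> E; have [v hv] := kf_generic K.
  have := kg_inv H v (_ : Kg k (z ^+ p j)%:M); rewrite -E => /(_ (kg_zK H j)).
  rewrite mul_scalar_mx (peval_homog _ _ (kf_homog K k)) -[RHS]mul1r => /(mulIf (hv k)).
  rewrite -exprM => /eqP; rewrite -(prim_order_dvd (kg_prim H)) -(kf_pm K j).
  by rewrite dvdn_pmul2l // (p_gt0 H).
move=> E; have mE : m (i + 1) = m i by apply/eqP; rewrite eqn_dvd !dvd.
have [||t ht] := K_invariant_power H hx (i := i) (f := a (i + 1)) (j := 1) _ _ (kf_p K i).
- by rewrite muln1 -mE; exact: kf_homog K _.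
- by move=> g v; rewrite E; apply: (kg_inv H).
have [v v0 av] := form_zero (kf_homog K i) (m_gt0 H i).
by case/eqP: v0; apply: (kf_nz2 K av); rewrite ht av expr1 mulr0.
Qed.

Lemma klein_subgroup_inj : injective Kg.
Proof.
move=> i j E; apply/eqP; apply: contrapT => ne; move: E ne.
move: j; apply: (ord3P (i := i)) => [_|E _|E _]; first by rewrite eqxx.
  exact: klein_subgroup_neq E.
by apply: (@klein_subgroup_neq (i + 1 + 1)); rewrite ord3_cycle.
Qed.

Lemma klein_groups_main :
  [/\ d ord0 = d ord_max,
      linear_subspace_of_dim 2 (poly_fields_of_degree (C := C) d (- (d ord0)%:Z)) &
      exists l : 'I_3 -> set (poly_field (C := C) (n := 1)),
        [/\ (forall i, linear_subspace_of_dim 1 (l i) /\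
               l i `<=` poly_fields_of_degree d (- (d ord0)%:Z)) /\ injective l,
            forall e, poly_fields_of_degree d (- (d ord0)%:Z) e -> e != 0 ->
              ((exists S, natural_saito G x d S e) <-> exists i, l i e) &
            forall i xK dK, basic_invariants (Kg i) xK dK ->
              exists2 pi, orbit_space_map xK x pi &
                forall r S, almost_saito (regular_orbits G x) r S ->
                  ((exists2 e, natural_saito G x d S e & l i e) <->
                   (exists SK eK, natural_saito (Kg i) xK dK SK eK /\
                                  induced_saito G x xK pi SK S))]].
Proof.
have [dE [al [alE al_sum al_det]]] := orbit_degrees H hx.
have al0 i : al i != 0.
  by apply/negP => /eqP E; have := al_det i; rewrite E /det2 !mxE !mul0r subrr eqxx.
have degP (f : @poly_field C 1) : poly_fields_of_degree d (- (d ord0)%:Z) f <-> exists v, f = const_field v.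
  split=> [|[v ->]]; first exact: (degree_fields_G H dE).
  exact: const_field_degree_G.
split; first by rewrite !dE.
  exists (fun j => const_field (delta_mx j 0)).
  have E (c : 'I_2 -> C) : \sum_j c j *: const_field (delta_mx j 0) = const_field (\col_j c j).
    rewrite ord2_sum -[c 1 *: _]addr0 -(_ : const_field 0 = 0).
      rewrite -!const_field_lin; congr const_field.
      by apply: vec2P; rewrite !mxE /= !(mulr0, mulr1, addr0, add0r).
    by apply/eqP; rewrite const_field_eq0.
  split=> [c|].
    rewrite E => /eqP; rewrite const_field_eq0 => /eqP c0 j.
    by have := congr1 (fun v : V => v j 0) c0; rewrite !mxE.
  apply/seteqP; split=> f /=; rewrite degP.
    case=> v ->; exists (fun j => v j 0) => //; rewrite E; congr const_field.
    by apply/colP => j; rewrite mxE.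
  by case=> c _ <-; rewrite E; eexists.
exists (special_line al); split.
- split.
    move=> i; split; first exact: lf_line_dim1.
    by move=> f [v _ <-]; apply/degP; exists v.
  have ne i : special_line al i <> special_line al (i + 1).
    move=> E; have [] : special_line al (i + 1) (const_field (perp (al i))).
      by rewrite -E; exists (perp (al i)) => //=; rewrite lf_perp det2_self.
    move=> v /= lv /const_field_inj vE; have := al_det i; move/eqP; apply.
    by rewrite -[RHS]oppr0 -[in RHS]lv vE lf_perp /det2; ring.
  move=> i j E; apply/eqP; apply: contrapT => nij; move: E nij.
  move: j; apply: (ord3P (i := i)) => [_|E _|E _]; first by rewrite eqxx.
    exact: ne E.
  by apply: (ne (i + 1 + 1)); rewrite ord3_cycle.
- move=> f /degP[v ->]; rewrite const_field_eq0 => v0; split.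
    case=> S [asS nab _ _ eE]; rewrite (regular_orbits_G H hx alE al_det 0) in asS eE.
    have eE' q : arr_compl (al (0 + 1)) (al (0 + 1 + 1)) (al 0) q -> e_field S q = v.
      by move=> Nq; rewrite eE // field_of_const.
    have [lv|lv|lv] := e_on_arrangement (al_sum_cycle al_sum 0) (al_det (0 + 1)) (delta_neq0 H)
      (kappa_neq_delta H _) (kappa_neq_delta H _) asS eE'
      (proj1 (is_nablaV_G H hx alE al_det 0 _) nab).
    + by exists (0 + 1); exists v.
    + by exists (0 + 1 + 1); exists v.
    + by exists 0; exists v.
  case=> i [u lu /const_field_inj uE]; rewrite uE in lu.
  by eexists; exact: (natural_saito_special H hx dE alE al_sum al_det v0 lu).
- move=> i y e hy.
  have [e0E e1E [lam [mu [nu [lam0 mu0 y1E y0E]]]]] := K_degrees H hx hy.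
  have pE : p i = (p i).-2.+2 by case: (p i) (kf_p K i) => [|[]].
  (* The covering map expresses the invariants of G, which are K_i-invariant, as polynomials in
     y. *)
  have inv j : exists h : P, forall v, peval (tnth x j) v = peval h (pmap y v).
    case: hy => _ _ _; apply => g v kg; case: hx => _ _ hinv _.
    by apply: hinv; exact: kg_sub H _ _ kg.
  have [h hE] := choice inv.
  have fE : orbit_space_map y x [tuple h j | j < 2].
    by move=> v; apply/colP => j; rewrite !mxE tnth_mktuple hE.
  exists [tuple h j | j < 2] => // r S asS; split.
    exact: (special_induced H hx dE alE al_sum al_det hy pE e0E e1E lam0 mu0 y1E y0E fE asS).
  exact: (induced_special H hx dE alE al_sum al_det hy pE e0E e1E lam0 mu0 y1E y0E fE asS).
Qed.

End KleinGroupsTheorem.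

(** * Binary polyhedral groups and their extensions *)

Section MatrixGroups.
Context {C : numClosedFieldType}.
Local Notation V := 'cV[C]_2.
Local Notation M := 'M[C]_2.
Implicit Types (A g h s t : M) (B : set M) (v : V).

Lemma det_mx2 A : \det A = A 0 0 * A 1 1 - A 0 1 * A 1 0.
Proof.
have l0 : lift (0 : 'I_2) (0 : 'I_1) = 1 by exact: val_inj.
have l1 : lift (1 : 'I_2) (0 : 'I_1) = 0 by exact: val_inj.
rewrite (expand_det_row _ 0) ord2_sum /cofactor !det_mx11 !mxE /= l0 l1 expr0 expr1.
by ring.
Qed.

Lemma tr_mx2 A : \tr A = A 0 0 + A 1 1. Proof. exact: ord2_sum. Qed.

Lemma mx2_eqP A (B : M) : A 0 0 = B 0 0 -> A 0 1 = B 0 1 -> A 1 0 = B 1 0 -> A 1 1 = B 1 1 -> A = B.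
Proof.
by move=> e00 e01 e10 e11; apply/matrixP; apply: ord2P; apply: ord2P.
Qed.

Lemma cayley_hamilton2 A : A *m A = \tr A *: A - (\det A)%:M.
Proof.
rewrite det_mx2 tr_mx2.
by apply: mx2_eqP; rewrite !mxE !ord2_sum /= ?mulr1n ?mulr0n; ring.
Qed.

(** With c k = u^k - u^(-k), Cayley-Hamilton gives (u - u^-1) A^(k+1) = c (k+1) A - c k. If u^(2n) =
    1 then c n = 0 and only the scalar term of A^n is left. *)
Lemma unimodular_power A (u : C) n : \det A = 1 -> \tr A = u + u^-1 -> u != 0 ->
  u ^+ 2 != 1 -> (u ^+ n) ^+ 2 = 1 -> A ^+ n = (u ^+ n)%:M.
Proof.
move=> dA tA u0 u1; pose c k := u ^+ k - u^-1 ^+ k.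
have key k : (u - u^-1) *: A ^+ k.+1 = c k.+1 *: A - (c k)%:M.
  elim: k => [|k IH]; first by rewrite /c !expr1 !expr0 subrr raddf0 subr0.
  have -> : c k.+2 = c k.+1 * (u + u^-1) - c k by rewrite /c !exprS; field.
  rewrite exprS scalerAr IH mulrBr -scalerAr -[A * A]/(A *m A) cayley_hamilton2 dA tA.
  rewrite -[A * _]/(A *m _) mul_mx_scalar.
  move: (c k.+1) (c k) => c1 c0; apply/matrixP => i j; rewrite !mxE.
  by case: (i == j); rewrite ?mulr1n ?mulr0n; ring.
case: n => [|n] un; first by rewrite !expr0.
have c0 : u - u^-1 != 0.
  by apply: contra u1; rewrite subr_eq0 => /eqP E; rewrite expr2 {1}E mulVf.
have iw : u^-1 ^+ n.+1 = u ^+ n.+1.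
  by rewrite exprVn; apply: (mulfI (expf_neq0 n.+1 u0)); rewrite mulfV ?expf_neq0 // -expr2 un.
have cn : c n = - (u ^+ n.+1 * (u - u^-1)).
  by rewrite mulrBr -{1}iw /c !exprS; field.
apply: (scalerI c0); rewrite key cn {1}/c iw subrr scale0r sub0r raddfN opprK.
by rewrite mulrC scale_scalar_mx.
Qed.

Lemma reflectionP g : \det (g - 1%:M) = 0 -> g != 1%:M -> is_reflection g.
Proof.
move=> d0 g1; apply/eqP; rewrite eqn_leq lt0n mxrank_eq0 subr_eq0 g1 andbT.
rewrite -ltnS ltn_neqAle rank_leq_row andbT -/(row_free _) row_free_unit unitmxE d0.
by rewrite unitr0.
Qed.

Lemma matrix_group_exp B g n : matrix_group B -> B g -> B (g ^+ n).
Proof. by case=> B1 BM _ Bg; elim: n => [|n IH]; rewrite ?expr0 // exprS; exact: BM. Qed.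

Lemma unit_matrix_group : matrix_group [set g : M | g \in unitmx].
Proof.
split=> [|g h /= gu hu|g /= gu]; rewrite /= ?unitmx1 ?unitmx_mul ?gu //.
by rewrite unitmx_inv.
Qed.

Lemma fixing_matrix_group (F : V -> C) :
  matrix_group [set g : M | g \in unitmx /\ forall v, F (g *m v) = F v].
Proof.
split=> [|g h /= [gu gF] [hu hF]|g /= [gu gF]] /=.
- by rewrite unitmx1; split=> // v; rewrite mul1mx.
- by rewrite unitmx_mul gu hu; split=> // v; rewrite -mulmxA gF hF.
- rewrite unitmx_inv gu; do 2!split=> //; move=> v.
  by rewrite -[in RHS](mulKVmx gu v) gF.
Qed.

Lemma gen_matrix_group (A : set M) : (forall g, A g -> g \in unitmx) ->
  matrix_group (generated_group A).
Proof.
move=> Au; split=> [B [gB _]|g h Gg Gh B [gB AB]|g Gg]; first by case: gB.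
  by case: (gB) => _ mB _; apply: mB; [exact: (Gg B) | exact: (Gh B)].
split; first exact: (Gg _ (conj unit_matrix_group Au)).
by move=> B [gB AB]; case: (gB) => _ _ /(_ g (Gg B (conj gB AB)))[].
Qed.

Lemma gen_sub (A B : set M) : matrix_group B -> (A `<=` B) -> generated_group A `<=` B.
Proof. exact: smallest_sub. Qed.

Lemma gen_incl (A : set M) : A `<=` generated_group A.
Proof. exact: sub_gen_smallest. Qed.

Definition gen s t : set M := generated_group [set s; t].

Lemma gen_l s t : gen s t s. Proof. by apply: gen_incl; left. Qed.
Lemma gen_r s t : gen s t t. Proof. by apply: gen_incl; right. Qed.

Lemma gen_group s t : s \in unitmx -> t \in unitmx -> matrix_group (gen s t).
Proof. by move=> su tu; apply: gen_matrix_group => g [] ->. Qed.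

Lemma gen_subP s t B : matrix_group B -> B s -> B t -> gen s t `<=` B.
Proof. by move=> gB Bs Bt; apply: gen_sub => // g [] ->. Qed.

Lemma gen_eq s t s' t' : s \in unitmx -> t \in unitmx -> gen s t s' -> gen s t t' ->
  gen s' t' s -> gen s' t' t -> gen s t = gen s' t'.
Proof.
move=> su tu s1 t1 s2 t2; have g1 := gen_group su tu.
have u' : matrix_group (gen s' t').
  by apply: gen_group; [case: g1 => _ _ /(_ _ s1)[] | case: g1 => _ _ /(_ _ t1)[]].
by apply/seteqP; split; apply: gen_subP.
Qed.

End MatrixGroups.

Arguments gen_l {C} s t.
Arguments gen_r {C} s t.

(** * Groups generated by multiples of a polyhedral pair *)

Section PolyhedralGroups.
Context {C : numClosedFieldType}.
Local Notation V := 'cV[C]_2.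
Local Notation P := (mpoly 2 C).
Local Notation M := 'M[C]_2.

Section FormCharacters.
Variables (a : 'I_3 -> P) (p m : 'I_3 -> nat) (D : nat) (iota : C) (A : M) (u : C).
Hypotheses (K : klein_forms a p m D iota) (p0 : p 0 = 2%N) (p1 : p 1 = 3%N).
Hypotheses (dA : \det A = 1) (a2A : forall v, peval (a (1 + 1)) (A *m v) = u * peval (a (1 + 1)) v).

Let det2A x y : det2 (A *m x) (A *m y) = det2 x y.
Proof. by rewrite det2_mulmx -det_mx2 dA mul1r. Qed.

Let gradA f (w : C) : (forall v, peval f (A *m v) = w * peval f v) ->
  forall v x, grad f (A *m v) (A *m x) = w * grad f v x.
Proof.
move=> fA v x; rewrite -grad_plin -gradZ; congr (grad _ v x).
by apply: peval_inj => z; rewrite peval_plin pevalZ fA.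
Qed.

(* a 1 is the Hessian determinant of a 2, up to a constant. *)
Lemma hessian_form_character v : peval (a 1) (A *m v) = u ^+ 2 * peval (a 1) v.
Proof.
have E v' x y := kf_hess K (1 + 1) v' x y y.
have i0 : (1 + 1 + 1 : 'I_3) = 0 by exact: val_inj.
have i1 : (0 + 1 : 'I_3) = 1 by exact: val_inj.
have hA x y : hess (a (1 + 1)) (A *m v) (A *m x) (A *m y) = u * hess (a (1 + 1)) v x y.
  rewrite -hess_plin -hessZ; congr (hess _ v x y).
  by apply: peval_inj => z; rewrite peval_plin pevalZ a2A.
have := E (A *m v) (A *m vec2 1 0) (A *m vec2 0 1); rewrite !hA !det2A.
have -> : det2 (vec2 1 0 : V) (vec2 0 1) = 1.
  by rewrite /det2 !vec2_0 !vec2_1 mulr1 mulr0 subr0.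
have := E v (vec2 1 0) (vec2 0 1); rewrite i0 i1 p0 p1 /= !expr0 !expr1.
have -> : det2 (vec2 1 0 : V) (vec2 0 1) = 1.
  by rewrite /det2 !vec2_0 !vec2_1 mulr1 mulr0 subr0.
rewrite !mulr1; set N := _ ^+ 2 => E1 E2.
have N0 : N != 0.
  by rewrite expf_neq0 // !mulf_neq0 ?invr_eq0 ?mulf_neq0 ?(kf_iota K) ?(natm_neq0 K) ?(natm1_neq0 K) ?(natD_neq0 K).
by apply: (mulfI N0); rewrite mulrCA -E1 -E2; ring.
Qed.

(** Since p_0 = 2, the form a 0 is up to a constant the Jacobian of a 1 and a 2, whose characters
    are u^2 and u. *)
Lemma jacobian_form_character v : peval (a 0) (A *m v) = u ^+ 3 * peval (a 0) v.
Proof.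
have i0 : (1 + 1 + 1 : 'I_3) = 0 by exact: val_inj.
have := kf_jac K 1 (A *m v) (A *m vec2 1 0) (A *m vec2 0 1).
rewrite !(gradA a2A) !(gradA hessian_form_character) det2A.
have := kf_jac K 1 v (vec2 1 0) (vec2 0 1).
have -> : det2 (vec2 1 0 : V) (vec2 0 1) = 1.
  by rewrite /det2 !vec2_0 !vec2_1 mulr1 mulr0 subr0.
rewrite i0 p0 /= !expr1 !mulr1 => E E'.
have N0 : iota * 2%:R != 0 by rewrite mulf_neq0 ?(kf_iota K) ?pnatr_eq0.
apply: (mulfI N0); rewrite -E' [RHS]mulrCA -E; ring.
Qed.

End FormCharacters.

Lemma common_eigenvector_comm (A B : M) (v : V) s t : A *m v = s *: v -> B *m v = t *: v ->
  \det (A *m B - B *m A) != 0 -> v = 0.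
Proof.
move=> Av Bv; rewrite -unitfE -unitmxE => u; rewrite -[v](mulKmx u).
by rewrite mulmxBl -!mulmxA Av Bv -!scalemxAr Av Bv !scalerA mulrC subrr mulmx0.
Qed.

Lemma det2_eq0 (v w : V) : v != 0 -> det2 v w = 0 -> exists c, w = c *: v.
Proof.
move=> v0 vw; have vE : v = perp (vec2 (- v 1 0) (v 0 0)).
  by apply: vec2P; rewrite /perp !(vec2_0, vec2_1) ?opprK.
rewrite vE; apply: perpP.
  by apply: contra v0 => /eqP e; apply/eqP; rewrite vE e /perp; apply: vec2P; rewrite !mxE /= ?oppr0.
by rewrite -vw /lf vec2_0 vec2_1 /det2; ring.
Qed.

(** In dimension 2 a proper invariant subspace is a common eigenline, and a common eigenvector of A1
    and A2 is killed by their invertible commutator. *)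
Lemma irreducibleP (B : set M) (A1 A2 : M) :
  (forall v : V, (forall g, B g -> exists c, g *m v = c *: v) ->
     (exists s, A1 *m v = s *: v) /\ (exists t, A2 *m v = t *: v)) ->
  \det (A1 *m A2 - A2 *m A1) != 0 -> irreducible_group B.
Proof.
move=> h dA W Winv; have [W0|W0] := eqVneq W 0%VS; first by left.
have vW := memv_pick W; have v0 : vpick W != 0 by rewrite vpick0.
move: (vpick W) vW v0 => v vW v0; right.
have [line|/existsNP[w /not_implyP[wW /eqP vw]]] :=
    pselect (forall w, w \in W -> det2 v w = 0).
  have [g Bg|[s Av] [t Bv]] := h v; first exact: det2_eq0 v0 (line _ (Winv _ _ Bg vW)).
  by case/eqP: v0; exact: common_eigenvector_comm Av Bv dA.
apply/vspaceP => u; rewrite memvf.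
have -> : u = (det2 u w / det2 v w) *: v + (det2 v u / det2 v w) *: w.
  by move: vw; rewrite /det2 => vw; apply: vec2P; rewrite !mxE; field.
by rewrite rpredD ?rpredZ.
Qed.

Variables (S T : M) (z : C) (D eS eT eP k : nat).

(** The eigenvalues of S, T and S T are recorded as exponents of z. The conditions [pl_exp] make
    S^2, T^3 and (S T)^k scalar and the two eigenvalues of each matrix distinct. *)
Record polyhedral_pair : Prop := {
  pl_detS : \det S = 1;
  pl_detT : \det T = 1;
  pl_trS : \tr S = z ^+ eS + (z ^+ eS)^-1;
  pl_trT : \tr T = z ^+ eT + (z ^+ eT)^-1;
  pl_trP : \tr (S *m T) = z ^+ eP + (z ^+ eP)^-1;
  pl_prim : D.-primitive_root z;
  pl_comm : \det (S *m T - T *m S) != 0;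
  pl_exp : [&& (D %| 4 * eS)%N, (D %| 6 * eT)%N, (D %| 2 * (k * eP))%N,
     ~~ (D %| 2 * eS)%N, ~~ (D %| 2 * eT)%N & ~~ (D %| 2 * eP)%N] }.

Hypothesis HP : polyhedral_pair.
Let z_prim := pl_prim HP.

Definition pgen c d : set M := gen (z ^+ c *: S) (z ^+ d *: T).

Lemma z_neq0 : z != 0.
Proof.
apply: contraTneq (prim_order_gt0 z_prim) => z0; have := prim_expr_order z_prim.
by rewrite z0 expr0n; case: D => //= n /eqP; rewrite eq_sym oner_eq0.
Qed.

Lemma zX_neq0 n : z ^+ n != 0. Proof. by rewrite expf_neq0 ?z_neq0. Qed.

Lemma scaled_unit n (A : M) : \det A = 1 -> z ^+ n *: A \in unitmx.
Proof. by move=> dA; rewrite unitmxE detZ dA mulr1 unitfE expf_neq0 ?zX_neq0. Qed.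

Lemma pgen_group c d : matrix_group (pgen c d).
Proof. by apply: gen_group; apply: scaled_unit; [exact: pl_detS HP | exact: pl_detT HP]. Qed.

Lemma eigen_power (A : M) e n : \det A = 1 -> \tr A = z ^+ e + (z ^+ e)^-1 ->
  ~~ (D %| 2 * e)%N -> (D %| 2 * (n * e))%N -> forall c,
  (z ^+ c *: A) ^+ n = (z ^+ (n * (c + e)))%:M.
Proof.
move=> dA tA ne ne' c; rewrite exprZn (unimodular_power dA tA (zX_neq0 e)).
- by rewrite scale_scalar_mx -!exprM -exprD mulnDr ![(n * _)%N]mulnC.
- by rewrite -exprM mulnC -(prim_order_dvd z_prim).
- by rewrite -!exprM; apply/eqP; rewrite -(prim_order_dvd z_prim) mulnC mulnAC mulnC.
Qed.

Section Scalars.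
Variable B : set M.
Hypothesis gB : matrix_group B.

Lemma scalar_mul a b : B (z ^+ a)%:M -> B (z ^+ b)%:M -> B (z ^+ (a + b))%:M.
Proof. by case: gB => _ BM _ Ba Bb; rewrite exprD scalar_mxM; exact: BM. Qed.

Lemma scalar_exp a n : B (z ^+ a)%:M -> B (z ^+ (n * a))%:M.
Proof.
move=> Ba; elim: n => [|n IH]; first by rewrite mul0n expr0; case: gB.
by rewrite mulSn; exact: scalar_mul.
Qed.

Lemma scaled_mem a A : B (z ^+ a)%:M -> B A -> B (z ^+ a *: A).
Proof. by case: gB => _ BM _ Ba BA; rewrite -mul_scalar_mx; exact: BM. Qed.

End Scalars.

Lemma zX_mod a b : a = b %[mod D] -> z ^+ a = z ^+ b.
Proof. by move=> E; rewrite -(prim_expr_mod z_prim) E (prim_expr_mod z_prim). Qed.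

Lemma pgen_P c d : pgen c d (z ^+ (c + d) *: (S *m T)).
Proof.
rewrite exprD -scalerA scalemxAr scalemxAl.
by case: (pgen_group c d) => _ + _; apply; [exact: gen_l | exact: gen_r].
Qed.

(** The square, cube and k-th power of the scaled S, T and S T are scalars; n1, n2, n3 tell how to
    combine them into a required one. *)
Lemma pgen_scalar c d n1 n2 n3 a :
  (n1 * (2 * (c + eS)) + n2 * (3 * (d + eT)) + n3 * (k * (c + d + eP)))%N = a %[mod D] ->
  pgen c d (z ^+ a)%:M.
Proof.
move=> /zX_mod <-; have gB := pgen_group c d; have := pl_exp HP.
case/and5P => hS hT hP nS /andP[nT nP].
have dP : \det (S *m T) = 1 by rewrite det_mulmx (pl_detS HP) (pl_detT HP) mulr1.
apply: (scalar_mul gB); first apply: (scalar_mul gB); apply: (scalar_exp gB).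
- rewrite -(eigen_power (pl_detS HP) (pl_trS HP)) ?mulnA //.
  by apply: matrix_group_exp gB _; exact: gen_l.
- rewrite -(eigen_power (pl_detT HP) (pl_trT HP)) ?mulnA //.
  by apply: matrix_group_exp gB _; exact: gen_r.
- rewrite -(eigen_power dP (pl_trP HP)) //.
  by apply: matrix_group_exp gB _; exact: pgen_P.
Qed.

Section PolyhedralKleinGroups.
Variables (a : 'I_3 -> P) (p m : 'I_3 -> nat) (iota : C).
Hypotheses (K : klein_forms a p m D iota) (p0 : p 0 = 2%N) (p1 : p 1 = 3%N).
Variables (g h sig tau : nat) (c d : 'I_3 -> nat).
Hypotheses (aS : forall v, peval (a (1 + 1)) (S *m v) = z ^+ sig * peval (a (1 + 1)) v)
  (aT : forall v, peval (a (1 + 1)) (T *m v) = z ^+ tau * peval (a (1 + 1)) v).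
Hypothesis scalG : exists n1 n2 n3,
  (n1 * (2 * (g + eS)) + n2 * (3 * (h + eT)) + n3 * (k * (g + h + eP)))%N = 1 %[mod D].
Hypothesis scalK : forall i, exists n1 n2 n3,
  (n1 * (2 * (c i + eS)) + n2 * (3 * (d i + eT)) + n3 * (k * (c i + d i + eP)))%N = p i %[mod D].
Hypothesis charS : forall i, (D %| c i * m i + sig * (3 - i))%N.
Hypothesis charT : forall i, (D %| d i * m i + tau * (3 - i))%N.

(** The matrix z^b A with eigenvalues z^(b+e) and z^(b-e) has eigenvalue 1; if A is not scalar it is
    then a reflection. *)
Definition refl_exp b e : bool := (D %| b + e)%N || (b == e %[mod D]).

Hypothesis reflK : forall i,
  [|| refl_exp (c i) eS && refl_exp (d i) eT,
      refl_exp (c i) eS && refl_exp (c i + d i) eP |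
      refl_exp (d i) eT && refl_exp (c i + d i) eP].

Local Notation Gp := (pgen g h).
Local Notation Kp i := (pgen (c i) (d i)).

Lemma pgen_scalar1 n : Gp (z ^+ n)%:M.
Proof.
have [n1 [n2 [n3 /pgen_scalar]]] := scalG; rewrite -[n]muln1.
by move=> G1; exact: (scalar_exp (pgen_group g h) n G1).
Qed.

Lemma pgen_scalarK i : Kp i (z ^+ p i)%:M.
Proof. by have [n1 [n2 [n3 /pgen_scalar]]] := scalK i. Qed.

(** The natural number D.-1 * b serves as the exponent - b modulo D. *)
Lemma shift_exp n b : z ^+ (n + D.-1 * b) * z ^+ b = z ^+ n.
Proof.
rewrite -exprD -addnA -mulSnr prednK ?(prim_order_gt0 z_prim) //; apply: zX_mod.
by rewrite addnC mulnC modnMDl.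
Qed.

Lemma pgen_S n : Gp (z ^+ n *: S).
Proof.
rewrite -(shift_exp n g) -scalerA; exact: (scaled_mem (pgen_group g h) (pgen_scalar1 _) (gen_l _ _)).
Qed.

Lemma pgen_T n : Gp (z ^+ n *: T).
Proof.
rewrite -(shift_exp n h) -scalerA; exact: (scaled_mem (pgen_group g h) (pgen_scalar1 _) (gen_r _ _)).
Qed.

Lemma pgen_sub i : Kp i `<=` Gp.
Proof. by apply: gen_subP (pgen_group g h) _ _; [exact: pgen_S | exact: pgen_T]. Qed.

(** The generators of G are multiples by powers of z of those of K_i, and the matrices that factor
    in this way form a group. *)
Lemma pgen_factor i A : Gp A -> exists2 B, Kp i B & exists e, A = z ^+ e *: B.
Proof.
have gK := pgen_group (c i) (d i); have [K1 KM KV] := gK.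
have gB : matrix_group [set A : M | A \in unitmx /\ exists2 B, Kp i B & exists e, A = z ^+ e *: B].
  split=> [|A1 A2 [u1 [B1 k1 [e1 E1]]] [u2 [B2 k2 [e2 E2]]]|A1 [u1 [B1 k1 [e1 E1]]]] /=.
  - by rewrite unitmx1; split=> //; exists 1%:M => //; exists 0%N; rewrite expr0 scale1r.
  - rewrite unitmx_mul u1 u2; split=> //; exists (B1 *m B2); first exact: KM.
    by exists (e1 + e2)%N; rewrite E1 E2 -scalemxAl -scalemxAr scalerA exprD.
  - rewrite unitmx_inv u1; do 2!split=> //; have [v1 k1'] := KV _ k1.
    exists (invmx B1) => //; exists (D.-1 * e1)%N.
    rewrite E1 invmxZ ?v1 //; last by rewrite -E1.
    congr (_ *: _); apply: (mulfI (zX_neq0 e1)); rewrite mulfV ?zX_neq0 // mulrC.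
    by have := shift_exp 0 e1; rewrite add0n expr0.
have gS : z ^+ g *: S \in unitmx by apply: scaled_unit; exact: pl_detS HP.
have hT : z ^+ h *: T \in unitmx by apply: scaled_unit; exact: pl_detT HP.
move=> GA; have /= := gen_subP gB _ _ GA; case=> [| |_ //].
- split=> //; exists (z ^+ c i *: S); first exact: gen_l.
  by exists (g + D.-1 * c i)%N; rewrite scalerA shift_exp.
- split=> //; exists (z ^+ d i *: T); first exact: gen_r.
  by exists (h + D.-1 * d i)%N; rewrite scalerA shift_exp.
Qed.

Lemma form_character (A : M) w : \det A = 1 ->
  (forall v, peval (a (1 + 1)) (A *m v) = z ^+ w * peval (a (1 + 1)) v) ->
  forall i v, peval (a i) (A *m v) = z ^+ (w * (3 - i)) * peval (a i) v.
Proof.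
move=> dA wA; have i2 : (1 + 1 + 1 : 'I_3) = 0 by exact: val_inj.
apply: (ord3P (i := 1)) => v.
- by rewrite (hessian_form_character K p0 p1 dA wA) exprM.
- by rewrite wA muln1.
- by rewrite i2 (jacobian_form_character K p0 p1 dA wA) exprM.
Qed.

Lemma pgen_fixes i A v : Kp i A -> peval (a i) (A *m v) = peval (a i) v.
Proof.
have fix_scaled b A' w : \det A' = 1 -> (D %| b * m i + w * (3 - i))%N ->
    (forall v, peval (a (1 + 1)) (A' *m v) = z ^+ w * peval (a (1 + 1)) v) ->
    z ^+ b *: A' \in unitmx /\ forall v, peval (a i) (z ^+ b *: A' *m v) = peval (a i) v.
  move=> dA' E wA; split=> [|u]; first exact: scaled_unit.
  rewrite -scalemxAl (peval_homog _ _ (kf_homog K i)) (form_character dA' wA) mulrA.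
  by rewrite -exprM -exprD (_ : z ^+ _ = 1) ?mul1r //; apply/eqP; rewrite -(prim_order_dvd z_prim).
move=> KA; have [_ fA] := gen_subP (fixing_matrix_group (peval (a i)))
  (fix_scaled _ _ _ (pl_detS HP) (charS i) aS) (fix_scaled _ _ _ (pl_detT HP) (charT i) aT) KA.
exact: fA.
Qed.

Lemma nonscalar_reflection (A : M) b e : \det A = 1 -> \tr A = z ^+ e + (z ^+ e)^-1 ->
  (forall s, A <> s%:M) -> refl_exp b e -> is_reflection (z ^+ b *: A).
Proof.
move=> dA tA nA be; apply: reflectionP.
  have -> : \det (z ^+ b *: A - 1%:M) = z ^+ b ^+ 2 * \det A - z ^+ b * \tr A + 1.
    by rewrite !det_mx2 tr_mx2 !mxE /= mulr1n mulr0n; ring.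
  rewrite dA tA; case/orP: be => [|/eqP/zX_mod ->].
    rewrite (prim_order_dvd z_prim) exprD => /eqP E.
    rewrite (_ : z ^+ b = (z ^+ e)^-1); first by field; exact: zX_neq0.
    by apply: (mulIf (zX_neq0 e)); rewrite E mulVf // zX_neq0.
  by field; exact: zX_neq0.
apply/negP => /eqP E; apply: (nA (z ^+ b)^-1); apply: (scalerI (zX_neq0 b)).
by rewrite E scale_scalar_mx mulfV ?zX_neq0.
Qed.

(** If one of the three were scalar, S and T would commute. *)
Lemma pair_nonscalar : [/\ forall s, S <> s%:M, forall s, T <> s%:M & forall s, S *m T <> s%:M].
Proof.
have comm : S *m T <> T *m S.
  by move=> E; have := pl_comm HP; rewrite E subrr det0 eqxx.
have uS : S \in unitmx by rewrite unitmxE (pl_detS HP) unitr1.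
split=> s E; apply: comm; rewrite ?E ?scalar_mxC //.
have TE : T = invmx S *m s%:M by rewrite -E mulKmx.
by rewrite TE -mulmxA -scalar_mxC mulKmx.
Qed.

Lemma detP : \det (S *m T) = 1.
Proof. by rewrite det_mulmx (pl_detS HP) (pl_detT HP) mulr1. Qed.

(** The given generators need not both be reflections. Two of the scaled S, T and S T are, and any
    two of these recover the third. *)
Lemma pgen_generators i : exists s t, [/\ is_reflection s, is_reflection t & Kp i = gen s t].
Proof.
have [nS nT nP] := pair_nonscalar.
have rS := nonscalar_reflection (pl_detS HP) (pl_trS HP) nS.
have rT := nonscalar_reflection (pl_detT HP) (pl_trT HP) nT.
have rP := nonscalar_reflection detP (pl_trP HP) nP.
have uS := scaled_unit (c i) (pl_detS HP); have uT := scaled_unit (d i) (pl_detT HP).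
have uP := scaled_unit (c i + d i) detP.
have PE : z ^+ (c i + d i) *: (S *m T) = (z ^+ c i *: S) *m (z ^+ d i *: T).
  by rewrite exprD -scalerA scalemxAr scalemxAl.
have mP : Kp i _ := @pgen_P (c i) (d i).
case/or3P: (reflK i) => /andP[r1 r2].
- by exists (z ^+ c i *: S), (z ^+ d i *: T); split; [exact: rS | exact: rT |].
- exists (z ^+ c i *: S), (z ^+ (c i + d i) *: (S *m T)).
  split; [exact: rS | exact: rP |].
  have [_ gM gV] := gen_group uS uP; have [_ gi] := gV _ (gen_l _ _).
  apply: gen_eq => //; [exact: gen_l | exact: gen_l |].
  rewrite -[z ^+ d i *: T](mulKmx uS) -PE; apply: gM => //; exact: gen_r.
- exists (z ^+ d i *: T), (z ^+ (c i + d i) *: (S *m T)).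
  split; [exact: rT | exact: rP |].
  have [_ gM gV] := gen_group uT uP; have [_ gi] := gV _ (gen_l _ _).
  apply: gen_eq => //; [exact: gen_r | | exact: gen_l].
  rewrite -[z ^+ c i *: S](mulmxK uT) -PE; apply: gM => //; exact: gen_r.
Qed.

Lemma polyhedral_klein_groups : klein_groups a p m D iota Gp (fun i => Kp i) z.
Proof.
split=> //.
- exact: pgen_group.
- by move=> i; exact: pgen_group.
- exact: pgen_sub.
- by rewrite -[z]expr1; exact: pgen_scalar1.
- exact: pgen_scalarK.
- exact: pgen_factor.
- by move=> i A v; exact: pgen_fixes.
- move=> i A v /(pgen_factor i)[B kB [e ->]].
  rewrite !pevalXn -scalemxAl (peval_homog _ _ (kf_homog K i)) (pgen_fixes _ kB).
  rewrite exprMn -!exprM (_ : (e * m i * p i)%N = (D * e)%N); last first.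
    by rewrite -(kf_pm K i) -mulnA mulnC [(m i * p i)%N]mulnC.
  by rewrite exprM (prim_expr_order z_prim) expr1n mul1r.
- by move=> i; have [s [t [rs _ ->]]] := pgen_generators i; exists s => //; exact: gen_l.
Qed.

Lemma pgen_irreducible i : irreducible_group (Kp i).
Proof.
apply: (irreducibleP (A1 := S) (A2 := T)); last exact: pl_comm HP.
have descend b A v : (exists s, z ^+ b *: A *m v = s *: v) -> exists s, A *m v = s *: v.
  case=> s E; exists ((z ^+ b)^-1 * s).
  by rewrite -scalerA -E -scalemxAl scalerA mulVf ?scale1r ?zX_neq0.
move=> v kv; split; apply: descend; apply: kv; [exact: gen_l | exact: gen_r].
Qed.

Lemma pgen_duality i : duality_group (Kp i) /\ normal_reflection_subgroup (Kp i) Gp.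
Proof.
have [s [t [rs rt E]]] := pgen_generators i.
have gK := pgen_group (c i) (d i).
have frg : finite_reflection_group (Kp i).
  split=> //; first exact: (@finite_K _ _ _ _ _ _ _ _ _ polyhedral_klein_groups i).
  apply/seteqP; split; last by apply: gen_sub => // A [].
  have [us ut] : s \in unitmx /\ t \in unitmx.
    case: gK => _ _ gV; rewrite E in gV.
    by have [] := gV _ (gen_l s t); have [] := gV _ (gen_r s t).
  rewrite {1}E; apply: gen_subP.
  - by apply: gen_matrix_group => A [KA _]; case: gK => _ _ /(_ _ KA)[].
  - by apply: gen_incl; split=> //; rewrite E; exact: gen_l.
  - by apply: gen_incl; split=> //; rewrite E; exact: gen_r.
split.
  split=> //; first exact: pgen_irreducible.
  exists (fun j : 'I_2 => if j == 0 then s else t).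
    by apply: ord2P.
  rewrite E /gen; congr generated_group; apply/seteqP; split=> A.
    by case=> ->; [exists 0 | exists 1].
  by case=> j _ <-; case: (j == 0); [left | right].
split=> //; first exact: pgen_sub.
(* Scalars are central, so conjugation by z^e B' is conjugation by the element B' of K_i. *)
move=> A B /(pgen_factor i)[B' kB' [e ->]] kB; have [_ gM gV] := gK.
have [uB' iB'] := gV _ kB'.
rewrite invmxZ; last by rewrite unitmxE detZ unitrM unitfE expf_neq0 ?zX_neq0 //= -unitmxE.
rewrite -scalemxAl -scalemxAr -scalemxAl scalerA mulVf ?zX_neq0 // scale1r.
by apply: (gM) => //; apply: (gM).
Qed.

End PolyhedralKleinGroups.

End PolyhedralGroups.

(** * Transport of the model groups by conjugation *)

Section Conjugation.
Context {C : numClosedFieldType}.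
Local Notation V := 'cV[C]_2.
Local Notation P := (mpoly 2 C).
Local Notation M := 'M[C]_2.
Implicit Types (Q g s t : M).

Definition conjm Q g : M := Q *m g *m invmx Q.

Lemma invmxM (A B : M) : A \in unitmx -> B \in unitmx ->
  invmx (A *m B) = invmx B *m invmx A.
Proof. exact: (@invrM _ A B). Qed.

Lemma conjmK Q : Q \in unitmx -> cancel (conjm Q) (conjm (invmx Q)).
Proof. by move=> uQ g; rewrite /conjm invmxK !mulmxA mulVmx // mul1mx mulmxKV. Qed.

Lemma conjmVK Q : Q \in unitmx -> cancel (conjm (invmx Q)) (conjm Q).
Proof. by move=> uQ g; rewrite -{1}[Q]invmxK conjmK // unitmx_inv. Qed.

Lemma conjmM Q g s : Q \in unitmx -> conjm Q (g *m s) = conjm Q g *m conjm Q s.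
Proof. by move=> uQ; rewrite /conjm !mulmxA mulmxKV. Qed.

Lemma conjmZ Q b g : conjm Q (b *: g) = b *: conjm Q g.
Proof. by rewrite /conjm -scalemxAr -scalemxAl. Qed.

Lemma det_conjm Q g : Q \in unitmx -> \det (conjm Q g) = \det g.
Proof.
move=> uQ; rewrite !det_mulmx mulrAC -det_mulmx mulmxV // det1 mul1r //.
Qed.

Lemma tr_conjm Q g : Q \in unitmx -> \tr (conjm Q g) = \tr g.
Proof. by move=> uQ; rewrite /conjm mxtrace_mulC mulKmx. Qed.

Lemma preimage_conj_group Q (B : set M) : Q \in unitmx -> matrix_group B ->
  matrix_group [set g | B (conjm Q g)].
Proof.
move=> uQ [B1 BM BV]; split=> /= [|g h Bg Bh|g Bg].
- by rewrite /conjm mulmx1 mulmxV.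
- by rewrite conjmM //; exact: BM.
have [u Bi] := BV _ Bg.
have ug : g \in unitmx by move: u; rewrite !unitmx_mul => /andP[/andP[]].
split=> //; move: Bi; rewrite /conjm invmxM ?unitmx_mul ?uQ ?unitmx_inv //.
by rewrite invmxK invmxM // mulmxA.
Qed.

Lemma conj_gen Q s t : Q \in unitmx -> s \in unitmx -> t \in unitmx ->
  [set Q *m g *m invmx Q | g in gen s t] = gen (conjm Q s) (conjm Q t).
Proof.
move=> uQ us ut; have uc g : g \in unitmx -> conjm Q g \in unitmx.
  by move=> ug; rewrite !unitmx_mul uQ ug unitmx_inv.
have g1 := gen_group us ut; have g2 := gen_group (uc _ us) (uc _ ut).
apply/seteqP; split=> [_ [g kg <-]|g kg].
  by apply: (gen_subP (preimage_conj_group uQ g2) _ _ kg); [exact: gen_l | exact: gen_r].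
exists (conjm (invmx Q) g); last by rewrite -/(conjm _ _) conjmVK.
have uQ' : invmx Q \in unitmx by rewrite unitmx_inv.
by apply: (gen_subP (preimage_conj_group uQ' g1) _ _ kg) => /=; rewrite conjmK //;
  [exact: gen_l | exact: gen_r].
Qed.

Lemma conjugate_trans (A B D : set M) : conjugate_to A B -> conjugate_to B D -> conjugate_to A D.
Proof.
case=> Q uQ -> [Q' uQ' ->]; exists (Q' *m Q); first by rewrite unitmx_mul uQ'.
have E g : Q' *m Q *m g *m invmx (Q' *m Q) = Q' *m (Q *m g *m invmx Q) *m invmx Q'.
  by rewrite invmxM // !mulmxA.
apply/seteqP; split=> h /=.
  by case=> _ [g Ag <-] <-; exists g.
by case=> g Ag <-; exists (Q *m g *m invmx Q) => //; exists g.
Qed.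

Lemma conjugate_refl (A : set M) : conjugate_to A A.
Proof.
exists 1%:M; first exact: unitmx1.
apply/seteqP; split=> [g Ag|_ [g Ag <-]]; last by rewrite invmx1 mulmx1 mul1mx.
by exists g => //; rewrite invmx1 mulmx1 mul1mx.
Qed.

Section PolyhedralConjugation.
Variables (S T : M) (z : C) (D eS eT eP k : nat) (Q : M).
Hypotheses (uQ : Q \in unitmx) (HP : polyhedral_pair S T z D eS eT eP k).

Lemma polyhedral_conj : polyhedral_pair (conjm Q S) (conjm Q T) z D eS eT eP k.
Proof.
case: HP => h1 h2 h3 h4 h5 h6 h7 h8; split=> //; rewrite -?conjmM ?det_conjm ?tr_conjm //.
rewrite (_ : _ - _ = conjm Q (S *m T - T *m S)) ?det_conjm //.
by rewrite /conjm mulmxBr mulmxBl.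
Qed.

Lemma pgen_conj c d : [set Q *m g *m invmx Q | g in pgen S T z c d] =
  pgen (conjm Q S) (conjm Q T) z c d.
Proof.
rewrite /pgen conj_gen ?conjmZ //; apply: (scaled_unit HP); first exact: pl_detS HP.
exact: pl_detT HP.
Qed.

End PolyhedralConjugation.

Section PolyhedralTheorem.
Variables (S T : M) (z : C) (D eS eT eP k : nat).
Hypothesis HP : polyhedral_pair S T z D eS eT eP k.
Variables (a : 'I_3 -> P) (p m : 'I_3 -> nat) (iota : C).
Hypotheses (K : klein_forms a p m D iota) (p0 : p 0 = 2%N) (p1 : p 1 = 3%N).
Variables (g h sig tau : nat) (c d : 'I_3 -> nat).
Hypotheses (aS : forall v, peval (a (1 + 1)) (S *m v) = z ^+ sig * peval (a (1 + 1)) v)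
  (aT : forall v, peval (a (1 + 1)) (T *m v) = z ^+ tau * peval (a (1 + 1)) v).
Hypothesis scalG : exists n1 n2 n3,
  (n1 * (2 * (g + eS)) + n2 * (3 * (h + eT)) + n3 * (k * (g + h + eP)))%N = 1 %[mod D].
Hypothesis scalK : forall i, exists n1 n2 n3,
  (n1 * (2 * (c i + eS)) + n2 * (3 * (d i + eT)) + n3 * (k * (c i + d i + eP)))%N = p i %[mod D].
Hypothesis charS : forall i, (D %| c i * m i + sig * (3 - i))%N.
Hypothesis charT : forall i, (D %| d i * m i + tau * (3 - i))%N.
Hypothesis reflK : forall i,
  [|| refl_exp D (c i) eS && refl_exp D (d i) eT,
      refl_exp D (c i) eS && refl_exp D (c i + d i) eP |
      refl_exp D (d i) eT && refl_exp D (c i + d i) eP].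
Variable Ts : 3.-tuple (set M).
Hypothesis TsE : forall i, conjugate_to (tnth Ts i) (pgen S T z (c i) (d i)).

(** For G conjugate to the model by Q, the forms are composed with the inverse of Q. Determinants,
    traces and characters are unchanged, so all conditions on exponents carry over. *)
Lemma polyhedral_main (G : set M) (hG : conjugate_to (pgen S T z g h) G)
    (x : 2.-tuple P) (d' : 'I_2 -> nat) (hx : basic_invariants G x d') :
  [/\ d' ord0 = d' ord_max,
      linear_subspace_of_dim 2
        (poly_fields_of_degree (C := C) d' (- (d' ord0)%:Z)) &
      exists (l : 'I_3 -> set (poly_field (C := C) (n := 1)))
             (K : 'I_3 -> set M),
        [/\ (forall i, linear_subspace_of_dim 1 (l i) /\
               l i `<=` poly_fields_of_degree d' (- (d' ord0)%:Z)) /\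
            injective l,
            forall e, poly_fields_of_degree d' (- (d' ord0)%:Z) e -> e != 0 ->
              ((exists S, natural_saito G x d' S e) <-> exists i, l i e),
            (forall i, [/\ conjugate_to (tnth Ts i) (K i),
               duality_group (K i) & normal_reflection_subgroup (K i) G]) /\
            injective K &
            forall i xK dK, basic_invariants (K i) xK dK ->
              exists2 pi, orbit_space_map xK x pi &
                forall r S, almost_saito (regular_orbits G x) r S ->
                  ((exists2 e, natural_saito G x d' S e & l i e) <->
                   (exists SK eK, natural_saito (K i) xK dK SK eK /\
                                  induced_saito G x xK pi SK S))]].
Proof.
case: hG => Q uQ GE; rewrite (pgen_conj uQ HP) in GE; rewrite {}GE in hx *.
have HP' := polyhedral_conj uQ HP.
have uQ' : invmx Q \in unitmx by rewrite unitmx_inv.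
have K' := klein_forms_plin uQ' K.
have charc A w : (forall v, peval (a (1 + 1)) (A *m v) = z ^+ w * peval (a (1 + 1)) v) ->
    forall v, peval (plin (invmx Q) (a (1 + 1))) (conjm Q A *m v) =
      z ^+ w * peval (plin (invmx Q) (a (1 + 1))) v.
  by move=> wA v; rewrite !peval_plin /conjm -!mulmxA mulKmx // wA.
have HK := polyhedral_klein_groups HP' K' p0 p1 (charc _ _ aS) (charc _ _ aT) scalG scalK charS charT reflK.
have dual := pgen_duality HP' K' p0 p1 (charc _ _ aS) (charc _ _ aT) scalG scalK charS charT reflK.
have [dE dim [l [l1 l2 l3]]] := klein_groups_main HK hx.
split=> //; exists l, (fun i => pgen (conjm Q S) (conjm Q T) z (c i) (d i)); split=> //.
split; last exact: (klein_subgroup_inj HK hx).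
move=> i; have [dK nK] := dual i; split=> //.
apply: conjugate_trans (TsE i) _; exists Q => //.
by rewrite (pgen_conj uQ HP).
Qed.

End PolyhedralTheorem.

End Conjugation.

(** * Binary forms as lists of terms, and Klein's forms *)

Section FormsByTerms.
Context {C : numClosedFieldType}.
Local Notation V := 'cV[C]_2.
Local Notation P := (mpoly 2 C).
Local Notation X_ i := (mpolyX C (mnm1 i)).
Local Notation terms := (seq (C * (nat * nat))).
Implicit Types (s : terms) (x y : C) (v h : V).

(** Forms are lists of a coefficient with two exponents; derivatives are then computed by reduction,
    and identities between forms become polynomial identities in x and y. *)
Definition term_val x y (t : C * (nat * nat)) : C := t.1 * (x ^+ t.2.1 * y ^+ t.2.2).
Definition ev s x y : C := foldr (fun t u => term_val x y t + u) 0 s.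
Definition bform s : P :=
  foldr (fun (t : C * (nat * nat)) f => t.1 *: (X_ 0 ^+ t.2.1 * X_ 1 ^+ t.2.2) + f) 0 s.
Definition dX s : terms := [seq (t.1 * t.2.1%:R, (t.2.1.-1, t.2.2)) | t <- s].
Definition dY s : terms := [seq (t.1 * t.2.2%:R, (t.2.1, t.2.2.-1)) | t <- s].

Lemma peval_bform s v : peval (bform s) v = ev s (v 0 0) (v 1 0).
Proof.
elim: s => [|t s IH] /=; first exact: peval0.
by rewrite pevalD pevalZ pevalM !pevalXn !pevalX IH.
Qed.

Lemma pD_bform s h : pD h (bform s) = h 0 0 *: bform (dX s) + h 1 0 *: bform (dY s).
Proof.
apply: peval_inj => v; rewrite pevalD !pevalZ !peval_bform.
elim: s => [|t s IH] /=; first by rewrite (_ : pD h 0 = 0) ?peval0; [ring | rewrite -(mpolyC0 2) pDC].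
rewrite pDD pevalD IH pDZ pDM !pDXn !pDX pevalZ pevalD !pevalM !pevalZ !pevalM !pevalXn !pevalX !pevalC /term_val /=.
by ring.
Qed.

Lemma grad_bform s v h : grad (bform s) v h =
  h 0 0 * ev (dX s) (v 0 0) (v 1 0) + h 1 0 * ev (dY s) (v 0 0) (v 1 0).
Proof. by rewrite /grad pD_bform pevalD !pevalZ !peval_bform. Qed.

Lemma ev_dXdY s x y : ev (dX (dY s)) x y = ev (dY (dX s)) x y.
Proof. by elim: s => [|t s IH] //=; rewrite IH /term_val /=; congr (_ + _); ring. Qed.

Lemma hess_bform s v h k : hess (bform s) v h k =
  h 0 0 * k 0 0 * ev (dX (dX s)) (v 0 0) (v 1 0)
  + (h 0 0 * k 1 0 + h 1 0 * k 0 0) * ev (dX (dY s)) (v 0 0) (v 1 0)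
  + h 1 0 * k 1 0 * ev (dY (dY s)) (v 0 0) (v 1 0).
Proof.
rewrite /hess pD_bform pDD !pDZ pevalD !pevalZ -/(grad _ _ _) -/(grad (bform (dY s)) _ _).
by rewrite !grad_bform -ev_dXdY; ring.
Qed.

Lemma bform_homog s n : all (fun t => t.2.1 + t.2.2 == n)%N s -> bform s \is ishomog1 n mdeg.
Proof.
move=> hs; apply: homogP => c v; rewrite !peval_bform !mxE.
elim: s hs => [|t s IH] /=; first by rewrite mulr0.
by case/andP=> /eqP tn hs; rewrite (IH hs) -tn mulrDr /term_val !exprMn exprD; congr (_ + _); ring.
Qed.

Definition tri (A : Type) (a0 a1 a2 : A) (i : 'I_3) : A :=
  match val i with 0%N => a0 | 1%N => a1 | _ => a2 end.

Section KleinFormsOfTerms.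
Variables (b0 b1 b2 : terms) (c0 c1 c2 C0 C1 C2 kap : C) (k D m0 m1 m2 : nat).
Local Notation p := (tri 2%N 3%N k).
Local Notation m := (tri m0 m1 m2).
Local Notation nn mi mj ml := (mi.-1%:R * D%:R / (mj%:R * ml%:R) : C).
Hypotheses (h0 : all (fun t => t.2.1 + t.2.2 == m0)%N b0)
  (h1 : all (fun t => t.2.1 + t.2.2 == m1)%N b1) (h2 : all (fun t => t.2.1 + t.2.2 == m2)%N b2)
  (mD : [&& 1 < m0, 1 < m1, 1 < m2, 1 < k, 2 * m0 == D, 3 * m1 == D & k * m2 == D]%N)
  (kk : 1 - 2^-1 + (1 - 3^-1) + (1 - k%:R^-1) = 2 * (1 - D%:R^-1) :> C)
  (kap0 : kap != 0) (c00 : c0 != 0) (c10 : c1 != 0) (c20 : c2 != 0)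
  (cE0 : c0 ^+ 2 = C0) (cE1 : c1 ^+ 3 = C1) (cE2 : c2 ^+ k = C2).
Hypotheses
  (rel : forall x y, C0 * ev b0 x y ^+ 2 + C1 * ev b1 x y ^+ 3 + C2 * ev b2 x y ^+ k = 0)
  (nz : forall x y, ev b1 x y = 0 -> ev b2 x y = 0 -> x = 0 /\ y = 0).
Hypotheses
  (J0 : forall x y, ev (dX b0) x y * ev (dY b1) x y - ev (dY b0) x y * ev (dX b1) x y =
     kap * k%:R * C2 * ev b2 x y ^+ k.-1)
  (J1 : forall x y, ev (dX b1) x y * ev (dY b2) x y - ev (dY b1) x y * ev (dX b2) x y =
     kap * 2 * C0 * ev b0 x y ^+ 1)
  (J2 : forall x y, ev (dX b2) x y * ev (dY b0) x y - ev (dY b2) x y * ev (dX b0) x y =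
     kap * 3 * C1 * ev b1 x y ^+ 2).
Hypotheses
  (H0 : forall x y, ev (dX (dX b0)) x y * ev (dY (dY b0)) x y - ev (dX (dY b0)) x y ^+ 2 =
     (nn m0 m1 m2 * kap) ^+ 2 * C1 * C2 * ev b1 x y ^+ 1 * ev b2 x y ^+ k.-2)
  (H1 : forall x y, ev (dX (dX b1)) x y * ev (dY (dY b1)) x y - ev (dX (dY b1)) x y ^+ 2 =
     (nn m1 m2 m0 * kap) ^+ 2 * C2 * C0 * ev b2 x y ^+ k.-2 * ev b0 x y ^+ 0)
  (H2 : forall x y, ev (dX (dX b2)) x y * ev (dY (dY b2)) x y - ev (dX (dY b2)) x y ^+ 2 =
     (nn m2 m0 m1 * kap) ^+ 2 * C0 * C1 * ev b0 x y ^+ 0 * ev b1 x y ^+ 1).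

Local Notation a := (fun i => tri c0 c1 c2 i *: bform (tri b0 b1 b2 i)).
Local Notation iota := (kap * (c0 * c1 * c2)).

Let jac_scale s t u (cs ct cu : C) (q : nat) Cu v h h' : cu != 0 -> cu ^+ q = Cu -> (0 < q)%N ->
  iota = kap * (cs * ct * cu) ->
  (forall x y, ev (dX s) x y * ev (dY t) x y - ev (dY s) x y * ev (dX t) x y =
     kap * q%:R * Cu * ev u x y ^+ q.-1) ->
  grad (cs *: bform s) v h * grad (ct *: bform t) v h' - grad (cs *: bform s) v h' * grad (ct *: bform t) v h =
  iota * q%:R * peval (cu *: bform u) v ^+ q.-1 * det2 h h'.
Proof.
move=> cu0 cuE q0 -> J; rewrite !gradZ !grad_bform pevalZ peval_bform exprMn /det2.
have {J} := J (v 0 0) (v 1 0); rewrite -cuE -(prednK q0) exprS /=.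
move: (ev (dX s) _ _) (ev (dY s) _ _) (ev (dX t) _ _) (ev (dY t) _ _) (ev u _ _ ^+ _) (cu ^+ _) (q.-1.+1%:R)
  => sx sy tx ty w z N J.
transitivity (cs * ct * (sx * ty - sy * tx) * (h 0 0 * h' 1 0 - h 1 0 * h' 0 0)); first by ring.
by rewrite J; ring.
Qed.

Let hess_scale s t u (cs ct cu : C) (qt qu : nat) Ct Cu N v g h h' : ct != 0 -> cu != 0 ->
  ct ^+ qt = Ct -> cu ^+ qu = Cu -> (1 < qt)%N -> (1 < qu)%N ->
  iota = kap * (cs * ct * cu) ->
  (forall x y, ev (dX (dX s)) x y * ev (dY (dY s)) x y - ev (dX (dY s)) x y ^+ 2 =
     (N * kap) ^+ 2 * Ct * Cu * ev t x y ^+ qt.-2 * ev u x y ^+ qu.-2) ->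
  hess (cs *: bform s) v g g * hess (cs *: bform s) v h h' -
    hess (cs *: bform s) v g h * hess (cs *: bform s) v g h' =
  (N * iota) ^+ 2 * peval (ct *: bform t) v ^+ qt.-2 * peval (cu *: bform u) v ^+ qu.-2 *
    (det2 g h * det2 g h').
Proof.
move=> ct0 cu0 <- <- qt1 qu1 -> J; rewrite !hessZ !hess_bform !pevalZ !peval_bform !exprMn /det2.
have e2 (c : C) n : (1 < n)%N -> c ^+ n = c * c * c ^+ n.-2.
  by case: n => [|[|n]] // _; rewrite !exprS mulrA.
have {J} := J (v 0 0) (v 1 0); rewrite (e2 ct qt) // (e2 cu qu) // !exprMn.
move: (ev (dX (dX s)) _ _) (ev (dY (dY s)) _ _) (ev (dX (dY s)) _ _) => sx sy sxy.
move: (ev t _ _ ^+ _) (ev u _ _ ^+ _) (ct ^+ qt.-2) (cu ^+ qu.-2) => wt wu zt zu J.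
transitivity (cs ^+ 2 * (sx * sy - sxy ^+ 2) *
  ((g 0 0 * h 1 0 - g 1 0 * h 0 0) * (g 0 0 * h' 1 0 - g 1 0 * h' 0 0))); first by ring.
by rewrite J; ring.
Qed.

(** Scaling the forms by c_i, a p_i-th root of C_i, removes the coefficients C_i from the relation.
    The hypotheses contain only the C_i, so that they can be checked without roots of high order. *)
Lemma klein_forms_of_terms : klein_forms a p m D iota.
Proof.
case/and5P: mD => m01 m11 m21 k1 /and3P[/eqP D0 /eqP D1 /eqP D2].
have i1 : (0 + 1 : 'I_3) = 1 by exact: val_inj.
have i2 : (1 + 1 + 1 : 'I_3) = 0 by exact: val_inj.
have e12 : iota = kap * (c1 * c2 * c0) by ring.
have e20 : iota = kap * (c2 * c0 * c1) by ring.
split.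
- apply: (ord3P (i := 0)); rewrite ?i1; apply: dhomogZ; exact: bform_homog.
- exact: (ord3P (i := 0)).
- exact: (ord3P (i := 0)).
- exact: (ord3P (i := 0)).
- by rewrite !mulf_neq0.
- by rewrite (ord3_sum _ 0).
- move=> v; rewrite (ord3_sum _ 0) i1 -[RHS](rel (v 0 0) (v 1 0)) -cE0 -cE1 -cE2 -!exprMn.
  by rewrite !pevalZ !peval_bform.
- move=> v; rewrite !pevalZ !peval_bform => /eqP; rewrite mulf_eq0 (negbTE c00) => /eqP e0 /eqP.
  rewrite mulf_eq0 (negbTE c10) => /eqP e1.
  have e2 : ev b2 (v 0 0) (v 1 0) = 0.
    have := rel (v 0 0) (v 1 0); rewrite e0 e1 !expr0n /= !mulr0 !add0r => /eqP.
    by rewrite -cE2 mulf_eq0 !expf_eq0 (negbTE c20) andbF => /andP[_ /eqP].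
  have [v0 v1] := nz e1 e2.
  by apply: vec2P; rewrite mxE.
- apply: (ord3P (i := 0)) => v h h'; rewrite ?i1 ?i2.
  + exact: (jac_scale v h h' c20 cE2 (ltnW k1) (erefl _) J0).
  + exact: (jac_scale v h h' c00 cE0 isT e12 J1).
  + exact: (jac_scale v h h' c10 cE1 isT e20 J2).
- have nE q r t : q%:R * D%:R * iota / (r%:R * t%:R) = q%:R * D%:R / (r%:R * t%:R) * iota :> C.
    by rewrite mulrAC.
  apply: (ord3P (i := 0)) => v g h h'; rewrite ?i1 ?i2 nE.
  + exact: (hess_scale v g h h' c10 c20 cE1 cE2 isT k1 (erefl _) H0).
  + exact: (hess_scale v g h h' c20 c00 cE2 cE0 k1 isT e12 H1).
  + exact: (hess_scale v g h h' c00 c10 cE0 cE1 isT isT e20 H2).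
Qed.

End KleinFormsOfTerms.

End FormsByTerms.

Section ConcreteForms.
Context {C : numClosedFieldType}.
Local Notation terms := (seq (C * (nat * nat))).

Definition mono (c : C) (i j : nat) : C * (nat * nat) := (c, (i, j)).

(** Klein's forms, whose zeros on the sphere are the vertices, face centres and edge midpoints of
    the solids. The sextic [tet_t] belongs to the edges of the tetrahedron and to the vertices of
    the octahedron. *)
Definition tet_t : terms := [:: mono 1 5 1; mono (-1) 1 5].
Definition tet_phi (th : C) : terms := [:: mono 1 4 0; mono (2 * th) 2 2; mono 1 0 4].
Definition oct_w : terms := [:: mono 1 8 0; mono 14%:R 4 4; mono 1 0 8].
Definition oct_chi : terms :=
  [:: mono 1 12 0; mono (-33%:R) 8 4; mono (-33%:R) 4 8; mono 1 0 12].
Definition ico_f : terms := [:: mono 1 11 1; mono 11%:R 6 6; mono (-1) 1 11].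
Definition ico_h : terms := [:: mono (-1) 20 0; mono 228%:R 15 5; mono (-494%:R) 10 10;
  mono (-228%:R) 5 15; mono (-1) 0 20].
(** Klein's coefficient 10005 appears as 15 * 667. *)
Definition ico_t : terms := [:: mono 1 30 0; mono 522%:R 25 5; mono (-(15%:R * 667%:R)) 20 10;
  mono (-(15%:R * 667%:R)) 10 20; mono (-522%:R) 5 25; mono 1 0 30].

(** Common zeros of two forms are excluded by a combination of them that is a multiple of a power of
    x y, together with their values on the axes. *)
Lemma combine_zeros (k l u v : C) : u = 0 -> v = 0 -> k * u - l * v = 0.
Proof. by move=> -> ->; rewrite !mulr0 subr0. Qed.

Lemma axes_intersect (x y : C) n : (0 < n)%N -> x * y = 0 ->
  (y = 0 -> x ^+ n = 0) -> (x = 0 -> y ^+ n = 0) -> x = 0 /\ y = 0.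
Proof.
move=> n0 /eqP; rewrite mulf_eq0 => /orP[] /eqP e0 hx hy.
  by have /eqP := hy e0; rewrite expf_eq0 n0 => /eqP.
by have /eqP := hx e0; rewrite expf_eq0 n0 => /eqP.
Qed.

Lemma mul_eq0_exp (x y k : C) n : k != 0 -> k * (x * y) ^+ n = 0 -> x * y = 0.
Proof.
move=> k0 /eqP; rewrite mulf_eq0 (negbTE k0) expf_eq0 => /andP[_] /eqP //.
Qed.

(** The relation is phi(th)^3 - phi(-th)^3 = 12 th t^2 for the quartics of two dual tetrahedra. *)
Lemma tet_klein_forms (th : C) : th ^+ 2 = - 3 -> exists c : 'I_3 -> C, exists iota,
  klein_forms (fun i => c i *: bform (tri tet_t (tet_phi (- th)) (tet_phi th) i))
    (tri 2 3 3)%N (tri 6 4 4)%N 12 iota.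
Proof.
move=> th2; have th0 : th != 0 by rewrite -sqrf_eq0 th2 oppr_eq0 pnatr_eq0.
have c0 : sqrtC (- 12 * th) != 0 by rewrite sqrtC_eq0 mulf_neq0 // oppr_eq0 pnatr_eq0.
exists (tri (sqrtC (- 12 * th)) (-1) 1); eexists.
apply: (klein_forms_of_terms (C0 := - 12 * th) (C1 := -1) (C2 := 1) (kap := - 4 / 3)) => //=;
  rewrite /term_val /mono /=.
- by field.
- exact: sqrtCK.
- by ring.
- exact: expr1n.
- by move=> x y; ring: th2.
- move=> x y e1 e2; apply: (@axes_intersect _ _ 4) => // [|y0|x0].
  + apply: (@mul_eq0_exp _ _ (4 * th) 2); first by rewrite mulf_neq0 ?pnatr_eq0.
    by rewrite -[RHS](combine_zeros 1 1 e2 e1); ring.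
  + by rewrite -[RHS]e1 y0; ring.
  + by rewrite -[RHS]e1 x0; ring.
- by move=> x y; field: th2.
- by move=> x y; field: th2.
- by move=> x y; field: th2.
- by move=> x y; field: th2.
- by move=> x y; field: th2.
- by move=> x y; field: th2.
Qed.

Lemma oct_klein_forms : exists c : 'I_3 -> C, exists iota,
  klein_forms (fun i => c i *: bform (tri oct_chi oct_w tet_t i))
    (tri 2 3 4)%N (tri 12 8 6)%N 24 iota.
Proof.
have c2 : sqrtC (sqrtC 108%:R) != 0 :> C by rewrite !sqrtC_eq0 pnatr_eq0.
(* These constants come from chi^2 - w^3 + 108 t^4 = 0. *)
exists (tri 1 (-1) (sqrtC (sqrtC 108%:R))); eexists.
apply: (klein_forms_of_terms (C0 := 1) (C1 := -1) (C2 := 108%:R) (kap := 4)) => //=;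
  rewrite /term_val /mono /=.
- by field.
- exact: expr1n.
- by ring.
- by rewrite -[4%N]/(2 * 2)%N exprM !sqrtCK.
- by move=> x y; ring.
- move=> x y e1 e2; apply: (@axes_intersect _ _ 8) => // [|y0|x0].
  + apply: (@mul_eq0_exp _ _ 16 5); first by rewrite pnatr_eq0.
    by rewrite -[RHS](combine_zeros (x * y) (x ^+ 4 - y ^+ 4) e1 e2); ring.
  + by rewrite -[RHS]e1 y0; ring.
  + by rewrite -[RHS]e1 x0; ring.
- by move=> x y; field.
- by move=> x y; field.
- by move=> x y; field.
- by move=> x y; field.
- by move=> x y; field.
- by move=> x y; field.
Qed.

Lemma ico_klein_forms : exists c : 'I_3 -> C, exists iota,
  klein_forms (fun i => c i *: bform (tri ico_t ico_h ico_f i))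
    (tri 2 3 5)%N (tri 30 20 12)%N 60 iota.
Proof.
have c2 : 5.-root (- (12 ^+ 3)) != 0 :> C by rewrite rootC_eq0 // oppr_eq0 expf_neq0 // pnatr_eq0.
(* These constants come from Klein's relation T^2 + H^3 = 1728 f^5. *)
exists (tri 1 1 (5.-root (- (12 ^+ 3)))); eexists.
apply: (klein_forms_of_terms (C0 := 1) (C1 := 1) (C2 := - (12 ^+ 3)) (kap := -10)) => //=;
  rewrite /term_val /mono /=.
- by field.
- exact: expr1n.
- exact: expr1n.
- by rewrite rootCK.
- by move=> x y; ring.
- move=> x y e1 e2; apply: (@axes_intersect _ _ 20) => // [|y0|x0].
  + apply: (@mul_eq0_exp _ _ (5 ^+ 5) 11); first by rewrite expf_neq0 ?pnatr_eq0.
    rewrite -[RHS](combine_zeros (- (x ^+ 10) + 239%:R * x ^+ 5 * y ^+ 5 + y ^+ 10) (x * y) e2 e1).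
    by ring.
  + by rewrite -[RHS](combine_zeros (-1) 0 e1 e1) y0; ring.
  + by rewrite -[RHS](combine_zeros (-1) 0 e1 e1) x0; ring.
- by move=> x y; field.
- by move=> x y; field.
- by move=> x y; field.
- by move=> x y; field.
- by move=> x y; field.
- by move=> x y; field.
Qed.

End ConcreteForms.

Local Open Scope complex_scope.

(** * Roots of unity and the square roots of 2 and 5 *)

Section RootsOfUnity.
Context {R : realType}.
Local Notation C := R[i].

Lemma zeta_exp m n : zeta R m ^+ n =
  cos (2 * pi / m%:R * n%:R) +i* sin (2 * pi / m%:R * n%:R).
Proof.
elim: n => [|n IH]; first by rewrite mulr0 cos0 sin0 expr0.
have E : 2 * pi / m%:R * n.+1%:R = 2 * pi / m%:R * n%:R + 2 * pi / m%:R :> R.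
  by rewrite -natr1; ring.
rewrite exprSr IH E cosD sinD /zeta; apply/eqP; rewrite eq_complex /=.
by rewrite eqxx /= addrC.
Qed.

Lemma zeta_exp_dvd m n : (0 < m)%N -> (0 < n)%N -> zeta R (m * n) ^+ m = zeta R n.
Proof.
move=> m0 n0; rewrite zeta_exp /zeta natrM (_ : _ / _ * _ = 2 * pi / n%:R) //.
by field; rewrite !pnatr_eq0 -!lt0n m0 n0.
Qed.

Lemma zeta_prim m : (0 < m)%N -> m.-primitive_root (zeta R m).
Proof.
move=> m0; have m1 : (m%:R : R) != 0 by rewrite pnatr_eq0 -lt0n.
have order n : (0 < n < m)%N -> zeta R m ^+ n != 1.
  case/andP=> n0 nm; rewrite zeta_exp; set t : R := _ * _; apply/negP => /eqP[c1 _].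
  have t2 : t = t / 2 + t / 2 by field.
  (* From cos t = 1, while t / 2 lies strictly between 0 and pi. *)
  have : sin (t / 2) = 0.
    move: c1; rewrite {1}t2 cosD -!expr2 cos2sin2; move: (sin (t / 2)) => s E.
    have : 2 * s ^+ 2 = 0 by transitivity (1 - (1 - s ^+ 2 - s ^+ 2)); [ring | rewrite E subrr].
    by move/eqP; rewrite mulf_eq0 pnatr_eq0 sqrf_eq0 => /eqP.
  apply/eqP; rewrite gt_eqF // sin_gt0_pi // (_ : t / 2 = pi * (n%:R / m%:R)); last first.
    by rewrite /t; field.
  have p0 := pi_gt0 R; rewrite mulr_gt0 ?divr_gt0 ?ltr0n //=.
  by rewrite gtr_pMr // ltr_pdivrMr ?ltr0n // mul1r ltr_nat.
rewrite /primitive_root_of_unity m0; apply/forallP => -[n nm] /=.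
rewrite unity_rootE; have [->|ne] := eqVneq n.+1 m.
  rewrite zeta_exp divfK // (_ : 2 * pi = pi *+ 2) ?cos2pi ?sin2pi ?eqxx //.
  by rewrite mulr_natl.
by rewrite eqbF_neg order //= ltn_neqAle ne.
Qed.

Lemma zeta_conj m n : (0 < m)%N -> (n <= m)%N ->
  zeta R m ^+ n + zeta R m ^+ (m - n) = (2 * cos (2 * pi / m%:R * n%:R))%:C.
Proof.
move=> m0 nm; have m1 : (m%:R : R) != 0 by rewrite pnatr_eq0 -lt0n.
set t : R := 2 * pi / m%:R * n%:R.
have E : zeta R m ^+ n = cos t +i* sin t by rewrite zeta_exp.
have u0 : zeta R m ^+ n != 0.
  apply: contraTneq (prim_order_gt0 (zeta_prim m0)) => u0.
  have := prim_expr_order (zeta_prim m0); rewrite -[X in _ ^+ X](subnKC nm) exprD u0 mul0r => /eqP.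
  by rewrite eq_sym oner_eq0.
have -> : zeta R m ^+ (m - n) = cos t -i* sin t.
  apply: (mulfI u0); rewrite -exprD subnKC // (prim_expr_order (zeta_prim m0)) E.
  apply/eqP; rewrite eq_complex /= mulrN opprK -!expr2 cos2Dsin2 eqxx /=.
  by rewrite mulrN mulrC addNr.
by rewrite E; apply/eqP; rewrite eq_complex /= subrr eqxx andbT mulr_natl mulr2n.
Qed.

(** A sum of roots of unity is recognized as a square root by its square; the sign comes from its
    expression by cosines. *)
Lemma real_sqrtC (x : C) (r : R) n : 0 <= r -> x = r%:C -> x ^+ 2 = n%:R -> x = (Num.sqrt n%:R)%:C.
Proof.
move=> r0 ->; rewrite -rmorphXn /= => /eqP; rewrite -(rmorph_nat (real_complex R)) => /eqP.
by move=> /(@complexI R) <-; rewrite sqrtr_sqr ger0_norm.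
Qed.

Lemma prim_half (z : C) n : (2 * n).-primitive_root z -> z ^+ n = - 1.
Proof.
move=> zp; have n0 : (0 < n)%N by have := prim_order_gt0 zp; rewrite muln_gt0.
have /eqP : (z ^+ n) ^+ 2 = 1 by rewrite -exprM mulnC (prim_expr_order zp).
rewrite sqrf_eq1 -(prim_order_dvd zp) => /orP[/(dvdn_leq n0)|/eqP //].
by rewrite leqNgt -[X in (X < _)%N]mul1n ltn_pmul2r.
Qed.

Lemma zeta8_sqrt2 : zeta R 8 + zeta R 8 ^+ 7 = (Num.sqrt 2)%:C.
Proof.
have p0 := pi_gt0 R.
apply: (@real_sqrtC _ (2 * cos (2 * pi / 8%:R * 1%:R))).
- rewrite mulr_ge0 // ltW // cos_gt0_pihalf //.
  by apply/andP; split; lra.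
- by rewrite -zeta_conj.
have e4 : zeta R 8 ^+ 4 = - 1 by apply: (@prim_half _ 4); exact: (@zeta_prim 8).
transitivity (zeta R 8 ^+ 2 + 2 * (zeta R 8 ^+ 4) ^+ 2 + zeta R 8 ^+ 2 * (zeta R 8 ^+ 4) ^+ 3).
  by ring.
by rewrite e4; ring.
Qed.

Lemma zeta3_sum : 1 + zeta R 3 + zeta R 3 ^+ 2 = 0.
Proof.
have w1 := prim_expr_order (zeta_prim (isT : (0 < 3)%N)).
have ne : zeta R 3 - 1 != 0.
  by rewrite subr_eq0 -[zeta R 3]expr1 -(prim_order_dvd (zeta_prim (isT : (0 < 3)%N))).
by apply: (mulfI ne); rewrite mulr0 -[RHS](subrr 1) -[X in _ = X - 1]w1; ring.
Qed.

Lemma zeta5_sum : 1 + zeta R 5 + zeta R 5 ^+ 2 + zeta R 5 ^+ 3 + zeta R 5 ^+ 4 = 0.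
Proof.
have w1 := prim_expr_order (zeta_prim (isT : (0 < 5)%N)).
have ne : zeta R 5 - 1 != 0.
  by rewrite subr_eq0 -[zeta R 5]expr1 -(prim_order_dvd (zeta_prim (isT : (0 < 5)%N))).
by apply: (mulfI ne); rewrite mulr0 -[RHS](subrr 1) -[X in _ = X - 1]w1; ring.
Qed.

Lemma zeta5_sqrt5 : zeta R 5 + zeta R 5 ^+ 4 - zeta R 5 ^+ 2 - zeta R 5 ^+ 3 = (Num.sqrt 5)%:C.
Proof.
have p0 := pi_gt0 R.
apply: (@real_sqrtC _ (2 * cos (2 * pi / 5%:R * 1%:R) - 2 * cos (2 * pi / 5%:R * 2%:R))).
- rewrite subr_ge0 ler_pM2l // ltW // ltr_cos ?in_itv /=; first by lra.
  + by apply/andP; split; lra.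
  + by apply/andP; split; lra.
- by rewrite rmorphB /= -!zeta_conj //= expr1; ring.
have h5 := prim_expr_order (zeta_prim (isT : (0 < 5)%N)).
have := zeta5_sum; move: (zeta R 5) h5 => h h5 hs.
have e4 : h ^+ 4 = - (1 + h + h ^+ 2 + h ^+ 3) by apply/eqP; rewrite -addr_eq0 addrC hs.
transitivity ((- 1 - 2 * (h ^+ 2 + h ^+ 3)) ^+ 2); first by rewrite e4; ring.
transitivity (1 + 4 * (h ^+ 2 + h ^+ 3) + 4 * (h ^+ 4 + 2 * h ^+ 5 + h ^+ 5 * h)); first by ring.
by rewrite h5 e4; ring.
Qed.

End RootsOfUnity.

(** * Generators of the binary polyhedral groups *)

Section BinaryPolyhedralPairs.
Context {R : realType}.
Local Notation C := R[i].
Local Notation M := 'M[C]_2.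

Lemma mx2_00 (a b c d : C) : mx2 a b c d 0 0 = a. Proof. by rewrite mxE. Qed.
Lemma mx2_01 (a b c d : C) : mx2 a b c d 0 1 = b. Proof. by rewrite mxE. Qed.
Lemma mx2_10 (a b c d : C) : mx2 a b c d 1 0 = c. Proof. by rewrite mxE. Qed.
Lemma mx2_11 (a b c d : C) : mx2 a b c d 1 1 = d. Proof. by rewrite mxE. Qed.
Definition mx2E := (mx2_00, mx2_01, mx2_10, mx2_11).

Lemma scaled_mx2 (k a b c d : C) : k *: mx2 a b c d = mx2 (k * a) (k * b) (k * c) (k * d).
Proof. by apply: mx2_eqP; rewrite mxE !mx2E. Qed.

Lemma mul_mx2 (a b c d a' b' c' d' : C) : mx2 a b c d *m mx2 a' b' c' d' =
  mx2 (a * a' + b * c') (a * b' + b * d') (c * a' + d * c') (c * b' + d * d').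
Proof. by apply: mx2_eqP; rewrite mxE ord2_sum !mx2E. Qed.

(** Fricke's identity: on SL_2 the determinant of A B - B A is 4 - tr(A)^2 - tr(B)^2 - tr(A B)^2 +
    tr(A) tr(B) tr(A B). The proof uses its version homogenized by determinants. *)
Lemma det_commutator (A B : M) : \det A = 1 -> \det B = 1 -> \tr A = 0 ->
  \det (A *m B - B *m A) = 4 - \tr B ^+ 2 - \tr (A *m B) ^+ 2.
Proof.
move=> dA dB tA; transitivity (4 * \det A * \det B - \det B * \tr A ^+ 2 - \det A * \tr B ^+ 2
   - \tr (A *m B) ^+ 2 + \tr A * \tr B * \tr (A *m B)); last by rewrite dA dB tA; ring.
by rewrite !det_mx2 !tr_mx2 !mxE !ord2_sum; ring.
Qed.

Let s2 : C := (Num.sqrt 2)%:C.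
Let s5 : C := (Num.sqrt 5)%:C.

Lemma sqrt2_sq : s2 ^+ 2 = 2.
Proof. by rewrite /s2 -rmorphXn /= sqr_sqrtr ?ler0n // rmorph_nat. Qed.
Lemma sqrt5_sq : s5 ^+ 2 = 5.
Proof. by rewrite /s5 -rmorphXn /= sqr_sqrtr ?ler0n // rmorph_nat. Qed.
Lemma sqrt2_neq0 : s2 != 0.
Proof. by rewrite -sqrf_eq0 sqrt2_sq pnatr_eq0. Qed.
Lemma sqrt5_neq0 : s5 != 0.
Proof. by rewrite -sqrf_eq0 sqrt5_sq pnatr_eq0. Qed.

Lemma zeta8_4 : zeta R 8 ^+ 4 = - 1.
Proof. by apply: (@prim_half _ _ 4); exact: (@zeta_prim _ 8). Qed.

Lemma zeta4_8 : zeta R 4 = zeta R 8 ^+ 2. Proof. by rewrite (@zeta_exp_dvd _ 2 4). Qed.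

Lemma zeta4_sq : zeta R 4 ^+ 2 = - 1.
Proof. by rewrite zeta4_8 -exprM zeta8_4. Qed.

Lemma zeta6_3 : zeta R 6 = - zeta R 3 ^+ 2.
Proof.
have e3 : zeta R 6 ^+ 3 = - 1 by apply: (@prim_half _ _ 3); exact: (@zeta_prim _ 6).
rewrite -(@zeta_exp_dvd _ 2 3) // -exprM -[(2 * 2)%N]/(3 + 1)%N exprD e3.
by rewrite expr1 mulN1r opprK.
Qed.

Lemma zeta3_inv : (zeta R 3)^-1 = zeta R 3 ^+ 2.
Proof.
have w1 := prim_expr_order (@zeta_prim R 3 isT).
have w0 : zeta R 3 != 0 by apply: contra_eq_neq w1 => ->; rewrite expr0n eq_sym oner_eq0.
by apply: (mulfI w0); rewrite mulfV // -exprS.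
Qed.

Lemma zeta3_trace : zeta R 3 + (zeta R 3)^-1 = - 1.
Proof. by apply/eqP; rewrite zeta3_inv -addr_eq0 addrC addrA zeta3_sum. Qed.

Lemma zeta6_trace : zeta R 6 + (zeta R 6)^-1 = 1.
Proof.
by rewrite zeta6_3 invrN -exprVn zeta3_inv -exprM -[(2 * 2)%N]/(3 + 1)%N exprD
  (prim_expr_order (@zeta_prim R 3 isT)) mul1r expr1 -opprD addrC -zeta3_inv zeta3_trace opprK.
Qed.

Lemma zeta4_trace : zeta R 4 + (zeta R 4)^-1 = 0.
Proof.
have i0 : zeta R 4 != 0 by rewrite -sqrf_eq0 zeta4_sq oppr_eq0 oner_eq0.
by apply: (mulfI i0); rewrite mulr0 mulrDr mulfV // -expr2 zeta4_sq addNr.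
Qed.

Lemma det_tetT : \det (tetT R) = 1.
Proof.
rewrite /tetT -/s2 scaled_mx2 det_mx2 !mx2E.
transitivity ((zeta R 8 ^+ 4) * (zeta R 8 ^+ 4 - 1) / s2 ^+ 2).
  by field; exact: sqrt2_neq0.
by rewrite zeta8_4 sqrt2_sq; field.
Qed.

Lemma tr_tetT : \tr (tetT R) = 1.
Proof.
rewrite /tetT -/s2 scaled_mx2 tr_mx2 !mx2E -mulrDr zeta8_sqrt2 mulVf //.
exact: sqrt2_neq0.
Qed.

(** The eigenvalues of S, T and S T have orders 4, 6 and 3. *)
Lemma tet_pair : polyhedral_pair (tetS R) (tetT R) (zeta R 12) 12 3 2 4 3.
Proof.
have z3 : zeta R 12 ^+ 3 = zeta R 4 by exact: (@zeta_exp_dvd _ 3 4).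
have z2 : zeta R 12 ^+ 2 = zeta R 6 by exact: (@zeta_exp_dvd _ 2 6).
have z4 : zeta R 12 ^+ 4 = zeta R 3 by exact: (@zeta_exp_dvd _ 4 3).
have dS : \det (tetS R) = 1.
  by rewrite det_mx2 !mx2E mulr0 subr0 mulrN -expr2 zeta4_sq opprK.
have tS : \tr (tetS R) = 0 by rewrite tr_mx2 !mx2E subrr.
have tP : \tr (tetS R *m tetT R) = - 1.
  rewrite /tetS /tetT -/s2 scaled_mx2 mul_mx2 tr_mx2 !mx2E zeta4_8.
  transitivity (- (zeta R 8 + zeta R 8 ^+ 7
     + (1 + zeta R 8 ^+ 4) * (zeta R 8 ^+ 5 - zeta R 8 - zeta R 8 ^+ 3)) / s2).
    by field; exact: sqrt2_neq0.
  by rewrite zeta8_4 addrN mul0r addr0 zeta8_sqrt2 -/s2 mulNr divff ?sqrt2_neq0.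
split; rewrite ?z3 ?z2 ?z4 ?zeta4_trace ?zeta6_trace ?zeta3_trace;
  [exact: dS | exact: det_tetT | exact: tS | exact: tr_tetT | exact: tP | exact: zeta_prim | | by []].
rewrite det_commutator ?det_tetT // tr_tetT tP.
  by rewrite sqrrN expr1n -addrA -opprD -(natrD _ 1 1) -natrB // pnatr_eq0.
Qed.

Lemma octP_diag : octS R *m octT R = mx2 (zeta R 8 ^+ 3) 0 0 (zeta R 8 ^+ 5).
Proof.
rewrite /octS /octT /tetT -/s2 !scaled_mx2 mul_mx2 zeta4_8.
have s0 := sqrt2_neq0; have ss := sqrt2_sq; have e4 := zeta8_4.
move: s0 ss e4; move: (zeta R 8) s2 => e s s0 ss e4.
have s20 : s ^+ 2 != 0 by rewrite expf_neq0.
congr mx2; apply: (mulfI s20).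
- by transitivity (2 * e ^+ 3); [field | rewrite ss].
- by transitivity (e ^+ 3 * (1 + e ^+ 4)); [field | rewrite e4 addrN !mulr0].
- by transitivity (- e * (1 + e ^+ 4)); [field | rewrite e4 addrN !mulr0].
- by transitivity (- e * (1 + (e ^+ 4) ^+ 2)); [field | rewrite ss (exprD e 4 1) e4; ring].
Qed.

Lemma zeta8_inv3 : (zeta R 8 ^+ 3)^-1 = zeta R 8 ^+ 5.
Proof.
have e8 := prim_expr_order (@zeta_prim R 8 isT).
have e0 : zeta R 8 ^+ 3 != 0.
  by apply: contra_eq_neq e8 => e0; rewrite -[8%N]/(3 + 5)%N exprD e0 mul0r eq_sym oner_eq0.
by apply: (mulfI e0); rewrite mulfV // -exprD.
Qed.

(** The eigenvalues of S, T and S T have orders 4, 6 and 8. *)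
Lemma oct_pair : polyhedral_pair (octS R) (octT R) (zeta R 24) 24 6 4 9 4.
Proof.
have z6 : zeta R 24 ^+ 6 = zeta R 4 by exact: (@zeta_exp_dvd _ 6 4).
have z4 : zeta R 24 ^+ 4 = zeta R 6 by exact: (@zeta_exp_dvd _ 4 6).
have z9 : zeta R 24 ^+ 9 = zeta R 8 ^+ 3.
  by rewrite -(@zeta_exp_dvd _ 3 8) // -exprM.
have dS : \det (octS R) = 1.
  rewrite /octS -/s2 scaled_mx2 det_mx2 !mx2E.
  transitivity ((1 - zeta R 4 ^+ 2) / s2 ^+ 2); first by field; exact: sqrt2_neq0.
  by rewrite zeta4_sq sqrt2_sq; field.
have tS : \tr (octS R) = 0.
  by rewrite /octS scaled_mx2 tr_mx2 !mx2E mulrN subrr.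
have tP : \tr (octS R *m octT R) = zeta R 8 ^+ 3 + zeta R 8 ^+ 5.
  by rewrite octP_diag tr_mx2 !mx2E.
split; rewrite ?z6 ?z4 ?z9 ?zeta4_trace ?zeta6_trace ?zeta8_inv3;
  [exact: dS | exact: det_tetT | exact: tS | exact: tr_tetT | exact: tP | exact: zeta_prim | | by []].
rewrite det_commutator ?det_tetT // tr_tetT tP.
  rewrite (_ : _ - _ = 1) ?oner_eq0 //.
  transitivity (3 - zeta R 8 ^+ 6 * (1 + zeta R 8 ^+ 4) - 2 * (zeta R 8 ^+ 4) ^+ 2); first by ring.
  by rewrite zeta8_4; ring.
Qed.

(** Reduces determinant and invariance for T to those for S and for a diagonal matrix, and makes S T
    diagonal since S^2 = -1. *)
Lemma icoT_diag : icoT R = icoS R *m mx2 (zeta R 5 ^+ 3) 0 0 (zeta R 5 ^+ 2).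
Proof.
have h5 := prim_expr_order (@zeta_prim R 5 isT).
rewrite /icoT /icoS !scaled_mx2 mul_mx2; move: (zeta R 5) h5 _^-1 => h h5 s.
congr mx2.
- by transitivity (s * (h ^+ 5 * h ^+ 2 - h ^+ 4)); [rewrite h5 mul1r | ring].
- by transitivity (s * (h ^+ 4 - h ^+ 5)); [rewrite h5 | ring].
- by transitivity (s * (h ^+ 5 - h ^+ 5 * h)); [rewrite h5 mul1r | ring].
- by transitivity (s * (h ^+ 3 - h ^+ 5 * h)); [rewrite h5 mul1r | ring].
Qed.

Lemma icoS_norm :
  (zeta R 5 ^+ 4 - zeta R 5) ^+ 2 + (zeta R 5 ^+ 2 - zeta R 5 ^+ 3) ^+ 2 = - s5 ^+ 2.
Proof.
have h5 := prim_expr_order (@zeta_prim R 5 isT); have := @zeta5_sum R.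
rewrite sqrt5_sq; move: (zeta R 5) h5 => h h5 hs.
transitivity (h ^+ 5 * h ^+ 3 + h ^+ 2 + h ^+ 4 + h ^+ 5 * h - 4 * h ^+ 5); first by ring.
rewrite h5; transitivity ((1 + h + h ^+ 2 + h ^+ 3 + h ^+ 4) - 5); first by ring.
by rewrite hs sub0r.
Qed.

Lemma icoS_sq : icoS R *m icoS R = mx2 (-1) 0 0 (-1).
Proof.
rewrite /icoS -/s5 scaled_mx2 mul_mx2; have := icoS_norm.
have s0 := sqrt5_neq0; move: s0; move: s5 (zeta R 5) => s h s0 E.
have N : - s ^+ 2 / s ^+ 2 = - 1 by rewrite mulNr divff // expf_neq0.
congr mx2; try by ring.
  by rewrite -N -E; field.
by rewrite -N -E; field.
Qed.

Lemma icoP_diag : icoS R *m icoT R = mx2 (- zeta R 5 ^+ 3) 0 0 (- zeta R 5 ^+ 2).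
Proof. by rewrite icoT_diag mulmxA icoS_sq mul_mx2; congr mx2; ring. Qed.

Lemma det_icoS : \det (icoS R) = 1.
Proof.
rewrite /icoS -/s5 scaled_mx2 det_mx2 !mx2E; have := icoS_norm.
have s0 := sqrt5_neq0; move: s0; move: s5 (zeta R 5) => s h s0 E.
transitivity (- ((h ^+ 4 - h) ^+ 2 + (h ^+ 2 - h ^+ 3) ^+ 2) / s ^+ 2); first by field.
by rewrite E opprK divff // expf_neq0.
Qed.

(** The eigenvalues of S, T and S T have orders 4, 3 and 10. *)
Lemma ico_pair : polyhedral_pair (icoS R) (icoT R) (zeta R 60) 60 15 20 6 5.
Proof.
have h5 := prim_expr_order (@zeta_prim R 5 isT).
have z15 : zeta R 60 ^+ 15 = zeta R 4 by exact: (@zeta_exp_dvd _ 15 4).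
have z20 : zeta R 60 ^+ 20 = zeta R 3 by exact: (@zeta_exp_dvd _ 20 3).
have z12 : zeta R 60 ^+ 12 = zeta R 5 by exact: (@zeta_exp_dvd _ 12 5).
have z30 : zeta R 60 ^+ 30 = - 1 by apply: (@prim_half _ _ 30); exact: (@zeta_prim _ 60).
have z6 : zeta R 60 ^+ 6 = - zeta R 5 ^+ 3.
  by rewrite -z12 -exprM -[(12 * 3)%N]/(30 + 6)%N exprD z30 mulN1r opprK.
have z6i : (zeta R 60 ^+ 6)^-1 = - zeta R 5 ^+ 2.
  rewrite z6; have h0 : - zeta R 5 ^+ 3 != 0.
    rewrite oppr_eq0; apply: contra_eq_neq h5 => h0.
    by rewrite -[5%N]/(3 + 2)%N exprD h0 mul0r eq_sym oner_eq0.
  by apply: (mulfI h0); rewrite mulfV // mulrNN -exprD.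
have tS : \tr (icoS R) = 0 by rewrite /icoS scaled_mx2 tr_mx2 !mx2E; ring.
have dT : \det (icoT R) = 1.
  rewrite icoT_diag det_mulmx det_icoS det_mx2 !mx2E mul1r mulr0 subr0 -exprD.
  exact: h5.
have tT : \tr (icoT R) = - 1.
  rewrite /icoT -/s5 scaled_mx2 tr_mx2 !mx2E.
  transitivity (- (zeta R 5 + zeta R 5 ^+ 4 - zeta R 5 ^+ 2 - zeta R 5 ^+ 3) / s5).
    by field; exact: sqrt5_neq0.
  by rewrite zeta5_sqrt5 -/s5 mulNr divff ?sqrt5_neq0.
have tP : \tr (icoS R *m icoT R) = - zeta R 5 ^+ 3 - zeta R 5 ^+ 2.
  by rewrite icoP_diag tr_mx2 !mx2E.
split; rewrite ?z15 ?z20 ?z6i ?z6 ?zeta4_trace ?zeta3_trace;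
  [exact: det_icoS | exact: dT | exact: tS | exact: tT | exact: tP | exact: zeta_prim | | by []].
rewrite det_commutator ?det_icoS // tT tP.
  have := @zeta5_sum R; move: (zeta R 5) h5 => h h5' hs.
  have q : (h ^+ 2 + h ^+ 3) ^+ 2 + (h ^+ 2 + h ^+ 3) - 1 = 0.
    transitivity (h ^+ 4 + 2 * h ^+ 5 + h ^+ 5 * h + h ^+ 2 + h ^+ 3 - 1); first by ring.
    by rewrite h5' -[RHS]hs; ring.
  rewrite [X in X != 0](_ : _ = 2 + (h ^+ 2 + h ^+ 3)); last first.
    transitivity (2 + (h ^+ 2 + h ^+ 3) - ((h ^+ 2 + h ^+ 3) ^+ 2 + (h ^+ 2 + h ^+ 3) - 1)); first by ring.
    by rewrite q subr0.
  apply/eqP => s0; move: q; rewrite (_ : h ^+ 2 + h ^+ 3 = - 2); last first.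
    by apply/eqP; rewrite -addr_eq0 addrC s0.
  rewrite [X in X = 0 -> _](_ : _ = 1); last by ring.
  by apply/eqP; rewrite oner_eq0.
Qed.

End BinaryPolyhedralPairs.

(** * Characters of Klein's forms, and the two copies of G_6 *)

Section Characters.
Context {R : realType}.
Local Notation C := R[i].

Lemma ev_character (s : seq (C * (nat * nat))) (A : 'M[C]_2) (w : C) :
  (forall x y, ev s (A 0 0 * x + A 0 1 * y) (A 1 0 * x + A 1 1 * y) = w * ev s x y) ->
  forall k v, peval (k *: bform s) (A *m v) = w * peval (k *: bform s) v.
Proof.
by move=> h k v; rewrite !pevalZ !peval_bform !mxE !ord2_sum h mulrCA.
Qed.

Lemma pgenE (A B : 'M[C]_2) z (c d : nat) (s t : C) : s = z ^+ c -> t = z ^+ d ->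
  gen2 (s *: A) (t *: B) = pgen A B z c d.
Proof. by move=> -> ->. Qed.

Let th : C := 1 + 2 * zeta R 3.

Lemma th_sq : th ^+ 2 = - 3.
Proof.
transitivity (4 * (1 + zeta R 3 + zeta R 3 ^+ 2) - 3); first by rewrite /th; ring.
by rewrite zeta3_sum mulr0 sub0r.
Qed.

Lemma phi_tetS k v :
  peval (k *: bform (tet_phi th)) (tetS R *m v) = 1 * peval (k *: bform (tet_phi th)) v.
Proof.
apply: ev_character => x y; rewrite !mx2E /= /term_val /=.
have i2 := @zeta4_sq R; move: th (zeta R 4) i2 => t i i2.
by ring: i2.
Qed.

Lemma phi_tetT k v :
  peval (k *: bform (tet_phi th)) (tetT R *m v) = zeta R 3 * peval (k *: bform (tet_phi th)) v.
Proof.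
apply: ev_character => x y; rewrite /tetT scaled_mx2 !mx2E /= /term_val /=.
have e4 := @zeta8_4 R; have w2 := @zeta3_sum R.
have u2 : 2 * ((Num.sqrt 2)%:C^-1 : C) ^+ 2 = 1.
  by rewrite exprVn sqrt2_sq divff // pnatr_eq0.
rewrite /th; move: (zeta R 3) (zeta R 8) ((Num.sqrt 2)%:C^-1 : C) e4 w2 u2 => w e u e4 w2 u2.
have w2' : w ^+ 2 = - 1 - w by transitivity (1 + w + w ^+ 2 - 1 - w); [ring | rewrite w2 sub0r].
have e7 : e ^+ 7 = - e ^+ 3 by rewrite -[7%N]/(4 + 3)%N exprD e4 mulN1r.
rewrite e7; have u2' : u ^+ 2 = 2^-1 by apply: (mulfI (_ : 2 != 0 :> C)); rewrite ?pnatr_eq0 // u2 divff ?pnatr_eq0.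
transitivity ((u ^+ 2) ^+ 2 * (e ^+ 4 * (x + y) ^+ 4 + 2 * (1 + 2 * w) * (e ^+ 4) ^+ 2 * (x ^+ 2 - y ^+ 2) ^+ 2
  + (e ^+ 4) ^+ 3 * (x - y) ^+ 4)); first by ring.
rewrite e4 u2'; transitivity (w * (x ^+ 4 + y ^+ 4) + (2 * w + 4 * w ^+ 2) * (x ^+ 2 * y ^+ 2)).
  by rewrite w2'; field.
by ring.
Qed.

Lemma t_octS k v :
  peval (k *: bform tet_t) (octS R *m v) = - 1 * peval (k *: bform tet_t) v.
Proof.
apply: ev_character => x y; rewrite /octS scaled_mx2 !mx2E /= /term_val /=.
have i2 := @zeta4_sq R.
have u2 : ((Num.sqrt 2)%:C^-1 : C) ^+ 2 = 2^-1 by rewrite exprVn sqrt2_sq.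
move: (zeta R 4) ((Num.sqrt 2)%:C^-1 : C) i2 u2 => e u i2 u2.
transitivity ((u ^+ 2) ^+ 3 * (e * (e ^+ 2 * x ^+ 2 - y ^+ 2) * ((e * x + y) ^+ 4 - (e ^+ 2) ^+ 2 * (e * x - y) ^+ 4))).
  by rewrite -![e ^+ 2]/(e * e); ring: i2.
rewrite u2 i2; transitivity ((2^-1) ^+ 3 * (e * (- x ^+ 2 - y ^+ 2) * (8 * (e ^+ 2 * e * x ^+ 3 * y + e * x * y ^+ 3)))).
  by ring.
rewrite i2; transitivity ((2^-1) ^+ 3 * (e ^+ 2 * (- x ^+ 2 - y ^+ 2) * (8 * (- x ^+ 3 * y + x * y ^+ 3)))).
  by ring.
by rewrite i2; field.
Qed.

Lemma t_tetT k v :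
  peval (k *: bform tet_t) (tetT R *m v) = 1 * peval (k *: bform tet_t) v.
Proof.
apply: ev_character => x y; rewrite /tetT scaled_mx2 !mx2E /= /term_val /=.
have e4 := @zeta8_4 R.
have u2 : ((Num.sqrt 2)%:C^-1 : C) ^+ 2 = 2^-1 by rewrite exprVn sqrt2_sq.
move: (zeta R 8) ((Num.sqrt 2)%:C^-1 : C) e4 u2 => e u e4 u2.
have e7 : e ^+ 7 = - e ^+ 3 by rewrite -[7%N]/(4 + 3)%N exprD e4 mulN1r.
rewrite e7; transitivity ((u ^+ 2) ^+ 3 * ((e ^+ 4) ^+ 2 * (x ^+ 2 - y ^+ 2) * ((x + y) ^+ 4 - (e ^+ 4) ^+ 2 * (x - y) ^+ 4))).
  by ring.
by rewrite e4 u2; field.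
Qed.

(** Klein's f in u = x y and w = x^2 - y^2. The matrix [icoS] maps (u, w) to (u + w, 4 u - w)
    divided by the square root of 5, so invariance of f becomes an identity of degree 6 in u and
    w. *)
Definition ico_f_uw (u w : C) : C :=
  u * (w ^+ 5 + 5 * w ^+ 3 * u ^+ 2 + 5 * w * u ^+ 4 + 11 * u ^+ 5).

Lemma ico_fE x y : ev ico_f x y = ico_f_uw (x * y) (x ^+ 2 - y ^+ 2).
Proof. by rewrite /ico_f_uw /= /term_val /=; ring. Qed.

Lemma f_icoS k v :
  peval (k *: bform ico_f) (icoS R *m v) = 1 * peval (k *: bform ico_f) v.
Proof.
apply: ev_character => x y; rewrite /icoS scaled_mx2 !mx2E !ico_fE mul1r.
have h5 := prim_expr_order (@zeta_prim R 5 isT); have s5 := @zeta5_sqrt5 R.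
have hs := @zeta5_sum R; have s50 := @sqrt5_neq0 R; have ss := @sqrt5_sq R.
move: (zeta R 5) ((Num.sqrt 5)%:C : C) h5 s5 hs s50 ss => h s h5 s5 hs s0 ss.
set A := s^-1 * (h ^+ 4 - h); set B := s^-1 * (h ^+ 2 - h ^+ 3).
have AB : A * B = s^-1.
  transitivity (s^-1 ^+ 2 * (h ^+ 5 * h - h ^+ 5 * h ^+ 2 - h ^+ 3 + h ^+ 4)); first by rewrite /A /B; ring.
  rewrite h5 (_ : _ + h ^+ 4 = s); last by rewrite -s5; ring.
  by field.
have B2A2 : B ^+ 2 - A ^+ 2 = s^-1.
  transitivity (s^-1 ^+ 2 * (h ^+ 4 - 2 * h ^+ 5 + h ^+ 5 * h - h ^+ 5 * h ^+ 3 + 2 * h ^+ 5 - h ^+ 2)).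
    by rewrite /A /B; ring.
  rewrite h5 (_ : _ - h ^+ 2 = s); last by rewrite -s5; ring.
  by field.
have -> : s^-1 * (h - h ^+ 4) = - A by rewrite /A; ring.
have -> : (A * x + B * y) * (B * x + - A * y) = s^-1 * ((x ^+ 2 - y ^+ 2) + x * y).
  transitivity (A * B * (x ^+ 2 - y ^+ 2) + (B ^+ 2 - A ^+ 2) * (x * y)); first by ring.
  by rewrite AB B2A2; ring.
have -> : (A * x + B * y) ^+ 2 - (B * x + - A * y) ^+ 2 = s^-1 * (4 * (x * y) - (x ^+ 2 - y ^+ 2)).
  transitivity (4 * (A * B) * (x * y) - (B ^+ 2 - A ^+ 2) * (x ^+ 2 - y ^+ 2)); first by ring.
  by rewrite AB B2A2; ring.
have u2 : s^-1 ^+ 2 = 5^-1 by rewrite exprVn ss.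
move: (x * y) (x ^+ 2 - y ^+ 2) => u w.
transitivity ((s^-1 ^+ 2) ^+ 3 * (125 * ico_f_uw u w)); first by rewrite /ico_f_uw; ring.
by rewrite u2; field.
Qed.

Lemma f_icoT k v :
  peval (k *: bform ico_f) (icoT R *m v) = 1 * peval (k *: bform ico_f) v.
Proof.
rewrite icoT_diag -mulmxA f_icoS mul1r; move: k v; apply: ev_character => x y.
rewrite !mx2E /= /term_val /=.
have h5 := prim_expr_order (@zeta_prim R 5 isT); move: (zeta R 5) h5 => h h5.
transitivity ((h ^+ 5) ^+ 7 * x ^+ 11 * y + 11 * (h ^+ 5) ^+ 6 * x ^+ 6 * y ^+ 6 - (h ^+ 5) ^+ 5 * x * y ^+ 11).
  by ring.
by rewrite h5; ring.
Qed.

(** Conjugation by this matrix sends S to -S and T to its inverse; the substitution (x, y) -> (i y,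
    x) exchanges the two quartics, whose stabilizers are the two subgroups of type G_6. *)
Definition tet_N : 'M[C]_2 := mx2 0 (zeta R 4) 1 0.

Lemma tet_N_unit : tet_N \in unitmx.
Proof.
rewrite unitmxE det_mx2 !mx2E unitfE mul0r sub0r mulr1 oppr_eq0.
by rewrite -sqrf_eq0 zeta4_sq oppr_eq0 oner_eq0.
Qed.

Lemma conjm_eq (Q A B : 'M[C]_2) : Q \in unitmx -> Q *m A = B *m Q -> conjm Q A = B.
Proof. by move=> uQ E; rewrite /conjm E mulmxK. Qed.

Lemma conj_tetS : conjm tet_N (tetS R) = - 1 *: tetS R.
Proof.
apply: (conjm_eq tet_N_unit); rewrite /tet_N /tetS scaled_mx2 !mul_mx2; congr mx2; ring.
Qed.

Lemma conj_tetT : conjm tet_N (tetT R) = invmx (tetT R).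
Proof.
have uT : tetT R \in unitmx by rewrite unitmxE det_tetT unitr1.
apply: (conjm_eq tet_N_unit); rewrite -[LHS](mulKmx uT); congr (_ *m _).
rewrite /tetT /tet_N scaled_mx2 !mul_mx2 zeta4_8; have e4 := @zeta8_4 R.
have u2 : ((Num.sqrt 2)%:C^-1 : C) ^+ 2 = 2^-1 by rewrite exprVn sqrt2_sq.
move: (zeta R 8) ((Num.sqrt 2)%:C^-1 : C) e4 u2 => e u e4 u2.
congr mx2.
- by transitivity (u ^+ 2 * e ^+ 2 * (e ^+ 4 + 1)); [ring | rewrite e4 addNr mulr0].
- by transitivity (u ^+ 2 * e ^+ 2 * ((e ^+ 4) ^+ 2 + 1)); [ring | rewrite e4 u2; field].
- by transitivity (u ^+ 2 * (2 * (e ^+ 4) ^+ 2)); [ring | rewrite e4 u2; field].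
- by transitivity (u ^+ 2 * (e ^+ 4) ^+ 2 * (e ^+ 4 + 1)); [ring | rewrite e4 addNr mulr0].
Qed.

Lemma ST6_conj : conjugate_to (pgen (tetS R) (tetT R) (zeta R 12) 3 10)
  (pgen (tetS R) (tetT R) (zeta R 12) 3 2).
Proof.
have HP := @tet_pair R; have HP' := polyhedral_conj tet_N_unit HP.
exists tet_N; first exact: tet_N_unit.
rewrite (pgen_conj tet_N_unit HP).
(* Both groups contain the scalar z^3, the cube of the scaled S T, hence also z^6 = -1, which
   absorbs the sign in [conj_tetS]. *)
have m1 S' T' c d (HQ : polyhedral_pair S' T' (zeta R 12) 12 3 2 4 3) :
    (3 * (c + d + 4) = 3 %[mod 12])%N -> pgen S' T' (zeta R 12) c d (zeta R 12 ^+ 6)%:M.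
  move=> E; apply: (scalar_mul (pgen_group HQ c d) (a := 3) (b := 3));
  by apply: (pgen_scalar HQ (n1 := 0) (n2 := 0) (n3 := 1)); rewrite !mul0n !add0n mul1n.
have zz : zeta R 12 ^+ 6 = - 1 by apply: (@prim_half _ _ 6); exact: (@zeta_prim _ 12).
have z12 := prim_expr_order (@zeta_prim R 12 isT).
have z0 : zeta R 12 != 0 by apply: contra_eq_neq z12 => ->; rewrite expr0n eq_sym oner_eq0.
have uT : tetT R \in unitmx by rewrite unitmxE det_tetT unitr1.
have sE : zeta R 12 ^+ 3 *: conjm tet_N (tetS R) = zeta R 12 ^+ 6 *: (zeta R 12 ^+ 3 *: tetS R).
  by rewrite conj_tetS zz !scalerA mulrC.
have sE' : zeta R 12 ^+ 3 *: tetS R = zeta R 12 ^+ 6 *: (zeta R 12 ^+ 3 *: conjm tet_N (tetS R)).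
  by rewrite sE scalerA -exprD z12 scale1r.
have uS c : zeta R 12 ^+ c *: tetS R \in unitmx by apply: (scaled_unit HP); exact: pl_detS HP.
have uT' c : zeta R 12 ^+ c *: tetT R \in unitmx by apply: (scaled_unit HP); exact: pl_detT HP.
have tE : zeta R 12 ^+ 10 *: conjm tet_N (tetT R) = invmx (zeta R 12 ^+ 2 *: tetT R).
  rewrite conj_tetT (invmxZ (uT' 2%N)).
  congr (_ *: _); apply: (mulfI (expf_neq0 2 z0)); rewrite mulfV ?expf_neq0 //.
  by rewrite -exprD.
have g1 := pgen_group HP 3 2; have g2 := pgen_group HP' 3 10.
rewrite /pgen; apply: gen_eq; [exact: uS | exact: uT' | | | | ].
- rewrite sE; apply: (scaled_mem g1); last exact: gen_l.
  exact: m1 HP _.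
- rewrite tE; case: (g1) => _ _ gV; have [] // := gV (zeta R 12 ^+ 2 *: tetT R) _.
  exact: gen_r.
- rewrite sE'; apply: (scaled_mem g2); last exact: gen_l.
  exact: m1 HP' _.
- rewrite -[zeta R 12 ^+ 2 *: tetT R]invmxK -tE; case: (g2) => _ _ gV.
  by have [] // := gV (zeta R 12 ^+ 10 *: conjm tet_N (tetT R)) _; exact: gen_r.
Qed.

End Characters.

(** * Scalars of the Shephard-Todd generators as powers of z *)

Section RootExponents.
Context {R : realType}.
Local Notation C := R[i].

Lemma tet_scalars : [/\ zeta R 4 = zeta R 12 ^+ 3, zeta R 3 = zeta R 12 ^+ 4,
  - zeta R 3 = zeta R 12 ^+ 10 & zeta R 4 * zeta R 3 = zeta R 12 ^+ 7].
Proof.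
have z3 : zeta R 12 ^+ 3 = zeta R 4 by exact: (@zeta_exp_dvd _ 3 4).
have z4 : zeta R 12 ^+ 4 = zeta R 3 by exact: (@zeta_exp_dvd _ 4 3).
have z6 : zeta R 12 ^+ 6 = - 1 by apply: (@prim_half _ _ 6); exact: (@zeta_prim _ 12).
split; first by rewrite z3.
- by rewrite z4.
- by rewrite -mulN1r -z6 -z4 -exprD.
- by rewrite -z3 -z4 -exprD.
Qed.

Lemma oct_scalars : [/\ zeta R 4 = zeta R 24 ^+ 6, zeta R 8 = zeta R 24 ^+ 3,
  - zeta R 3 = zeta R 24 ^+ 20, zeta R 8 * zeta R 3 = zeta R 24 ^+ 11 &
  zeta R 8 ^+ 7 * zeta R 3 ^+ 2 = zeta R 24 ^+ 13].
Proof.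
have z6 : zeta R 24 ^+ 6 = zeta R 4 by exact: (@zeta_exp_dvd _ 6 4).
have z8 : zeta R 24 ^+ 8 = zeta R 3 by exact: (@zeta_exp_dvd _ 8 3).
have z3 : zeta R 24 ^+ 3 = zeta R 8 by exact: (@zeta_exp_dvd _ 3 8).
have z12 : zeta R 24 ^+ 12 = - 1 by apply: (@prim_half _ _ 12); exact: (@zeta_prim _ 24).
split; first by rewrite z6.
- by rewrite z3.
- by rewrite -mulN1r -z12 -z8 -exprD.
- by rewrite -z3 -z8 -exprD.
- by rewrite -z3 -z8 -!exprM -exprD (exprD _ 24 13) (prim_expr_order (@zeta_prim R 24 isT)) mul1r.
Qed.

Lemma ico_scalars : [/\ zeta R 4 = zeta R 60 ^+ 15, zeta R 4 * zeta R 3 = zeta R 60 ^+ 35,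
  zeta R 4 * zeta R 5 ^+ 3 = zeta R 60 ^+ 51, zeta R 3 ^+ 2 = zeta R 60 ^+ 40 &
  - zeta R 3 * zeta R 5 ^+ 3 = zeta R 60 ^+ 26].
Proof.
have z15 : zeta R 60 ^+ 15 = zeta R 4 by exact: (@zeta_exp_dvd _ 15 4).
have z20 : zeta R 60 ^+ 20 = zeta R 3 by exact: (@zeta_exp_dvd _ 20 3).
have z12 : zeta R 60 ^+ 12 = zeta R 5 by exact: (@zeta_exp_dvd _ 12 5).
have z30 : zeta R 60 ^+ 30 = - 1 by apply: (@prim_half _ _ 30); exact: (@zeta_prim _ 60).
split; first by rewrite z15.
- by rewrite -z15 -z20 -exprD.
- by rewrite -z15 -z12 -exprM -exprD.
- by rewrite -z20 -exprM.
- rewrite -z20 -z12; move: (zeta R 60) z30 (prim_expr_order (@zeta_prim R 60 isT)) => z z30 z60.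
  by rewrite -mulN1r -z30 -exprM -!exprD (exprD z 60 26) z60 mul1r.
Qed.

End RootExponents.

Theorem mainTheorem8 (R : realType)
    (T : set 'M[R[i]]_2) (Ts : 3.-tuple (set 'M[R[i]]_2))
    (hT : [\/ T = ST7 R /\ Ts = [tuple ST5 R; ST6 R; ST6 R],
              T = ST11 R /\ Ts = [tuple ST10 R; ST9 R; ST14 R] |
              T = ST19 R /\ Ts = [tuple ST18 R; ST17 R; ST21 R]])
    (G : set 'M[R[i]]_2) (hG : conjugate_to T G)
    (x : 2.-tuple (mpoly 2 R[i])) (d : 'I_2 -> nat)
    (hx : basic_invariants G x d) :
  [/\ d ord0 = d ord_max,
      linear_subspace_of_dim 2
        (poly_fields_of_degree (C := R[i]) d (- (d ord0)%:Z)) &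
      exists (l : 'I_3 -> set (poly_field (C := R[i]) (n := 1)))
             (K : 'I_3 -> set 'M[R[i]]_2),
        [/\ (forall i, linear_subspace_of_dim 1 (l i) /\
               l i `<=` poly_fields_of_degree d (- (d ord0)%:Z)) /\
            injective l,
            forall e, poly_fields_of_degree d (- (d ord0)%:Z) e -> e != 0 ->
              ((exists S, natural_saito G x d S e) <-> exists i, l i e),
            (forall i, [/\ conjugate_to (tnth Ts i) (K i),
               duality_group (K i) & normal_reflection_subgroup (K i) G]) /\
            injective K &
            forall i xK dK, basic_invariants (K i) xK dK ->
              exists2 pi, orbit_space_map xK x pi &
                forall r S, almost_saito (regular_orbits G x) r S ->
                  ((exists2 e, natural_saito G x d S e & l i e) <->
                   (exists SK eK, natural_saito (K i) xK dK SK eK /\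
                                  induced_saito G x xK pi SK S))]].
Proof.
case: hT => -[TE TsE]; subst T Ts.
- have [i4 w3 nw iw] := @tet_scalars R; have [c [iota KF]] := tet_klein_forms (@th_sq R).
  rewrite /ST7 (pgenE _ _ iw nw) in hG.
  (* The quartic a_2 is fixed by S and multiplied by z^4 under T. The exponents (10, 10) and (3, 10)
     are those of G_5 and G_6; in (3, 2) the exponent 2 makes the scaled T a reflection that fixes
     a_2. *)
  apply: (polyhedral_main (@tet_pair R) KF erefl erefl (sig := 0) (tau := 4)
    (c := tri 10%N 3%N 3%N) (d := tri 10%N 10%N 2%N) _ _ _ _ _ _ _ _ hG hx) => //.
  + exact: phi_tetS.
  + by move=> v; rewrite phi_tetT w3.
  (* Here 2 * 20 + 3 * 63 = 229, which is 1 modulo 12; the other witnesses solve similar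
     congruences. *)
  + by exists 2%N, 0%N, 3%N.
  + apply: (ord3P (i := 0)); [by exists 1%N, 0%N, 0%N|by exists 0%N, 0%N, 1%N|by exists 0%N, 0%N, 1%N].
  + exact: (ord3P (i := 0)).
  + exact: (ord3P (i := 0)).
  + exact: (ord3P (i := 0)).
  + apply: (ord3P (i := 0)).
    * by rewrite -(pgenE _ _ nw nw); exact: conjugate_refl.
    * by rewrite -(pgenE _ _ i4 nw); exact: conjugate_refl.
    * have := @ST6_conj R; rewrite -(pgenE _ _ i4 nw); exact.
- have [i4 e8 nw ew ew2] := @oct_scalars R; have [c [iota KF]] := @oct_klein_forms R[i].
  have z12 : zeta R 24 ^+ 12 = - 1 by apply: (@prim_half _ _ 12); exact: (@zeta_prim _ 24).
  rewrite /ST11 (pgenE _ _ i4 ew) in hG.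
  (* The value 12 is the character of the sextic under S, which changes its sign. *)
  apply: (polyhedral_main (@oct_pair R) KF erefl erefl (sig := 12) (tau := 0)
    (c := tri 13%N 6%N 6%N) (d := tri 20%N 3%N 20%N) _ _ _ _ _ _ _ _ hG hx) => //.
  + by move=> v; rewrite z12; exact: t_octS.
  + exact: t_tetT.
  + by exists 0%N, 5%N, 2%N.
  + apply: (ord3P (i := 0)); [by exists 7%N, 0%N, 0%N|by exists 0%N, 7%N, 0%N|by exists 0%N, 0%N, 5%N].
  + exact: (ord3P (i := 0)).
  + exact: (ord3P (i := 0)).
  + exact: (ord3P (i := 0)).
  + apply: (ord3P (i := 0)).
    * by rewrite -(pgenE _ _ ew2 nw); exact: conjugate_refl.
    * by rewrite -(pgenE _ _ i4 e8); exact: conjugate_refl.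
    * by rewrite -(pgenE _ _ i4 nw); exact: conjugate_refl.
- have [i4 iw ih w2 wh] := @ico_scalars R; have [c [iota KF]] := @ico_klein_forms R[i].
  rewrite /ST19 (pgenE _ _ iw ih) in hG.
  apply: (polyhedral_main (@ico_pair R) KF erefl erefl (sig := 0) (tau := 0)
    (c := tri 26%N 15%N 15%N) (d := tri 40%N 51%N 40%N) _ _ _ _ _ _ _ _ hG hx) => //.
  + exact: f_icoS.
  + exact: f_icoT.
  + by exists 1%N, 17%N, 0%N.
  + apply: (ord3P (i := 0)); [by exists 11%N, 0%N, 0%N|by exists 0%N, 11%N, 0%N|by exists 0%N, 0%N, 1%N].
  + exact: (ord3P (i := 0)).
  + exact: (ord3P (i := 0)).
  + exact: (ord3P (i := 0)).
  + apply: (ord3P (i := 0)).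
    * by rewrite -(pgenE _ _ wh w2); exact: conjugate_refl.
    * by rewrite -(pgenE _ _ i4 ih); exact: conjugate_refl.
    * by rewrite -(pgenE _ _ i4 w2); exact: conjugate_refl.
Qed.
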